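(* Let $n\ge1$ be an integer and let $\Lambda\subset\mathbb{R}^2$ be a lattice. Then $\Gamma_\Lambda$ is an interpolating sequence for $\mathbf{F}^n(\mathbb{C})$ if and only if $D(\Lambda)<n$.
   Context: The polyanalytic Fock space $\mathbf{F}^n(\mathbb{C})$ is the space of functions $F(z)=\sum_{k=0}^{n-1}\bar z^k\varphi_k(z)$ with $\varphi_k$ entire on $\mathbb{C}$ and $\int_{\mathbb{C}}|F(z)|^2e^{-\pi|z|^2}dz<\infty$. A lattice is $\Lambda=A\mathbb{Z}^2$ with $A$ an invertible real $2\times2$ matrix, with density $D(\Lambda)=|\det A|^{-1}$; $\Gamma_\Lambda=\{x+i\omega:(x,\omega)\in\Lambda\}$. $\Gamma$ is an interpolating sequence for $\mathbf{F}^n(\mathbb{C})$ if for every $(\alpha_z)_{z\in\Gamma}\in\ell^2$ there is $F\in\mathbf{F}^n(\mathbb{C})$ with $e^{-\frac{\pi}{2}|z|^2}F(z)=\alpha_z$ for every $z\in\Gamma$. *)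

(* Defs.v *)
From Stdlib Require Import Reals Lra Lia.
Open Scope R_scope.

Definition C : Type := (R * R)%type.
Definition Cadd (z w : C) : C := (fst z + fst w, snd z + snd w).
Definition Csub (z w : C) : C := (fst z - fst w, snd z - snd w).
Definition Cmul (z w : C) : C :=
  (fst z * fst w - snd z * snd w, fst z * snd w + snd z * fst w).
Definition Cconj (z : C) : C := (fst z, - snd z).
Definition Cnorm2 (z : C) : R := fst z * fst z + snd z * snd z.
Definition Cnorm (z : C) : R := sqrt (Cnorm2 z).
Definition Cscale (r : R) (z : C) : C := (r * fst z, r * snd z).
Definition C0 : C := (0, 0).
Definition C1 : C := (1, 0).
Fixpoint Cpow (z : C) (k : nat) : C :=
  match k with O => C1 | S k' => Cmul z (Cpow z k') end.

Fixpoint rsum (N : nat) (f : nat -> R) : R :=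
  match N with O => 0 | S N' => rsum N' f + f N' end.
Fixpoint csum (N : nat) (f : nat -> C) : C :=
  match N with O => C0 | S N' => Cadd (csum N' f) (f N') end.

Definition entire (phi : C -> C) : Prop :=
  forall z : C, exists L : C, forall eps : R, 0 < eps -> exists delta : R, 0 < delta /\
    forall h : C, 0 < Cnorm h < delta ->
      Cnorm (Csub (Csub (phi (Cadd z h)) (phi z)) (Cmul L h)) <= eps * Cnorm h.

(* Finiteness of the integral over C = R^2 of a nonnegative continuous function f
   (Lebesgue measure): the lower Darboux sums of f over uniform N x N grids of
   the squares [-a,a]^2 are uniformly bounded. *)
Definition finite_integral_C (f : C -> R) : Prop :=
  exists M : R, forall (a : R) (N : nat) (c : nat -> nat -> R),
    0 < a ->
    (forall (i j : nat) (x y : R), (i < N)%nat -> (j < N)%nat ->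
        -a + INR i * (2 * a / INR N) <= x <= -a + INR (S i) * (2 * a / INR N) ->
        -a + INR j * (2 * a / INR N) <= y <= -a + INR (S j) * (2 * a / INR N) ->
        c i j <= f (x, y)) ->
    rsum N (fun i => rsum N (fun j => c i j * ((2 * a / INR N) * (2 * a / INR N)))) <= M.

Definition in_polyFock (n : nat) (F : C -> C) : Prop :=
  (exists phi : nat -> C -> C,
     (forall k, (k < n)%nat -> entire (phi k)) /\
     (forall z, F z = csum n (fun k => Cmul (Cpow (Cconj z) k) (phi k z)))) /\
  finite_integral_C (fun z => Cnorm2 (F z) * exp (- PI * Cnorm2 z)).

Definition lattice_pt (a11 a12 a21 a22 : R) (m k : Z) : C :=
  (a11 * IZR m + a12 * IZR k, a21 * IZR m + a22 * IZR k).

Definition l2_Z2 (alpha : Z -> Z -> C) : Prop :=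
  exists M : R, forall N : nat,
    rsum (2 * N + 1) (fun i => rsum (2 * N + 1) (fun j =>
      Cnorm2 (alpha (Z.of_nat i - Z.of_nat N)%Z (Z.of_nat j - Z.of_nat N)%Z))) <= M.

(* Gamma_Lambda is an interpolating sequence for F^n(C).  Since A is invertible,
   (m,k) |-> A(m,k) is a bijection Z^2 -> Gamma_Lambda, so sequences on Gamma_Lambda
   are indexed by Z^2. *)
Definition interpolating_lattice (n : nat) (a11 a12 a21 a22 : R) : Prop :=
  forall alpha : Z -> Z -> C, l2_Z2 alpha ->
    exists F : C -> C, in_polyFock n F /\
      forall m k : Z,
        Cscale (exp (- (PI / 2) * Cnorm2 (lattice_pt a11 a12 a21 a22 m k)))
               (F (lattice_pt a11 a12 a21 a22 m k)) = alpha m k.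

Definition lattice_density (a11 a12 a21 a22 : R) : R :=
  / Rabs (a11 * a22 - a12 * a21).

(* Main.v *)
Require Import Defs.
From Stdlib Require Import Reals Lra Lia ZArith List FinFun Classical ClassicalEpsilon FunctionalExtensionality.
From Coquelicot Require Import Coquelicot.
Import ListNotations.
Open Scope R_scope.

(* Write the lattice as w1 (m + l tau) with T = Im tau > 0 and A = |w1|^2, so that the density is 1 / (A T).
   Let g(l) = exp (i pi tau (l^2 - n l) / n).  Linear algebra gives a nonzero n-(anti)periodic b with
   sum_l b(l) g(l) l^k = 0 for k < n, and a nonzero polynomial p of degree < n with
   sum_j (+-1)^j p(l + n j) g(l + n j) = 0 for all l.

   Sufficiency: exp (kappa v^2) sum_l b(l) g(l) p(l + Im v / T) exp (2 pi i l v / n), with kappa = pi / (2 n T),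
   vanishes on the lattice; divided by a power of v it becomes an n-polyanalytic function equal to 1 at 0 and 0 at
   the other lattice points, of Gaussian growth below pi A / 2 when n A T > 1.  Its Fock translates interpolate.

   Necessity: on the row Im v = l T a polyanalytic F equals a holomorphic function depending polynomially on l with
   degree < n.  Periodizing it against a Gaussian and expanding in a Fourier series, the moment conditions on b give
   one linear relation between the values of F on the lattice.  For n A T < 1 the relation is violated by a delta.
   For n A T = 1 it only holds up to an error O(sqrt L) when truncated to L rows, by a local mean-square estimate of
   F and its polyanalytic parts, whereas suitable l^2 data make the truncated sum of order L^(3/4). *)

(** Everything hinges on comparing two Gaussians: the theta series grows like exp(pi |v|^2 / (2 n
    T)), while the Fock weight at w1 v tolerates exp(pi A |v|^2 / 2); the first exponent is smaller
    exactly when the density is below n. The weight g turns translation by a lattice point into a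
    shift of l, so that vanishing at all lattice points reduces to one relation per residue class
    modulo n. The moment conditions give the theta series a zero of some order N >= n at 0; with d
    the degree of p, division by v^(N - d) leaves at 0 only the leading coefficient of p times the
    first nonzero moment, up to nonzero factors. At n A T = 1 no Gaussian decay is left across the
    rows. The exponent is then taken 1 / L^2 above the critical one: this costs a bounded factor on
    L rows, and Cauchy-Schwarz along a row of effective length L costs sqrt L. The data have modulus
    at most of order l^(-5/4) on a number of points of row l proportional to l, so their squares sum
    like l^(-3/2), while a row where b does not vanish contributes about l^(-1/4). *)

Lemma eq_dec_classic {I : Type} (x y : I) : {x = y} + {x <> y}.
Proof. apply excluded_middle_informative. Qed.

(** * Finite sums over lists *)

Definition lsum {I : Type} (l : list I) (f : I -> C) : C :=
  fold_right (fun i s => (f i + s)%C) (RtoC 0) l.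
Definition lsumR {I : Type} (l : list I) (f : I -> R) : R :=
  fold_right (fun i s => f i + s) 0 l.

Lemma lsum_app {I} (l l' : list I) f : lsum (l ++ l') f = (lsum l f + lsum l' f)%C.
Proof. induction l as [|a l IH]; simpl; [ring | rewrite IH; ring]. Qed.
Lemma lsumR_app {I} (l l' : list I) f : lsumR (l ++ l') f = lsumR l f + lsumR l' f.
Proof. induction l as [|a l IH]; simpl; [ring | rewrite IH; ring]. Qed.
Lemma lsum_ext {I} (l : list I) f g : (forall i, In i l -> f i = g i) -> lsum l f = lsum l g.
Proof. induction l as [|a l IH]; simpl; intros H; auto. rewrite H, IH; auto. Qed.
Lemma lsumR_ext {I} (l : list I) f g : (forall i, In i l -> f i = g i) -> lsumR l f = lsumR l g.
Proof. induction l as [|a l IH]; simpl; intros H; auto. rewrite H, IH; auto. Qed.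
Lemma lsum_plus {I} (l : list I) f g : lsum l (fun i => f i + g i)%C = (lsum l f + lsum l g)%C.
Proof. induction l as [|a l IH]; simpl; [ring | rewrite IH; ring]. Qed.
Lemma lsum_scal {I} (l : list I) c f : lsum l (fun i => c * f i)%C = (c * lsum l f)%C.
Proof. induction l as [|a l IH]; simpl; [ring | rewrite IH; ring]. Qed.
Lemma lsumR_plus {I} (l : list I) f g : lsumR l (fun i => f i + g i) = lsumR l f + lsumR l g.
Proof. induction l as [|a l IH]; simpl; [ring | rewrite IH; ring]. Qed.
Lemma lsumR_scal {I} (l : list I) c f : lsumR l (fun i => c * f i) = c * lsumR l f.
Proof. induction l as [|a l IH]; simpl; [ring | rewrite IH; ring]. Qed.
Lemma lsum_zero {I} (l : list I) : lsum l (fun _ => RtoC 0) = RtoC 0.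
Proof. induction l as [|a l IH]; simpl; [auto | rewrite IH; ring]. Qed.
Lemma lsumR_const {I} (l : list I) c : lsumR l (fun _ => c) = INR (length l) * c.
Proof. induction l as [|a l IH]; [simpl; ring|]. cbn [lsumR fold_right length]. fold (lsumR l (fun _ : I => c)). rewrite S_INR, IH. ring. Qed.
Lemma lsum_map {I J} (h : I -> J) (l : list I) f : lsum (map h l) f = lsum l (fun i => f (h i)).
Proof. induction l as [|a l IH]; simpl; [auto | rewrite IH; auto]. Qed.
Lemma lsumR_map {I J} (h : I -> J) (l : list I) f : lsumR (map h l) f = lsumR l (fun i => f (h i)).
Proof. induction l as [|a l IH]; simpl; [auto | rewrite IH; auto]. Qed.
Lemma lsumR_le {I} (l : list I) f g : (forall i, In i l -> f i <= g i) -> lsumR l f <= lsumR l g.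
Proof.
  induction l as [|a l IH]; simpl; intros H; [lra|].
  apply Rplus_le_compat; auto.
Qed.
Lemma lsumR_nonneg {I} (l : list I) f : (forall i, In i l -> 0 <= f i) -> 0 <= lsumR l f.
Proof.
  induction l as [|a l IH]; simpl; intros H; [lra|].
  apply Rplus_le_le_0_compat; auto.
Qed.
Lemma lsum_Cmod {I} (l : list I) f : Cmod (lsum l f) <= lsumR l (fun i => Cmod (f i)).
Proof.
  induction l as [|a l IH]; simpl; [rewrite Cmod_0; lra|].
  eapply Rle_trans; [apply Cmod_triangle|]. lra.
Qed.
Lemma lsum_RtoC {I} (l : list I) (f : I -> R) : lsum l (fun i => RtoC (f i)) = RtoC (lsumR l f).
Proof. induction l as [|a l IH]; simpl; [auto | rewrite IH, RtoC_plus; auto]. Qed.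
Lemma lsum_flat_map {I J} (h : I -> list J) (l : list I) f :
  lsum (flat_map h l) f = lsum l (fun i => lsum (h i) f).
Proof. induction l as [|a l IH]; simpl; [auto | rewrite lsum_app, IH; auto]. Qed.
Lemma lsumR_flat_map {I J} (h : I -> list J) (l : list I) f :
  lsumR (flat_map h l) f = lsumR l (fun i => lsumR (h i) f).
Proof. induction l as [|a l IH]; simpl; [auto | rewrite lsumR_app, IH; auto]. Qed.

(** Duplicate-free lists stand for finite sets, and [D] is the complement of [A] in [B]. Partial
    sums over nested sets are compared through this splitting. *)
Lemma split_incl {I} (A : list I) : forall B, NoDup A -> NoDup B -> incl A B ->
  exists D, NoDup D /\ (forall f, lsum B f = (lsum A f + lsum D f)%C) /\
    (forall f, lsumR B f = lsumR A f + lsumR D f) /\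
    (forall x, In x D <-> In x B /\ ~ In x A).
Proof.
  induction A as [|a A IH]; intros B HA HB Hi.
  - exists B. repeat split; auto; intros; simpl; try ring; try tauto.
  - inversion HA; subst.
    destruct (IH B) as (D & HD & E1 & E2 & E3); auto.
    { intros x Hx; apply Hi; right; auto. }
    assert (HaD : In a D). { apply E3. split; [apply Hi; left; auto | auto]. }
    destruct (in_split _ _ HaD) as (D1 & D2 & ->).
    exists (D1 ++ D2). split; [eapply NoDup_remove_1; eauto|].
    split; [|split].
    + intros f. rewrite E1, !lsum_app. simpl. ring.
    + intros f. rewrite E2, !lsumR_app. simpl. ring.
    + intros x. specialize (E3 x). rewrite in_app_iff in *. simpl in *.
      pose proof (NoDup_remove_2 _ _ _ HD) as Hn. rewrite in_app_iff in Hn.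
      split.
      * intros Hx. assert (x <> a) by (intros ->; tauto).
        split; [tauto|]. intros [|]; [congruence | tauto].
      * intros [Hx Hx']. assert (In x D1 \/ a = x \/ In x D2) by tauto. tauto.
Qed.

Lemma lsumR_incl {I} (A B : list I) f : NoDup A -> NoDup B -> incl A B ->
  (forall i, 0 <= f i) -> lsumR A f <= lsumR B f.
Proof.
  intros HA HB Hi Hf. destruct (split_incl A B HA HB Hi) as (D & _ & _ & E & _).
  rewrite E. pose proof (lsumR_nonneg D f (fun i _ => Hf i)). lra.
Qed.

Lemma union_list {I} (A B : list I) : exists U, NoDup U /\ incl A U /\ incl B U.
Proof.
  exists (nodup eq_dec_classic (A ++ B)). split; [apply NoDup_nodup|].
  split; intros x Hx; apply nodup_In; apply in_app_iff; auto.
Qed.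

(** * Unordered sums *)
(* Unconditional convergence of a family; absolute summability is [bsum] of the moduli. *)
Definition HS {I : Type} (f : I -> C) (s : C) : Prop :=
  forall eps, 0 < eps -> exists A, NoDup A /\
    forall B, NoDup B -> incl A B -> Cmod (lsum B f - s) < eps.
Definition bsum {I : Type} (f : I -> R) (M : R) : Prop :=
  forall l, NoDup l -> lsumR l f <= M.

Lemma HS_unique {I} (f : I -> C) s s' : HS f s -> HS f s' -> s = s'.
Proof.
  intros H H'. apply NNPP; intros Hne.
  assert (Hp : 0 < Cmod (s - s')).
  { apply Cmod_gt_0. intros E. apply Hne. apply Ceq_minus. auto. }
  destruct (H (Cmod (s - s') / 2)) as (A & _ & HA); [lra|].
  destruct (H' (Cmod (s - s') / 2)) as (A' & _ & HA'); [lra|].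
  destruct (union_list A A') as (U & HU & I1 & I2).
  specialize (HA U HU I1). specialize (HA' U HU I2).
  assert (Cmod (s - s') <= Cmod (lsum U f - s') + Cmod (lsum U f - s)).
  { replace (s - s')%C with ((lsum U f - s') + - (lsum U f - s))%C by ring.
    eapply Rle_trans; [apply Cmod_triangle|]. rewrite Cmod_opp. lra. }
  lra.
Qed.

Lemma HS_ext {I} (f g : I -> C) s : (forall i, f i = g i) -> HS f s -> HS g s.
Proof. intros E. replace g with f; auto. apply functional_extensionality; auto. Qed.

Lemma HS_plus {I} (f g : I -> C) s t : HS f s -> HS g t -> HS (fun i => f i + g i)%C (s + t)%C.
Proof.
  intros Hf Hg eps He.
  destruct (Hf (eps / 2)) as (A & _ & HA); [lra|].
  destruct (Hg (eps / 2)) as (A' & _ & HA'); [lra|].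
  destruct (union_list A A') as (U & HU & I1 & I2).
  exists U; split; auto. intros B HB Hi.
  specialize (HA B HB (fun x h => Hi x (I1 x h))). specialize (HA' B HB (fun x h => Hi x (I2 x h))).
  rewrite lsum_plus. replace (lsum B f + lsum B g - (s + t))%C with ((lsum B f - s) + (lsum B g - t))%C by ring.
  eapply Rle_lt_trans; [apply Cmod_triangle|]. lra.
Qed.

Lemma HS_scal {I} (f : I -> C) s c : HS f s -> HS (fun i => c * f i)%C (c * s)%C.
Proof.
  intros Hf eps He. pose proof (Cmod_ge_0 c).
  destruct (Hf (eps / (Cmod c + 1))) as (A & HA0 & HA); [apply Rdiv_lt_0_compat; lra|].
  exists A; split; auto. intros B HB Hi. specialize (HA B HB Hi).
  rewrite lsum_scal. replace (c * lsum B f - c * s)%C with (c * (lsum B f - s))%C by ring.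
  rewrite Cmod_mult. apply Rle_lt_trans with (Cmod c * (eps / (Cmod c + 1))).
  - apply Rmult_le_compat_l; lra.
  - unfold Rdiv. rewrite <- Rmult_assoc. apply (Rmult_lt_reg_r (Cmod c + 1)); [lra|].
    field_simplify; [|lra]. nra.
Qed.

Lemma HS_finite {I} (f : I -> C) (l : list I) :
  NoDup l -> (forall i, ~ In i l -> f i = RtoC 0) -> HS f (lsum l f).
Proof.
  intros Hl H0 eps He. exists l; split; auto. intros B HB Hi.
  destruct (split_incl l B Hl HB Hi) as (D & _ & E & _ & E3).
  rewrite E. rewrite (lsum_ext D f (fun _ => RtoC 0)), lsum_zero.
  - replace (lsum l f + 0 - lsum l f)%C with (RtoC 0) by ring. rewrite Cmod_0; auto.
  - intros i Hi'. apply H0. apply E3; auto.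
Qed.

Lemma HS_zero {I} : HS (fun _ : I => RtoC 0) (RtoC 0).
Proof. apply (HS_finite _ (@nil I)); [constructor | auto]. Qed.

Lemma HS_lsum {I J} (l : list J) (f : J -> I -> C) (s : J -> C) :
  (forall j, In j l -> HS (f j) (s j)) -> HS (fun i => lsum l (fun j => f j i)) (lsum l s).
Proof.
  induction l as [|a l IH]; simpl; intros H.
  - apply HS_zero.
  - apply HS_plus; auto.
Qed.

Lemma bsum_le {I} (f g : I -> R) M : (forall i, f i <= g i) -> bsum g M -> bsum f M.
Proof. intros H Hg l Hl. eapply Rle_trans; [apply lsumR_le; auto | apply Hg; auto]. Qed.
Lemma bsum_weaken {I} (f : I -> R) M M' : M <= M' -> bsum f M -> bsum f M'.
Proof. intros H Hg l Hl. eapply Rle_trans; [apply Hg; auto | auto]. Qed.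
Lemma bsum_plus {I} (f g : I -> R) M N : bsum f M -> bsum g N -> bsum (fun i => f i + g i) (M + N).
Proof. intros H Hg l Hl. rewrite lsumR_plus. apply Rplus_le_compat; auto. Qed.
Lemma bsum_scal {I} (f : I -> R) M c : 0 <= c -> bsum f M -> bsum (fun i => c * f i) (c * M).
Proof. intros H Hg l Hl. rewrite lsumR_scal. apply Rmult_le_compat_l; auto. Qed.
Lemma bsum_ge0 {I} (f : I -> R) M : bsum f M -> 0 <= M.
Proof. intros H. apply (H nil). constructor. Qed.
Lemma bsum_term {I} (f : I -> R) M i : bsum f M -> f i <= M.
Proof.
  intros H. specialize (H (i :: nil)). simpl in H. rewrite Rplus_0_r in H. apply H.
  constructor; [simpl; tauto | constructor].
Qed.
Lemma bsum_inj {I J} (h : I -> J) (f : J -> R) M :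
  (forall i i', h i = h i' -> i = i') -> bsum f M -> bsum (fun i => f (h i)) M.
Proof.
  intros Hinj Hf l Hl. rewrite <- lsumR_map. apply Hf.
  apply Injective_map_NoDup; auto.
Qed.

Lemma HS_bound {I} (f : I -> C) s M : HS f s -> bsum (fun i => Cmod (f i)) M -> Cmod s <= M.
Proof.
  intros H Hb. apply le_epsilon. intros eps He.
  destruct (H eps He) as (A & HA & HA'). specialize (HA' A HA (incl_refl _)).
  replace s with (lsum A f + - (lsum A f - s))%C by ring.
  eapply Rle_trans; [apply Cmod_triangle|]. rewrite Cmod_opp.
  pose proof (lsum_Cmod A f). specialize (Hb A HA). lra.
Qed.

Lemma HS_exists_pos {I} (f : I -> R) M : (forall i, 0 <= f i) -> bsum f M ->
  exists s, HS (fun i => RtoC (f i)) (RtoC s).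
Proof.
  intros Hf Hb.
  destruct (completeness (fun x => exists l, NoDup l /\ x = lsumR l f)) as (s & Hs1 & Hs2).
  - exists M. intros x (l & Hl & ->). apply Hb; auto.
  - exists 0, nil. split; [constructor | auto].
  - exists s. intros eps He.
    assert (exists A, NoDup A /\ s - eps < lsumR A f) as (A & HA & HA').
    { apply NNPP; intros Hn. assert (s <= s - eps); [|lra].
      apply Hs2. intros x (l & Hl & ->). apply Rnot_lt_le. intros Hlt. apply Hn. eauto. }
    exists A; split; auto. intros B HB Hi.
    pose proof (lsumR_incl A B f HA HB Hi Hf).
    assert (lsumR B f <= s) by (apply Hs1; eauto).
    rewrite lsum_RtoC, <- RtoC_minus, Cmod_R. apply Rabs_def1; lra.
Qed.

(** Splitting into real and imaginary parts, and each of these into positive and negative parts,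
    reduces the claim to nonnegative families, whose sum is the supremum of the finite partial
    sums. *)
Lemma HS_exists {I} (f : I -> C) M : bsum (fun i => Cmod (f i)) M -> exists s, HS f s.
Proof.
  intros Hb.
  assert (Hr : forall h : I -> R, (forall i, Rabs (h i) <= Cmod (f i)) ->
     exists s, HS (fun i => RtoC (h i)) (RtoC s)).
  { intros h Hh.
    destruct (HS_exists_pos (fun i => Rmax (h i) 0) M) as (s1 & H1).
    { intros; apply Rmax_r. }
    { eapply bsum_le; [|apply Hb]. intros i; simpl. apply Rmax_lub; [|apply Cmod_ge_0].
      eapply Rle_trans; [apply Rle_abs | apply Hh]. }
    destruct (HS_exists_pos (fun i => Rmax (- h i) 0) M) as (s2 & H2).
    { intros; apply Rmax_r. }
    { eapply bsum_le; [|apply Hb]. intros i; simpl. apply Rmax_lub; [|apply Cmod_ge_0].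
      eapply Rle_trans; [apply Rle_abs | rewrite Rabs_Ropp; apply Hh]. }
    exists (s1 - s2).
    replace (RtoC (s1 - s2)) with (RtoC s1 + (- (1)) * RtoC s2)%C by (rewrite RtoC_minus; ring).
    apply (HS_scal _ _ (- (1))%C) in H2.
    eapply HS_ext; [|apply (HS_plus _ _ _ _ H1 H2)].
    intros i; simpl. replace (RtoC (h i)) with (RtoC (Rmax (h i) 0 - Rmax (- h i) 0)).
    - rewrite RtoC_minus. ring.
    - f_equal. unfold Rmax. repeat destruct Rle_dec; lra. }
  assert (Hc : forall z : C, Rabs (fst z) <= Cmod z /\ Rabs (snd z) <= Cmod z).
  { intros z. pose proof (Rmax_Cmod z). pose proof (Rmax_l (Rabs (fst z)) (Rabs (snd z))).
    pose proof (Rmax_r (Rabs (fst z)) (Rabs (snd z))). lra. }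
  destruct (Hr (fun i => fst (f i))) as (s1 & H1); [intros; apply Hc|].
  destruct (Hr (fun i => snd (f i))) as (s2 & H2); [intros; apply Hc|].
  exists (RtoC s1 + Ci * RtoC s2)%C.
  eapply HS_ext; [|apply (HS_plus _ _ _ _ H1 (HS_scal _ _ Ci H2))].
  intros i; simpl. apply injective_projections; simpl; ring.
Qed.

Lemma HS_reindex {I J} (h : I -> J) (k : J -> I) (f : J -> C) s :
  (forall i, k (h i) = i) -> (forall j, h (k j) = j) -> HS f s -> HS (fun i => f (h i)) s.
Proof.
  intros H1 H2 Hf eps He. destruct (Hf eps He) as (A & HA & HA').
  assert (Ih : Injective h). { intros x y E. rewrite <- (H1 x), <- (H1 y), E; auto. }
  assert (Ik : Injective k). { intros x y E. rewrite <- (H2 x), <- (H2 y), E; auto. }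
  exists (map k A). split; [apply Injective_map_NoDup; auto|].
  intros B HB Hi. rewrite <- lsum_map. apply HA'.
  - apply Injective_map_NoDup; auto.
  - intros x Hx. apply in_map_iff. exists (k x). split; auto. apply Hi. apply in_map; auto.
Qed.

Lemma NoDup_pairs {I J} (l : list I) (h : I -> list J) :
  NoDup l -> (forall i, NoDup (h i)) -> NoDup (flat_map (fun i => map (pair i) (h i)) l).
Proof.
  intros Hl Hh. induction Hl as [|a l Ha Hl IH]; simpl; [constructor|].
  apply NoDup_app; auto.
  - apply Injective_map_NoDup; auto. intros x y E; congruence.
  - intros x Hx Hx'. apply in_map_iff in Hx. destruct Hx as (j & <- & Hj).
    apply in_flat_map in Hx'. destruct Hx' as (i & Hi & Hi').
    apply in_map_iff in Hi'. destruct Hi' as (j' & E & _). congruence.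
Qed.

(** For finitely many rows one picks in each row a finite set that is accurate for the sum of that
    row and contains the relevant part of [A]. The union of these sets contains [A], so its sum is
    close to [s]. *)
Lemma HS_Fubini {I J} (f : I * J -> C) (F : I -> C) s :
  HS f s -> (forall i, HS (fun j => f (i, j)) (F i)) -> HS F s.
Proof.
  intros Hf HF eps He.
  destruct (Hf (eps / 2)) as (A & HA & HA'); [lra|].
  exists (nodup eq_dec_classic (map fst A)). split; [apply NoDup_nodup|].
  intros B HB Hi.
  (* The tolerance is shared between the rows of [B]; the added 1 covers an empty [B]. *)
  set (d := eps / 2 / (INR (length B) + 1)).
  assert (Hd : 0 < d). { apply Rdiv_lt_0_compat; [lra|]. pose proof (pos_INR (length B)); lra. }
  assert (Hc : forall i, exists L, NoDup L /\ (forall j, In (i, j) A -> In j L) /\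
             Cmod (lsum L (fun j => f (i, j)) - F i) < d).
  { intros i. destruct (HF i d Hd) as (Ai & HAi & HAi').
    destruct (union_list Ai (map snd A)) as (U & HU & I1 & I2).
    exists U. split; auto. split; auto.
    intros j Hj. apply I2. apply in_map_iff. exists (i, j); auto. }
  destruct (choice _ Hc) as (L & HL).
  set (W := flat_map (fun i => map (pair i) (L i)) B).
  assert (HW : NoDup W). { apply NoDup_pairs; auto. intros i; apply HL. }
  assert (HAW : incl A W).
  { intros [i j] Hij. apply in_flat_map. exists i. split.
    - apply Hi. apply nodup_In. apply in_map_iff. exists (i, j); auto.
    - apply in_map. apply HL; auto. }
  specialize (HA' W HW HAW).
  assert (E : lsum W f = lsum B (fun i => lsum (L i) (fun j => f (i, j)))).
  { unfold W. rewrite lsum_flat_map. apply lsum_ext. intros i _. apply lsum_map. }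
  assert (E2 : Cmod (lsum B F - lsum W f) <= INR (length B) * d).
  { rewrite E. replace (lsum B F - lsum B (fun i => lsum (L i) (fun j => f (i, j))))%C
      with (lsum B (fun i => F i + (- (1)) * lsum (L i) (fun j => f (i, j)))%C).
    - eapply Rle_trans; [apply lsum_Cmod|]. rewrite <- lsumR_const.
      apply lsumR_le. intros i _.
      destruct (HL i) as (_ & _ & Hl). left.
      replace (F i + - (1) * lsum (L i) (fun j : J => f (i, j)))%C with
        (- (lsum (L i) (fun j : J => f (i, j)) - F i))%C by ring. rewrite Cmod_opp; auto.
    - rewrite lsum_plus, lsum_scal. ring. }
  replace (lsum B F - s)%C with ((lsum B F - lsum W f) + (lsum W f - s))%C by ring.
  eapply Rle_lt_trans; [apply Cmod_triangle|].
  assert (INR (length B) * d < eps / 2); [|lra].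
  unfold d. pose proof (pos_INR (length B)). apply (Rmult_lt_reg_r (INR (length B) + 1)); [lra|].
  field_simplify; [|lra]. nra.
Qed.

Lemma bsum_Fubini {I J} (f : I * J -> R) (m : I -> R) M :
  (forall x, 0 <= f x) -> (forall i, bsum (fun j => f (i, j)) (m i)) -> bsum m M -> bsum f M.
Proof.
  intros Hf Hm HM l Hl.
  set (B := nodup eq_dec_classic (map fst l)). set (L := nodup eq_dec_classic (map snd l)).
  apply Rle_trans with (lsumR (flat_map (fun i => map (pair i) L) B) f).
  - apply lsumR_incl; auto.
    + apply NoDup_pairs; [apply NoDup_nodup | intros; apply NoDup_nodup].
    + intros [i j] Hij. apply in_flat_map. exists i. split.
      * apply nodup_In. apply in_map_iff. exists (i, j); auto.
      * apply in_map. apply nodup_In. apply in_map_iff. exists (i, j); auto.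
  - rewrite lsumR_flat_map. apply Rle_trans with (lsumR B m).
    + apply lsumR_le. intros i _. rewrite lsumR_map. apply Hm. apply NoDup_nodup.
    + apply HM. apply NoDup_nodup.
Qed.

Lemma bsum_prod {I J} (f : I -> R) (g : J -> R) M N :
  (forall i, 0 <= f i) -> (forall j, 0 <= g j) -> bsum f M -> bsum g N ->
  bsum (fun x : I * J => f (fst x) * g (snd x)) (M * N).
Proof.
  intros Hf Hg HM HN. apply (bsum_Fubini _ (fun i => f i * N)).
  - intros x; apply Rmult_le_pos; auto.
  - intros i; simpl. apply bsum_scal; auto.
  - assert (0 <= N) by (apply (bsum_ge0 _ _ HN)).
    apply bsum_le with (fun i => N * f i); [intros; lra|]. rewrite Rmult_comm. apply bsum_scal; auto.
Qed.

Lemma HS_swap {I J} (f : I * J -> C) s : HS f s -> HS (fun x : J * I => f (snd x, fst x)) s.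
Proof.
  intros H. apply (HS_reindex (fun x : J * I => (snd x, fst x)) (fun x => (snd x, fst x))) in H; auto;
  intros [a b]; auto.
Qed.

(** A total summation operator: the value is arbitrary unless the family has a sum, so it carries
    information only through [gsum_HS] and [gsum_eq]. *)
Definition gsum {I : Type} (f : I -> C) : C := epsilon (inhabits (RtoC 0)) (fun s => HS f s).

Lemma gsum_HS {I} (f : I -> C) M : bsum (fun i => Cmod (f i)) M -> HS f (gsum f).
Proof. intros H. apply (epsilon_spec (inhabits (RtoC 0)) (fun s => HS f s)). eapply HS_exists; eauto. Qed.
Lemma gsum_eq {I} (f : I -> C) s : HS f s -> gsum f = s.
Proof. intros H. apply (HS_unique f); auto. apply (epsilon_spec (inhabits (RtoC 0)) (fun s => HS f s)). eauto. Qed.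

Lemma bsum_nat (f : nat -> R) M : (forall k, 0 <= f k) ->
  (forall N, lsumR (seq 0 N) f <= M) -> bsum f M.
Proof.
  intros Hf H l Hl.
  assert (exists N, incl l (seq 0 N)) as (N & HN).
  { exists (S (list_max l)). intros x Hx. apply in_seq.
    pose proof (proj1 (list_max_le l (list_max l)) (Nat.le_refl _)) as Hm.
    rewrite Forall_forall in Hm. specialize (Hm x Hx). lia. }
  eapply Rle_trans; [|apply (H N)]. apply lsumR_incl; auto. apply seq_NoDup.
Qed.

Lemma lsumR_seq_S N f : lsumR (seq 0 (S N)) f = lsumR (seq 0 N) f + f N.
Proof. rewrite seq_S, lsumR_app. simpl. ring. Qed.
Lemma lsum_seq_S N f : lsum (seq 0 (S N)) f = (lsum (seq 0 N) f + f N)%C.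
Proof. rewrite seq_S, lsum_app. simpl. ring. Qed.

Lemma bsum_geom q : 0 <= q < 1 -> bsum (fun k => q ^ k) (/ (1 - q)).
Proof.
  intros Hq. apply bsum_nat; [intros; apply pow_le; lra|].
  intros N. assert (lsumR (seq 0 N) (fun k => q ^ k) = (1 - q ^ N) / (1 - q)) as ->.
  { induction N as [|N IH]; [simpl; field; lra|].
    rewrite lsumR_seq_S, IH. simpl. field. lra. }
  unfold Rdiv. rewrite <- (Rmult_1_l (/ (1 - q))) at 2. apply Rmult_le_compat_r.
  - left; apply Rinv_0_lt_compat; lra.
  - pose proof (pow_le q N). lra.
Qed.

Lemma bsum_half : bsum (fun k => (/ 2) ^ k) 2.
Proof. eapply bsum_weaken; [|apply (bsum_geom (/ 2)); lra]. right; field. Qed.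

Lemma lsumR_filter_split {I} (l : list I) (p : I -> bool) f :
  lsumR l f = lsumR (filter p l) f + lsumR (filter (fun x => negb (p x)) l) f.
Proof. induction l as [|a l IH]; simpl; [ring|]. destruct (p a); simpl; rewrite IH; ring. Qed.

Lemma bsum_Z (f : Z -> R) M N :
  bsum (fun n => f (Z.of_nat n)) M -> bsum (fun n => f (- Z.of_nat n)%Z) N -> bsum f (M + N).
Proof.
  intros HM HN l Hl. rewrite (lsumR_filter_split l (fun x => Z.leb 0 x)).
  apply Rplus_le_compat.
  - set (l' := filter _ l).
    assert (E : l' = map Z.of_nat (map Z.to_nat l')).
    { rewrite map_map, <- (map_id l') at 1. apply map_ext_in. intros x Hx.
      apply filter_In in Hx. destruct Hx as [_ Hx]. apply Z.leb_le in Hx. lia. }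
    assert (HN' : NoDup l') by (apply NoDup_filter; auto).
    rewrite E, lsumR_map. apply HM. rewrite E in HN'. apply NoDup_map_inv in HN'. auto.
  - set (l' := filter _ l).
    assert (E : l' = map (fun n => (- Z.of_nat n)%Z) (map (fun x => Z.to_nat (- x)) l')).
    { rewrite map_map, <- (map_id l') at 1. apply map_ext_in. intros x Hx.
      apply filter_In in Hx. destruct Hx as [_ Hx].
      destruct (Z.leb_spec 0 x); simpl in Hx; [congruence|]. lia. }
    assert (HN' : NoDup l') by (apply NoDup_filter; auto).
    rewrite E, lsumR_map. apply HN. rewrite E in HN'. apply NoDup_map_inv in HN'. auto.
Qed.

Lemma exp_pow x k : exp x ^ k = exp (INR k * x).
Proof.
  induction k as [|k IH]; [simpl; rewrite Rmult_0_l, exp_0; auto|].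
  rewrite S_INR. simpl pow. rewrite IH, <- exp_plus. f_equal; ring.
Qed.

Lemma bsum_exp_Z c : 0 < c -> exists K, bsum (fun l => exp (- c * Rabs (IZR l))) K.
Proof.
  intros Hc. exists (/ (1 - exp (- c)) + / (1 - exp (- c))).
  assert (0 <= exp (- c) < 1).
  { split; [left; apply exp_pos|]. rewrite <- exp_0. apply exp_increasing. lra. }
  apply bsum_Z.
  - apply bsum_le with (fun k => exp (- c) ^ k); [|apply bsum_geom; auto].
    intros k. rewrite exp_pow, <- INR_IZR_INZ, Rabs_pos_eq by apply pos_INR. right; f_equal; ring.
  - apply bsum_le with (fun k => exp (- c) ^ k); [|apply bsum_geom; auto].
    intros k. rewrite exp_pow, opp_IZR, Rabs_Ropp, <- INR_IZR_INZ, Rabs_pos_eq by apply pos_INR.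
    right; f_equal; ring.
Qed.

(** * The complex exponential *)

Definition Cexp (z : C) : C := (exp (fst z) * cos (snd z), exp (fst z) * sin (snd z)).

Lemma Cexp_plus z w : Cexp (z + w) = (Cexp z * Cexp w)%C.
Proof.
  unfold Cexp. apply injective_projections; simpl; rewrite exp_plus, ?cos_plus, ?sin_plus; ring.
Qed.
Lemma Cexp_0 : Cexp (RtoC 0) = RtoC 1.
Proof. unfold Cexp, RtoC; simpl. rewrite exp_0, cos_0, sin_0. f_equal; ring. Qed.
Lemma Cmod_sqr z : Cmod z * Cmod z = fst z * fst z + snd z * snd z.
Proof. unfold Cmod. rewrite sqrt_sqrt; [ring|]. nra. Qed.
Lemma Cmod_Cexp z : Cmod (Cexp z) = exp (Re z).
Proof.
  unfold Cmod, Cexp, Re; simpl.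
  replace (exp (fst z) * cos (snd z) * (exp (fst z) * cos (snd z) * 1) +
     exp (fst z) * sin (snd z) * (exp (fst z) * sin (snd z) * 1)) with
   ((exp (fst z)) * (exp (fst z)) * ((Rsqr (sin (snd z)) + Rsqr (cos (snd z))))) by (unfold Rsqr; ring).
  rewrite sin2_cos2, Rmult_1_r. apply sqrt_square. left; apply exp_pos.
Qed.
Lemma Cexp_neq_0 z : Cexp z <> RtoC 0.
Proof.
  intros E. pose proof (Cmod_Cexp z) as H. rewrite E, Cmod_0 in H. pose proof (exp_pos (Re z)). lra.
Qed.
Lemma Cexp_opp z : Cexp (- z) = (/ Cexp z)%C.
Proof.
  pose proof (Cexp_neq_0 z).
  assert (E : (Cexp (- z) * Cexp z)%C = RtoC 1).
  { rewrite <- Cexp_plus, <- Cexp_0. f_equal. ring. }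
  transitivity (Cexp (- z) * Cexp z * / Cexp z)%C; [field; auto | rewrite E; ring].
Qed.
Lemma Cexp_real x : Cexp (RtoC x) = RtoC (exp x).
Proof. unfold Cexp, RtoC; simpl. rewrite cos_0, sin_0. f_equal; ring. Qed.
Lemma Cexp_2PI_nat k : Cexp (RtoC (2 * PI * INR k) * Ci) = RtoC 1.
Proof.
  unfold Cexp, RtoC, Ci; simpl.
  replace (2 * PI * INR k * 0 - 0 * 1) with 0 by ring. rewrite exp_0.
  replace (2 * PI * INR k * 1 + 0 * 0) with (0 + 2 * INR k * PI) by ring.
  rewrite cos_period, sin_period, cos_0, sin_0. f_equal; ring.
Qed.
Lemma Cexp_2PI k : Cexp (RtoC (2 * PI * IZR k) * Ci) = RtoC 1.
Proof.
  destruct (Z.le_gt_cases 0 k) as [H|H].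
  - rewrite <- (Z2Nat.id k) by auto. rewrite <- INR_IZR_INZ. apply Cexp_2PI_nat.
  - replace (RtoC (2 * PI * IZR k) * Ci)%C with (- (RtoC (2 * PI * INR (Z.to_nat (- k))) * Ci))%C.
    + rewrite Cexp_opp, Cexp_2PI_nat. field.
    + rewrite INR_IZR_INZ, Z2Nat.id by lia. rewrite opp_IZR.
      replace (2 * PI * - IZR k) with (- (2 * PI * IZR k)) by ring. rewrite RtoC_opp. ring.
Qed.
Lemma Cexp_PI : Cexp (RtoC PI * Ci) = (- (1))%C.
Proof.
  unfold Cexp, RtoC, Ci; simpl. replace (PI * 0 - 0 * 1) with 0 by ring.
  replace (PI * 1 + 0 * 0) with PI by ring. rewrite exp_0, cos_PI, sin_PI.
  apply injective_projections; simpl; ring.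
Qed.

(** * Complex differentiability *)
Definition cdiff (f : C -> C) (z L : C) : Prop :=
  forall eps, 0 < eps -> exists delta, 0 < delta /\
    forall h, Cmod h < delta -> Cmod (f (z + h) - f z - L * h)%C <= eps * Cmod h.
Definition ent (f : C -> C) : Prop := forall z, exists L, cdiff f z L.

Lemma cdiff_bound f z L : cdiff f z L ->
  exists delta, 0 < delta /\ forall h, Cmod h < delta -> Cmod (f (z + h) - f z)%C <= (Cmod L + 1) * Cmod h.
Proof.
  intros H. destruct (H 1) as (d & Hd & Hd'); [lra|]. exists d; split; auto.
  intros h Hh. specialize (Hd' h Hh).
  replace (f (z + h) - f z)%C with ((f (z + h) - f z - L * h) + L * h)%C by ring.
  eapply Rle_trans; [apply Cmod_triangle|]. rewrite Cmod_mult. lra.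
Qed.

Lemma cdiff_cont f z L : cdiff f z L -> forall eps, 0 < eps -> exists delta, 0 < delta /\
  forall h, Cmod h < delta -> Cmod (f (z + h) - f z)%C < eps.
Proof.
  intros H eps He. destruct (cdiff_bound f z L H) as (d & Hd & Hd').
  pose proof (Cmod_ge_0 L).
  exists (Rmin d (eps / (Cmod L + 1))). split.
  - apply Rmin_pos; auto. apply Rdiv_lt_0_compat; lra.
  - intros h Hh.
    assert (Cmod h < d) by (eapply Rlt_le_trans; [apply Hh | apply Rmin_l]).
    assert (Hx : Cmod h < eps / (Cmod L + 1)) by (eapply Rlt_le_trans; [apply Hh | apply Rmin_r]).
    eapply Rle_lt_trans; [apply Hd'; auto|].
    apply (Rmult_lt_compat_l (Cmod L + 1)) in Hx; [|lra].
    replace ((Cmod L + 1) * (eps / (Cmod L + 1))) with eps in Hx by (field; lra). auto.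
Qed.

Lemma cdiff_ext f g z L : (forall w, f w = g w) -> cdiff f z L -> cdiff g z L.
Proof. intros E. replace g with f; auto. apply functional_extensionality; auto. Qed.
Lemma ent_ext f g : (forall w, f w = g w) -> ent f -> ent g.
Proof. intros E. replace g with f; auto. apply functional_extensionality; auto. Qed.

Lemma cdiff_const c z : cdiff (fun _ => c) z (RtoC 0).
Proof.
  intros eps He. exists 1; split; [lra|]. intros h _.
  replace (c - c - 0 * h)%C with (RtoC 0) by ring. rewrite Cmod_0.
  apply Rmult_le_pos; [lra | apply Cmod_ge_0].
Qed.
Lemma cdiff_id z : cdiff (fun w => w) z (RtoC 1).
Proof.
  intros eps He. exists 1; split; [lra|]. intros h _.
  replace (z + h - z - 1 * h)%C with (RtoC 0) by ring. rewrite Cmod_0.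
  apply Rmult_le_pos; [lra | apply Cmod_ge_0].
Qed.
Lemma cdiff_plus f g z L M : cdiff f z L -> cdiff g z M -> cdiff (fun w => f w + g w)%C z (L + M).
Proof.
  intros Hf Hg eps He. destruct (Hf (eps / 2)) as (d & Hd & Hd'); [lra|].
  destruct (Hg (eps / 2)) as (e & He0 & He'); [lra|].
  exists (Rmin d e); split; [apply Rmin_pos; auto|]. intros h Hh.
  specialize (Hd' h (Rlt_le_trans _ _ _ Hh (Rmin_l _ _))).
  specialize (He' h (Rlt_le_trans _ _ _ Hh (Rmin_r _ _))).
  replace (f (z + h) + g (z + h) - (f z + g z) - (L + M) * h)%C with
    ((f (z + h) - f z - L * h) + (g (z + h) - g z - M * h))%C by ring.
  eapply Rle_trans; [apply Cmod_triangle|]. lra.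
Qed.

(* Carathéodory form: differentiability at z is the existence of a slope function
   continuous at z; products and compositions follow from it. *)
Definition slope (f : C -> C) (z L h : C) : C :=
  if Ceq_dec h 0 then L else ((f (z + h) - f z) / h)%C.
Definition cont0 (u : C -> C) : Prop := forall eps, 0 < eps -> exists delta, 0 < delta /\
  forall h, Cmod h < delta -> Cmod (u h - u (RtoC 0))%C < eps.

Lemma slope_eq f z L h : (f (z + h) - f z)%C = (slope f z L h * h)%C.
Proof.
  unfold slope. destruct (Ceq_dec h 0) as [->|Hh].
  - replace (z + 0)%C with z by ring. ring.
  - field; auto.
Qed.
Lemma slope_cont f z L : cdiff f z L -> cont0 (slope f z L).
Proof.
  intros H eps He. destruct (H (eps / 2)) as (d & Hd & Hd'); [lra|].
  exists d; split; auto. intros h Hh.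
  unfold slope at 2. destruct (Ceq_dec 0 0) as [_|n]; [|congruence].
  destruct (Ceq_dec h 0) as [->|Hn].
  - unfold slope. destruct (Ceq_dec 0 0); [|congruence].
    replace (L - L)%C with (RtoC 0) by ring. rewrite Cmod_0; auto.
  - assert (Hp : 0 < Cmod h) by (apply Cmod_gt_0; auto).
    specialize (Hd' h Hh). rewrite (slope_eq f z L h) in Hd'.
    replace (slope f z L h * h - L * h)%C with ((slope f z L h - L) * h)%C in Hd' by ring.
    rewrite Cmod_mult in Hd'. apply Rmult_le_reg_r in Hd'; auto. lra.
Qed.
Lemma cdiff_of_slope f z u : (forall h, (f (z + h) - f z = u h * h)%C) -> cont0 u -> cdiff f z (u (RtoC 0)).
Proof.
  intros E H eps He. destruct (H eps He) as (d & Hd & Hd'). exists d; split; auto.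
  intros h Hh. rewrite E. replace (u h * h - u 0 * h)%C with ((u h - u (RtoC 0)) * h)%C by ring.
  rewrite Cmod_mult. apply Rmult_le_compat_r; [apply Cmod_ge_0|]. left; auto.
Qed.
Lemma cont0_plus u v : cont0 u -> cont0 v -> cont0 (fun h => u h + v h)%C.
Proof.
  intros Hu Hv eps He. destruct (Hu (eps / 2)) as (d & Hd & Hd'); [lra|].
  destruct (Hv (eps / 2)) as (e & He0 & He'); [lra|].
  exists (Rmin d e); split; [apply Rmin_pos; auto|]. intros h Hh.
  specialize (Hd' h (Rlt_le_trans _ _ _ Hh (Rmin_l _ _))).
  specialize (He' h (Rlt_le_trans _ _ _ Hh (Rmin_r _ _))).
  replace (u h + v h - (u 0 + v 0))%C with ((u h - u 0) + (v h - v 0))%C by ring.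
  eapply Rle_lt_trans; [apply Cmod_triangle|]. lra.
Qed.
Lemma cont0_mult u v : cont0 u -> cont0 v -> cont0 (fun h => u h * v h)%C.
Proof.
  intros Hu Hv eps He. set (a := u (RtoC 0)). set (b := v (RtoC 0)).
  pose proof (Cmod_ge_0 a) as Ha. pose proof (Cmod_ge_0 b) as Hb.
  set (e' := Rmin 1 (eps / (Cmod a + Cmod b + 2))).
  assert (He1 : 0 < e'). { apply Rmin_pos; [lra|]. apply Rdiv_lt_0_compat; lra. }
  destruct (Hu e' He1) as (d & Hd & Hd'). destruct (Hv e' He1) as (e & He0 & He').
  exists (Rmin d e); split; [apply Rmin_pos; auto|]. intros h Hh.
  specialize (Hd' h (Rlt_le_trans _ _ _ Hh (Rmin_l _ _))).
  specialize (He' h (Rlt_le_trans _ _ _ Hh (Rmin_r _ _))).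
  fold a in Hd' |- *. fold b in He' |- *.
  replace (u h * v h - a * b)%C with ((u h - a) * (v h - b) + (a * (v h - b) + b * (u h - a)))%C by ring.
  eapply Rle_lt_trans; [apply Cmod_triangle|].
  eapply Rle_lt_trans; [apply Rplus_le_compat_l, Cmod_triangle|]. rewrite !Cmod_mult.
  set (p := Cmod (u h - a)) in *. set (q := Cmod (v h - b)) in *.
  assert (0 <= p) by apply Cmod_ge_0. assert (0 <= q) by apply Cmod_ge_0.
  assert (e' <= 1) by apply Rmin_l. assert (H3 : e' <= eps / (Cmod a + Cmod b + 2)) by apply Rmin_r.
  assert (e' * (Cmod a + Cmod b + 2) <= eps).
  { apply (Rmult_le_compat_r (Cmod a + Cmod b + 2)) in H3; [|lra]. field_simplify in H3; lra. }
  nra.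
Qed.
Lemma cont0_const c : cont0 (fun _ => c).
Proof. intros eps He. exists 1; split; [lra|]. intros h _. replace (c - c)%C with (RtoC 0) by ring. rewrite Cmod_0; auto. Qed.
Lemma cont0_cdiff f z L : cdiff f z L -> cont0 (fun h => f (z + h)%C).
Proof.
  intros H eps He. destruct (cdiff_cont f z L H eps He) as (d & Hd & Hd').
  exists d; split; auto. intros h Hh. replace (z + 0)%C with z by ring. auto.
Qed.

Lemma cdiff_mult f g z L M : cdiff f z L -> cdiff g z M ->
  cdiff (fun w => f w * g w)%C z (L * g z + f z * M)%C.
Proof.
  intros Hf Hg.
  assert (E : (L * g z + f z * M)%C =
    ((fun h => slope f z L h * g (z + h)%C + f z * slope g z M h)%C (RtoC 0))).
  { unfold slope. destruct (Ceq_dec 0 0); [|congruence]. replace (z + 0)%C with z by ring. auto. }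
  rewrite E. apply (cdiff_of_slope (fun w => f w * g w)%C z (fun h => slope f z L h * g (z + h)%C + f z * slope g z M h)%C).
  - intros h. pose proof (slope_eq f z L h) as E1. pose proof (slope_eq g z M h) as E2.
    transitivity ((f (z + h) - f z) * g (z + h) + f z * (g (z + h) - g z))%C; [ring|].
    rewrite E1, E2. ring.
  - apply cont0_plus; apply cont0_mult; try apply slope_cont; auto; try apply cont0_const.
    eapply cont0_cdiff; eauto.
Qed.

Lemma cdiff_comp f g z L M : cdiff f z L -> cdiff g (f z) M -> cdiff (fun w => g (f w)) z (M * L)%C.
Proof.
  intros Hf Hg.
  assert (E : (M * L)%C = (fun h => slope g (f z) M (f (z + h)%C - f z) * slope f z L h)%C (RtoC 0)).
  { unfold slope. replace (z + 0)%C with z by ring. replace (f z - f z)%C with (RtoC 0) by ring.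
    destruct (Ceq_dec 0 0); [auto|congruence]. }
  rewrite E. apply (cdiff_of_slope (fun w => g (f w)) z (fun h => slope g (f z) M (f (z + h)%C - f z) * slope f z L h)%C).
  - intros h. pose proof (slope_eq f z L h) as E1.
    pose proof (slope_eq g (f z) M (f (z + h) - f z)%C) as E2.
    replace (f z + (f (z + h) - f z))%C with (f (z + h)%C) in E2 by (f_equal; ring).
    rewrite E2, <- Cmult_assoc, <- E1. ring.
  - apply cont0_mult; [|apply slope_cont; auto].
    intros eps He. destruct (slope_cont g (f z) M Hg eps He) as (d & Hd & Hd').
    destruct (cdiff_cont f z L Hf d Hd) as (e & He1 & He').
    exists e; split; auto. intros h Hh. replace (z + 0)%C with z by ring.
    replace (f z - f z)%C with (RtoC 0) by ring. apply Hd'. auto.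
Qed.

Lemma cdiff_inv z : z <> RtoC 0 -> cdiff (fun w => / w)%C z (- / (z * z))%C.
Proof.
  intros Hz eps He. assert (Hp : 0 < Cmod z) by (apply Cmod_gt_0; auto).
  set (r := Cmod z) in *.
  exists (Rmin (r / 2) (eps * (r * r * r) / 2)). split.
  { apply Rmin_pos; [lra|]. apply Rdiv_lt_0_compat; [|lra]. repeat apply Rmult_lt_0_compat; auto. }
  intros h Hh.
  assert (H1 : Cmod h < r / 2) by (eapply Rlt_le_trans; [apply Hh | apply Rmin_l]).
  assert (H2 : Cmod h < eps * (r * r * r) / 2) by (eapply Rlt_le_trans; [apply Hh | apply Rmin_r]).
  assert (H3 : r / 2 <= Cmod (z + h)).
  { assert (Cmod z <= Cmod (z + h) + Cmod h); [|fold r in H; lra].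
    replace z with ((z + h) + - h)%C at 1 by ring. eapply Rle_trans; [apply Cmod_triangle|].
    rewrite Cmod_opp; lra. }
  assert (Hn : (z + h)%C <> RtoC 0). { apply Cmod_gt_0. lra. }
  replace (/ (z + h) - / z - - / (z * z) * h)%C with (h * h / ((z * z) * (z + h)))%C by (field; auto).
  rewrite Cmod_div by (repeat apply Cmult_neq_0; auto). rewrite !Cmod_mult. fold r.
  pose proof (Cmod_ge_0 h).
  assert (0 < Cmod (z + h)) by lra.
  apply (Rmult_le_reg_r (r * r * Cmod (z + h))); [apply Rmult_lt_0_compat; auto; nra|].
  unfold Rdiv. rewrite Rmult_assoc, Rinv_l, Rmult_1_r by (apply Rgt_not_eq; apply Rmult_lt_0_compat; auto; nra).
  replace (eps * Cmod h * (r * r * Cmod (z + h))) with (Cmod h * (eps * (r * r) * Cmod (z + h))) by ring.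
  apply Rmult_le_compat_l; auto.
  apply Rle_trans with (eps * (r * r) * (r / 2)); [lra|].
  apply Rmult_le_compat_l; auto. apply Rmult_le_pos; nra.
Qed.

Lemma small_deriv f L : derivable_pt_lim f 0 L -> forall eps, 0 < eps ->
  exists d, 0 < d /\ forall x, Rabs x < d -> Rabs (f x - f 0 - L * x) <= eps * Rabs x.
Proof.
  intros H eps He. destruct (H eps He) as [d Hd]. exists (pos d). split; [apply cond_pos|].
  intros x Hx. destruct (Req_dec x 0) as [->|Hn].
  - replace (f 0 - f 0 - L * 0) with 0 by ring. rewrite Rabs_R0. lra.
  - specialize (Hd x Hn Hx). rewrite Rplus_0_l in Hd.
    replace (f x - f 0 - L * x) with (((f x - f 0) / x - L) * x) by (field; auto).
    rewrite Rabs_mult. apply Rmult_le_compat_r; [apply Rabs_pos | lra].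
Qed.

Lemma Cmod_le_sum z : Cmod z <= Rabs (fst z) + Rabs (snd z).
Proof.
  replace z with (RtoC (fst z) + Ci * RtoC (snd z))%C at 1.
  - eapply Rle_trans; [apply Cmod_triangle|]. rewrite Cmod_mult, !Cmod_R, Cmod_Ci. lra.
  - apply injective_projections; simpl; ring.
Qed.
Lemma fst_le_Cmod z : Rabs (fst z) <= Cmod z.
Proof. pose proof (Rmax_Cmod z). pose proof (Rmax_l (Rabs (fst z)) (Rabs (snd z))). lra. Qed.
Lemma snd_le_Cmod z : Rabs (snd z) <= Cmod z.
Proof. pose proof (Rmax_Cmod z). pose proof (Rmax_r (Rabs (fst z)) (Rabs (snd z))). lra. Qed.

(** The derivative at 0 is assembled from the real derivatives of exp, cos and sin at 0; the
    functional equation then transports it to every point in [cdiff_exp]. *)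
Lemma cdiff_exp0 : cdiff Cexp (RtoC 0) (RtoC 1).
Proof.
  intros eps He. set (e := Rmin 1 (eps / 8)).
  assert (He1 : 0 < e) by (apply Rmin_pos; lra).
  assert (He2 : e <= 1) by apply Rmin_l. assert (He3 : e <= eps / 8) by apply Rmin_r.
  pose proof (derivable_pt_lim_exp 0) as D1. rewrite exp_0 in D1.
  pose proof (derivable_pt_lim_cos 0) as D2. rewrite sin_0, Ropp_0 in D2.
  pose proof (derivable_pt_lim_sin 0) as D3. rewrite cos_0 in D3.
  destruct (small_deriv _ _ D1 e He1) as (d1 & P1' & Q1).
  destruct (small_deriv _ _ D2 e He1) as (d2 & P2' & Q2).
  destruct (small_deriv _ _ D3 e He1) as (d3 & P3' & Q3).
  rewrite exp_0 in Q1. rewrite cos_0 in Q2. rewrite sin_0 in Q3.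
  exists (Rmin (Rmin d1 (e / 2)) (Rmin d2 d3)). split; [repeat apply Rmin_pos; lra|].
  intros h Hh.
  assert (A1 : Cmod h < d1) by (eapply Rlt_le_trans; [apply Hh | eapply Rle_trans; [apply Rmin_l | apply Rmin_l]]).
  assert (A2 : Cmod h < e / 2) by (eapply Rlt_le_trans; [apply Hh | eapply Rle_trans; [apply Rmin_l | apply Rmin_r]]).
  assert (A3 : Cmod h < d2) by (eapply Rlt_le_trans; [apply Hh | eapply Rle_trans; [apply Rmin_r | apply Rmin_l]]).
  assert (A4 : Cmod h < d3) by (eapply Rlt_le_trans; [apply Hh | eapply Rle_trans; [apply Rmin_r | apply Rmin_r]]).
  pose proof (fst_le_Cmod h) as F1. pose proof (snd_le_Cmod h) as F2.
  set (x := fst h) in *. set (y := snd h) in *.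
  specialize (Q1 x ltac:(lra)). specialize (Q2 y ltac:(lra)). specialize (Q3 y ltac:(lra)).
  set (m := Cmod h) in *. assert (0 <= m) by apply Cmod_ge_0.
  pose proof (Rabs_pos x). pose proof (Rabs_pos y).
  replace (exp x - 1 - 1 * x) with (exp x - 1 - x) in Q1 by ring.
  replace (cos y - 1 - 0 * y) with (cos y - 1) in Q2 by ring.
  replace (sin y - 0 - 1 * y) with (sin y - y) in Q3 by ring.
  assert (Hex : Rabs (exp x - 1) <= e).
  { replace (exp x - 1) with ((exp x - 1 - x) + x) by ring. eapply Rle_trans; [apply Rabs_triang|]. nra. }
  assert (Hex2 : exp x <= 2). { apply Rabs_le_between in Hex. lra. }
  pose proof (exp_pos x).
  eapply Rle_trans; [apply Cmod_le_sum|]. unfold Cexp; simpl.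
  rewrite !Rplus_0_l. fold x y.
  rewrite exp_0, cos_0, sin_0.
  replace (exp x * cos y + - (1 * 1) + - (1 * x - 0 * y)) with (exp x * (cos y - 1) + (exp x - 1 - x)) by ring.
  replace (exp x * sin y + - (1 * 0) + - (1 * y + 0 * x)) with (exp x * (sin y - y) + (exp x - 1) * y) by ring.
  eapply Rle_trans; [apply Rplus_le_compat; apply Rabs_triang|].
  rewrite !Rabs_mult, (Rabs_pos_eq (exp x)) by lra.
  pose proof (Rabs_pos (cos y - 1)). pose proof (Rabs_pos (sin y - y)).
  assert (exp x * Rabs (cos y - 1) <= 2 * (e * m)) by (apply Rmult_le_compat; try lra; nra).
  assert (exp x * Rabs (sin y - y) <= 2 * (e * m)) by (apply Rmult_le_compat; try lra; nra).
  assert (Rabs (exp x - 1 - x) <= e * m) by nra.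
  assert (Rabs (exp x - 1) * Rabs y <= e * m) by (apply Rmult_le_compat; try lra; apply Rabs_pos).
  assert (e * m <= eps / 8 * m) by (apply Rmult_le_compat_r; auto). nra.
Qed.

Lemma cdiff_exp z : cdiff Cexp z (Cexp z).
Proof.
  intros eps He. pose proof (Cexp_neq_0 z) as Hz. apply Cmod_gt_0 in Hz.
  destruct (cdiff_exp0 (eps / Cmod (Cexp z))) as (d & Hd & Hd'); [apply Rdiv_lt_0_compat; lra|].
  exists d; split; auto. intros h Hh. specialize (Hd' h Hh). rewrite Cexp_0, Cplus_0_l in Hd'.
  replace (Cexp (z + h) - Cexp z - Cexp z * h)%C with (Cexp z * (Cexp h - 1 - 1 * h))%C
    by (rewrite Cexp_plus; ring).
  rewrite Cmod_mult. apply (Rmult_le_compat_l (Cmod (Cexp z))) in Hd'; [|lra].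
  eapply Rle_trans; [apply Hd'|]. right; field. lra.
Qed.

Lemma ent_const c : ent (fun _ => c).
Proof. intros z; eexists; apply cdiff_const. Qed.
Lemma ent_id : ent (fun z => z).
Proof. intros z; eexists; apply cdiff_id. Qed.
Lemma ent_plus f g : ent f -> ent g -> ent (fun z => f z + g z)%C.
Proof. intros Hf Hg z. destruct (Hf z), (Hg z). eexists; apply cdiff_plus; eauto. Qed.
Lemma ent_mult f g : ent f -> ent g -> ent (fun z => f z * g z)%C.
Proof. intros Hf Hg z. destruct (Hf z), (Hg z). eexists; apply cdiff_mult; eauto. Qed.
Lemma ent_comp f g : ent f -> ent g -> ent (fun z => g (f z)).
Proof. intros Hf Hg z. destruct (Hf z), (Hg (f z)). eexists; apply cdiff_comp; eauto. Qed.
Lemma ent_exp f : ent f -> ent (fun z => Cexp (f z)).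
Proof. intros Hf. apply (ent_comp f Cexp); auto. intros z; eexists; apply cdiff_exp. Qed.
Lemma ent_pow f k : ent f -> ent (fun z => f z ^ k)%C.
Proof. intros Hf. induction k as [|k IH]; [apply (ent_const (RtoC 1)) | apply (ent_mult f (fun z => f z ^ k)%C); auto]. Qed.
Lemma ent_lsum {I} (l : list I) (f : I -> C -> C) : (forall i, In i l -> ent (f i)) -> ent (fun z => lsum l (fun i => f i z)).
Proof.
  induction l as [|a l IH]; intros H; [apply (ent_const (RtoC 0))|].
  apply (ent_plus (f a) (fun z => lsum l (fun i => f i z))); [apply H; left; auto | apply IH; intros; apply H; right; auto].
Qed.
Lemma ent_opp f : ent f -> ent (fun z => - f z)%C.
Proof. intros H. apply (ent_ext (fun z => (- (1)) * f z)%C); [intros; ring|]. apply ent_mult; auto. apply ent_const. Qed.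
Lemma ent_minus f g : ent f -> ent g -> ent (fun z => f z - g z)%C.
Proof. intros. apply (ent_plus f (fun z => - g z)%C); auto. apply ent_opp; auto. Qed.
Ltac ent_tac := repeat first
  [ assumption | apply ent_const | apply ent_id
  | match goal with
    | |- ent (fun z => Cplus _ _) => apply ent_plus
    | |- ent (fun z => Cminus _ _) => apply ent_minus
    | |- ent (fun z => Copp _) => apply ent_opp
    | |- ent (fun z => Cmult _ _) => apply ent_mult
    | |- ent (fun z => Cpow _ _) => apply ent_pow
    | |- ent (fun z => Cexp _) => apply ent_exp
    | |- ent (fun z => lsum _ _) => apply ent_lsum; intros
    | |- ent (Cmult ?c) => apply (ent_mult (fun _ => c) (fun z => z))
    | |- ent (Cplus ?c) => apply (ent_plus (fun _ => c) (fun z => z))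
    end ].

(** * Contour integrals over rectangles *)
Definition ccont (f : R -> C) (t : R) : Prop := forall eps, 0 < eps -> exists d, 0 < d /\
  forall s, Rabs (s - t) < d -> Cmod (f s - f t)%C < eps.
Definition contC (f : C -> C) (z : C) : Prop := forall eps, 0 < eps -> exists d, 0 < d /\
  forall h, Cmod h < d -> Cmod (f (z + h) - f z)%C < eps.
Definition CI (f : R -> C) (a b : R) : C :=
  (RInt (fun t => fst (f t)) a b, RInt (fun t => snd (f t)) a b).
Definition ccont_on (f : R -> C) (a b : R) : Prop := forall t, a <= t <= b -> ccont f t.

Lemma ccont_fst f t : ccont f t -> continuous (fun s => fst (f s)) t.
Proof.
  intros H. apply continuity_pt_filterlim. intros eps He. destruct (H eps He) as (d & Hd & Hd').
  exists d; split; auto. intros s [_ Hs]. simpl in Hs. unfold R_dist in *. simpl. unfold R_dist.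
  specialize (Hd' s Hs). eapply Rle_lt_trans; [|apply Hd'].
  eapply Rle_trans; [|apply fst_le_Cmod]. simpl. right. f_equal.
Qed.
Lemma ccont_snd f t : ccont f t -> continuous (fun s => snd (f s)) t.
Proof.
  intros H. apply continuity_pt_filterlim. intros eps He. destruct (H eps He) as (d & Hd & Hd').
  exists d; split; auto. intros s [_ Hs]. simpl in Hs. unfold R_dist in *. simpl. unfold R_dist.
  specialize (Hd' s Hs). eapply Rle_lt_trans; [|apply Hd'].
  eapply Rle_trans; [|apply snd_le_Cmod]. simpl. right. f_equal.
Qed.
Lemma ccont_ex1 f a b : a <= b -> ccont_on f a b -> ex_RInt (fun t => fst (f t)) a b.
Proof.
  intros Hab H. apply (ex_RInt_continuous (V := R_CompleteNormedModule)). intros t Ht.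
  rewrite Rmin_left, Rmax_right in Ht by auto. apply ccont_fst; auto.
Qed.
Lemma ccont_ex2 f a b : a <= b -> ccont_on f a b -> ex_RInt (fun t => snd (f t)) a b.
Proof.
  intros Hab H. apply (ex_RInt_continuous (V := R_CompleteNormedModule)). intros t Ht.
  rewrite Rmin_left, Rmax_right in Ht by auto. apply ccont_snd; auto.
Qed.

Lemma CI_ext f g a b : a <= b -> (forall t, a < t < b -> f t = g t) -> CI f a b = CI g a b.
Proof.
  intros Hab H. unfold CI. f_equal; apply RInt_ext; intros t Ht; rewrite Rmin_left, Rmax_right in Ht by auto;
  rewrite H; auto.
Qed.
Lemma CI_plus f g a b : a <= b -> ccont_on f a b -> ccont_on g a b ->
  CI (fun t => f t + g t)%C a b = (CI f a b + CI g a b)%C.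
Proof.
  intros Hab Hf Hg. unfold CI, Cplus; simpl. f_equal.
  - apply (RInt_plus (V := R_CompleteNormedModule)); apply ccont_ex1; auto.
  - apply (RInt_plus (V := R_CompleteNormedModule)); apply ccont_ex2; auto.
Qed.
Lemma CI_scal c f a b : a <= b -> ccont_on f a b -> CI (fun t => c * f t)%C a b = (c * CI f a b)%C.
Proof.
  intros Hab Hf. pose proof (ccont_ex1 f a b Hab Hf) as E1. pose proof (ccont_ex2 f a b Hab Hf) as E2.
  unfold CI, Cmult; simpl. f_equal.
  - rewrite (RInt_minus (V := R_CompleteNormedModule) (fun t => fst c * fst (f t)) (fun t => snd c * snd (f t))).
    + rewrite (RInt_scal (V := R_CompleteNormedModule) (fun t => fst (f t))), (RInt_scal (V := R_CompleteNormedModule) (fun t => snd (f t))); auto.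
    + apply (ex_RInt_scal (V := R_NormedModule)); auto.
    + apply (ex_RInt_scal (V := R_NormedModule)); auto.
  - rewrite (RInt_plus (V := R_CompleteNormedModule) (fun t => fst c * snd (f t)) (fun t => snd c * fst (f t))).
    + rewrite (RInt_scal (V := R_CompleteNormedModule) (fun t => fst (f t))), (RInt_scal (V := R_CompleteNormedModule) (fun t => snd (f t))); auto.
    + apply (ex_RInt_scal (V := R_NormedModule)); auto.
    + apply (ex_RInt_scal (V := R_NormedModule)); auto.
Qed.
Lemma CI_Chasles f a b c : a <= b <= c -> ccont_on f a c -> (CI f a b + CI f b c)%C = CI f a c.
Proof.
  intros [H1 H2] Hf.
  assert (Fa : ccont_on f a b) by (intros t Ht; apply Hf; lra).
  assert (Fb : ccont_on f b c) by (intros t Ht; apply Hf; lra).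
  pose proof (RInt_Chasles (V := R_CompleteNormedModule) (fun t => fst (f t)) a b c
    (ccont_ex1 f a b H1 Fa) (ccont_ex1 f b c H2 Fb)) as E1.
  pose proof (RInt_Chasles (V := R_CompleteNormedModule) (fun t => snd (f t)) a b c
    (ccont_ex2 f a b H1 Fa) (ccont_ex2 f b c H2 Fb)) as E2.
  unfold CI, Cplus. cbn [fst snd]. rewrite <- E1, <- E2. reflexivity.
Qed.
(** The factor 2 comes from estimating the real and the imaginary part separately. *)
Lemma CI_bound f a b M : a <= b -> ccont_on f a b -> (forall t, a <= t <= b -> Cmod (f t) <= M) ->
  Cmod (CI f a b) <= 2 * M * (b - a).
Proof.
  intros Hab Hf HM. eapply Rle_trans; [apply Cmod_le_sum|]. unfold CI; simpl.
  assert (Rabs (RInt (fun t => fst (f t)) a b) <= (b - a) * M).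
  { apply abs_RInt_le_const; auto; [apply ccont_ex1; auto|]. intros t Ht.
    eapply Rle_trans; [apply fst_le_Cmod | auto]. }
  assert (Rabs (RInt (fun t => snd (f t)) a b) <= (b - a) * M).
  { apply abs_RInt_le_const; auto; [apply ccont_ex2; auto|]. intros t Ht.
    eapply Rle_trans; [apply snd_le_Cmod | auto]. }
  lra.
Qed.

Lemma contC_h f x y : contC f (x, y) -> ccont (fun t => f (t, y)) x.
Proof.
  intros H eps He. destruct (H eps He) as (d & Hd & Hd'). exists d; split; auto.
  intros s Hs. specialize (Hd' (RtoC (s - x))). rewrite Cmod_R in Hd'. specialize (Hd' Hs).
  replace ((x, y) + RtoC (s - x))%C with ((s, y) : C) in Hd'; auto.
  apply injective_projections; simpl; ring.
Qed.
Lemma contC_v f x y : contC f (x, y) -> ccont (fun t => f (x, t)) y.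
Proof.
  intros H eps He. destruct (H eps He) as (d & Hd & Hd'). exists d; split; auto.
  intros s Hs. specialize (Hd' (Ci * RtoC (s - y))%C). rewrite Cmod_mult, Cmod_Ci, Cmod_R, Rmult_1_l in Hd'. specialize (Hd' Hs).
  replace ((x, y) + Ci * RtoC (s - y))%C with ((x, s) : C) in Hd'; auto.
  apply injective_projections; simpl; ring.
Qed.
Lemma cdiff_contC f z L : cdiff f z L -> contC f z.
Proof. intros H eps He. apply (cdiff_cont f z L H eps He). Qed.

(** The counterclockwise integral of f(z) dz along the boundary of the rectangle: dz is dx on
    horizontal sides and i dy on vertical ones. *)
Definition RI (f : C -> C) (x1 x2 y1 y2 : R) : C :=
  (CI (fun x => f (x, y1)) x1 x2 + Ci * CI (fun y => f (x2, y)) y1 y2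
   - CI (fun x => f (x, y2)) x1 x2 - Ci * CI (fun y => f (x1, y)) y1 y2)%C.
Definition inrect (x1 x2 y1 y2 : R) (z : C) : Prop := x1 <= fst z <= x2 /\ y1 <= snd z <= y2.
Definition onbd (x1 x2 y1 y2 : R) (z : C) : Prop :=
  inrect x1 x2 y1 y2 z /\ (fst z = x1 \/ fst z = x2 \/ snd z = y1 \/ snd z = y2).
Definition contbd f x1 x2 y1 y2 := forall z, onbd x1 x2 y1 y2 z -> contC f z.

Lemma contbd_sides f x1 x2 y1 y2 : x1 <= x2 -> y1 <= y2 -> contbd f x1 x2 y1 y2 ->
  ccont_on (fun x => f (x, y1)) x1 x2 /\ ccont_on (fun x => f (x, y2)) x1 x2 /\
  ccont_on (fun y => f (x1, y)) y1 y2 /\ ccont_on (fun y => f (x2, y)) y1 y2.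
Proof.
  intros H1 H2 H. repeat split; intros t Ht; (apply contC_h || apply contC_v); apply H;
  (split; [split; simpl; lra | simpl; tauto]).
Qed.

Lemma RI_ext f g x1 x2 y1 y2 : x1 <= x2 -> y1 <= y2 ->
  (forall z, onbd x1 x2 y1 y2 z -> f z = g z) -> RI f x1 x2 y1 y2 = RI g x1 x2 y1 y2.
Proof.
  intros H1 H2 H. unfold RI.
  assert (forall x, x1 < x < x2 -> f (x, y1) = g (x, y1)) by (intros; apply H; split; [split; simpl; lra | simpl; tauto]).
  assert (forall x, x1 < x < x2 -> f (x, y2) = g (x, y2)) by (intros; apply H; split; [split; simpl; lra | simpl; tauto]).
  assert (forall y, y1 < y < y2 -> f (x1, y) = g (x1, y)) by (intros; apply H; split; [split; simpl; lra | simpl; tauto]).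
  assert (forall y, y1 < y < y2 -> f (x2, y) = g (x2, y)) by (intros; apply H; split; [split; simpl; lra | simpl; tauto]).
  rewrite (CI_ext (fun x => f (x, y1)) (fun x => g (x, y1)) x1 x2), (CI_ext (fun x => f (x, y2)) (fun x => g (x, y2)) x1 x2),
    (CI_ext (fun y => f (x1, y)) (fun y => g (x1, y)) y1 y2), (CI_ext (fun y => f (x2, y)) (fun y => g (x2, y)) y1 y2); auto.
Qed.
Lemma RI_plus f g x1 x2 y1 y2 : x1 <= x2 -> y1 <= y2 -> contbd f x1 x2 y1 y2 -> contbd g x1 x2 y1 y2 ->
  RI (fun z => f z + g z)%C x1 x2 y1 y2 = (RI f x1 x2 y1 y2 + RI g x1 x2 y1 y2)%C.
Proof.
  intros H1 H2 Hf Hg.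
  destruct (contbd_sides f x1 x2 y1 y2 H1 H2 Hf) as (A & B & D & E).
  destruct (contbd_sides g x1 x2 y1 y2 H1 H2 Hg) as (A' & B' & D' & E').
  unfold RI. rewrite !CI_plus; auto. ring.
Qed.
Lemma RI_scal c f x1 x2 y1 y2 : x1 <= x2 -> y1 <= y2 -> contbd f x1 x2 y1 y2 ->
  RI (fun z => c * f z)%C x1 x2 y1 y2 = (c * RI f x1 x2 y1 y2)%C.
Proof.
  intros H1 H2 Hf.
  destruct (contbd_sides f x1 x2 y1 y2 H1 H2 Hf) as (A & B & D & E).
  unfold RI. rewrite !CI_scal; auto. ring.
Qed.
Lemma RI_bound f x1 x2 y1 y2 M : x1 <= x2 -> y1 <= y2 -> contbd f x1 x2 y1 y2 ->
  (forall z, onbd x1 x2 y1 y2 z -> Cmod (f z) <= M) ->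
  Cmod (RI f x1 x2 y1 y2) <= 4 * M * ((x2 - x1) + (y2 - y1)).
Proof.
  intros H1 H2 Hf HM.
  destruct (contbd_sides f x1 x2 y1 y2 H1 H2 Hf) as (A & B & D & E).
  assert (I1 : Cmod (CI (fun x => f (x, y1)) x1 x2) <= 2 * M * (x2 - x1)).
  { apply CI_bound; auto; intros; apply HM; split; [split; simpl; lra | simpl; tauto]. }
  assert (I2 : Cmod (CI (fun x => f (x, y2)) x1 x2) <= 2 * M * (x2 - x1)).
  { apply CI_bound; auto; intros; apply HM; split; [split; simpl; lra | simpl; tauto]. }
  assert (I3 : Cmod (CI (fun y => f (x1, y)) y1 y2) <= 2 * M * (y2 - y1)).
  { apply CI_bound; auto; intros; apply HM; split; [split; simpl; lra | simpl; tauto]. }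
  assert (I4 : Cmod (CI (fun y => f (x2, y)) y1 y2) <= 2 * M * (y2 - y1)).
  { apply CI_bound; auto; intros; apply HM; split; [split; simpl; lra | simpl; tauto]. }
  unfold RI, Cminus. eapply Rle_trans; [apply Cmod_triangle|].
  eapply Rle_trans; [apply Rplus_le_compat_r, Cmod_triangle|].
  eapply Rle_trans; [apply Rplus_le_compat_r, Rplus_le_compat_r, Cmod_triangle|].
  rewrite !Cmod_opp, !Cmod_mult, !Cmod_Ci. lra.
Qed.
Lemma RI_split_x f x1 xm x2 y1 y2 : x1 <= xm <= x2 -> y1 <= y2 ->
  contbd f x1 xm y1 y2 -> contbd f xm x2 y1 y2 ->
  RI f x1 x2 y1 y2 = (RI f x1 xm y1 y2 + RI f xm x2 y1 y2)%C.
Proof.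
  intros H1 H2 Hf Hg.
  destruct (contbd_sides f x1 xm y1 y2 (proj1 H1) H2 Hf) as (A & B & D & E).
  destruct (contbd_sides f xm x2 y1 y2 (proj2 H1) H2 Hg) as (A' & B' & D' & E').
  unfold RI. rewrite <- (CI_Chasles (fun x => f (x, y1)) x1 xm x2), <- (CI_Chasles (fun x => f (x, y2)) x1 xm x2); auto.
  - ring.
  - intros t Ht. destruct (Rle_dec t xm); [apply B | apply B']; lra.
  - intros t Ht. destruct (Rle_dec t xm); [apply A | apply A']; lra.
Qed.
Lemma RI_split_y f x1 x2 y1 ym y2 : x1 <= x2 -> y1 <= ym <= y2 ->
  contbd f x1 x2 y1 ym -> contbd f x1 x2 ym y2 ->
  RI f x1 x2 y1 y2 = (RI f x1 x2 y1 ym + RI f x1 x2 ym y2)%C.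
Proof.
  intros H1 H2 Hf Hg.
  destruct (contbd_sides f x1 x2 y1 ym H1 (proj1 H2) Hf) as (A & B & D & E).
  destruct (contbd_sides f x1 x2 ym y2 H1 (proj2 H2) Hg) as (A' & B' & D' & E').
  unfold RI. rewrite <- (CI_Chasles (fun y => f (x1, y)) y1 ym y2), <- (CI_Chasles (fun y => f (x2, y)) y1 ym y2); auto.
  - ring.
  - intros t Ht. destruct (Rle_dec t ym); [apply E | apply E']; lra.
  - intros t Ht. destruct (Rle_dec t ym); [apply D | apply D']; lra.
Qed.

Ltac eqR := match goal with |- ?a = ?b => change (@eq R a b) end.

Lemma sqsum_pos a d : 0 < d -> 0 < a * a + d * d.
Proof. intros. pose proof (Rle_0_sqr a) as H'. unfold Rsqr in H'. nra. Qed.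
Ltac nz := match goal with |- _ /\ _ => split; nz | _ => first [lra | apply Rgt_not_eq; apply sqsum_pos; lra | apply Rgt_not_eq;
  match goal with H : 0 < ?d |- context [(?t - ?x)] => generalize (sqsum_pos (t - x) d H); intros; nra
   | H : 0 < ?d |- context [(?t + - ?x)] => generalize (sqsum_pos (t - x) d H); intros; nra end ] end.

Lemma RInt_lin (a b p q : R) : RInt (fun t => p + q * t) a b = p * (b - a) + q * (b * b - a * a) / 2.
Proof.
  apply is_RInt_unique.
  replace (p * (b - a) + q * (b * b - a * a) / 2) with
    (minus ((fun t => p * t + q * (t * t) / 2) b) ((fun t => p * t + q * (t * t) / 2) a)).
  - apply (is_RInt_derive (V := R_CompleteNormedModule) (fun t => p * t + q * (t * t) / 2)).
    + intros t _. auto_derive; auto. field.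
    + intros t _. apply continuity_pt_filterlim. reg.
  - unfold minus, plus, opp; simpl. field.
Qed.

Lemma CI_lin (c d : C) a b : CI (fun t => c + d * RtoC t)%C a b = (c * RtoC (b - a) + d * RtoC ((b * b - a * a) / 2))%C.
Proof.
  unfold CI. apply injective_projections; simpl.
  - rewrite (RInt_ext _ (fun t => fst c + fst d * t)); [rewrite RInt_lin; field|]. intros; eqR; ring.
  - rewrite (RInt_ext _ (fun t => snd c + snd d * t)); [rewrite RInt_lin; field|]. intros; eqR; ring.
Qed.
Lemma RI_lin (c d : C) x1 x2 y1 y2 : RI (fun z => c + d * z)%C x1 x2 y1 y2 = RtoC 0.
Proof.
  unfold RI.
  assert (Eh : forall y a b, CI (fun x => c + d * ((x, y) : C))%C a b =
     CI (fun t => (c + d * (Ci * RtoC y)) + d * RtoC t)%C a b).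
  { intros. f_equal. apply functional_extensionality. intros t.
    apply injective_projections; simpl; ring. }
  assert (Ev : forall x a b, CI (fun y => c + d * ((x, y) : C))%C a b =
     CI (fun t => (c + d * RtoC x) + (d * Ci) * RtoC t)%C a b).
  { intros. f_equal. apply functional_extensionality. intros t.
    apply injective_projections; simpl; ring. }
  rewrite !Eh, !Ev, !CI_lin. apply injective_projections; simpl; field.
Qed.

Lemma pow_half_small C0 : 0 <= C0 -> forall eps, 0 < eps -> exists k, C0 / 2 ^ k < eps.
Proof.
  intros HC eps He. destruct (pow_lt_1_zero (/ 2)) with (y := eps / (C0 + 1)) as (N & HN).
  - rewrite Rabs_pos_eq; lra.
  - apply Rdiv_lt_0_compat; lra.
  - exists N. specialize (HN N (Nat.le_refl _)).
    assert (0 < (/ 2) ^ N) by (apply pow_lt; lra).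
    rewrite Rabs_pos_eq in HN by lra. unfold Rdiv. rewrite <- pow_inv.
    apply (Rmult_lt_compat_l (C0 + 1)) in HN; [|lra].
    replace ((C0 + 1) * (eps / (C0 + 1))) with eps in HN by (field; lra). lra.
Qed.

(** Goursat's subdivision: rectangles halved repeatedly, each keeping a quarter of the integral of
    its predecessor, close down on a point. Near it the affine approximation integrates to 0 by
    [RI_lin], and the error is of smaller order than the area, which also shrinks by a quarter at
    each step. *)
Lemma goursat f x1 x2 y1 y2 : x1 <= x2 -> y1 <= y2 ->
  (forall z, inrect x1 x2 y1 y2 z -> exists L, cdiff f z L) -> RI f x1 x2 y1 y2 = RtoC 0.
Proof.
  intros Hx Hy Hf. apply NNPP; intros Hne. apply Cmod_gt_0 in Hne.
  set (eta := Cmod (RI f x1 x2 y1 y2)) in *.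
  set (a := x2 - x1). set (b := y2 - y1).
  assert (Ha : 0 <= a) by (unfold a; lra). assert (Hb : 0 <= b) by (unfold b; lra).
  set (wx := fun k : nat => a / 2 ^ k). set (wy := fun k : nat => b / 2 ^ k).
  assert (Hwx : forall k, 0 <= wx k). { intros; apply Rdiv_le_0_compat; auto; apply pow_lt; lra. }
  assert (Hwy : forall k, 0 <= wy k). { intros; apply Rdiv_le_0_compat; auto; apply pow_lt; lra. }
  assert (Wx : forall k, wx k = 2 * wx (S k)). { intros; unfold wx; simpl; field; apply pow_nonzero; lra. }
  assert (Wy : forall k, wy k = 2 * wy (S k)). { intros; unfold wy; simpl; field; apply pow_nonzero; lra. }
  set (J := fun (k : nat) (c : C) => RI f (fst c) (fst c + wx k) (snd c) (snd c + wy k)).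
  set (inR := fun (k : nat) (c : C) => x1 <= fst c /\ fst c + wx k <= x2 /\ y1 <= snd c /\ snd c + wy k <= y2).
  (* An admissible successor: the lower left corner of a half-size rectangle inside the current one
     whose integral keeps at least a quarter of the modulus. *)
  set (nx := fun (k : nat) (c c' : C) => inR (S k) c' /\ fst c <= fst c' /\ fst c' + wx (S k) <= fst c + wx k /\
     snd c <= snd c' /\ snd c' + wy (S k) <= snd c + wy k /\ Cmod (J k c) / 4 <= Cmod (J (S k) c')).
  assert (Hc : forall u, x1 <= fst u <= x2 -> y1 <= snd u <= y2 -> contC f u).
  { intros u H1 H2. destruct (Hf u (conj H1 H2)) as (L & HL). eapply cdiff_contC; eauto. }
  assert (Step : forall k c, inR k c -> exists c', nx k c c').
  { intros k c (I1 & I2 & I3 & I4).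
    set (p := wx (S k)). set (q := wy (S k)).
    assert (Hp : 0 <= p) by apply Hwx. assert (Hq : 0 <= q) by apply Hwy.
    assert (Ep : wx k = 2 * p) by apply Wx. assert (Eq : wy k = 2 * q) by apply Wy.
    set (X := fst c) in *. set (Y := snd c) in *. rewrite Ep in I2. rewrite Eq in I4.
    assert (Hcb : forall u1 u2 v1 v2, X <= u1 -> u2 <= X + 2 * p -> Y <= v1 -> v2 <= Y + 2 * q -> contbd f u1 u2 v1 v2).
    { intros u1 u2 v1 v2 ? ? ? ? z [[? ?] _]. apply Hc; lra. }
    assert (Split : J k c = (J (S k) (X, Y) + J (S k) (X, (Y + q)%R) + (J (S k) ((X + p)%R, Y) + J (S k) ((X + p)%R, (Y + q)%R)))%C).
    { unfold J; simpl fst; simpl snd. fold X Y p q. rewrite Ep, Eq.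
      rewrite (RI_split_x f X (X + p) (X + 2 * p)); [|lra|lra|apply Hcb; lra|apply Hcb; lra].
      rewrite (RI_split_y f X (X + p) Y (Y + q) (Y + 2 * q)); [|lra|lra|apply Hcb; lra|apply Hcb; lra].
      rewrite (RI_split_y f (X + p) (X + 2 * p) Y (Y + q) (Y + 2 * q)); [|lra|lra|apply Hcb; lra|apply Hcb; lra].
      replace (X + p + p) with (X + 2 * p) by ring. replace (Y + q + q) with (Y + 2 * q) by ring. ring. }
    assert (Hs : Cmod (J k c) <= Cmod (J (S k) (X, Y)) + Cmod (J (S k) (X, (Y + q)%R)) + (Cmod (J (S k) ((X + p)%R, Y)) + Cmod (J (S k) ((X + p)%R, (Y + q)%R)))).
    { rewrite Split. eapply Rle_trans; [apply Cmod_triangle|].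
      apply Rplus_le_compat; apply Cmod_triangle. }
    apply NNPP; intros Hn.
    assert (forall c', inR (S k) c' -> X <= fst c' -> fst c' + p <= X + 2 * p -> Y <= snd c' -> snd c' + q <= Y + 2 * q ->
      Cmod (J (S k) c') < Cmod (J k c) / 4).
    { intros c' ? ? ? ? ?. apply Rnot_le_lt. intros Hle. apply Hn. exists c'. unfold nx.
      rewrite Ep, Eq. fold p q X Y. tauto. }
    assert (G1 := H (X, Y)). assert (G2 := H (X, Y + q)). assert (G3 := H (X + p, Y)). assert (G4 := H (X + p, Y + q)).
    unfold inR in *. simpl in *. fold p q in G1, G2, G3, G4.
    specialize (G1 ltac:(repeat split; lra) ltac:(lra) ltac:(lra) ltac:(lra) ltac:(lra)).
    specialize (G2 ltac:(repeat split; lra) ltac:(lra) ltac:(lra) ltac:(lra) ltac:(lra)).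
    specialize (G3 ltac:(repeat split; lra) ltac:(lra) ltac:(lra) ltac:(lra) ltac:(lra)).
    specialize (G4 ltac:(repeat split; lra) ltac:(lra) ltac:(lra) ltac:(lra) ltac:(lra)).
    lra. }
  set (next := fun k c => epsilon (inhabits (RtoC 0)) (nx k c)).
  assert (Hnext : forall k c, inR k c -> nx k c (next k c)).
  { intros k c H. unfold next. apply (epsilon_spec (inhabits (RtoC 0)) (nx k c)). auto. }
  set (cs := fix cs k := match k with O => (x1, y1) : C | S k' => next k' (cs k') end).
  assert (Hin : forall k, inR k (cs k)).
  { induction k as [|k IH].
    - unfold inR; simpl. unfold wx, wy, a, b. simpl. split; [lra|]. split; [right; field|]. split; [lra|right; field].
    - apply (Hnext k (cs k) IH). }
  assert (Hst : forall k, nx k (cs k) (cs (S k))). { intros k. apply Hnext; auto. }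
  assert (HJ : forall k, eta / 4 ^ k <= Cmod (J k (cs k))).
  { induction k as [|k IH].
    - unfold J; simpl. unfold wx, wy, a, b; simpl. replace (x1 + (x2 - x1) / 1) with x2 by field.
      replace (y1 + (y2 - y1) / 1) with y2 by field. fold eta. right; field.
    - destruct (Hst k) as (_ & _ & _ & _ & _ & H). eapply Rle_trans; [|apply H].
      simpl pow. replace (eta / (4 * 4 ^ k)) with (eta / 4 ^ k / 4) by (field; apply pow_nonzero; lra). lra. }
  assert (Mono : forall j k, (k <= j)%nat -> fst (cs k) <= fst (cs j) /\ fst (cs j) + wx j <= fst (cs k) + wx k /\
     snd (cs k) <= snd (cs j) /\ snd (cs j) + wy j <= snd (cs k) + wy k).
  { intros j k Hjk. induction Hjk as [|j Hjk IH]; [repeat split; lra|].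
    destruct (Hst j) as (_ & ? & ? & ? & ? & _). repeat split; lra. }
  (* The limit point is the supremum of the lower left corners, coordinate by coordinate. *)
  assert (Lim : exists z, forall k, fst (cs k) <= fst z <= fst (cs k) + wx k /\ snd (cs k) <= snd z <= snd (cs k) + wy k).
  { destruct (completeness (fun x => exists k, x = fst (cs k))) as (X & HX1 & HX2).
    - exists x2. intros x (k & ->). destruct (Hin k) as (? & ? & _). specialize (Hwx k). lra.
    - exists (fst (cs 0%nat)), 0%nat; auto.
    - destruct (completeness (fun x => exists k, x = snd (cs k))) as (Y & HY1 & HY2).
      + exists y2. intros x (k & ->). destruct (Hin k) as (_ & _ & ? & ?). specialize (Hwy k). lra.
      + exists (snd (cs 0%nat)), 0%nat; auto.
      + exists (X, Y). intros k; simpl. repeat split.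
        * apply HX1; eauto.
        * apply HX2. intros x (j & ->). destruct (Nat.le_ge_cases k j) as [H|H].
          -- destruct (Mono j k H) as (_ & ? & _ & _). specialize (Hwx j). lra.
          -- destruct (Mono k j H) as (? & _ & _ & _). specialize (Hwx k). lra.
        * apply HY1; eauto.
        * apply HY2. intros x (j & ->). destruct (Nat.le_ge_cases k j) as [H|H].
          -- destruct (Mono j k H) as (_ & _ & _ & ?). specialize (Hwy j). lra.
          -- destruct (Mono k j H) as (_ & _ & ? & _). specialize (Hwy k). lra. }
  destruct Lim as (z & Hz).
  assert (HzR : inrect x1 x2 y1 y2 z).
  { destruct (Hz 0%nat) as (? & ?). destruct (Hin 0%nat) as (? & ? & ? & ?). split; lra. }
  destruct (Hf z HzR) as (L & HL).
  (* The final bound on the k-th integral is 4 e (a + b)^2 / 4^k; this choice of [e] keeps it below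
     half of eta / 4^k. *)
  set (e := eta / (8 * ((a + b) * (a + b) + 1))).
  assert (He : 0 < e). { apply Rdiv_lt_0_compat; [lra|nra]. }
  destruct (HL e He) as (d & Hd & Hd').
  destruct (pow_half_small (a + b) ltac:(lra) d Hd) as (k & Hk).
  assert (Hw : wx k + wy k = (a + b) / 2 ^ k) by (unfold wx, wy, Rdiv; ring).
  set (w := wx k + wy k) in *.
  set (X := fst (cs k)) in *. set (Y := snd (cs k)) in *.
  destruct (Hz k) as (Hz1 & Hz2). fold X in Hz1. fold Y in Hz2.
  destruct (Hin k) as (I1 & I2 & I3 & I4). fold X in I1, I2. fold Y in I3, I4.
  assert (Hcb : contbd f X (X + wx k) Y (Y + wy k)).
  { intros u [[? ?] _]. apply Hc; lra. }
  pose proof (Hwx k). pose proof (Hwy k).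
  (* [f] minus its affine approximation at the limit point, with the same integral as [f]. *)
  set (g := fun u => (f u + (- (1)) * ((f z - L * z) + L * u))%C).
  assert (Hlc : forall c0 d0 u, contC (fun u => c0 + d0 * u)%C u).
  { intros c0 d0 u. eapply cdiff_contC. apply (cdiff_plus (fun _ => c0) (fun u => d0 * u)%C); [apply cdiff_const|].
    apply cdiff_mult; [apply cdiff_const | apply cdiff_id]. }
  assert (EJ : J k (cs k) = RI g X (X + wx k) Y (Y + wy k)).
  { unfold J. fold X Y. unfold g.
    rewrite (RI_plus f (fun u => (- (1)) * ((f z - L * z) + L * u))%C); [|lra|lra|auto|].
    - rewrite (RI_scal (- (1)) (fun u => ((f z - L * z) + L * u))%C); [|lra|lra|].
      + rewrite RI_lin. ring.
      + intros u _. apply Hlc.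
    - intros u _. intros eps Heps. destruct (Hlc (f z - L * z)%C L u eps Heps) as (d1 & Hd1 & Hd1').
      exists d1; split; auto. intros h Hh. specialize (Hd1' h Hh).
      replace (- (1) * (f z - L * z + L * (u + h)) - - (1) * (f z - L * z + L * u))%C with
       (- (f z - L * z + L * (u + h) - (f z - L * z + L * u)))%C by ring. rewrite Cmod_opp; auto. }
  assert (Bg : forall u, onbd X (X + wx k) Y (Y + wy k) u -> Cmod (g u) <= e * w).
  { intros u [[U1 U2] _]. assert (Hu : Cmod (u - z) <= w).
    { eapply Rle_trans; [apply Cmod_le_sum|]. unfold Cminus, Cplus, Copp; simpl. unfold w.
      apply Rplus_le_compat; apply Rabs_le; lra. }
    specialize (Hd' (u - z)%C ltac:(lra)).
    replace (z + (u - z))%C with u in Hd' by ring.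
    replace (g u) with (f u - f z - L * (u - z))%C by (unfold g; ring).
    eapply Rle_trans; [apply Hd'|]. apply Rmult_le_compat_l; lra. }
  assert (Cg : contbd g X (X + wx k) Y (Y + wy k)).
  { intros u Hu. unfold onbd, inrect in Hu. destruct (Hf u) as (Lu & HLu); [split; lra|].
    eapply cdiff_contC. unfold g. apply cdiff_plus; [apply HLu|].
    apply cdiff_mult; [apply cdiff_const|]. apply cdiff_plus; [apply cdiff_const|].
    apply cdiff_mult; [apply cdiff_const|apply cdiff_id]. }
  pose proof (RI_bound g X (X + wx k) Y (Y + wy k) (e * w) ltac:(lra) ltac:(lra) Cg Bg) as B.
  rewrite <- EJ in B. specialize (HJ k).
  assert (E2 : w * w = (a + b) * (a + b) / 4 ^ k).
  { rewrite Hw. replace 4 with (2 * 2) by ring. rewrite Rpow_mult_distr. field. apply pow_nonzero; lra. }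
  replace (4 * (e * w) * (X + wx k - X + (Y + wy k - Y))) with (4 * e * (w * w)) in B by (unfold w; ring).
  rewrite E2 in B.
  assert (P4 : 0 < / 4 ^ k). { apply Rinv_0_lt_compat, pow_lt; lra. }
  assert (eta * / 4 ^ k <= (4 * e * ((a + b) * (a + b))) * / 4 ^ k).
  { unfold Rdiv in *. lra. }
  apply Rmult_le_reg_r in H1; auto.
  assert (e * (8 * ((a + b) * (a + b) + 1)) = eta). { unfold e. field. nra. }
  nra.
Qed.

(** The region between the two rectangles is cut into four rectangles that miss [z0], and [goursat]
    annihilates each of them. *)
Lemma RI_shrink f x1 x2 y1 y2 u1 u2 v1 v2 (z0 : C) :
  x1 <= u1 -> u2 <= x2 -> y1 <= v1 -> v2 <= y2 -> u1 < fst z0 < u2 -> v1 < snd z0 < v2 ->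
  (forall z, inrect x1 x2 y1 y2 z -> z <> z0 -> exists L, cdiff f z L) ->
  RI f x1 x2 y1 y2 = RI f u1 u2 v1 v2.
Proof.
  intros H1 H2 H3 H4 Hx Hy Hf.
  assert (Hc : forall z, inrect x1 x2 y1 y2 z -> z <> z0 -> contC f z).
  { intros z Hz Hn. destruct (Hf z Hz Hn). eapply cdiff_contC; eauto. }
  assert (Hcb : forall p1 p2 q1 q2, x1 <= p1 -> p2 <= x2 -> y1 <= q1 -> q2 <= y2 ->
     (fst z0 <> p1 /\ fst z0 <> p2 /\ snd z0 <> q1 /\ snd z0 <> q2) -> contbd f p1 p2 q1 q2).
  { intros p1 p2 q1 q2 ? ? ? ? (N1 & N2 & N3 & N4) z [[Z1 Z2] Z3]. apply Hc; [split; lra|].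
    intros ->. intuition congruence. }
  assert (Hz : forall p1 p2 q1 q2, x1 <= p1 -> p2 <= x2 -> y1 <= q1 -> q2 <= y2 -> p1 <= p2 -> q1 <= q2 ->
     (fst z0 < p1 \/ p2 < fst z0 \/ snd z0 < q1 \/ q2 < snd z0) -> RI f p1 p2 q1 q2 = RtoC 0).
  { intros p1 p2 q1 q2 ? ? ? ? ? ? Ho. apply goursat; auto. intros z [Z1 Z2]. apply Hf; [split; lra|].
    intros ->. lra. }
  rewrite (RI_split_x f x1 u1 x2); [|lra|lra|apply Hcb; lra|apply Hcb; lra].
  rewrite (Hz x1 u1); [|lra|lra|lra|lra|lra|lra|lra].
  rewrite (RI_split_x f u1 u2 x2); [|lra|lra|apply Hcb; lra|apply Hcb; lra].
  rewrite (Hz u2 x2); [|lra|lra|lra|lra|lra|lra|lra].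
  rewrite (RI_split_y f u1 u2 y1 v1 y2); [|lra|lra|apply Hcb; lra|apply Hcb; lra].
  rewrite (Hz u1 u2 y1 v1); [|lra|lra|lra|lra|lra|lra|lra].
  rewrite (RI_split_y f u1 u2 v1 v2 y2); [|lra|lra|apply Hcb; lra|apply Hcb; lra].
  rewrite (Hz u1 u2 v2 y2); [|lra|lra|lra|lra|lra|lra|lra]. ring.
Qed.

(** By [RI_shrink] the integral equals the one over an arbitrarily small square around [z0], where a
    bounded integrand contributes at most a multiple of the side. *)
Lemma goursat_removable f x1 x2 y1 y2 (z0 : C) M r : x1 < fst z0 < x2 -> y1 < snd z0 < y2 ->
  (forall z, inrect x1 x2 y1 y2 z -> z <> z0 -> exists L, cdiff f z L) -> 0 < r ->
  (forall z, z <> z0 -> Cmod (z - z0) < r -> Cmod (f z) <= M) -> RI f x1 x2 y1 y2 = RtoC 0.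
Proof.
  intros Hx Hy Hf Hr HM. apply NNPP; intros Hn. apply Cmod_gt_0 in Hn.
  set (eta := Cmod (RI f x1 x2 y1 y2)) in *.
  assert (HM0 : 0 <= M).
  { eapply Rle_trans; [apply Cmod_ge_0|]. apply (HM (z0 + RtoC (r / 2))%C).
    - intros E. apply (f_equal fst) in E. simpl in E. lra.
    - replace (z0 + RtoC (r / 2) - z0)%C with (RtoC (r / 2)) by ring. rewrite Cmod_R, Rabs_pos_eq; lra. }
  (* On the square of half side [d] the integral is at most 16 M d; the 17 and the added 1 push this
     strictly below [eta]. The other bounds keep the square inside the rectangle and inside the disc
     of radius [r]. *)
  set (d := Rmin (Rmin (r / 4) (eta / (17 * (M + 1)))) (Rmin (Rmin (fst z0 - x1) (x2 - fst z0)) (Rmin (snd z0 - y1) (y2 - snd z0)))).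
  assert (Hd : 0 < d). { repeat apply Rmin_pos; try lra. apply Rdiv_lt_0_compat; lra. }
  assert (D1 : d <= r / 4) by (eapply Rle_trans; [apply Rmin_l|apply Rmin_l]).
  assert (D2 : d <= eta / (17 * (M + 1))) by (eapply Rle_trans; [apply Rmin_l|apply Rmin_r]).
  assert (D3 : d <= fst z0 - x1) by (eapply Rle_trans; [apply Rmin_r|eapply Rle_trans; [apply Rmin_l|apply Rmin_l]]).
  assert (D4 : d <= x2 - fst z0) by (eapply Rle_trans; [apply Rmin_r|eapply Rle_trans; [apply Rmin_l|apply Rmin_r]]).
  assert (D5 : d <= snd z0 - y1) by (eapply Rle_trans; [apply Rmin_r|eapply Rle_trans; [apply Rmin_r|apply Rmin_l]]).
  assert (D6 : d <= y2 - snd z0) by (eapply Rle_trans; [apply Rmin_r|eapply Rle_trans; [apply Rmin_r|apply Rmin_r]]).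
  clearbody d.
  assert (E : RI f x1 x2 y1 y2 = RI f (fst z0 - d) (fst z0 + d) (snd z0 - d) (snd z0 + d)).
  { apply (RI_shrink f x1 x2 y1 y2 _ _ _ _ z0); auto; lra. }
  assert (Hb : forall u, onbd (fst z0 - d) (fst z0 + d) (snd z0 - d) (snd z0 + d) u -> u <> z0 /\ inrect x1 x2 y1 y2 u /\ Cmod (u - z0) < r).
  { intros u [[U1 U2] U3]. split; [|split].
    - intros ->. lra.
    - split; lra.
    - eapply Rle_lt_trans; [apply Cmod_le_sum|]. unfold Cminus, Cplus, Copp; simpl.
      assert (Rabs (fst u + - fst z0) <= d) by (apply Rabs_le; lra).
      assert (Rabs (snd u + - snd z0) <= d) by (apply Rabs_le; lra). lra. }
  pose proof (RI_bound f (fst z0 - d) (fst z0 + d) (snd z0 - d) (snd z0 + d) M ltac:(lra) ltac:(lra)) as B.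
  rewrite <- E in B. fold eta in B.
  assert (eta <= 4 * M * (fst z0 + d - (fst z0 - d) + (snd z0 + d - (snd z0 - d)))).
  { apply B.
    - intros u Hu. destruct (Hb u Hu) as (U1 & U2 & U3). destruct (Hf u U2 U1). eapply cdiff_contC; eauto.
    - intros u Hu. destruct (Hb u Hu) as (U1 & U2 & U3). auto. }
  assert (D7 : d * (17 * (M + 1)) <= eta).
  { apply (Rmult_le_compat_r (17 * (M + 1))) in D2; [|lra]. field_simplify in D2; lra. }
  nra.
Qed.

Lemma RInt_atan x0 d : 0 < d -> is_RInt (fun t => d / ((t - x0) * (t - x0) + d * d)) (x0 - d) (x0 + d) (PI / 2).
Proof.
  intros Hd.
  replace (PI / 2) with (minus ((fun t => atan ((t - x0) / d)) (x0 + d)) ((fun t => atan ((t - x0) / d)) (x0 - d))).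
  - apply (is_RInt_derive (V := R_CompleteNormedModule) (fun t => atan ((t - x0) / d))).
    + intros t _. auto_derive; auto. field. nz.
    + intros t0 _. apply continuity_pt_filterlim. reg. nz.
  - unfold minus, plus, opp; simpl. replace ((x0 + d - x0) / d) with 1 by (field; lra).
    replace ((x0 - d - x0) / d) with (- (1)) by (field; lra). rewrite atan_opp, atan_1. field.
Qed.

(** On each side one component of 1 / (z - z0) integrates to pi / 2 up to sign, and the four
    contributions add up to 2 pi; the other components cancel between opposite sides. *)
Lemma RI_inv_square (z0 : C) d : 0 < d ->
  RI (fun z => / (z - z0))%C (fst z0 - d) (fst z0 + d) (snd z0 - d) (snd z0 + d) = (RtoC (2 * PI) * Ci)%C.
Proof.
  intros Hd. pose proof (RInt_atan (fst z0) d Hd) as I1. pose proof (RInt_atan (snd z0) d Hd) as I2.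
  set (x0 := fst z0) in *. set (y0 := snd z0) in *.
  pose proof (is_RInt_unique (V := R_CompleteNormedModule) _ _ _ _ (is_RInt_scal (V := R_NormedModule) _ _ _ (-1) _ I1)) as J1.
  pose proof (is_RInt_unique (V := R_CompleteNormedModule) _ _ _ _ (is_RInt_scal (V := R_NormedModule) _ _ _ (-1) _ I2)) as J2.
  unfold scal in J1, J2; simpl in J1, J2; unfold mult in J1, J2; simpl in J1, J2.
  apply (is_RInt_unique (V := R_CompleteNormedModule)) in I1. apply (is_RInt_unique (V := R_CompleteNormedModule)) in I2.
  unfold RI, CI.
  rewrite (RInt_ext (fun t => snd (/ (((t, (y0 - d)%R) : C) - z0))%C) (fun t => d / ((t - x0) * (t - x0) + d * d))).
  2:{ intros t _. unfold Cinv, Cminus, Cplus, Copp; simpl. fold x0 y0. eqR. field. nz. }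
  rewrite (RInt_ext (fun t => snd (/ (((t, (y0 + d)%R) : C) - z0))%C) (fun t => (-1) * (d / ((t - x0) * (t - x0) + d * d)))).
  2:{ intros t _. unfold Cinv, Cminus, Cplus, Copp, scal; simpl. unfold mult; simpl. fold x0 y0. eqR. field. nz. }
  rewrite (RInt_ext (fun t => fst (/ ((((x0 + d)%R, t) : C) - z0))%C) (fun t => d / ((t - y0) * (t - y0) + d * d))).
  2:{ intros t _. unfold Cinv, Cminus, Cplus, Copp; simpl. fold x0 y0. eqR. field. nz. }
  rewrite (RInt_ext (fun t => fst (/ ((((x0 - d)%R, t) : C) - z0))%C) (fun t => (-1) * (d / ((t - y0) * (t - y0) + d * d)))).
  2:{ intros t _. unfold Cinv, Cminus, Cplus, Copp, scal; simpl. unfold mult; simpl. fold x0 y0. eqR. field. nz. }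
  rewrite J1, J2, I1, I2.
  rewrite (RInt_ext (fun t => fst (/ (((t, (y0 - d)%R) : C) - z0))%C) (fun t => fst (/ (((t, (y0 + d)%R) : C) - z0))%C)).
  2:{ intros t _. unfold Cinv, Cminus, Cplus, Copp; simpl. fold x0 y0. eqR. field. nz. }
  rewrite (RInt_ext (fun t => snd (/ ((((x0 + d)%R, t) : C) - z0))%C) (fun t => snd (/ ((((x0 - d)%R, t) : C) - z0))%C)).
  2:{ intros t _. unfold Cinv, Cminus, Cplus, Copp; simpl. fold x0 y0. eqR. field. nz. }
  apply injective_projections; simpl; unfold scal; simpl; unfold mult; simpl; field.
Qed.

Lemma cdiff_ex_minus z0 z : z <> z0 -> exists L, cdiff (fun w => / (w - z0))%C z L.
Proof.
  intros Hn. eexists. apply (cdiff_comp (fun w => w - z0)%C (fun w => / w)%C).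
  - apply (cdiff_plus (fun w => w) (fun _ => - z0)%C); [apply cdiff_id | apply cdiff_const].
  - apply cdiff_inv. intros E. apply Hn. apply Ceq_minus. auto.
Qed.

(** The difference quotient of [f] at [w] is bounded near [w], so its integral vanishes by
    [goursat_removable]; what remains is [f w] times the integral of 1 / (z - w), computed on a
    square centred at [w]. *)
Lemma cauchy_formula f (w : C) r : ent f -> Rabs (fst w) < r -> Rabs (snd w) < r ->
  RI (fun z => f z * / (z - w))%C (- r) r (- r) r = (RtoC (2 * PI) * Ci * f w)%C.
Proof.
  intros Hf Hx Hy. apply Rabs_def2 in Hx. apply Rabs_def2 in Hy.
  assert (Hcb : forall g : C -> C, (forall z, z <> w -> exists L, cdiff g z L) -> contbd g (- r) r (- r) r).
  { intros g Hg z [[Z1 Z2] Z3]. destruct (Hg z) as (L & HL); [intros ->; lra|]. eapply cdiff_contC; eauto. }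
  assert (D1 : forall z, z <> w -> exists L, cdiff (fun z => f z * / (z - w))%C z L).
  { intros z Hz. destruct (Hf z), (cdiff_ex_minus w z Hz). eexists. apply cdiff_mult; eauto. }
  assert (D2 : forall z, z <> w -> exists L, cdiff (fun z => (- f w) * / (z - w))%C z L).
  { intros z Hz. destruct (cdiff_ex_minus w z Hz). eexists. apply cdiff_mult; [apply cdiff_const | eauto]. }
  assert (E : RI (fun z => f z * / (z - w) + (- f w) * / (z - w))%C (- r) r (- r) r = RtoC 0).
  { destruct (Hf w) as (L & HL). destruct (cdiff_bound f w L HL) as (d & Hd & Hd').
    apply (goursat_removable _ _ _ _ _ w (Cmod L + 1) d); auto; try lra.
    - intros z _ Hz. destruct (D1 z Hz), (D2 z Hz). eexists. apply cdiff_plus; eauto.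
    - intros z Hz Hzd. specialize (Hd' (z - w)%C Hzd). replace (w + (z - w))%C with z in Hd' by ring.
      replace (f z * / (z - w) + - f w * / (z - w))%C with ((f z - f w) / (z - w))%C by (unfold Cdiv; ring).
      assert (Hn : (z - w)%C <> RtoC 0). { intros E. apply Hz. apply Ceq_minus. auto. }
      rewrite Cmod_div by auto. apply Cmod_gt_0 in Hn.
      apply (Rmult_le_reg_r (Cmod (z - w))); auto. unfold Rdiv. rewrite Rmult_assoc, Rinv_l by lra. lra. }
  rewrite RI_plus, RI_scal in E; auto; try lra; try (apply Hcb; auto).
  2:{ intros; apply cdiff_ex_minus; auto. }
  set (d := Rmin (Rmin (fst w + r) (r - fst w)) (Rmin (snd w + r) (r - snd w))).
  assert (Hd : 0 < d) by (repeat apply Rmin_pos; lra).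
  assert (d <= fst w + r) by (eapply Rle_trans; [apply Rmin_l|apply Rmin_l]).
  assert (d <= r - fst w) by (eapply Rle_trans; [apply Rmin_l|apply Rmin_r]).
  assert (d <= snd w + r) by (eapply Rle_trans; [apply Rmin_r|apply Rmin_l]).
  assert (d <= r - snd w) by (eapply Rle_trans; [apply Rmin_r|apply Rmin_r]).
  assert (E2 : RI (fun z => / (z - w))%C (- r) r (- r) r = (RtoC (2 * PI) * Ci)%C).
  { rewrite <- (RI_inv_square w d Hd). apply (RI_shrink _ _ _ _ _ _ _ _ _ w); try lra.
    intros; apply cdiff_ex_minus; auto. }
  rewrite E2 in E.
  transitivity (RI (fun z => f z * / (z - w))%C (- r) r (- r) r + - f w * (RtoC (2 * PI) * Ci) + RtoC (2 * PI) * Ci * f w)%C; [ring|].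
  rewrite E. ring.
Qed.

(** * Power series *)
(** An everywhere convergent power series: the growth clause encodes an infinite radius of
    convergence, the second clause identifies the sum. *)
Definition PS (a : nat -> C) (f : C -> C) : Prop :=
  (forall r, 0 < r -> exists M, forall k, Cmod (a k) * r ^ k <= M) /\
  forall z, HS (fun k => a k * z ^ k)%C (f z).

(** Absolute summability provides an unordered sum, which the ordered partial sums then identify. *)
Lemma HS_of_seq (f : nat -> C) s M : bsum (fun k => Cmod (f k)) M ->
  (forall eps, 0 < eps -> exists N, forall n, (N <= n)%nat -> Cmod (lsum (seq 0 n) f - s) < eps) -> HS f s.
Proof.
  intros Hb Hs. pose proof (gsum_HS f M Hb) as H.
  replace s with (gsum f); auto. apply NNPP; intros Hne.
  assert (Hp : 0 < Cmod (gsum f - s)). { apply Cmod_gt_0. intros E. apply Hne. apply Ceq_minus. auto. }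
  destruct (H (Cmod (gsum f - s) / 2)) as (A & _ & HA); [lra|].
  destruct (Hs (Cmod (gsum f - s) / 2)) as (N & HN); [lra|].
  set (n := Nat.max N (S (list_max A))).
  specialize (HN n (Nat.le_max_l _ _)).
  assert (Hi : incl A (seq 0 n)).
  { intros x Hx. apply in_seq.
    pose proof (proj1 (list_max_le A (list_max A)) (Nat.le_refl _)) as Hm.
    rewrite Forall_forall in Hm. specialize (Hm x Hx). unfold n. lia. }
  specialize (HA (seq 0 n) (seq_NoDup n 0) Hi).
  assert (Cmod (gsum f - s) <= Cmod (lsum (seq 0 n) f - s) + Cmod (lsum (seq 0 n) f - gsum f)).
  { replace (gsum f - s)%C with ((lsum (seq 0 n) f - s) + - (lsum (seq 0 n) f - gsum f))%C by ring.
    eapply Rle_trans; [apply Cmod_triangle|]. rewrite Cmod_opp. lra. }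
  lra.
Qed.

(** The growth clause at radius 2 r + 2 gains a factor 2^(-k) over radius r. *)
Lemma growth_bsum (a : nat -> C) : (forall r, 0 < r -> exists M, forall k, Cmod (a k) * r ^ k <= M) ->
  forall r, 0 <= r -> exists M, bsum (fun k => Cmod (a k) * r ^ k) M.
Proof.
  intros H r Hr. destruct (H (2 * r + 2)) as (M & HM); [lra|].
  exists (M * 2). assert (0 <= M). { eapply Rle_trans; [|apply (HM 0%nat)]. simpl. pose proof (Cmod_ge_0 (a 0%nat)). lra. }
  apply bsum_le with (fun k => M * (/ 2) ^ k); [|apply bsum_scal; auto; apply bsum_half].
  intros k. specialize (HM k).
  apply Rle_trans with (Cmod (a k) * ((2 * r + 2) ^ k * (/ 2) ^ k)).
  - apply Rmult_le_compat_l; [apply Cmod_ge_0|]. rewrite <- Rpow_mult_distr. apply pow_incr. lra.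
  - rewrite <- Rmult_assoc. apply Rmult_le_compat_r; auto. apply pow_le; lra.
Qed.

Lemma growth_terms (a : nat -> C) : (forall r, 0 < r -> exists M, forall k, Cmod (a k) * r ^ k <= M) ->
  forall z, exists M, bsum (fun k => Cmod (a k * z ^ k)%C) M.
Proof.
  intros H z. destruct (growth_bsum a H (Cmod z) (Cmod_ge_0 z)) as (M & HM). exists M.
  eapply bsum_le; [|apply HM]. intros k. simpl. rewrite Cmod_mult, Cmod_pow. lra.
Qed.

Lemma PS_bound a f : PS a f -> forall r, exists M, forall z, Cmod z <= r -> Cmod (f z) <= M.
Proof.
  intros [Hg Hs] r. destruct (Rle_dec 0 r) as [Hr|Hr].
  - destruct (growth_bsum a Hg r Hr) as (M & HM). exists M. intros z Hz.
    eapply HS_bound; [apply Hs|]. eapply bsum_le; [|apply HM]. intros k; simpl.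
    rewrite Cmod_mult, Cmod_pow. apply Rmult_le_compat_l; [apply Cmod_ge_0|].
    apply pow_incr. split; auto. apply Cmod_ge_0.
  - exists 0. intros z Hz. pose proof (Cmod_ge_0 z). lra.
Qed.

Lemma pow_diff_bound (z h : C) R : 1 <= R -> Cmod z + Cmod h <= R -> forall k,
  Cmod ((z + h) ^ k - z ^ k - RtoC (INR k) * z ^ (pred k) * h)%C <= INR k * INR k * R ^ k * (Cmod h * Cmod h).
Proof.
  intros HR Hzh k. pose proof (Cmod_ge_0 z) as Hz. pose proof (Cmod_ge_0 h) as Hh.
  induction k as [|k IH].
  - simpl. replace (1 - 1 - 0 * 1 * h)%C with (RtoC 0) by ring. rewrite Cmod_0. lra.
  - set (D := ((z + h) ^ k - z ^ k - RtoC (INR k) * z ^ (pred k) * h)%C) in *.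
    replace ((z + h) ^ S k - z ^ S k - RtoC (INR (S k)) * z ^ pred (S k) * h)%C with
      ((z + h) * D + RtoC (INR k) * z ^ (pred k) * (h * h))%C.
    2:{ unfold D. rewrite S_INR, RtoC_plus. destruct k as [|k']; [simpl; ring|].
        simpl pred. rewrite !Cpow_S. ring. }
    eapply Rle_trans; [apply Cmod_triangle|]. rewrite !Cmod_mult, Cmod_pow, Cmod_R, (Rabs_pos_eq (INR k)) by apply pos_INR.
    assert (H1 : Cmod (z + h) <= R) by (eapply Rle_trans; [apply Cmod_triangle | auto]).
    assert (H2 : Cmod z ^ pred k <= R ^ S k).
    { apply Rle_trans with (R ^ pred k); [apply pow_incr; lra|]. apply Rle_pow; [auto|lia]. }
    pose proof (pos_INR k). set (hh := Cmod h * Cmod h) in *.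
    assert (0 <= hh) by (unfold hh; nra).
    assert (0 <= R ^ k) by (apply pow_le; lra).
    assert (0 <= Cmod z ^ pred k) by (apply pow_le; auto).
    apply Rle_trans with (R * (INR k * INR k * R ^ k * hh) + INR k * R ^ S k * hh).
    + apply Rplus_le_compat.
      * apply Rmult_le_compat; auto; apply Cmod_ge_0.
      * apply Rmult_le_compat_r; auto. apply Rmult_le_compat_l; auto.
    + rewrite S_INR. simpl pow.
      assert (0 <= R * R ^ k * hh) by (apply Rmult_le_pos; auto; apply Rmult_le_pos; lra). nra.
Qed.

Lemma INR_sqr_pow2 k : INR k * INR k <= 4 * 2 ^ k.
Proof.
  assert (H : forall k, INR k * INR k <= 4 * 2 ^ k /\ 2 * INR k + 1 <= 4 * 2 ^ k).
  { clear k; induction k as [|k [IH1 IH2]]; [simpl; lra|].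
    rewrite S_INR. simpl pow. pose proof (pow_R1_Rle 2 k). split; nra. }
  apply H.
Qed.

(** Termwise differentiation: the second-order remainder of z^k carries a factor k^2, bounded by 4
    times 2^k, so the coefficient bound at twice the radius absorbs it. *)
Lemma PS_cdiff a f : PS a f -> forall z,
  cdiff f z (gsum (fun k => RtoC (INR (S k)) * a (S k) * z ^ k)%C).
Proof.
  intros [Hg Hs] z.
  set (R := Cmod z + 1). assert (HR : 1 <= R). { unfold R; pose proof (Cmod_ge_0 z); lra. }
  destruct (growth_bsum a Hg (2 * R)) as (M & HM); [lra|].
  assert (Hb : bsum (fun k => INR k * INR k * (Cmod (a k) * R ^ k)) (4 * M)).
  { apply bsum_le with (fun k => 4 * (Cmod (a k) * (2 * R) ^ k)); [|apply bsum_scal; auto; lra].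
    intros k. rewrite Rpow_mult_distr. pose proof (INR_sqr_pow2 k).
    assert (0 <= Cmod (a k) * R ^ k) by (apply Rmult_le_pos; [apply Cmod_ge_0 | apply pow_le; lra]). nra. }
  assert (Hd : HS (fun k => RtoC (INR k) * a k * z ^ (pred k))%C (gsum (fun k => RtoC (INR (S k)) * a (S k) * z ^ k)%C)).
  { assert (Hb1 : bsum (fun k => Cmod (RtoC (INR k) * a k * z ^ (pred k))%C) (4 * M)).
    { eapply bsum_le; [|apply Hb]. intros k; simpl. rewrite !Cmod_mult, Cmod_pow, Cmod_R, Rabs_pos_eq by apply pos_INR.
      destruct k as [|k]; [simpl; lra|]. rewrite Rmult_assoc. rewrite (Rmult_assoc (INR (S k)) (INR (S k))).
      apply Rmult_le_compat_l; [apply pos_INR|].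
      apply Rle_trans with (1 * (Cmod (a (S k)) * R ^ S k)).
      - rewrite Rmult_1_l. apply Rmult_le_compat_l; [apply Cmod_ge_0|]. simpl pred.
        apply Rle_trans with (R ^ k); [apply pow_incr; split; [apply Cmod_ge_0 | unfold R; lra]|].
        apply Rle_pow; [auto|lia].
      - apply Rmult_le_compat_r; [apply Rmult_le_pos; [apply Cmod_ge_0 | apply pow_le; lra]|].
        rewrite S_INR. pose proof (pos_INR k); lra. }
    assert (Hb2 : bsum (fun k => Cmod (RtoC (INR (S k)) * a (S k) * z ^ k)%C) (4 * M)).
    { apply (bsum_inj S _ _ (fun i j => eq_add_S i j) Hb1). }
    pose proof (gsum_HS _ _ Hb2) as H2.
    apply (HS_of_seq _ _ _ Hb1). intros eps He. destruct (H2 eps He) as (A & _ & HA).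
    exists (S (S (list_max A))). intros n Hn. destruct n as [|n]; [lia|].
    assert (E : lsum (seq 0 (S n)) (fun k => RtoC (INR k) * a k * z ^ (pred k))%C =
      lsum (seq 0 n) (fun k => RtoC (INR (S k)) * a (S k) * z ^ k)%C).
    { simpl seq. rewrite <- seq_shift. simpl lsum. rewrite lsum_map. simpl pred.
      replace (RtoC (INR 0)) with (RtoC 0) by reflexivity. rewrite !Cmult_0_l, Cplus_0_l. reflexivity. }
    rewrite E. apply HA; [apply seq_NoDup|].
    intros x Hx. apply in_seq.
    pose proof (proj1 (list_max_le A (list_max A)) (Nat.le_refl _)) as Hm.
    rewrite Forall_forall in Hm. specialize (Hm x Hx). lia. }
  set (L := gsum (fun k => RtoC (INR (S k)) * a (S k) * z ^ k)%C) in *.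
  assert (HM0 : 0 <= M) by (apply (bsum_ge0 _ _ HM)).
  intros eps He. exists (Rmin 1 (eps / (4 * M + 1))). split.
  { apply Rmin_pos; [lra|]. apply Rdiv_lt_0_compat; lra. }
  intros h Hh.
  assert (H1 : Cmod h < 1) by (eapply Rlt_le_trans; [apply Hh | apply Rmin_l]).
  assert (H2 : Cmod h < eps / (4 * M + 1)) by (eapply Rlt_le_trans; [apply Hh | apply Rmin_r]).
  assert (HS (fun k => a k * (z + h) ^ k + ((- (1)) * (a k * z ^ k) + (- h) * (RtoC (INR k) * a k * z ^ (pred k))))%C
     (f (z + h) + ((- (1)) * f z + (- h) * L))%C) as HH.
  { apply HS_plus; [apply Hs|]. apply HS_plus; apply HS_scal; auto. }
  replace (f (z + h) - f z - L * h)%C with (f (z + h) + ((- (1)) * f z + (- h) * L))%C by ring.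
  apply Rle_trans with (Cmod h * Cmod h * (4 * M)).
  - eapply HS_bound; [apply HH|].
    apply bsum_le with (fun k => Cmod h * Cmod h * (INR k * INR k * (Cmod (a k) * R ^ k))).
    + intros k. replace (a k * (z + h) ^ k + (- (1) * (a k * z ^ k) + - h * (RtoC (INR k) * a k * z ^ pred k)))%C with
        (a k * ((z + h) ^ k - z ^ k - RtoC (INR k) * z ^ pred k * h))%C by ring.
      rewrite Cmod_mult.
      pose proof (pow_diff_bound z h R HR ltac:(unfold R; lra) k) as Hp.
      apply (Rmult_le_compat_l (Cmod (a k))) in Hp; [|apply Cmod_ge_0]. lra.
    + apply bsum_scal; auto. pose proof (Cmod_ge_0 h); nra.
  - pose proof (Cmod_ge_0 h).
    assert (Cmod h * (4 * M + 1) <= eps).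
    { apply Rlt_le in H2. apply (Rmult_le_compat_r (4 * M + 1)) in H2; [|lra]. field_simplify in H2; lra. }
    nra.
Qed.
Lemma PS_ent a f : PS a f -> ent f.
Proof. intros H z. eexists. apply (PS_cdiff a f H). Qed.

Lemma ccont_bounded f a b : a <= b -> ccont_on f a b -> exists M, forall t, a <= t <= b -> Cmod (f t) <= M.
Proof.
  intros Hab Hf. destruct (continuity_ab_maj (fun t => Cmod (f t)) a b Hab) as (x & Hx & _).
  - intros c Hc eps He. destruct (Hf c Hc eps He) as (d & Hd & Hd'). exists d; split; auto.
    intros s [_ Hs]. simpl in Hs. unfold R_dist in Hs. simpl. unfold R_dist.
    specialize (Hd' s Hs). eapply Rle_lt_trans; [|apply Hd'].
    apply Rabs_le. split.
    + assert (Cmod (f c) <= Cmod (f s) + Cmod (f s - f c)); [|lra].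
      replace (f c) with (f s + - (f s - f c))%C at 1 by ring.
      eapply Rle_trans; [apply Cmod_triangle|]. rewrite Cmod_opp. lra.
    + assert (Cmod (f s) <= Cmod (f c) + Cmod (f s - f c)); [|lra].
      replace (f s) with (f c + (f s - f c))%C at 1 by ring. apply Cmod_triangle.
  - exists (Cmod (f x)). auto.
Qed.

Lemma ent_bd_bounded f r : ent f -> 0 < r -> exists M, forall z, onbd (- r) r (- r) r z -> Cmod (f z) <= M.
Proof.
  intros Hf Hr.
  destruct (contbd_sides f (- r) r (- r) r ltac:(lra) ltac:(lra)) as (A & B & D & E).
  { intros z _. destruct (Hf z). eapply cdiff_contC; eauto. }
  destruct (ccont_bounded _ (- r) r ltac:(lra) A) as (M1 & H1).
  destruct (ccont_bounded _ (- r) r ltac:(lra) B) as (M2 & H2).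
  destruct (ccont_bounded _ (- r) r ltac:(lra) D) as (M3 & H3).
  destruct (ccont_bounded _ (- r) r ltac:(lra) E) as (M4 & H4).
  exists (Rmax (Rmax M1 M2) (Rmax M3 M4)). intros [x y] [[Hx Hy] Hz]. simpl in *.
  pose proof (Rmax_l (Rmax M1 M2) (Rmax M3 M4)). pose proof (Rmax_r (Rmax M1 M2) (Rmax M3 M4)).
  pose proof (Rmax_l M1 M2). pose proof (Rmax_r M1 M2). pose proof (Rmax_l M3 M4). pose proof (Rmax_r M3 M4).
  destruct Hz as [->|[->|[->| ->]]].
  - specialize (H3 y Hy). lra.
  - specialize (H4 y Hy). lra.
  - specialize (H1 x Hx). lra.
  - specialize (H2 x Hx). lra.
Qed.

Lemma onbd_Cmod r (z : C) : 0 < r -> onbd (- r) r (- r) r z -> r <= Cmod z <= 2 * r.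
Proof.
  intros Hr [[Hx Hy] Hz]. pose proof (fst_le_Cmod z). pose proof (snd_le_Cmod z).
  pose proof (Cmod_le_sum z).
  assert (Rabs (fst z) <= r) by (apply Rabs_le; lra). assert (Rabs (snd z) <= r) by (apply Rabs_le; lra).
  split; [|lra].
  destruct Hz as [E|[E|[E|E]]]; rewrite E in *; rewrite ?Rabs_Ropp, ?(Rabs_pos_eq r) in * by lra; lra.
Qed.

(** Cauchy's formula combined with the geometric expansion of 1 / (w - z). The second conclusion is
    Cauchy's estimate: the square of half side r lies within |z| <= 2 r, and the constant 16 / (2
    pi) coming from [RI_bound] is at most 4. *)
Lemma ent_PS f : ent f -> exists a, PS a f /\
  forall r M, 0 < r -> (forall z, Cmod z <= 2 * r -> Cmod (f z) <= M) -> forall k, Cmod (a k) * r ^ k <= 4 * M.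
Proof.
  intros Hf. set (c := (RtoC (2 * PI) * Ci)%C).
  assert (HPI : 2 < PI). { pose proof PI2_1. lra. }
  assert (Hc : Cmod c = 2 * PI). { unfold c. rewrite Cmod_mult, Cmod_Ci, Cmod_R, Rabs_pos_eq; lra. }
  assert (Hc0 : c <> RtoC 0). { apply Cmod_gt_0. lra. }
  set (g := fun (k : nat) (z : C) => (f z * (/ z) ^ (S k))%C).
  set (a := fun k => (RI (g k) (- (1)) 1 (- (1)) 1 / c)%C).
  assert (Dinv : forall z : C, z <> RtoC 0 -> exists L, cdiff (fun w => / w)%C z L).
  { intros z Hz. eexists; apply cdiff_inv; auto. }
  assert (Dpow : forall k (z : C), z <> RtoC 0 -> exists L, cdiff (fun w => (/ w) ^ k)%C z L).
  { intros k z Hz. destruct (Dinv z Hz) as (L & HL).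
    destruct (ent_pow (fun w => w) k ent_id (/ z)%C) as (L' & HL').
    eexists. apply (cdiff_comp (fun w => / w)%C (fun w => w ^ k)%C); eauto. }
  assert (Dg : forall k (z : C), z <> RtoC 0 -> exists L, cdiff (g k) z L).
  { intros k z Hz. destruct (Hf z), (Dpow (S k) z Hz). eexists. apply cdiff_mult; eauto. }
  (* The coefficient integral is the same over every centred square, the only singularity being at
     0. *)
  assert (A : forall k r, 0 < r -> RI (g k) (- r) r (- r) r = (c * a k)%C).
  { intros k r Hr. replace (c * a k)%C with (RI (g k) (- (1)) 1 (- (1)) 1) by (unfold a; field; auto).
    destruct (Rle_dec 1 r).
    - apply (RI_shrink _ _ _ _ _ _ _ _ _ (RtoC 0)); simpl; try lra. intros; apply Dg; auto.
    - symmetry. apply (RI_shrink _ _ _ _ _ _ _ _ _ (RtoC 0)); simpl; try lra. intros; apply Dg; auto. }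
  assert (Hnz : forall r z, 0 < r -> onbd (- r) r (- r) r z -> z <> RtoC 0).
  { intros r z Hr Hz E. pose proof (onbd_Cmod r z Hr Hz). rewrite E, Cmod_0 in H. lra. }
  assert (Cg : forall k r, 0 < r -> contbd (g k) (- r) r (- r) r).
  { intros k r Hr z Hz. destruct (Dg k z (Hnz r z Hr Hz)). eapply cdiff_contC; eauto. }
  assert (Hinvb : forall r z, 0 < r -> onbd (- r) r (- r) r z -> Cmod (/ z) <= / r).
  { intros r z Hr Hz. rewrite Cmod_inv by (apply (Hnz r); auto). pose proof (onbd_Cmod r z Hr Hz).
    apply Rinv_le_contravar; lra. }
  assert (B : forall r M, 0 < r -> (forall z, onbd (- r) r (- r) r z -> Cmod (f z) <= M) ->
     forall k, Cmod (a k) * r ^ k <= 4 * M).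
  { intros r M Hr HM k.
    assert (HM0 : 0 <= M). { eapply Rle_trans; [apply Cmod_ge_0|]. apply (HM (r, r)). split; [split; simpl; lra | simpl; tauto]. }
    pose proof (RI_bound (g k) (- r) r (- r) r (M * (/ r) ^ S k) ltac:(lra) ltac:(lra) (Cg k r Hr)) as Hb.
    rewrite A in Hb by auto. rewrite Cmod_mult, Hc in Hb.
    assert (Hb2 : 2 * PI * Cmod (a k) <= 4 * (M * (/ r) ^ S k) * (r - - r + (r - - r))).
    { apply Hb. intros z Hz. unfold g. rewrite Cmod_mult, Cmod_pow. apply Rmult_le_compat; auto; try apply Cmod_ge_0.
      - apply pow_le, Cmod_ge_0.
      - apply pow_incr. split; [apply Cmod_ge_0|]. apply Hinvb; auto. }
    replace (4 * (M * (/ r) ^ S k) * (r - - r + (r - - r))) with (16 * M * / r ^ k) in Hb2.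
    2:{ rewrite pow_inv. simpl pow. field. split; [apply pow_nonzero|]; lra. }
    assert (0 < r ^ k) by (apply pow_lt; auto).
    apply (Rmult_le_compat_r (r ^ k)) in Hb2; [|lra].
    rewrite (Rmult_assoc (16 * M)), Rinv_l in Hb2 by lra.
    assert (0 <= Cmod (a k) * r ^ k) by (apply Rmult_le_pos; [apply Cmod_ge_0|lra]).
    nra. }
  exists a. split.
  2:{ intros r M Hr HM. apply B; auto. intros z Hz. apply HM. apply onbd_Cmod; auto. }
  assert (Hg : forall r, 0 < r -> exists M, forall k, Cmod (a k) * r ^ k <= M).
  { intros r Hr. destruct (ent_bd_bounded f r Hf Hr) as (M & HM). exists (4 * M). apply B; auto. }
  split; auto. intros z.
  destruct (growth_terms a Hg z) as (Mz & HMz). apply (HS_of_seq _ _ _ HMz).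
  (* On a square of this half side |z / w| <= 1/2 holds along the contour, so the remainder after N
     terms decays like 2^(-N). *)
  pose proof (Cmod_ge_0 z) as Hz0. set (r := 2 * Cmod z + 1). assert (Hr : 0 < r) by (unfold r; lra).
  set (Rem := fun (N : nat) (w : C) => (f w * ((z ^ N * (/ w) ^ N) * / (w - z)))%C).
  assert (Hzb : forall w, onbd (- r) r (- r) r w -> w <> RtoC 0 /\ w <> z /\ Cmod (/ (w - z)) <= 2 / r).
  { intros w Hw. pose proof (onbd_Cmod r w Hr Hw).
    assert (Hwz : r / 2 <= Cmod (w - z)).
    { assert (Cmod w <= Cmod (w - z) + Cmod z); [|unfold r in *; lra].
      replace w with ((w - z) + z)%C at 1 by ring. apply Cmod_triangle. }
    split; [apply (Hnz r); auto|]. split.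
    - intros ->. replace (z - z)%C with (RtoC 0) in Hwz by ring. rewrite Cmod_0 in Hwz. lra.
    - rewrite Cmod_inv by (apply Cmod_gt_0; lra). replace (2 / r) with (/ (r / 2)) by (field; lra).
      apply Rinv_le_contravar; lra. }
  assert (CR : forall N, contbd (Rem N) (- r) r (- r) r).
  { intros N w Hw. destruct (Hzb w Hw) as (W1 & W2 & _).
    destruct (Hf w), (Dpow N w W1), (cdiff_ex_minus z w W2). eapply cdiff_contC. unfold Rem.
    apply cdiff_mult; eauto. apply cdiff_mult; eauto. apply cdiff_mult; [apply cdiff_const | eauto]. }
  assert (Step : forall N, RI (Rem N) (- r) r (- r) r = (z ^ N * (c * a N) + RI (Rem (S N)) (- r) r (- r) r)%C).
  { intros N. rewrite <- (A N r Hr), <- RI_scal by (auto; lra).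
    rewrite <- (RI_plus (fun w => z ^ N * g N w)%C (Rem (S N))); try lra; auto.
    - apply RI_ext; try lra. intros w Hw. destruct (Hzb w Hw) as (W1 & W2 & _).
      unfold Rem, g. rewrite !Cpow_S.
      assert ((w - z)%C <> RtoC 0). { intros E; apply W2, Ceq_minus; auto. } field. auto.
    - intros w Hw. destruct (Hzb w Hw) as (W1 & W2 & _). destruct (Dg N w W1).
      eapply cdiff_contC. apply cdiff_mult; [apply cdiff_const | eauto]. }
  assert (Tot : forall N, (c * f z = c * lsum (seq 0 N) (fun k => a k * z ^ k) + RI (Rem N) (- r) r (- r) r)%C).
  { induction N as [|N IH].
    - assert (CF : RI (fun w => f w * / (w - z))%C (- r) r (- r) r = (c * f z)%C).
      { apply (cauchy_formula f z r Hf).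
        - eapply Rle_lt_trans; [apply fst_le_Cmod|]. unfold r; lra.
        - eapply Rle_lt_trans; [apply snd_le_Cmod|]. unfold r; lra. }
      rewrite <- CF. simpl. rewrite Cmult_0_r, Cplus_0_l. apply RI_ext; try lra.
      intros w _. unfold Rem. simpl. ring.
    - rewrite lsum_seq_S, IH, Step. ring. }
  destruct (ent_bd_bounded f r Hf Hr) as (M & HM).
  assert (HM0 : 0 <= M). { eapply Rle_trans; [apply Cmod_ge_0|]. apply (HM (r, r)). split; [split; simpl; lra | simpl; tauto]. }
  assert (RB : forall N, Cmod (RI (Rem N) (- r) r (- r) r) <= 32 * M / 2 ^ N).
  { intros N. eapply Rle_trans.
    - apply (RI_bound (Rem N) (- r) r (- r) r (M * ((/ 2) ^ N * (2 / r)))); try lra; auto.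
      intros w Hw. destruct (Hzb w Hw) as (W1 & W2 & W3). unfold Rem. rewrite !Cmod_mult.
      apply Rmult_le_compat; try apply Cmod_ge_0; auto.
      + apply Rmult_le_pos; [apply Rmult_le_pos|]; apply Cmod_ge_0.
      + apply Rmult_le_compat; try apply Cmod_ge_0; auto.
        * apply Rmult_le_pos; apply Cmod_ge_0.
        * rewrite !Cmod_pow, <- Rpow_mult_distr. apply pow_incr. split.
          -- apply Rmult_le_pos; apply Cmod_ge_0.
          -- specialize (Hinvb r w Hr Hw).
             apply Rle_trans with (Cmod z * / r); [apply Rmult_le_compat_l; auto|].
             apply (Rmult_le_reg_r r); auto. rewrite Rmult_assoc, Rinv_l by lra. unfold r; lra.
    - rewrite pow_inv. right. field. split; [apply pow_nonzero|]; lra. }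
  intros eps He. destruct (pow_half_small (32 * M) ltac:(lra) eps He) as (N & HN). exists N. intros n Hn.
  assert (E : (lsum (seq 0 n) (fun k => a k * z ^ k) - f z)%C = (- (RI (Rem n) (- r) r (- r) r / c))%C).
  { specialize (Tot n). apply (f_equal (fun x => x / c)%C) in Tot.
    replace (c * f z / c)%C with (f z) in Tot by (field; auto). rewrite Tot. field. auto. }
  rewrite E, Cmod_opp, Cmod_div, Hc by auto.
  apply Rle_lt_trans with (32 * M / 2 ^ N); auto.
  assert (Cmod (RI (Rem n) (- r) r (- r) r) <= 32 * M / 2 ^ N).
  { eapply Rle_trans; [apply RB|]. unfold Rdiv. apply Rmult_le_compat_l; [lra|].
    apply Rinv_le_contravar; [apply pow_lt; lra|]. apply Rle_pow; [lra|auto]. }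
  apply (Rmult_le_reg_r (2 * PI)); [lra|]. unfold Rdiv at 1. rewrite Rmult_assoc, Rinv_l by lra.
  assert (0 <= 32 * M / 2 ^ N). { apply Rdiv_le_0_compat; [lra|apply pow_lt; lra]. } nra.
Qed.

Lemma ent_bound f : ent f -> forall r, exists M, forall z, Cmod z <= r -> Cmod (f z) <= M.
Proof. intros H. destruct (ent_PS f H) as (a & Ha & _). apply (PS_bound a); auto. Qed.

(** * Division by z and uniqueness of coefficients *)
Lemma lsum_seq_shift n (f : nat -> C) : lsum (seq 0 (S n)) f = (f O + lsum (seq 0 n) (fun k => f (S k)))%C.
Proof. simpl seq. rewrite <- seq_shift. simpl lsum. rewrite lsum_map. auto. Qed.

Lemma HS_seq (f : nat -> C) s : HS f s -> forall eps, 0 < eps ->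
  exists N, forall n, (N <= n)%nat -> Cmod (lsum (seq 0 n) f - s) < eps.
Proof.
  intros H eps He. destruct (H eps He) as (A & _ & HA). exists (S (list_max A)). intros n Hn.
  apply HA; [apply seq_NoDup|]. intros x Hx. apply in_seq.
  pose proof (proj1 (list_max_le A (list_max A)) (Nat.le_refl _)) as Hm.
  rewrite Forall_forall in Hm. specialize (Hm x Hx). lia.
Qed.

Lemma PS_shift a f : PS a f -> exists g, PS (fun k => a (S k)) g /\ forall z, f z = (a O + z * g z)%C.
Proof.
  intros [Hg Hs].
  assert (Hg' : forall r, 0 < r -> exists M, forall k, Cmod (a (S k)) * r ^ k <= M).
  { intros r Hr. destruct (Hg r Hr) as (M & HM). exists (M / r). intros k. specialize (HM (S k)).
    apply (Rmult_le_reg_r r); auto. unfold Rdiv. rewrite (Rmult_assoc M), Rinv_l by lra. simpl in HM. lra. }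
  exists (fun z => gsum (fun k => a (S k) * z ^ k)%C). split.
  - split; auto. intros z. destruct (growth_terms _ Hg' z) as (M & HM). eapply gsum_HS; eauto.
  - intros z. destruct (growth_terms _ Hg' z) as (M & HM). pose proof (gsum_HS _ _ HM) as H1.
    destruct (growth_terms _ Hg z) as (M' & HM').
    apply (HS_unique (fun k => a k * z ^ k)%C); [apply Hs|].
    apply (HS_of_seq _ _ _ HM'). intros eps He.
    pose proof (HS_scal _ _ z H1) as H2.
    destruct (HS_seq _ _ H2 eps He) as (N & HN). exists (S N). intros n Hn. destruct n as [|n]; [lia|].
    rewrite lsum_seq_shift. specialize (HN n ltac:(lia)).
    rewrite (lsum_ext (seq 0 n) (fun k => a (S k) * z ^ S k)%C (fun k => z * (a (S k) * z ^ k))%C).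
    + match goal with |- Cmod ?x < _ => match type of HN with Cmod ?y < _ => replace x with y; auto end end.
      simpl Cpow. ring.
    + intros k _. rewrite Cpow_S. ring.
Qed.

(** Induction through division by z: the quotient vanishes away from 0, hence also at 0 by
    continuity. *)
Lemma PS_zero a f : PS a f -> (forall z, f z = RtoC 0) -> forall k, a k = RtoC 0.
Proof.
  intros H Hz k. revert a f H Hz. induction k as [|k IH]; intros a f H Hz.
  - destruct (PS_shift a f H) as (g & _ & E). specialize (E (RtoC 0)). rewrite Hz in E.
    replace (a O) with (a O + 0 * g 0)%C by ring. auto.
  - destruct (PS_shift a f H) as (g & Hg & E).
    assert (E0 : a O = RtoC 0). { specialize (E (RtoC 0)). rewrite Hz in E.
      replace (a O) with (a O + 0 * g 0)%C by ring. auto. }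
    apply (IH (fun k => a (S k)) g Hg).
    assert (Hn : forall z, z <> RtoC 0 -> g z = RtoC 0).
    { intros z Hzn. specialize (E z). rewrite Hz, E0, Cplus_0_l in E.
      apply NNPP; intros Hg0. apply (Cmult_neq_0 z (g z)); auto. }
    intros z. destruct (Ceq_dec z 0) as [->|Hzn]; [|apply Hn; auto].
    apply NNPP; intros Hg0. apply Cmod_gt_0 in Hg0.
    destruct (PS_ent _ _ Hg (RtoC 0)) as (L & HL).
    destruct (cdiff_cont g _ L HL _ Hg0) as (d & Hd & Hd').
    specialize (Hd' (RtoC (d / 2))). rewrite Cmod_R, Rabs_pos_eq in Hd' by lra.
    specialize (Hd' ltac:(lra)). rewrite Cplus_0_l in Hd'. rewrite (Hn (RtoC (d / 2))) in Hd'.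
    + replace (0 - g 0)%C with (- g 0)%C in Hd' by ring. rewrite Cmod_opp in Hd'. lra.
    + intros E1. apply (f_equal fst) in E1. simpl in E1. lra.
Qed.

(** * Weierstrass: sums of entire functions *)
(** Cauchy's estimate makes the double family of Taylor coefficients absolutely summable, so the sum
    over the index and the sum over the degree can be exchanged; the result is again a power
    series. *)
Lemma ent_gsum {I} (f : I -> C -> C) : (forall i, ent (f i)) ->
  (forall r, exists m M, (forall i z, Cmod z <= r -> Cmod (f i z) <= m i) /\ bsum m M) ->
  ent (fun z => gsum (fun i => f i z)) /\ (forall z, HS (fun i => f i z) (gsum (fun i => f i z))).
Proof.
  intros Hf Hm.
  assert (Hs : forall z, HS (fun i => f i z) (gsum (fun i => f i z))).
  { intros z. destruct (Hm (Cmod z)) as (m & M & H1 & H2). apply (gsum_HS _ M).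
    eapply bsum_le; [|apply H2]. intros i; apply H1. lra. }
  split; auto.
  destruct (choice (fun i a => PS a (f i) /\ forall r M, 0 < r -> (forall z, Cmod z <= 2 * r -> Cmod (f i z) <= M) ->
     forall k, Cmod (a k) * r ^ k <= 4 * M)) as (a & Ha).
  { intros i. apply ent_PS; auto. }
  assert (Hb : forall r, 0 < r -> exists M, bsum (fun x : I * nat => Cmod (a (fst x) (snd x)) * r ^ (snd x)) M).
  (* [ent_PS] at radius 2 r asks for a bound on the disc of radius 4 r, and leaves a factor 2^(-k)
     at radius r. *)
  { intros r Hr. destruct (Hm (4 * r)) as (m & M & H1 & H2). exists (4 * M * 2).
    assert (Hm0 : forall i, 0 <= m i). { intros i. eapply Rle_trans; [apply Cmod_ge_0|]. apply (H1 i (RtoC 0)). rewrite Cmod_0; lra. }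
    apply bsum_le with (fun x => (4 * m (fst x)) * (/ 2) ^ (snd x)).
    - intros [i k]; simpl. destruct (Ha i) as (_ & Hi). specialize (Hi (2 * r) (m i) ltac:(lra)).
      specialize (Hi ltac:(intros; apply H1; lra) k). rewrite Rpow_mult_distr in Hi.
      apply (Rmult_le_reg_r (2 ^ k)); [apply pow_lt; lra|]. rewrite pow_inv.
      rewrite (Rmult_assoc (4 * m i)), Rinv_l by (apply pow_nonzero; lra). lra.
    - apply (bsum_prod (fun i => 4 * m i)).
      + intros i. specialize (Hm0 i). lra.
      + intros k. apply pow_le; lra.
      + apply bsum_scal; auto; lra.
      + apply bsum_half. }
  assert (Hk : forall k, exists M, bsum (fun i => Cmod (a i k)) M).
  { intros k. destruct (Hb 1 ltac:(lra)) as (M & HM). exists M.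
    apply (bsum_inj (fun i => (i, k))) in HM; [|intros; congruence].
    eapply bsum_le; [|apply HM]. intros i; simpl. rewrite pow1. lra. }
  assert (Hk' : forall k, HS (fun i => a i k) (gsum (fun i => a i k))).
  { intros k. destruct (Hk k) as (M & HM). eapply gsum_HS; eauto. }
  apply (PS_ent (fun k => gsum (fun i => a i k))). split.
  - intros r Hr. destruct (Hb r Hr) as (M & HM). exists M. intros k.
    pose proof (bsum_inj (fun i => (i, k)) _ _ ltac:(intros; congruence) HM) as HMk. simpl in HMk.
    rewrite <- (Rabs_pos_eq (r ^ k)) by (apply pow_le; lra). rewrite <- Cmod_R, <- Cmod_mult, Cmult_comm.
    eapply HS_bound; [apply HS_scal, Hk'|]. eapply bsum_le; [|apply HMk]. intros i; simpl.
    rewrite Cmod_mult, Cmod_R, Rabs_pos_eq by (apply pow_le; lra). lra.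
  - intros z. destruct (Hb (Cmod z + 1)) as (M & HM). { pose proof (Cmod_ge_0 z); lra. }
    assert (HB : bsum (fun x : I * nat => Cmod (a (fst x) (snd x) * z ^ (snd x))%C) M).
    { eapply bsum_le; [|apply HM]. intros [i k]; simpl. rewrite Cmod_mult, Cmod_pow.
      apply Rmult_le_compat_l; [apply Cmod_ge_0|]. apply pow_incr. split; [apply Cmod_ge_0|lra]. }
    pose proof (gsum_HS _ _ HB) as H. set (S := gsum (fun x : I * nat => (a (fst x) (snd x) * z ^ snd x)%C)) in *.
    assert (ES : HS (fun i => f i z) S).
    { apply (HS_Fubini _ _ _ H). intros i; simpl. apply (proj1 (Ha i)). }
    rewrite (HS_unique _ _ _ (Hs z) ES).
    apply HS_swap in H. apply (HS_Fubini _ _ _ H). intros k; simpl.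
    rewrite Cmult_comm. apply (HS_ext (fun i => z ^ k * a i k)%C); [intros; ring|].
    apply HS_scal, Hk'.
Qed.

(** * Null vectors of theta-type sums *)
(** Gaussian elimination: an equation that vanishes on [U] is dropped, otherwise a pivot removes one
    equation together with one unknown. *)
Lemma underdetermined {J : Type} (rows : list (J -> C)) : forall U : list J, NoDup U ->
  (length rows < length U)%nat ->
  exists x : J -> C, (exists j, In j U /\ x j <> RtoC 0) /\ (forall j, ~ In j U -> x j = RtoC 0) /\
    forall r, In r rows -> lsum U (fun j => r j * x j)%C = RtoC 0.
Proof.
  remember (length rows) as len eqn:Elen. revert rows Elen.
  induction len as [|len IH]; intros rows Elen U HU HL.
  - destruct U as [|u U]; [simpl in HL; lia|].
    exists (fun j => if eq_dec_classic j u then RtoC 1 else RtoC 0). split; [|split].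
    + exists u. split; [left; auto|]. destruct (eq_dec_classic u u); [apply C1_nz | congruence].
    + intros j Hj. destruct (eq_dec_classic j u) as [->|]; auto. exfalso; apply Hj; left; auto.
    + destruct rows; [intros r []| simpl in Elen; lia].
  - destruct rows as [|r rows]; [simpl in Elen; lia|]. simpl in Elen.
    destruct (classic (forall j, In j U -> r j = RtoC 0)) as [Hz|Hz].
    + destruct (IH rows ltac:(lia) U HU ltac:(lia)) as (x & H1 & H2 & H3).
      exists x. split; [auto|]. split; auto. intros r' [<-|Hr']; auto.
      rewrite (lsum_ext U _ (fun _ => RtoC 0)), lsum_zero; auto.
      intros j Hj. rewrite Hz by auto. ring.
    + apply not_all_ex_not in Hz. destruct Hz as (j0 & Hj0). apply imply_to_and in Hj0.
      destruct Hj0 as (Hin & Hr0).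
      destruct (in_split _ _ Hin) as (U1 & U2 & ->).
      pose proof (NoDup_remove_1 _ _ _ HU) as HU'. pose proof (NoDup_remove_2 _ _ _ HU) as Hn0.
      set (U' := U1 ++ U2) in *.
      destruct (IH (map (fun s j => s j - s j0 / r j0 * r j)%C rows)) with (U := U') as (x & (j1 & J1 & J2) & H2 & H3); auto.
      { rewrite length_map. lia. }
      { unfold U'. rewrite length_app in *. simpl in HL. lia. }
      (* The pivot unknown is solved from the first equation. *)
      set (y := fun j => if eq_dec_classic j j0 then (- (lsum U' (fun j => r j * x j) / r j0))%C else x j).
      assert (Ey : forall s, lsum (U1 ++ j0 :: U2) (fun j => s j * y j)%C = (lsum U' (fun j => s j * x j) - s j0 / r j0 * lsum U' (fun j => r j * x j))%C).
      { intros s. rewrite lsum_app. simpl. unfold U'.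
        rewrite (lsum_ext U1 (fun j => s j * y j)%C (fun j => s j * x j)%C).
        2:{ intros j Hj. unfold y. destruct (eq_dec_classic j j0) as [->|]; auto.
            exfalso; apply Hn0, in_app_iff; auto. }
        rewrite (lsum_ext U2 (fun j => s j * y j)%C (fun j => s j * x j)%C).
        2:{ intros j Hj. unfold y. destruct (eq_dec_classic j j0) as [->|]; auto.
            exfalso; apply Hn0, in_app_iff; auto. }
        unfold y. destruct (eq_dec_classic j0 j0); [|congruence].
        unfold U'. rewrite (lsum_app U1 U2 (fun j => s j * x j)%C). field. auto. }
      exists y. split; [|split].
      * exists j1. split. { apply in_app_iff. apply in_app_iff in J1. simpl. tauto. }
        unfold y. destruct (eq_dec_classic j1 j0) as [E|]; auto. exfalso; apply Hn0; rewrite <- E; auto.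
      * intros j Hj. unfold y. destruct (eq_dec_classic j j0) as [->|].
        -- exfalso; apply Hj, in_app_iff; right; left; auto.
        -- apply H2. intros Hj'. apply Hj. apply in_app_iff. apply in_app_iff in Hj'. simpl. tauto.
      * intros s [<-|Hs]; rewrite Ey.
        -- field. auto.
        -- specialize (H3 _ (in_map (fun s j => s j - s j0 / r j0 * r j)%C rows s Hs)).
           rewrite <- H3. simpl.
           transitivity (lsum U' (fun j => s j * x j + (- (1)) * (s j0 / r j0 * (r j * x j)))%C).
           ++ rewrite lsum_plus, !lsum_scal. ring.
           ++ apply lsum_ext. intros; ring.
Qed.

Definition sgnZ (k : Z) : C := if Z.even k then RtoC 1 else (- (1))%C.
Lemma sgnZ_add a b : sgnZ (a + b) = (sgnZ a * sgnZ b)%C.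
Proof. unfold sgnZ. rewrite Z.even_add. destruct (Z.even a), (Z.even b); simpl; ring. Qed.
Lemma sgnZ_opp a : sgnZ (- a) = sgnZ a.
Proof. unfold sgnZ. rewrite Z.even_opp. auto. Qed.
Lemma sgnZ_sq a : (sgnZ a * sgnZ a)%C = RtoC 1.
Proof. unfold sgnZ. destruct (Z.even a); ring. Qed.
Lemma sgnZ_Cmod a : Cmod (sgnZ a) = 1.
Proof. unfold sgnZ. destruct (Z.even a); rewrite ?Cmod_opp, Cmod_1; auto. Qed.
Lemma sgnZ_even a : Z.even a = true -> sgnZ a = RtoC 1.
Proof. unfold sgnZ. intros ->; auto. Qed.
Lemma sgnZ_odd a : Z.even a = false -> sgnZ a = (- (1))%C.
Proof. unfold sgnZ. intros ->; auto. Qed.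
Lemma sgnZ_pow k x : ((- x) ^ k)%C = (sgnZ (Z.of_nat k) * x ^ k)%C.
Proof.
  induction k as [|k IH]; [unfold sgnZ; simpl; ring|].
  rewrite !Cpow_S, IH, Nat2Z.inj_succ, <- Z.add_1_r, sgnZ_add.
  replace (sgnZ 1) with (- (1))%C by reflexivity. ring.
Qed.

Definition mm (n : nat) (l : Z) : R := IZR (2 * l - Z.of_nat n).
(* [gw n tau l] = exp (i pi tau (l^2 - n l) / n), written in terms of [mm n l] = 2 l - n so that the reflection l -> n - l is visible. *)
Definition gw (n : nat) (tau : C) (l : Z) : C :=
  Cexp (Ci * tau * RtoC (PI * (mm n l * mm n l - INR n * INR n) / (4 * INR n)))%C.

Lemma mm_shift n l q : mm n (l + Z.of_nat n * q) = mm n l + 2 * INR n * IZR q.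
Proof. unfold mm. rewrite !minus_IZR, !mult_IZR, plus_IZR, mult_IZR, <- INR_IZR_INZ. ring. Qed.
Lemma mm_refl n l : mm n (Z.of_nat n - l) = - mm n l.
Proof. unfold mm. rewrite !minus_IZR, !mult_IZR, minus_IZR, <- INR_IZR_INZ. ring. Qed.

Lemma gw_refl n tau l : gw n tau (Z.of_nat n - l) = gw n tau l.
Proof. unfold gw. rewrite mm_refl. do 3 f_equal. f_equal. f_equal. ring. Qed.
Lemma gw_Cmod n tau l : Cmod (gw n tau l) = exp (- (PI * Im tau / (4 * INR n)) * (mm n l * mm n l - INR n * INR n)).
Proof.
  unfold gw. rewrite Cmod_Cexp. f_equal. unfold Re, Im, Ci, Cmult, RtoC; simpl. unfold Rdiv; ring.
Qed.

(* Completing the square: every Gaussian beats every exponential. *)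
Lemma gauss_le_exp A B : 0 < A -> exists K, 0 < K /\ forall x, exp (- A * (x * x) + B * x) <= K * exp (- x).
Proof.
  intros HA. exists (exp ((B + 1) * (B + 1) / (4 * A))). split; [apply exp_pos|].
  intros x. rewrite <- exp_plus.
  assert (- A * (x * x) + B * x <= (B + 1) * (B + 1) / (4 * A) + - x).
  { apply (Rmult_le_reg_r (4 * A)); [lra|].
    replace (((B + 1) * (B + 1) / (4 * A) + - x) * (4 * A)) with ((B + 1) * (B + 1) - x * (4 * A)) by (field; lra).
    pose proof (Rle_0_sqr (2 * A * x - (B + 1))) as Hs. unfold Rsqr in Hs. nra. }
  destruct H as [H|H]; [left; apply exp_increasing; auto | rewrite H; lra].
Qed.
Lemma exp_mono x y : x <= y -> exp x <= exp y.
Proof. intros [H|H]; [left; apply exp_increasing; auto | rewrite H; lra]. Qed.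
Lemma pow_le_exp x k : 0 <= x -> x ^ k <= exp (INR k * x).
Proof.
  intros Hx. rewrite <- exp_pow. apply pow_incr. split; auto.
  pose proof (exp_ineq1_le x). lra.
Qed.

Lemma mm_abs n l : Rabs (IZR l) - INR n <= Rabs (mm n l).
Proof.
  unfold mm. rewrite minus_IZR, mult_IZR, <- INR_IZR_INZ. pose proof (pos_INR n).
  unfold Rabs. repeat destruct Rcase_abs; lra.
Qed.

Lemma bsum_gauss n A B k : 0 < A -> exists K,
  bsum (fun l => Rabs (mm n l) ^ k * exp (- A * (mm n l * mm n l) + B * Rabs (mm n l))) K.
Proof.
  intros HA. destruct (gauss_le_exp A (B + INR k) HA) as (K & HK & HK').
  destruct (bsum_exp_Z 1 Rlt_0_1) as (M & HM).
  exists (K * exp (INR n) * M).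
  eapply bsum_le; [|apply bsum_scal; [|apply HM]].
  - intros l. simpl. set (x := Rabs (mm n l)).
    assert (Hx : 0 <= x) by apply Rabs_pos.
    apply Rle_trans with (exp (INR k * x) * exp (- A * (x * x) + B * x)).
    + apply Rmult_le_compat; [apply pow_le; auto | left; apply exp_pos | apply pow_le_exp; auto |].
      right. f_equal. f_equal. f_equal. unfold x. rewrite <- Rabs_mult. symmetry. apply Rabs_pos_eq.
      apply Rle_0_sqr.
    + rewrite <- exp_plus. replace (INR k * x + (- A * (x * x) + B * x)) with (- A * (x * x) + (B + INR k) * x) by ring.
      eapply Rle_trans; [apply HK'|]. rewrite Rmult_assoc. apply Rmult_le_compat_l; [lra|].
      rewrite <- exp_plus. apply exp_mono. pose proof (mm_abs n l). fold x in H. lra.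
  - apply Rmult_le_pos; [lra | left; apply exp_pos].
Qed.

Section Null.
Variables (n : nat) (tau : C).
Hypothesis Hn : (1 <= n)%nat.
Hypothesis HT : 0 < Im tau.

Let Nz := Z.of_nat n.
Let HN0 : 0 < INR n.
Proof. apply lt_0_INR. lia. Qed.

Lemma gw_bsum k B : exists K, bsum (fun l => Cmod (gw n tau l) * Rabs (mm n l) ^ k * exp (B * Rabs (mm n l))) K.
Proof.
  assert (HA : 0 < PI * Im tau / (4 * INR n)).
  { apply Rdiv_lt_0_compat; [apply Rmult_lt_0_compat; auto; apply PI_RGT_0 | lra]. }
  set (A := PI * Im tau / (4 * INR n)) in *.
  destruct (bsum_gauss n A B k HA) as (K & HK). exists (exp (A * (INR n * INR n)) * K).
  eapply bsum_le; [|apply bsum_scal; [left; apply exp_pos | apply HK]].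
  intros l; simpl. rewrite gw_Cmod. fold A.
  replace (- A * (mm n l * mm n l - INR n * INR n)) with (A * (INR n * INR n) + - A * (mm n l * mm n l)) by ring.
  rewrite !exp_plus. right; ring.
Qed.

(** Basis vector, supported on the residue class of [j], of the space of all b with b(l + n) =
    (-1)^n b(l). *)
Definition basis_per (j l : Z) : C :=
  if Z.eqb ((l - j) mod Nz) 0 then sgnZ (Nz * ((l - j) / Nz)) else RtoC 0.
Lemma basis_per_shift j l : basis_per j (l + Nz) = (sgnZ Nz * basis_per j l)%C.
Proof.
  assert (Nz <> 0)%Z by (unfold Nz; lia). unfold basis_per.
  replace (l + Nz - j)%Z with (l - j + 1 * Nz)%Z by ring.
  rewrite Z.mod_add, Z.div_add by auto. destruct Z.eqb; [|ring].
  rewrite Z.mul_add_distr_l, sgnZ_add. replace (Nz * 1)%Z with Nz by ring. ring.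
Qed.
Lemma basis_per_Cmod j l : Cmod (basis_per j l) <= 1.
Proof. unfold basis_per. destruct Z.eqb; [rewrite sgnZ_Cmod | rewrite Cmod_0]; lra. Qed.

(** Moments are taken in 2 l - n, which changes sign under l -> n - l; since all degrees below n
    occur, the conditions span the same space as those with powers of l. *)
Definition moment_vanish (b : Z -> C) : Prop :=
  forall k, (k < n)%nat -> HS (fun l => b l * gw n tau l * RtoC (mm n l) ^ k)%C (RtoC 0).

Lemma per_bsum b Bb k : (forall l, Cmod (b l) <= Bb) ->
  exists K, bsum (fun l => Cmod (b l * gw n tau l * RtoC (mm n l) ^ k)%C) K.
Proof.
  intros Hb. destruct (gw_bsum k 0) as (K & HK). exists (Bb * K).
  assert (HB : 0 <= Bb). { eapply Rle_trans; [apply Cmod_ge_0 | apply (Hb 0%Z)]. }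
  eapply bsum_le; [|apply bsum_scal; [auto | apply HK]].
  intros l; simpl. rewrite !Cmod_mult, Cmod_pow, Cmod_R, Rmult_0_l, exp_0, Rmult_1_r, Rmult_assoc.
  apply Rmult_le_compat_r; auto. apply Rmult_le_pos; [apply Cmod_ge_0 | apply pow_le, Rabs_pos].
Qed.

(* The moments of odd [k + n] vanish by the reflection; the others are floor(n/2) equations for floor(n/2) + 1 unknowns. *)
Lemma exists_b : exists b : Z -> C, (exists l, b l <> RtoC 0) /\ (exists Bb, forall l, Cmod (b l) <= Bb) /\
  (forall l, b (l + Nz)%Z = (sgnZ Nz * b l)%C) /\ moment_vanish b.
Proof.
  (* Even combinations: for them b(n - l) = (-1)^n b(l), which lets the reflection act on the
     moments. *)
  set (e := fun (j : nat) (l : Z) => (basis_per (Z.of_nat j) l + basis_per (Z.of_nat j) (- l))%C).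
  assert (He1 : forall j l, e j (l + Nz)%Z = (sgnZ Nz * e j l)%C).
  { intros j l. unfold e. rewrite basis_per_shift.
    assert (E : basis_per (Z.of_nat j) (- l) = (sgnZ Nz * basis_per (Z.of_nat j) (- (l + Nz)))%C).
    { rewrite <- basis_per_shift. f_equal. ring. }
    rewrite E. transitivity (sgnZ Nz * basis_per (Z.of_nat j) l + (sgnZ Nz * sgnZ Nz) * basis_per (Z.of_nat j) (- (l + Nz)))%C; [|ring].
    rewrite sgnZ_sq. ring. }
  assert (He2 : forall j l, e j (- l)%Z = e j l).
  { intros j l. unfold e. rewrite Z.opp_involutive. ring. }
  assert (He3 : forall j l, Cmod (e j l) <= 2).
  { intros. unfold e. eapply Rle_trans; [apply Cmod_triangle|].
    pose proof (basis_per_Cmod (Z.of_nat j) l). pose proof (basis_per_Cmod (Z.of_nat j) (- l)). lra. }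
  set (mom := fun (b : Z -> C) (k : nat) => gsum (fun l => b l * gw n tau l * RtoC (mm n l) ^ k)%C).
  set (U := seq 0 (S (n / 2))).
  destruct (underdetermined (map (fun i j => mom (e j) (n - 2 * S i)%nat) (seq 0 (n / 2))) U) as (x & (j0 & J1 & J2) & _ & H3).
  { apply seq_NoDup. }
  { unfold U. rewrite length_map, !length_seq. lia. }
  set (b := fun l => lsum U (fun j => x j * e j l)%C).
  assert (Hb2 : forall l, Cmod (b l) <= lsumR U (fun j => Cmod (x j) * 2)).
  { intros l. unfold b. eapply Rle_trans; [apply lsum_Cmod|]. apply lsumR_le. intros j _.
    rewrite Cmod_mult. apply Rmult_le_compat_l; [apply Cmod_ge_0 | auto]. }
  assert (Hb3 : forall l, b (l + Nz)%Z = (sgnZ Nz * b l)%C).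
  { intros l. unfold b. rewrite <- lsum_scal. apply lsum_ext. intros j _. rewrite He1. ring. }
  assert (Hb4 : forall l, b (- l)%Z = b l).
  { intros l. unfold b. apply lsum_ext. intros j _. rewrite He2. ring. }
  exists b. split; [|split; [|split]]; auto.
  - exists (Z.of_nat j0). unfold b.
    apply in_seq in J1. assert (Hj0 : (2 * j0 <= n)%nat).
    { pose proof (Nat.div_mod_eq n 2). lia. }
    (* Different indices j with 2 j <= n are neither congruent nor opposite modulo n, so the
       functions [e j] have disjoint supports. *)
    assert (E : forall j, In j U -> j <> j0 -> e j (Z.of_nat j0) = RtoC 0).
    { intros j Hj Hne. apply in_seq in Hj. assert (Hj2 : (2 * j <= n)%nat).
      { pose proof (Nat.div_mod_eq n 2). lia. }
      unfold e, basis_per, Nz.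
      destruct (Z.eqb_spec ((Z.of_nat j0 - Z.of_nat j) mod Z.of_nat n) 0) as [E|_].
      { apply Z.mod_divide in E; [|lia]. destruct E as (q & Eq). exfalso.
        assert (q = 0 \/ q <= -1 \/ 1 <= q)%Z as [->|[|]] by lia; nia. }
      destruct (Z.eqb_spec ((- Z.of_nat j0 - Z.of_nat j) mod Z.of_nat n) 0) as [E|_].
      { apply Z.mod_divide in E; [|lia]. destruct E as (q & Eq). exfalso.
        assert (q = 0 \/ q <= -1 \/ 1 <= q)%Z as [->|[|]] by lia; nia. }
      ring. }
    (* Where the two halves of [e j0] overlap, for j0 = 0 and 2 j0 = n, they add up to 2 and do not
       cancel: the sign is 1, n being even in the second case. *)
    assert (E2 : e j0 (Z.of_nat j0) <> RtoC 0).
    { unfold e, basis_per, Nz. rewrite Z.sub_diag, Z.mod_0_l, Z.div_0_l by lia. simpl.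
      rewrite Z.mul_0_r.
      destruct (Z.eqb_spec ((- Z.of_nat j0 - Z.of_nat j0) mod Z.of_nat n) 0) as [E'|_].
      - apply Z.mod_divide in E'; [|lia]. destruct E' as (q & Eq).
        assert (q = 0 \/ q = -1)%Z as [->| ->] by nia.
        + replace (- Z.of_nat j0 - Z.of_nat j0)%Z with 0%Z by lia. rewrite Z.div_0_l by lia. rewrite Z.mul_0_r.
          unfold sgnZ; simpl. intros E3. apply (f_equal fst) in E3. simpl in E3. lra.
        + rewrite Eq, Z.div_mul by lia. replace (Z.of_nat n * -1)%Z with (2 * - Z.of_nat j0)%Z by lia.
          rewrite (sgnZ_even (2 * _)) by (rewrite Z.even_mul; auto).
          unfold sgnZ; simpl. intros E3. apply (f_equal fst) in E3. simpl in E3. lra.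
      - unfold sgnZ; simpl. intros E3. apply (f_equal fst) in E3. simpl in E3. lra. }
    assert (In j0 U) as Hin by (apply in_seq; auto).
    destruct (in_split _ _ Hin) as (U1 & U2 & EU).
    assert (Hnd : NoDup U) by apply seq_NoDup. rewrite EU in Hnd.
    apply NoDup_remove_2 in Hnd. rewrite EU, lsum_app. simpl.
    rewrite (lsum_ext U1 _ (fun _ => RtoC 0)), (lsum_ext U2 _ (fun _ => RtoC 0)), !lsum_zero.
    + rewrite Cplus_0_l, Cplus_0_r. apply Cmult_neq_0; auto.
    + intros j Hj. rewrite E; [ring| |].
      * rewrite EU. apply in_app_iff; right; right; auto.
      * intros ->. apply Hnd, in_app_iff; auto.
    + intros j Hj. rewrite E; [ring| |].
      * rewrite EU. apply in_app_iff; left; auto.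
      * intros ->. apply Hnd, in_app_iff; auto.
  - eexists; apply Hb2.
  - intros k Hk. destruct (per_bsum b _ k Hb2) as (K & HK). pose proof (gsum_HS _ _ HK) as HH.
    set (s := gsum (fun l => b l * gw n tau l * RtoC (mm n l) ^ k)%C) in *.
    assert (s = RtoC 0) as Es; [|rewrite <- Es; auto].
    destruct (Nat.even (n - k)) eqn:Ev.
    + apply Nat.even_spec in Ev. destruct Ev as (i & Ei).
      assert (Hi : (0 < i)%nat) by lia.
      assert (In (fun j => mom (e j) k) (map (fun i j => mom (e j) (n - 2 * S i)%nat) (seq 0 (n / 2)))).
      { apply in_map_iff. exists (i - 1)%nat. split.
        - replace (n - 2 * S (i - 1))%nat with k by lia. auto.
        - apply in_seq. pose proof (Nat.div_mod_eq n 2). pose proof (Nat.mod_upper_bound n 2). lia. }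
      specialize (H3 _ H). apply (HS_unique _ _ _ HH).
      rewrite <- H3. apply (HS_ext (fun l => lsum U (fun j => x j * (e j l * gw n tau l * RtoC (mm n l) ^ k))%C)).
      { intros l. unfold b. rewrite <- !Cmult_assoc, (Cmult_comm (lsum U _)), <- lsum_scal. apply lsum_ext. intros; ring. }
      apply HS_lsum. intros j _. rewrite (Cmult_comm (mom (e j) k)). apply HS_scal.
      destruct (per_bsum (e j) 2 k (He3 j)) as (K' & HK'). eapply gsum_HS; eauto.
    + assert (HS (fun l => (- (1)) * (b l * gw n tau l * RtoC (mm n l) ^ k))%C s).
      { apply (HS_reindex (fun l => Nz - l)%Z (fun l => Nz - l)%Z) in HH; [|intros; ring|intros; ring].
        eapply HS_ext; [|apply HH]. intros l. simpl. unfold Nz at 2 3. rewrite gw_refl, mm_refl, RtoC_opp, sgnZ_pow.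
        replace (Nz - l)%Z with (- l + Nz)%Z by ring. rewrite Hb3, Hb4.
        assert (Es : (sgnZ Nz * sgnZ (Z.of_nat k))%C = (- (1))%C).
        { rewrite <- (sgnZ_opp (Z.of_nat k)), <- sgnZ_add. apply sgnZ_odd.
          replace (Nz + - Z.of_nat k)%Z with (Z.of_nat (n - k)) by (unfold Nz; lia).
          destruct (Z.even (Z.of_nat (n - k))) eqn:E'; auto. apply Z.even_spec in E'. destruct E' as (q & Eq).
          assert (Nat.even (n - k) = true); [|congruence]. apply Nat.even_spec. exists (Z.to_nat q). lia. }
        transitivity ((sgnZ Nz * sgnZ (Z.of_nat k)) * (b l * gw n tau l * RtoC (mm n l) ^ k))%C; [ring | rewrite Es; ring]. }
      pose proof (HS_unique _ _ _ H (HS_scal _ _ (- (1))%C HH)) as E.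
      assert (E' : (RtoC 2 * s)%C = RtoC 0). { transitivity (s + s)%C; [ring|]. rewrite E at 1. ring. }
      apply NNPP; intros Hne. apply (Cmult_neq_0 (RtoC 2) s); auto.
      intros E3. apply (f_equal fst) in E3. simpl in E3. lra.
Qed.

(* The polynomial is sum_(k < n) c k X^k, evaluated at X = mm n l = 2 l - n. *)
Lemma exists_p : exists c : nat -> C, (exists k, (k < n)%nat /\ c k <> RtoC 0) /\
  forall l, HS (fun j => sgnZ (Nz * j) * (lsum (seq 0 n) (fun k => c k * RtoC (mm n (l + Nz * j)) ^ k) * gw n tau (l + Nz * j)))%C (RtoC 0).
Proof.
  set (term := fun (k : nat) (l j : Z) => (sgnZ (Nz * j) * (RtoC (mm n (l + Nz * j)) ^ k * gw n tau (l + Nz * j)))%C).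
  assert (Hterm : forall k l, HS (term k l) (gsum (term k l))).
  { intros k l. destruct (gw_bsum k 0) as (K & HK). apply (gsum_HS _ K).
    apply (bsum_inj (fun j => l + Nz * j)%Z) in HK; [|intros j j' E; unfold Nz in E; nia].
    eapply bsum_le; [|apply HK]. intros j; cbv beta. unfold term.
    rewrite !Cmod_mult, sgnZ_Cmod, Cmod_pow, Cmod_R, Rmult_0_l, exp_0. lra. }
  (* Only exponents k with n - 1 - k even are used; this parity makes the function [F] below odd in
     l. *)
  set (U := map (fun i => n - 1 - 2 * i)%nat (seq 0 (S ((n - 1) / 2)))).
  assert (HU : NoDup U).
  { unfold U. apply NoDup_map_NoDup_ForallPairs; [|apply seq_NoDup].
    intros i i' Hi Hi' E. apply in_seq in Hi. apply in_seq in Hi'. pose proof (Nat.div_mod_eq (n - 1) 2). lia. }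
  assert (HUn : forall k, In k U -> (k < n)%nat /\ sgnZ (Z.of_nat k) = (- sgnZ Nz)%C).
  { intros k Hk. apply in_map_iff in Hk. destruct Hk as (i & <- & Hi). apply in_seq in Hi.
    pose proof (Nat.div_mod_eq (n - 1) 2). split; [lia|].
    replace (Z.of_nat (n - 1 - 2 * i)) with (Nz + (-1 + 2 * - Z.of_nat i))%Z by (unfold Nz; lia).
    rewrite sgnZ_add, sgnZ_add, (sgnZ_even (2 * _)) by (rewrite Z.even_mul; auto).
    replace (sgnZ (-1)) with (- (1))%C by reflexivity. ring. }
  (* One equation for each l = 1, ..., floor((n - 1) / 2), one fewer than the unknowns; oddness and
     quasi-periodicity of [F] supply all other l. *)
  destruct (underdetermined (map (fun i k => gsum (term k (Z.of_nat (S i)))) (seq 0 ((n - 1) / 2))) U HU) as (x & (k0 & K1 & K2) & Hx0 & H3).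
  { unfold U. rewrite !length_map, !length_seq. lia. }
  exists x. split. { exists k0. split; auto. apply HUn; auto. }
  set (F := fun l => lsum U (fun k => x k * gsum (term k l))%C).
  assert (HF : forall l, HS (fun j => lsum U (fun k => x k * term k l j)%C) (F l)).
  { intros l. apply HS_lsum. intros k _. apply HS_scal. apply Hterm. }
  assert (F1 : forall l, F (l + Nz)%Z = (sgnZ Nz * F l)%C).
  { intros l. unfold F. rewrite <- lsum_scal. apply lsum_ext. intros k _.
    assert (E : gsum (term k (l + Nz)%Z) = (sgnZ Nz * gsum (term k l))%C); [|rewrite E; ring].
    apply gsum_eq. pose proof (Hterm k l) as H.
    apply (HS_reindex (fun j => j + 1)%Z (fun j => j - 1)%Z) in H; [|intros; ring|intros; ring].
    eapply HS_ext; [|apply (HS_scal _ _ (sgnZ Nz) H)]. intros j; cbv beta. unfold term.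
    replace (l + Nz + Nz * j)%Z with (l + Nz * (j + 1))%Z by ring.
    replace (Nz * (j + 1))%Z with (Nz + Nz * j)%Z by ring. rewrite sgnZ_add.
    transitivity ((sgnZ Nz * sgnZ Nz) * (sgnZ (Nz * j) * (RtoC (mm n (l + (Nz + Nz * j))) ^ k * gw n tau (l + (Nz + Nz * j)))))%C; [ring|].
    rewrite sgnZ_sq. ring. }
  assert (F2 : forall l, F (- l)%Z = (- F l)%C).
  { intros l. unfold F. transitivity (- (1) * lsum U (fun k => x k * gsum (term k l)))%C; [|ring].
    rewrite <- lsum_scal. apply lsum_ext. intros k Hk.
    assert (E : gsum (term k (- l)%Z) = (- gsum (term k l))%C); [|rewrite E; ring].
    apply gsum_eq. pose proof (Hterm k l) as H.
    apply (HS_reindex (fun j => 1 - j)%Z (fun j => 1 - j)%Z) in H; [|intros; ring|intros; ring].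
    replace (- gsum (term k l))%C with ((- (1)) * gsum (term k l))%C by ring.
    eapply HS_ext; [|apply (HS_scal _ _ (- (1))%C H)]. intros j; cbv beta. unfold term.
    replace (l + Nz * (1 - j))%Z with (Z.of_nat n - (- l + Nz * j))%Z by (unfold Nz; ring).
    rewrite gw_refl, mm_refl, RtoC_opp, sgnZ_pow, (proj2 (HUn k Hk)).
    replace (Nz * (1 - j))%Z with (Nz + - (Nz * j))%Z by ring. rewrite sgnZ_add, sgnZ_opp.
    transitivity ((sgnZ Nz * sgnZ Nz) * (sgnZ (Nz * j) * (RtoC (mm n (- l + Nz * j)) ^ k * gw n tau (- l + Nz * j))))%C; [ring|].
    rewrite sgnZ_sq. ring. }
  assert (Hsym : forall z : C, z = (- z)%C -> z = RtoC 0).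
  { intros z E. apply injective_projections; [apply (f_equal fst) in E | apply (f_equal snd) in E]; simpl in *; lra. }
  (* At r = 0 and at 2 r = n the two symmetries give F = - F; elsewhere in this range the imposed
     equations apply. *)
  assert (Fsmall : forall r, (0 <= r)%Z -> (2 * r <= Nz)%Z -> F r = RtoC 0).
  { intros r Hr H2r. destruct (Z.eq_dec r 0) as [->|Hr0].
    - apply Hsym. rewrite <- (F2 0%Z). auto.
    - destruct (Z.eq_dec (2 * r) Nz) as [E|Hne].
      + apply Hsym. rewrite <- F2. replace r with (- r + Nz)%Z at 1 by lia. rewrite F1, sgnZ_even; [ring|].
        rewrite <- E, Z.even_mul; auto.
      + specialize (H3 (fun k => gsum (term k r))). unfold F.
        rewrite (lsum_ext U _ (fun k => gsum (term k r) * x k)%C) by (intros; ring). apply H3.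
        apply in_map_iff. exists (Z.to_nat r - 1)%nat. split.
        * replace (Z.of_nat (S (Z.to_nat r - 1))) with r by lia. auto.
        * apply in_seq. pose proof (Nat.div_mod_eq (n - 1) 2). pose proof (Nat.mod_upper_bound (n - 1) 2). unfold Nz in *. lia. }
  assert (Fred : forall r, (0 <= r < Nz)%Z -> F r = RtoC 0).
  { intros r Hr. destruct (Z.le_gt_cases (2 * r) Nz) as [H|H]; [apply Fsmall; lia|].
    replace r with (- (Nz - r) + Nz)%Z by ring. rewrite F1, F2, (Fsmall (Nz - r)%Z) by lia. ring. }
  assert (Fnat : forall (q : nat) r, F (r + Nz * Z.of_nat q)%Z = RtoC 0 <-> F r = RtoC 0).
  { induction q as [|q IH]; intros r.
    - replace (r + Nz * Z.of_nat 0)%Z with r by lia. tauto.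
    - replace (r + Nz * Z.of_nat (S q))%Z with (r + Nz * Z.of_nat q + Nz)%Z by lia. rewrite F1, <- (IH r).
      split; intros E; [|rewrite E; ring].
      transitivity ((sgnZ Nz * sgnZ Nz) * F (r + Nz * Z.of_nat q)%Z)%C; [rewrite sgnZ_sq; ring|].
      rewrite <- Cmult_assoc, E. ring. }
  assert (Fall : forall l, F l = RtoC 0).
  { intros l. assert (Nz <> 0)%Z by (unfold Nz; lia).
    pose proof (Z.div_mod l Nz H) as E. pose proof (Z.mod_pos_bound l Nz ltac:(unfold Nz; lia)) as Hb.
    destruct (Z.le_gt_cases 0 (l / Nz)) as [Hq|Hq].
    - pose proof (proj2 (Fnat (Z.to_nat (l / Nz)) (l mod Nz)%Z) (Fred _ Hb)) as H0.
      rewrite Z2Nat.id in H0 by auto. replace (l mod Nz + Nz * (l / Nz))%Z with l in H0 by lia. exact H0.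
    - apply (proj1 (Fnat (Z.to_nat (- (l / Nz))) l)). rewrite Z2Nat.id by lia.
      replace (l + Nz * - (l / Nz))%Z with (l mod Nz)%Z by lia. exact (Fred _ Hb). }
  intros l. rewrite <- (Fall l). eapply HS_ext; [|apply HF].
  intros j; cbv beta. symmetry.
  assert (E : forall X : C, lsum (seq 0 n) (fun k => x k * X ^ k)%C = lsum U (fun k => x k * X ^ k)%C).
  { intros X. destruct (split_incl U (seq 0 n) HU (seq_NoDup n 0)) as (D & _ & E1 & _ & E3).
    - intros k Hk. apply in_seq. destruct (HUn k Hk). lia.
    - rewrite E1, (lsum_ext D _ (fun _ => RtoC 0)), lsum_zero; [ring|].
      intros k Hk. rewrite Hx0; [ring|]. apply E3; auto. }
  rewrite E.
  transitivity (sgnZ (Nz * j) * gw n tau (l + Nz * j) * lsum U (fun k => x k * RtoC (mm n (l + Nz * j)) ^ k))%C; [ring|].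
  rewrite <- lsum_scal. apply lsum_ext. intros k _. unfold term. ring.
Qed.
End Null.

(** * Roots of unity and the exponential series *)
Lemma Cexp_eq_1 x : Cexp (Ci * RtoC x) = RtoC 1 -> exists k, x = 2 * PI * IZR k.
Proof.
  intros E. assert (E1 := f_equal fst E). assert (E2 := f_equal snd E).
  unfold Cexp, Ci, Cmult, RtoC in E1, E2; simpl in E1, E2.
  replace (0 * x - 1 * 0) with 0 in E1, E2 by ring. replace (0 * 0 + 1 * x) with x in E1, E2 by ring.
  rewrite exp_0, Rmult_1_l in E1, E2.
  destruct (sin_eq_0_0 x E2) as (k & Hk).
  destruct (Z.even k) eqn:Ev.
  - apply Z.even_spec in Ev. destruct Ev as (j & ->). exists j. rewrite Hk, mult_IZR. ring.
  - exfalso. assert (Z.odd k = true) as Ho by (rewrite <- Z.negb_even, Ev; auto).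
    apply Z.odd_spec in Ho. destruct Ho as (j & ->).
    assert (E3 : Cexp (RtoC x * Ci) = (- (1))%C).
    { rewrite Hk. replace (RtoC (IZR (2 * j + 1) * PI) * Ci)%C with (RtoC (2 * PI * IZR j) * Ci + RtoC PI * Ci)%C.
      - rewrite Cexp_plus, Cexp_2PI, Cexp_PI. ring.
      - rewrite plus_IZR, mult_IZR. apply injective_projections; simpl; ring. }
    rewrite Cmult_comm, E in E3. apply (f_equal fst) in E3. simpl in E3. lra.
Qed.

Definition wN (N : nat) (d : Z) : C := Cexp (Ci * RtoC (2 * PI * IZR d / INR N)).
Lemma wN_add N a b : wN N (a + b) = (wN N a * wN N b)%C.
Proof.
  unfold wN. rewrite <- Cexp_plus. f_equal. rewrite plus_IZR. unfold Rdiv.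
  apply injective_projections; simpl; ring.
Qed.
Lemma wN_0 N : wN N 0 = RtoC 1.
Proof. unfold wN. replace (2 * PI * 0 / INR N) with 0 by (unfold Rdiv; ring). rewrite Cmult_0_r. apply Cexp_0. Qed.
Lemma wN_pow N d k : (wN N d ^ k)%C = wN N (d * Z.of_nat k).
Proof.
  induction k as [|k IH]; [rewrite Z.mul_0_r, wN_0; auto|].
  rewrite Cpow_S, IH, <- wN_add. f_equal. lia.
Qed.
Lemma wN_Cmod N d : Cmod (wN N d) = 1.
Proof. unfold wN. rewrite Cmod_Cexp. unfold Re, Ci, Cmult, RtoC; simpl. rewrite <- exp_0. f_equal. ring. Qed.
Lemma wN_mult N q : (0 < N)%nat -> wN N (Z.of_nat N * q) = RtoC 1.
Proof.
  intros HN. unfold wN. assert (0 < INR N) by (apply lt_0_INR; auto).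
  rewrite mult_IZR, <- INR_IZR_INZ.
  replace (2 * PI * (INR N * IZR q) / INR N) with (2 * PI * IZR q) by (field; lra).
  rewrite Cmult_comm. apply Cexp_2PI.
Qed.
Lemma wN_1 N d : (0 < N)%nat -> wN N d = RtoC 1 -> exists q, d = (Z.of_nat N * q)%Z.
Proof.
  intros HN H. assert (HN' : 0 < INR N) by (apply lt_0_INR; auto).
  apply Cexp_eq_1 in H. destruct H as (k & Hk). exists k. apply eq_IZR.
  rewrite mult_IZR, <- INR_IZR_INZ. pose proof PI_RGT_0.
  apply (Rmult_eq_reg_l (2 * PI / INR N)).
  - replace (2 * PI / INR N * IZR d) with (2 * PI * IZR d / INR N) by (field; lra). rewrite Hk. field. lra.
  - apply Rgt_not_eq. apply Rdiv_lt_0_compat; lra.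
Qed.
Lemma lsum_geom (w : C) N : ((w - 1) * lsum (seq 0 N) (fun k => w ^ k) = w ^ N - 1)%C.
Proof. induction N as [|N IH]; [simpl; ring|]. rewrite lsum_seq_S, Cmult_plus_distr_l, IH, Cpow_S. ring. Qed.
Lemma root_sum N d : (0 < N)%nat -> (forall q, d <> (Z.of_nat N * q)%Z) ->
  lsum (seq 0 N) (fun k => wN N (d * Z.of_nat k)) = RtoC 0.
Proof.
  intros HN Hd. rewrite (lsum_ext _ _ (fun k => wN N d ^ k)%C) by (intros; rewrite wN_pow; auto).
  apply NNPP; intros Hne.
  assert (Hw : (wN N d - 1)%C <> RtoC 0).
  { intros E. destruct (wN_1 N d HN) as (q & Hq); [apply Ceq_minus; auto | apply (Hd q); auto]. }
  apply (Cmult_neq_0 _ _ Hw Hne). rewrite lsum_geom, wN_pow, Z.mul_comm, wN_mult by auto. ring.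
Qed.
Lemma root_sum_one N d q : (0 < N)%nat -> d = (Z.of_nat N * q)%Z ->
  lsum (seq 0 N) (fun k => wN N (d * Z.of_nat k)) = RtoC (INR N).
Proof.
  intros HN ->. rewrite (lsum_ext _ _ (fun k => RtoC 1)).
  - rewrite (lsum_RtoC _ (fun _ => 1)), lsumR_const, length_seq. f_equal; ring.
  - intros k _. rewrite <- Z.mul_assoc. apply wN_mult; auto.
Qed.

Lemma PS_unique a b f : PS a f -> PS b f -> forall k, a k = b k.
Proof.
  intros [Ha Ha'] [Hb Hb'] k. apply Ceq_minus.
  apply (PS_zero (fun k => a k - b k)%C (fun _ => RtoC 0)); auto. split.
  - intros r Hr. destruct (Ha r Hr) as (M & HM). destruct (Hb r Hr) as (M' & HM'). exists (M + M'). intros j.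
    specialize (HM j). specialize (HM' j). assert (0 <= r ^ j) by (apply pow_le; lra).
    apply Rle_trans with ((Cmod (a j) + Cmod (b j)) * r ^ j); [|lra].
    apply Rmult_le_compat_r; auto. unfold Cminus. eapply Rle_trans; [apply Cmod_triangle|]. rewrite Cmod_opp; lra.
  - intros z. replace (RtoC 0) with (f z + (- (1)) * f z)%C by ring.
    apply (HS_ext (fun k => a k * z ^ k + (- (1)) * (b k * z ^ k))%C); [intros; ring|].
    apply HS_plus; auto. apply HS_scal; auto.
Qed.
Lemma PS_at_0 a f : PS a f -> f (RtoC 0) = a O.
Proof. intros H. destruct (PS_shift a f H) as (g & _ & E). rewrite E. ring. Qed.
Lemma cdiff_unique f z L L' : cdiff f z L -> cdiff f z L' -> L = L'.
Proof.
  intros H H'. apply NNPP; intros Hne.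
  assert (Hp : 0 < Cmod (L - L')). { apply Cmod_gt_0. intros E. apply Hne, Ceq_minus; auto. }
  destruct (H (Cmod (L - L') / 4)) as (d & Hd & Hd'); [lra|].
  destruct (H' (Cmod (L - L') / 4)) as (e & He & He'); [lra|].
  set (r := Rmin d e / 2). assert (0 < Rmin d e) by (apply Rmin_pos; auto).
  assert (Hr : Cmod (RtoC r) = r) by (rewrite Cmod_R, Rabs_pos_eq; unfold r; lra).
  pose proof (Rmin_l d e). pose proof (Rmin_r d e).
  specialize (Hd' (RtoC r)). specialize (He' (RtoC r)). rewrite Hr in *.
  specialize (Hd' ltac:(unfold r; lra)). specialize (He' ltac:(unfold r; lra)).
  assert (Cmod (L - L') * r <= Cmod (L - L') / 4 * r + Cmod (L - L') / 4 * r); [|unfold r in *; nra].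
  rewrite <- Hr at 1. rewrite <- Cmod_mult.
  replace ((L - L') * RtoC r)%C with ((f (z + RtoC r) - f z - L' * RtoC r) + - (f (z + RtoC r) - f z - L * RtoC r))%C by ring.
  eapply Rle_trans; [apply Cmod_triangle|]. rewrite Cmod_opp. lra.
Qed.
Lemma PS_deriv a f f' : PS a f -> (forall z, cdiff f z (f' z)) -> PS (fun k => RtoC (INR (S k)) * a (S k))%C f'.
Proof.
  intros Ha Hd. assert (Hg : forall r, 0 < r -> exists M, forall k, Cmod (RtoC (INR (S k)) * a (S k))%C * r ^ k <= M).
  { intros r Hr. destruct (proj1 Ha (2 * r) ltac:(lra)) as (M & HM). exists (M / r * 2). intros k. specialize (HM (S k)).
    rewrite Cmod_mult, Cmod_R, Rabs_pos_eq by apply pos_INR. rewrite Rpow_mult_distr in HM.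
    assert (INR (S k) <= 2 * 2 ^ k).
    { clear. induction k as [|k IH]; [simpl; lra|]. rewrite (S_INR (S k)). change (2 ^ S k) with (2 * 2 ^ k). pose proof (pow_R1_Rle 2 k ltac:(lra)). lra. }
    assert (0 <= Cmod (a (S k)) * r ^ k) by (apply Rmult_le_pos; [apply Cmod_ge_0 | apply pow_le; lra]).
    apply (Rmult_le_reg_r r); auto. replace (M / r * 2 * r) with (2 * M) by (field; lra).
    simpl pow in HM. pose proof (pos_INR (S k)).
    assert (0 < 2 ^ k) by (apply pow_lt; lra).
    set (X := Cmod (a (S k)) * r ^ k) in *.
    replace (INR (S k) * Cmod (a (S k)) * r ^ k * r) with (INR (S k) * X * r) by (unfold X; ring).
    replace (Cmod (a (S k)) * (2 * 2 ^ k * (r * r ^ k))) with (2 * 2 ^ k * X * r) in HM by (unfold X; ring).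
    assert (0 <= X * r) by (apply Rmult_le_pos; lra).
    assert (INR (S k) * (X * r) <= 2 * 2 ^ k * (X * r)) by (apply Rmult_le_compat_r; auto).
    assert (0 <= INR (S k) * (X * r)) by (apply Rmult_le_pos; lra). lra. }
  split; auto. intros z. destruct (growth_terms _ Hg z) as (M & HM).
  rewrite (cdiff_unique _ _ _ _ (Hd z) (PS_cdiff a f Ha z)). eapply gsum_HS; eauto.
Qed.
(** [ent_PS] provides some expansion, and [Cexp] being its own derivative forces (k + 1) a(k + 1) =
    a(k) by uniqueness of coefficients. *)
Lemma Cexp_series w : HS (fun k => w ^ k / RtoC (INR (fact k)))%C (Cexp w).
Proof.
  destruct (ent_PS Cexp) as (a & Ha & _). { intros z; eexists; apply cdiff_exp. }
  pose proof (PS_deriv a Cexp Cexp Ha cdiff_exp) as Hd.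
  pose proof (PS_unique _ _ _ Ha Hd) as Hu. pose proof (PS_at_0 a _ Ha) as H0. rewrite Cexp_0 in H0.
  assert (E : forall k, a k = (/ RtoC (INR (fact k)))%C).
  { induction k as [|k IH].
    - rewrite <- H0. simpl. field.
    - specialize (Hu k). rewrite IH in Hu. cbv beta in Hu.
      assert (INR (S k) <> 0) by (apply not_0_INR; lia).
      assert (RtoC (INR (S k)) <> RtoC 0) by (intros E; apply H; apply RtoC_inj; auto).
      assert (INR (fact k) <> 0) by apply INR_fact_neq_0.
      assert (RtoC (INR (fact k)) <> RtoC 0) by (intros E; apply H2; apply RtoC_inj; auto).
      replace (fact (S k)) with (S k * fact k)%nat by reflexivity. rewrite mult_INR, RtoC_mult.
      transitivity (/ RtoC (INR (S k)) * (RtoC (INR (S k)) * a (S k)))%C; [field; auto|].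
      rewrite <- Hu. field. auto. }
  eapply HS_ext; [|apply (proj2 Ha)]. intros k; simpl. rewrite E. unfold Cdiv. ring.
Qed.
Lemma HS_pos_bsum {I} (f : I -> R) s : (forall i, 0 <= f i) -> HS (fun i => RtoC (f i)) (RtoC s) -> bsum f s.
Proof.
  intros Hf H l Hl. apply le_epsilon. intros eps He. destruct (H eps He) as (A & _ & HA).
  destruct (union_list A l) as (U & HU & I1 & I2). specialize (HA U HU I1).
  pose proof (lsumR_incl l U f Hl HU I2 Hf). rewrite lsum_RtoC, <- RtoC_minus, Cmod_R in HA.
  apply Rabs_def2 in HA. lra.
Qed.
Lemma bsum_exp x : 0 <= x -> bsum (fun k => x ^ k / INR (fact k)) (exp x).
Proof.
  intros Hx. apply HS_pos_bsum.
  - intros k. apply Rdiv_le_0_compat; [apply pow_le; auto | apply INR_fact_lt_0].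
  - rewrite <- Cexp_real. eapply HS_ext; [|apply Cexp_series]. intros k; simpl.
    rewrite RtoC_div, RtoC_pow; auto. apply INR_fact_neq_0.
Qed.

Lemma PS_shift_iter a f q : PS a f -> (forall k, (k < q)%nat -> a k = RtoC 0) ->
  exists g, PS (fun k => a (q + k)%nat) g /\ forall z, f z = (z ^ q * g z)%C.
Proof.
  revert a f. induction q as [|q IH]; intros a f H H0.
  - exists f. split; auto. intros; simpl; ring.
  - destruct (PS_shift a f H) as (g & Hg & E). destruct (IH _ _ Hg) as (h & Hh & E').
    + intros k Hk. apply H0. lia.
    + exists h. split; auto. intros z. rewrite E, E', H0 by lia. rewrite Cpow_S. ring.
Qed.

(** An inverse of [h] on its range is picked by [epsilon], which asks for an inhabited [J]; for
    empty [J] the whole family is 0. *)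
Lemma HS_inj {I J} (h : J -> I) (f : I -> C) s : (forall j j', h j = h j' -> j = j') ->
  (forall i, (forall j, h j <> i) -> f i = RtoC 0) -> HS (fun j => f (h j)) s -> HS f s.
Proof.
  intros Hi H0 H eps He. destruct (H eps He) as (A & HA & HA').
  exists (map h A). split; [apply Injective_map_NoDup; auto; intros x y; apply Hi|].
  intros B HB Hincl.
  destruct (classic (inhabited J)) as [[j0]|Hno].
  - set (k := fun i => epsilon (inhabits j0) (fun j => h j = i)).
    set (B1 := filter (fun i => if excluded_middle_informative (exists j, h j = i) then true else false) B).
    assert (HB1 : forall i, In i B1 <-> In i B /\ exists j, h j = i).
    { intros i. unfold B1. rewrite filter_In. destruct excluded_middle_informative; intuition congruence. }
    assert (Hk : forall i, In i B1 -> h (k i) = i).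
    { intros i Hi'. apply HB1 in Hi'. unfold k. apply (epsilon_spec (inhabits j0) (fun j => h j = i)). apply Hi'. }
    assert (E1 : B1 = map h (map k B1)).
    { rewrite map_map, <- (map_id B1) at 1. apply map_ext_in. intros; symmetry; auto. }
    assert (Hnd : NoDup B1) by (apply NoDup_filter; auto).
    assert (ES : lsum B f = lsum B1 f).
    { destruct (split_incl B1 B) as (D & _ & E & _ & E3); auto.
      - intros i Hi'. apply HB1; auto.
      - rewrite E, (lsum_ext D f (fun _ => RtoC 0)), lsum_zero; [ring|].
        intros i Hi'. apply E3 in Hi'. apply H0. intros j Hj. apply (proj2 Hi'), HB1. split; [tauto | eauto]. }
    rewrite ES, E1, lsum_map. apply HA'.
    + rewrite E1 in Hnd. apply NoDup_map_inv in Hnd. auto.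
    + intros j Hj. apply in_map_iff. exists (h j). split.
      * apply Hi. apply Hk. apply HB1. split; [|eauto]. apply Hincl. apply in_map; auto.
      * apply HB1. split; [|eauto]. apply Hincl. apply in_map; auto.
  - assert (A = []) as -> by (destruct A as [|a A]; auto; exfalso; apply Hno; constructor; exact a).
    specialize (HA' nil). simpl in HA'. rewrite (lsum_ext B f (fun _ => RtoC 0)), lsum_zero.
    + apply HA'; [constructor | apply incl_refl].
    + intros i _. apply H0. intros j. exfalso; apply Hno; constructor; auto.
Qed.

(** * Polyanalytic functions with Gaussian growth *)
(* [PAG n kap0 F]: [F] is polyanalytic of order [n] and its coefficients grow strictly slower than [exp (kap0 |v|^2)]. *)
Definition gro (kap0 : R) (f : C -> C) : Prop :=
  ent f /\ exists kap K, 0 <= kap < kap0 /\ forall v, Cmod (f v) <= K * exp (kap * (Cmod v * Cmod v)).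
Definition PAG (n : nat) (kap0 : R) (F : C -> C) : Prop :=
  exists phi : nat -> C -> C, (forall k, gro kap0 (phi k)) /\ (forall k v, (n <= k)%nat -> phi k v = RtoC 0) /\
    forall v, F v = lsum (seq 0 n) (fun k => Cconj v ^ k * phi k v)%C.

Lemma gro_zero kap0 : 0 < kap0 -> gro kap0 (fun _ => RtoC 0).
Proof. intros H. split; [apply ent_const|]. exists 0, 0. split; [lra|]. intros v. rewrite Cmod_0. lra. Qed.
Lemma gro_K kap0 f : gro kap0 f -> exists kap K, 0 <= kap < kap0 /\ 0 <= K /\ forall v, Cmod (f v) <= K * exp (kap * (Cmod v * Cmod v)).
Proof.
  intros (_ & kap & K & H1 & H2). exists kap, K. split; auto. split; auto.
  specialize (H2 (RtoC 0)). rewrite Cmod_0 in H2. replace (kap * (0 * 0)) with 0 in H2 by ring. rewrite exp_0 in H2.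
  pose proof (Cmod_ge_0 (f (RtoC 0))). lra.
Qed.
Lemma gro_plus kap0 f g : gro kap0 f -> gro kap0 g -> gro kap0 (fun v => f v + g v)%C.
Proof.
  intros Hf Hg. split; [apply ent_plus; [apply Hf | apply Hg]|].
  destruct (gro_K _ _ Hf) as (k1 & K1 & A1 & B1 & D1). destruct (gro_K _ _ Hg) as (k2 & K2 & A2 & B2 & D2).
  exists (Rmax k1 k2), (K1 + K2). split.
  { split; [eapply Rle_trans; [|apply Rmax_l]; lra | apply Rmax_lub_lt; lra]. }
  intros v. eapply Rle_trans; [apply Cmod_triangle|].
  assert (0 <= Cmod v * Cmod v) by (pose proof (Cmod_ge_0 v); nra).
  assert (exp (k1 * (Cmod v * Cmod v)) <= exp (Rmax k1 k2 * (Cmod v * Cmod v))).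
  { apply exp_mono. apply Rmult_le_compat_r; auto. apply Rmax_l. }
  assert (exp (k2 * (Cmod v * Cmod v)) <= exp (Rmax k1 k2 * (Cmod v * Cmod v))).
  { apply exp_mono. apply Rmult_le_compat_r; auto. apply Rmax_r. }
  specialize (D1 v). specialize (D2 v). nra.
Qed.
Lemma gro_scal kap0 c f : gro kap0 f -> gro kap0 (fun v => c * f v)%C.
Proof.
  intros Hf. split; [apply ent_mult; [apply ent_const | apply Hf]|].
  destruct (gro_K _ _ Hf) as (k1 & K1 & A1 & B1 & D1). exists k1, (Cmod c * K1). split; auto.
  intros v. rewrite Cmod_mult, Rmult_assoc. apply Rmult_le_compat_l; [apply Cmod_ge_0 | auto].
Qed.
(** The strict inequality in [gro] leaves room for polynomial factors: part of the gap in the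
    exponent pays for the factor v. *)
Lemma gro_id kap0 f : gro kap0 f -> gro kap0 (fun v => v * f v)%C.
Proof.
  intros Hf. split; [apply ent_mult; [apply ent_id | apply Hf]|].
  destruct (gro_K _ _ Hf) as (k1 & K1 & A1 & B1 & D1).
  set (e := (kap0 - k1) / 2). assert (He : 0 < e) by (unfold e; lra).
  exists (k1 + e), ((1 + / e) * K1). split; [unfold e; lra|].
  intros v. rewrite Cmod_mult. pose proof (Cmod_ge_0 v) as Hv. set (x := Cmod v) in *.
  assert (Hx : x <= (1 + / e) * exp (e * (x * x))).
  { pose proof (exp_ineq1_le (e * (x * x))).
    assert (0 < / e) by (apply Rinv_0_lt_compat; auto).
    assert (x <= (1 + / e) * (1 + e * (x * x))).
    { replace ((1 + / e) * (1 + e * (x * x))) with (1 + x * x + (e * (x * x) + / e)) by (field; lra).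
      assert (0 <= e * (x * x)) by (apply Rmult_le_pos; [lra|nra]). nra. }
    nra. }
  replace ((k1 + e) * (x * x)) with (e * (x * x) + k1 * (x * x)) by ring. rewrite exp_plus.
  apply Rle_trans with (((1 + / e) * exp (e * (x * x))) * (K1 * exp (k1 * (x * x)))); [|right; ring].
  apply Rmult_le_compat; auto. apply Cmod_ge_0.
Qed.

Lemma PAG_ext n kap0 F G : (forall v, F v = G v) -> PAG n kap0 F -> PAG n kap0 G.
Proof. intros E. replace G with F; auto. apply functional_extensionality; auto. Qed.
Lemma PAG_weaken n n' kap0 F : (n <= n')%nat -> PAG n kap0 F -> PAG n' kap0 F.
Proof.
  intros Hn (phi & H1 & H2 & H3). exists phi. split; auto. split; [intros; apply H2; lia|].
  intros v. rewrite H3. replace n' with (n + (n' - n))%nat by lia. rewrite seq_app, lsum_app.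
  rewrite (lsum_ext (seq (0 + n) (n' - n)) _ (fun _ => RtoC 0)), lsum_zero; [ring|].
  intros k Hk. apply in_seq in Hk. rewrite H2 by lia. ring.
Qed.
Lemma PAG_plus n kap0 F G : PAG n kap0 F -> PAG n kap0 G -> PAG n kap0 (fun v => F v + G v)%C.
Proof.
  intros (phi & H1 & H2 & H3) (psi & G1 & G2 & G3). exists (fun k v => phi k v + psi k v)%C.
  split; [intros; apply gro_plus; auto|]. split.
  - intros. rewrite H2, G2 by auto. ring.
  - intros v. rewrite H3, G3, <- lsum_plus. apply lsum_ext. intros; ring.
Qed.
Lemma PAG_scal n kap0 c F : PAG n kap0 F -> PAG n kap0 (fun v => c * F v)%C.
Proof.
  intros (phi & H1 & H2 & H3). exists (fun k v => c * phi k v)%C.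
  split; [intros; apply gro_scal; auto|]. split.
  - intros. rewrite H2 by auto. ring.
  - intros v. rewrite H3, <- lsum_scal. apply lsum_ext. intros; ring.
Qed.
Lemma PAG_gro kap0 f : 0 < kap0 -> gro kap0 f -> PAG 1 kap0 f.
Proof.
  intros H0 H. exists (fun k => match k with O => f | S _ => fun _ => RtoC 0 end). split; [|split].
  - intros [|k]; auto. apply gro_zero; auto.
  - intros [|k] v Hk; [lia|auto].
  - intros v. simpl. ring.
Qed.
(** Multiplication by v minus its conjugate, a multiple of Im v, is how powers of the conjugate
    enter the construction, one order at a time. *)
Lemma PAG_sub_conj n kap0 F : 0 < kap0 -> PAG n kap0 F -> PAG (S n) kap0 (fun v => (v - Cconj v) * F v)%C.
Proof.
  intros H0 (phi & H1 & H2 & H3).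
  exists (fun k v => v * phi k v + (- (1)) * match k with O => RtoC 0 | S k' => phi k' v end)%C. split; [|split].
  - intros k. apply gro_plus; [apply gro_id; auto|]. destruct k as [|k]; [apply gro_scal, gro_zero; auto | apply gro_scal; auto].
  - intros k v Hk. destruct k as [|k]; [lia|]. rewrite !H2 by lia. ring.
  - intros v. rewrite H3. rewrite (lsum_ext (seq 0 (S n)) _
      (fun k => v * (Cconj v ^ k * phi k v) + (- (1)) * (Cconj v ^ k * match k with O => RtoC 0 | S k' => phi k' v end))%C) by (intros; ring).
    rewrite lsum_plus, !lsum_scal, lsum_seq_S, (lsum_seq_shift n (fun k => Cconj v ^ k * match k with O => RtoC 0 | S k' => phi k' v end)%C).
    rewrite H2 by lia. rewrite (lsum_ext (seq 0 n) (fun k => Cconj v ^ S k * phi k v)%C (fun k => Cconj v * (Cconj v ^ k * phi k v))%C).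
    + rewrite lsum_scal. ring.
    + intros. rewrite Cpow_S. ring.
Qed.

(** * The polyanalytic function supported at one lattice point *)
Lemma Re_le_Cmod z : Re z <= Cmod z.
Proof. pose proof (re_le_Cmod z). pose proof (Rle_abs (Re z)). lra. Qed.
Lemma RtoC_neq0 x : x <> 0 -> RtoC x <> RtoC 0.
Proof. intros H E. apply H, RtoC_inj; auto. Qed.

Section GConstr.
Variables (n : nat) (tau : C) (b : Z -> C) (Bb : R).
Hypothesis Hn : (1 <= n)%nat.
Hypothesis HT : 0 < Im tau.
Hypothesis Hbb : forall l, Cmod (b l) <= Bb.

Let T := Im tau.
Let ci : C := (Ci * RtoC (PI / INR n))%C.
Let bet (l : Z) : C := (b l * gw n tau l)%C.
Let HN0 : 0 < INR n.
Proof. apply lt_0_INR. lia. Qed.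
Let HBb : 0 <= Bb.
Proof. eapply Rle_trans; [apply Cmod_ge_0 | apply (Hbb 0%Z)]. Qed.
Let Hpin : 0 < PI / INR n.
Proof. apply Rdiv_lt_0_compat; [apply PI_RGT_0 | apply HN0]. Qed.

Definition Mom (i : nat) : C := gsum (fun l => bet l * RtoC (mm n l) ^ i)%C.
(** A theta series for j = 0; in general the j-th derivative of [Th 0] divided by ci^j. *)
Definition Th (j : nat) (v : C) : C := gsum (fun l => bet l * RtoC (mm n l) ^ j * Cexp (ci * RtoC (mm n l) * v))%C.

Let Cmod_ci : Cmod ci = PI / INR n.
Proof. unfold ci. rewrite Cmod_mult, Cmod_Ci, Cmod_R, Rabs_pos_eq by lra. ring. Qed.

Lemma Mom_HS i : HS (fun l => bet l * RtoC (mm n l) ^ i)%C (Mom i).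
Proof. destruct (per_bsum n tau Hn HT b Bb i Hbb) as (K & HK). eapply gsum_HS; eauto. Qed.

(** Absolute summability jointly in l and in the degree of the exponential series, which permits
    regrouping by powers of v. *)
Lemma Th_double j r : 0 <= r -> exists K, bsum (fun x : Z * nat => Cmod (bet (fst x) * RtoC (mm n (fst x)) ^ j) *
  ((PI / INR n * Rabs (mm n (fst x)) * r) ^ snd x / INR (fact (snd x)))) K.
Proof.
  intros Hr. destruct (gw_bsum n tau Hn HT j (PI / INR n * r)) as (K & HK). exists (Bb * K).
  assert (Hx : forall l, 0 <= PI / INR n * Rabs (mm n l) * r).
  { intros l. apply Rmult_le_pos; auto. apply Rmult_le_pos; [lra | apply Rabs_pos]. }
  apply (bsum_Fubini _ (fun l => Cmod (bet l * RtoC (mm n l) ^ j) * exp (PI / INR n * Rabs (mm n l) * r))).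
  - intros [l i]; simpl. apply Rmult_le_pos; [apply Cmod_ge_0|].
    apply Rdiv_le_0_compat; [apply pow_le; auto | apply INR_fact_lt_0].
  - intros l. apply (bsum_scal (fun i => (PI / INR n * Rabs (mm n l) * r) ^ i / INR (fact i)) (exp (PI / INR n * Rabs (mm n l) * r)) (Cmod (bet l * RtoC (mm n l) ^ j))); [apply Cmod_ge_0 | apply bsum_exp; auto].
  - eapply bsum_le; [|apply bsum_scal; [apply HBb | apply HK]]. intros l; simpl. unfold bet.
    rewrite !Cmod_mult, Cmod_pow, Cmod_R.
    replace (PI / INR n * Rabs (mm n l) * r) with (PI / INR n * r * Rabs (mm n l)) by ring.
    rewrite !(Rmult_assoc). apply Rmult_le_compat_r; auto.
    repeat apply Rmult_le_pos; [apply Cmod_ge_0 | apply pow_le, Rabs_pos | left; apply exp_pos].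
Qed.

Lemma Th_bsum j v : exists K, bsum (fun l => Cmod (bet l * RtoC (mm n l) ^ j * Cexp (ci * RtoC (mm n l) * v))%C) K.
Proof.
  destruct (gw_bsum n tau Hn HT j (PI / INR n * Cmod v)) as (K & HK). exists (Bb * K).
  eapply bsum_le; [|apply bsum_scal; [apply HBb | apply HK]]. intros l; simpl. unfold bet.
  rewrite !Cmod_mult, Cmod_pow, Cmod_R, Cmod_Cexp.
  assert (exp (Re (ci * RtoC (mm n l) * v)) <= exp (PI / INR n * Cmod v * Rabs (mm n l))).
  { apply exp_mono. eapply Rle_trans; [apply Re_le_Cmod|]. rewrite !Cmod_mult, Cmod_ci, Cmod_R. right; ring. }
  rewrite !Rmult_assoc in H. rewrite !Rmult_assoc. apply Rmult_le_compat; auto; [apply Cmod_ge_0| |].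
  - repeat apply Rmult_le_pos; [apply Cmod_ge_0 | apply pow_le, Rabs_pos | left; apply exp_pos].
  - apply Rmult_le_compat_l; [apply Cmod_ge_0|]. apply Rmult_le_compat_l; auto. apply pow_le, Rabs_pos.
Qed.
Lemma Th_HS j v : HS (fun l => bet l * RtoC (mm n l) ^ j * Cexp (ci * RtoC (mm n l) * v))%C (Th j v).
Proof. destruct (Th_bsum j v) as (K & HK). eapply gsum_HS; eauto. Qed.

(** The Taylor coefficients at 0 are the moments up to nonzero factors, so vanishing moments
    translate into a zero of high order. *)
Lemma Th_PS j : PS (fun i => ci ^ i / RtoC (INR (fact i)) * Mom (i + j))%C (Th j).
Proof.
  assert (Hf : forall i, RtoC (INR (fact i)) <> RtoC 0) by (intros; apply RtoC_neq0, INR_fact_neq_0).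
  set (f := fun (v : C) (x : Z * nat) => (bet (fst x) * RtoC (mm n (fst x)) ^ j *
      ((ci * RtoC (mm n (fst x)) * v) ^ snd x / RtoC (INR (fact (snd x)))))%C).
  assert (Hb : forall v, exists K, bsum (fun x => Cmod (f v x)) K).
  { intros v. destruct (Th_double j (Cmod v) (Cmod_ge_0 v)) as (K & HK). exists K. eapply bsum_le; [|apply HK].
    intros [l i]; simpl. unfold f; simpl. rewrite Cmod_mult. right. f_equal.
    rewrite Cmod_div by auto. rewrite Cmod_pow, !Cmod_mult, Cmod_ci, !Cmod_R. f_equal.
    apply Rabs_pos_eq, pos_INR. }
  assert (Hrow : forall v i, HS (fun l => f v (l, i)) (ci ^ i / RtoC (INR (fact i)) * Mom (i + j) * v ^ i)%C).
  { intros v i.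
    replace (ci ^ i / RtoC (INR (fact i)) * Mom (i + j) * v ^ i)%C with (ci ^ i / RtoC (INR (fact i)) * v ^ i * Mom (i + j))%C by (unfold Cdiv; ring).
    eapply HS_ext; [|apply (HS_scal _ _ _ (Mom_HS (i + j)))].
    intros l. unfold f; simpl. rewrite !Cpow_mult_l, Cpow_add_r. unfold Cdiv. ring. }
  split.
  - intros r Hr. destruct (Hb (RtoC r)) as (K & HK). exists K. intros i.
    rewrite <- (Rabs_pos_eq r) at 1 by lra. rewrite <- Cmod_R, <- Cmod_pow, <- Cmod_mult.
    eapply HS_bound; [apply Hrow|]. apply (bsum_inj (fun l => (l, i)) _ _ ltac:(intros; congruence) HK).
  - intros v. destruct (Hb v) as (K & HK). pose proof (gsum_HS _ _ HK) as H.
    assert (E : HS (fun l => bet l * RtoC (mm n l) ^ j * Cexp (ci * RtoC (mm n l) * v))%C (gsum (f v))).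
    { apply (HS_Fubini _ _ _ H). intros l. unfold f; simpl. apply HS_scal. apply Cexp_series. }
    rewrite (HS_unique _ _ _ (Th_HS j v) E). apply HS_swap in H. apply (HS_Fubini _ _ _ H).
    intros i; simpl. apply Hrow.
Qed.

(* Fourier inversion by averaging over N-th roots of unity and letting N grow. *)
Lemma Th_injective : (forall v, Th 0 v = RtoC 0) -> forall l, b l = RtoC 0.
Proof.
  intros H l0. assert (Eb : bet l0 = RtoC 0).
  2:{ unfold bet in Eb. apply NNPP; intros Hne. apply (Cmult_neq_0 (b l0) (gw n tau l0)); auto. apply Cexp_neq_0. }
  destruct (per_bsum n tau Hn HT b Bb 0 Hbb) as (K & HK).
  apply NNPP; intros Hne. apply Cmod_gt_0 in Hne.
  pose proof (Mom_HS 0) as HM.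
  destruct (HM (Cmod (bet l0) / 4)) as (A & _ & HA); [lra|].
  (* N is so large that [A] contains no element congruent to [l0] modulo N other than possibly [l0]
     itself. *)
  assert (HNN : exists N, (0 < N)%nat /\ forall l q, In l A -> (l - l0 = Z.of_nat N * q)%Z -> q = 0%Z).
  { exists (S (list_max (map (fun l => Z.to_nat (Z.abs (l - l0))) A))). split; [lia|].
    intros l q Hl E.
    pose proof (proj1 (list_max_le (map (fun l => Z.to_nat (Z.abs (l - l0))) A) (list_max (map (fun l => Z.to_nat (Z.abs (l - l0))) A))) (Nat.le_refl _)) as Hm.
    rewrite Forall_forall in Hm. specialize (Hm _ (in_map (fun l => Z.to_nat (Z.abs (l - l0))) _ _ Hl)). cbv beta in Hm.
    destruct (Z.eq_dec q 0); auto. exfalso.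
    assert (Z.abs (l - l0) >= Z.of_nat (S (list_max (map (fun l => Z.to_nat (Z.abs (l - l0))) A))))%Z; [|lia].
    rewrite E, Z.abs_mul. rewrite (Z.abs_eq (Z.of_nat _)) by lia.
    assert (1 <= Z.abs q)%Z by lia. nia. }
  destruct HNN as (N & HN & HNq). assert (HNr : 0 < INR N) by (apply lt_0_INR; auto).
  set (vk := fun k : nat => RtoC (INR n * INR k / INR N)).
  set (w := fun k : nat => Cexp (- (ci * RtoC (mm n l0) * vk k))).
  assert (HH : HS (fun l => bet l * lsum (seq 0 N) (fun k => wN N ((l - l0) * Z.of_nat k)))%C (RtoC 0)).
  { assert (E0 : RtoC 0 = lsum (seq 0 N) (fun k => w k * Th 0 (vk k))%C).
    { rewrite (lsum_ext _ _ (fun _ => RtoC 0)), lsum_zero; auto. intros k _. rewrite H. ring. }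
    rewrite E0.
    apply (HS_ext (fun l => lsum (seq 0 N) (fun k => w k * (bet l * RtoC (mm n l) ^ 0 * Cexp (ci * RtoC (mm n l) * vk k))))%C).
    - intros l. rewrite <- lsum_scal. apply lsum_ext. intros k _. unfold w, wN.
      replace (Ci * RtoC (2 * PI * IZR ((l - l0) * Z.of_nat k) / INR N))%C with (- (ci * RtoC (mm n l0) * vk k) + ci * RtoC (mm n l) * vk k)%C.
      + rewrite Cexp_plus. simpl. ring.
      + unfold ci, vk, mm. rewrite mult_IZR, !minus_IZR, !mult_IZR, <- !INR_IZR_INZ.
        apply injective_projections; simpl; field; lra.
    - apply HS_lsum. intros k _. apply HS_scal. apply Th_HS. }
  (* The average over N-th roots of unity keeps exactly the progression l0 + N Z, whose sum is
     therefore 0. *)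
  assert (H2 : HS (fun l => if excluded_middle_informative (exists q, l - l0 = Z.of_nat N * q)%Z then bet l else RtoC 0) (RtoC 0)).
  { pose proof (HS_scal _ _ (/ RtoC (INR N))%C HH) as HH2. rewrite Cmult_0_r in HH2. eapply HS_ext; [|apply HH2].
    intros l; simpl. destruct excluded_middle_informative as [(q & Hq)|Hq].
    - rewrite (root_sum_one N _ q HN Hq). field. apply RtoC_neq0; lra.
    - rewrite root_sum; auto; [ring|]. intros q E. apply Hq; eauto. }
  destruct (H2 (Cmod (bet l0) / 4)) as (A2 & _ & HA2); [lra|].
  destruct (union_list (l0 :: A) A2) as (U & HU & I1 & I2).
  specialize (HA2 U HU I2).
  (* compare with the sum over U of bet restricted: both U and U minus the progression contain A *)
  set (p := fun l => if excluded_middle_informative (exists q, l - l0 = Z.of_nat N * q)%Z then true else false).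
  set (V := filter (fun l => negb (p l) || (if Z.eq_dec l l0 then true else false))%bool U).
  assert (HV : NoDup V) by (apply NoDup_filter; auto).
  assert (HAV : incl A V).
  { intros l Hl. apply filter_In. split; [apply I1; right; auto|]. unfold p.
    destruct (Z.eq_dec l l0); [apply Bool.orb_true_r|]. destruct excluded_middle_informative as [(q & Hq)|]; auto.
    exfalso. pose proof (HNq l q Hl Hq). lia. }
  assert (HAU : incl A U) by (intros l Hl; apply I1; right; auto).
  pose proof (HA U HU HAU) as B1. pose proof (HA V HV HAV) as B2.
  destruct (split_incl V U HV HU) as (D & HD & E1 & _ & E3).
  { intros l Hl. apply filter_In in Hl. tauto. }
  set (f1 := fun l => (bet l * RtoC (mm n l) ^ 0)%C) in *.
  set (f2 := fun l => if excluded_middle_informative (exists q, l - l0 = Z.of_nat N * q)%Z then bet l else RtoC 0) in *.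
  assert (ED : lsum D f1 = lsum D f2).
  { apply lsum_ext. intros l Hl. apply E3 in Hl. destruct Hl as (Hl1 & Hl2). unfold f1, f2.
    destruct excluded_middle_informative as [|Hq]; [simpl; ring|]. exfalso. apply Hl2. apply filter_In. split; auto.
    unfold p. destruct excluded_middle_informative; [contradiction|auto]. }
  assert (EV : lsum V f2 = bet l0).
  { assert (HlV : incl [l0] V).
    { intros l [<-|[]]. apply filter_In. split; [apply I1; left; auto|]. destruct (Z.eq_dec l0 l0); [apply Bool.orb_true_r|congruence]. }
    destruct (split_incl [l0] V) as (D' & _ & E' & _ & E3'); auto. { constructor; [simpl; tauto | constructor]. }
    rewrite E', (lsum_ext D' f2 (fun _ => RtoC 0)), lsum_zero.
    - simpl. unfold f2. destruct excluded_middle_informative as [|Hq]; [ring|]. exfalso; apply Hq. exists 0%Z. ring.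
    - intros l Hl. apply E3' in Hl. destruct Hl as (Hl1 & Hl2). apply filter_In in Hl1. unfold f2.
      destruct excluded_middle_informative as [Hq|]; auto. exfalso. destruct Hl1 as (_ & Hl1). unfold p in Hl1.
      destruct excluded_middle_informative; [|contradiction]. simpl in Hl1.
      destruct (Z.eq_dec l l0) as [->|]; [apply Hl2; left; auto | congruence]. }
  rewrite E1, EV, <- ED in HA2. rewrite E1 in B1.
  assert (Cmod (bet l0) <= Cmod (bet l0 + lsum D f1 - 0) + Cmod (lsum D f1)).
  { replace (bet l0) with ((bet l0 + lsum D f1 - 0) + - lsum D f1)%C at 1 by ring.
    eapply Rle_trans; [apply Cmod_triangle|]. rewrite Cmod_opp. lra. }
  assert (Cmod (lsum D f1) <= Cmod (lsum V f1 + lsum D f1 - Mom 0) + Cmod (lsum V f1 - Mom 0)).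
  { replace (lsum D f1) with ((lsum V f1 + lsum D f1 - Mom 0) + - (lsum V f1 - Mom 0))%C at 1 by ring.
    eapply Rle_trans; [apply Cmod_triangle|]. rewrite Cmod_opp. lra. }
  lra.
Qed.

(** If all moments vanished, the power series of [Th 0] would be 0, and [b] would vanish by
    [Th_injective]. The least index with nonzero moment is at least n by the moment conditions. *)
Lemma exists_order : (exists l, b l <> RtoC 0) -> moment_vanish n tau b ->
  exists N, (n <= N)%nat /\ Mom N <> RtoC 0 /\ forall i, (i < N)%nat -> Mom i = RtoC 0.
Proof.
  intros (l & Hl) Hv.
  assert (Hex : exists N, Mom N <> RtoC 0).
  { apply NNPP; intros Hno. apply Hl. apply Th_injective. intros v.
    destruct (Th_PS 0) as (_ & H). apply (HS_unique _ _ _ (H v)).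
    apply (HS_ext (fun _ => RtoC 0)); [|apply HS_zero]. intros i.
    assert (Mom (i + 0) = RtoC 0) as -> by (apply NNPP; intros Hm; apply Hno; eauto). ring. }
  destruct (Wf_nat.dec_inh_nat_subset_has_unique_least_element (fun N => Mom N <> RtoC 0)) as (N & (H1 & H2) & _); auto.
  { intros N. apply classic. }
  exists N. split; [|split; auto].
  - apply Nat.nlt_ge. intros Hlt. apply H1. apply gsum_eq. apply Hv; auto.
  - intros i Hi. apply NNPP; intros Hm. specialize (H2 i Hm). lia.
Qed.

Let kap := PI / (2 * INR n * T).

(** The factor exp(kap v^2) together with exp(i pi v), which compensates the exponents 2 l - n used
    in [Th]: the product has the frequencies 2 l / n. *)
Definition Ev (v : C) : C := Cexp (RtoC kap * v * v + Ci * RtoC PI * v).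

(* Growth: pi m y / n is absorbed by a fraction 1 - q of the Gaussian in m and the rest in y^2. *)
Lemma Th_growth kap0 j : kap < kap0 -> exists k1 K, 0 <= k1 < kap0 /\
  forall v, Cmod (Ev v * Th j v) <= K * exp (k1 * (Cmod v * Cmod v)).
Proof.
  intros Hk. assert (HTT : 0 < T) by auto. pose proof PI_RGT_0 as HPI.
  assert (Hkap : 0 < kap). { unfold kap. apply Rdiv_lt_0_compat; auto. apply Rmult_lt_0_compat; lra. }
  (* Here kap + 2 e = k1: one [e] pays for the mixed term in m and y, the other for the linear term
     pi y of [Ev]. *)
  set (k1 := (kap + kap0) / 2). set (e := (k1 - kap) / 2). assert (He : 0 < e) by (unfold e, k1; lra).
  set (At := PI * T / (4 * INR n)).
  assert (HAt : 0 < At). { apply Rdiv_lt_0_compat; [apply Rmult_lt_0_compat; auto | lra]. }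
  (* Chosen so that 4 (q At) (2 kap + e) = (pi / n)^2, the condition for completing the square in m
     and y. *)
  set (q := 2 * kap / (2 * kap + e)).
  assert (Hq : 0 < q < 1).
  { unfold q. split; [apply Rdiv_lt_0_compat; lra|]. apply (Rmult_lt_reg_r (2 * kap + e)); [lra|].
    unfold Rdiv. rewrite Rmult_assoc, Rinv_l by lra. lra. }
  destruct (bsum_gauss n ((1 - q) * At) 0 j) as (K & HK). { apply Rmult_lt_0_compat; lra. }
  set (C1 := exp (At * (INR n * INR n)) * exp (PI * PI / (4 * e))).
  exists k1, (Bb * C1 * K). split; [unfold k1; lra|].
  intros v. set (x := Re v). set (y := Im v).
  assert (Ev2 : Cmod v * Cmod v = x * x + y * y) by (rewrite Cmod_sqr; reflexivity).
  rewrite Ev2.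
  assert (Hpt : forall m, kap * (x * x - y * y) - PI * y + (- (At) * (m * m - INR n * INR n) - PI / INR n * m * y)
     <= At * (INR n * INR n) + PI * PI / (4 * e) + k1 * (x * x + y * y) + - ((1 - q) * At) * (m * m)).
  { intros m.
    assert (E1 : - (PI / INR n) * m * y <= q * At * (m * m) + (2 * kap + e) * (y * y)).
    { assert (Hc : (PI / INR n) * (PI / INR n) = 4 * (q * At) * (2 * kap + e)).
      { replace (4 * (q * At) * (2 * kap + e)) with (4 * At * (q * (2 * kap + e))) by ring.
        replace (q * (2 * kap + e)) with (2 * kap) by (unfold q; field; lra).
        unfold At, kap. field. split; apply Rgt_not_eq; auto. }
      assert (Hp : 0 < q * At) by (apply Rmult_lt_0_compat; lra).
      pose proof (Rle_0_sqr (2 * (q * At) * m + PI / INR n * y)) as Hs. unfold Rsqr in Hs.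
      apply (Rmult_le_reg_l (4 * (q * At))); [lra|].
      replace (4 * (q * At) * (q * At * (m * m) + (2 * kap + e) * (y * y))) with
        (4 * (q * At) * (q * At) * (m * m) + (4 * (q * At) * (2 * kap + e)) * (y * y)) by ring.
      rewrite <- Hc. nra. }
    assert (E2 : - PI * y <= e * (y * y) + PI * PI / (4 * e)).
    { apply (Rmult_le_reg_l (4 * e)); [lra|].
      replace (4 * e * (e * (y * y) + PI * PI / (4 * e))) with (4 * e * e * (y * y) + PI * PI) by (field; lra).
      pose proof (Rle_0_sqr (2 * e * y + PI)) as Hs. unfold Rsqr in Hs. nra. }
    assert (E3 : kap + 2 * e = k1) by (unfold e; lra).
    assert (E4 : kap * (x * x) <= k1 * (x * x)). { apply Rmult_le_compat_r; [apply Rle_0_sqr|]. lra. }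
    assert (E5 : k1 * (y * y) = kap * (y * y) + 2 * e * (y * y)) by (rewrite <- E3; ring). lra. }
  assert (HS (fun l => Ev v * (bet l * RtoC (mm n l) ^ j * Cexp (ci * RtoC (mm n l) * v)))%C (Ev v * Th j v)%C) as HH.
  { apply HS_scal, Th_HS. }
  apply (HS_bound _ _ _ HH).
  apply bsum_le with (fun l => Bb * C1 * exp (k1 * (x * x + y * y)) * (Rabs (mm n l) ^ j * exp (- ((1 - q) * At) * (mm n l * mm n l) + 0 * Rabs (mm n l)))).
  - intros l. unfold bet. rewrite !Cmod_mult, Cmod_pow, Cmod_R, Cmod_Cexp, gw_Cmod. unfold Ev. rewrite Cmod_Cexp.
    replace (Re (RtoC kap * v * v + Ci * RtoC PI * v)) with (kap * (x * x - y * y) - PI * y).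
    2:{ unfold x, y, Re, Im, Ci, Cmult, Cplus, RtoC; simpl. ring. }
    replace (Re (ci * RtoC (mm n l) * v)) with (- (PI / INR n) * mm n l * y).
    2:{ unfold ci, y, Re, Im, Ci, Cmult, Cplus, RtoC; simpl. ring. }
    fold T. fold At. unfold C1. rewrite Rmult_0_l, Rplus_0_r.
    specialize (Hpt (mm n l)). apply exp_mono in Hpt. rewrite !exp_plus in Hpt.
    apply Rle_trans with (Cmod (b l) * Rabs (mm n l) ^ j * (exp (kap * (x * x - y * y) - PI * y) * exp (- At * (mm n l * mm n l - INR n * INR n) - PI / INR n * mm n l * y))).
    + right. replace (- At * (mm n l * mm n l - INR n * INR n) - PI / INR n * mm n l * y) with
       (- At * (mm n l * mm n l - INR n * INR n) + - (PI / INR n) * mm n l * y) by ring. rewrite exp_plus. ring.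
    + apply Rle_trans with (Bb * Rabs (mm n l) ^ j * (exp (At * (INR n * INR n)) * exp (PI * PI / (4 * e)) * exp (k1 * (x * x + y * y)) * exp (- ((1 - q) * At) * (mm n l * mm n l)))).
      * apply Rmult_le_compat; auto.
        -- apply Rmult_le_pos; [apply Cmod_ge_0 | apply pow_le, Rabs_pos].
        -- apply Rmult_le_pos; left; apply exp_pos.
        -- apply Rmult_le_compat_r; auto. apply pow_le, Rabs_pos.
      * right; ring.
  - replace (Bb * C1 * K * exp (k1 * (x * x + y * y))) with (Bb * C1 * exp (k1 * (x * x + y * y)) * K) by ring.
    apply bsum_scal; auto. unfold C1. repeat apply Rmult_le_pos; auto; left; apply exp_pos.
Qed.
End GConstr.

Lemma greatest_below (P : nat -> Prop) n : (exists k, (k < n)%nat /\ P k) ->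
  exists d, (d < n)%nat /\ P d /\ forall k, (d < k < n)%nat -> ~ P k.
Proof.
  induction n as [|n IH]; intros (k & Hk & HP); [lia|].
  destruct (classic (P n)) as [Hn|Hn].
  - exists n. split; [lia|]. split; auto. intros; lia.
  - destruct IH as (d & H1 & H2 & H3).
    + exists k. split; auto. assert (k <> n) by (intros ->; auto). lia.
    + exists d. split; [lia|]. split; auto. intros j Hj. destruct (Nat.eq_dec j n) as [->|]; auto. apply H3; lia.
Qed.

Lemma per_shift (Nz : Z) (b : Z -> C) : (forall l, b (l + Nz)%Z = (sgnZ Nz * b l)%C) ->
  forall j l, b (l + Nz * j)%Z = (sgnZ (Nz * j) * b l)%C.
Proof.
  intros H.
  assert (Hnat : forall (q : nat) l, b (l + Nz * Z.of_nat q)%Z = (sgnZ (Nz * Z.of_nat q) * b l)%C).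
  { induction q as [|q IH]; intros l.
    - replace (Nz * Z.of_nat 0)%Z with 0%Z by lia. rewrite Z.add_0_r. unfold sgnZ; simpl. ring.
    - replace (l + Nz * Z.of_nat (S q))%Z with (l + Nz * Z.of_nat q + Nz)%Z by lia. rewrite H, IH.
      replace (Nz * Z.of_nat (S q))%Z with (Nz + Nz * Z.of_nat q)%Z by lia. rewrite sgnZ_add. ring. }
  intros j l. destruct (Z.le_gt_cases 0 j) as [Hj|Hj].
  - rewrite <- (Z2Nat.id j) by auto. apply Hnat.
  - pose proof (Hnat (Z.to_nat (- j)) (l + Nz * j)%Z) as E. rewrite Z2Nat.id in E by lia.
    replace (l + Nz * j + Nz * - j)%Z with l in E by ring.
    replace (Nz * - j)%Z with (- (Nz * j))%Z in E by ring. rewrite sgnZ_opp in E.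
    rewrite E, Cmult_assoc, sgnZ_sq. ring.
Qed.

Lemma residue_sum n (f : Z -> C) : (1 <= n)%nat ->
  (forall r, HS (fun j => f (r + Z.of_nat n * j)%Z) (RtoC 0)) -> HS f (RtoC 0).
Proof.
  intros Hn H. set (Nz := Z.of_nat n). assert (HN : (0 < Nz)%Z) by (unfold Nz; lia).
  set (fr := fun (r : nat) l => if Z.eqb (l mod Nz) (Z.of_nat r) then f l else RtoC 0).
  assert (E : RtoC 0 = lsum (seq 0 n) (fun _ => RtoC 0)) by (rewrite lsum_zero; auto).
  rewrite E. apply (HS_ext (fun l => lsum (seq 0 n) (fun r => fr r l))).
  - intros l. pose proof (Z.mod_pos_bound l Nz HN) as Hb.
    set (r0 := Z.to_nat (l mod Nz)).
    assert (Hin : In r0 (seq 0 n)) by (apply in_seq; unfold r0, Nz in *; lia).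
    assert (Hi : incl [r0] (seq 0 n)) by (intros x [<-|[]]; auto).
    destruct (split_incl [r0] (seq 0 n)) as (D & _ & E1 & _ & E3); auto.
    { constructor; [simpl; tauto | constructor]. } { apply seq_NoDup. }
    rewrite E1, (lsum_ext D _ (fun _ => RtoC 0)), lsum_zero.
    + simpl. unfold fr, r0. rewrite Z2Nat.id by lia. rewrite Z.eqb_refl. ring.
    + intros r Hr. apply E3 in Hr. destruct Hr as (Hr1 & Hr2). unfold fr.
      destruct (Z.eqb_spec (l mod Nz) (Z.of_nat r)) as [E4|]; auto. exfalso. apply Hr2. left. unfold r0. lia.
  - apply HS_lsum. intros r Hr. apply in_seq in Hr.
    apply (HS_inj (fun j => Z.of_nat r + Nz * j)%Z).
    + intros j j' Ej. nia.
    + intros l Hl. unfold fr. destruct (Z.eqb_spec (l mod Nz) (Z.of_nat r)) as [E4|]; auto.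
      exfalso. apply (Hl (l / Nz)%Z). rewrite <- E4. rewrite Z.add_comm. symmetry. apply Z.div_mod. lia.
    + eapply HS_ext; [|apply (H (Z.of_nat r))]. intros j; cbv beta. unfold fr.
      replace ((Z.of_nat r + Nz * j) mod Nz)%Z with (Z.of_nat r); [rewrite Z.eqb_refl; auto|].
      replace (Z.of_nat r + Nz * j)%Z with (Z.of_nat r + j * Nz)%Z by ring. rewrite Z.mod_add by lia.
      symmetry. apply Z.mod_small. unfold Nz. lia.
Qed.

Section ExistsG.
Variables (n : nat) (tau : C) (kap0 : R).
Hypothesis Hn : (1 <= n)%nat.
Hypothesis HT : 0 < Im tau.
Hypothesis Hkap : PI / (2 * INR n * Im tau) < kap0.

Let HN0 : 0 < INR n.
Proof. apply lt_0_INR. lia. Qed.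
Let Hkap0 : 0 < kap0.
Proof.
  eapply Rle_lt_trans; [|apply Hkap]. apply Rdiv_le_0_compat; [left; apply PI_RGT_0|].
  apply Rmult_lt_0_compat; lra.
Qed.

Let ci : C := (Ci * RtoC (PI / INR n))%C.

(** The quantity 2 Im v / T as a polynomial in v and its conjugate. At m + l0 tau it equals 2 l0,
    which is the change of 2 l - n under l -> l + l0. *)
Definition twos (v : C) : C := ((- Ci * RtoC (/ Im tau)) * (v - Cconj v))%C.
Lemma twos_im v : twos v = RtoC (2 * Im v / Im tau).
Proof. unfold twos, Cconj, Im, Ci, RtoC. apply injective_projections; simpl; field; unfold Im in HT; lra. Qed.

(** With [H j] the quotient of [Th j] by v^(N - j), this represents the sum of b gw mm^j (mm + twos
    v)^k exp(ci mm v), times [Ev v], divided by v^(N - d). The recursion splits off one factor mm +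
    twos v, so that only quotients of the holomorphic series [Th j] occur and each step raises the
    order in the conjugate by at most one. *)
Fixpoint Qf (d : nat) (H : nat -> C -> C) (k j : nat) (v : C) : C :=
  match k with
  | O => (Ev n tau v * (v ^ (d - j) * H j v))%C
  | S k' => (Qf d H k' (S j) v + twos v * Qf d H k' j v)%C
  end.

(** Outside the unit disc division by a power of v only decreases the modulus, so [Th_growth]
    applies; inside, the quotient is entire and hence bounded. *)
Lemma gro_base (b : Z -> C) Bb d N j (H : C -> C) : (forall l, Cmod (b l) <= Bb) -> ent H ->
  (j <= d)%nat -> (d <= N)%nat -> (forall v, Th n tau b j v = (v ^ (N - j) * H v)%C) ->
  gro kap0 (fun v => Ev n tau v * (v ^ (d - j) * H v))%C.
Proof.
  intros Hb HH Hj Hd E.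
  assert (He : ent (fun v => Ev n tau v * (v ^ (d - j) * H v))%C).
  { unfold Ev. ent_tac. }
  split; auto.
  destruct (Th_growth n tau b Bb Hn HT Hb kap0 j Hkap) as (k1 & K & Hk1 & HK).
  destruct (ent_bound _ He 1) as (M & HM).
  assert (HK0 : 0 <= K).
  { specialize (HK (RtoC 0)). rewrite Cmod_0 in HK. replace (k1 * (0 * 0)) with 0 in HK by ring. rewrite exp_0 in HK.
    pose proof (Cmod_ge_0 (Ev n tau 0 * Th n tau b j 0)). lra. }
  assert (HM0 : 0 <= M). { eapply Rle_trans; [apply Cmod_ge_0 | apply (HM (RtoC 0)); rewrite Cmod_0; lra]. }
  exists k1, (M + K). split; auto. intros v.
  assert (H1 : 1 <= exp (k1 * (Cmod v * Cmod v))).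
  { rewrite <- exp_0. apply exp_mono. apply Rmult_le_pos; [lra | apply Rle_0_sqr]. }
  destruct (Rle_dec (Cmod v) 1) as [Hv|Hv].
  - specialize (HM v Hv). nra.
  - assert (Cmod (Ev n tau v * (v ^ (d - j) * H v)) <= Cmod (Ev n tau v * Th n tau b j v)).
    { rewrite E, !Cmod_mult, !Cmod_pow. apply Rmult_le_compat_l; [apply Cmod_ge_0|].
      apply Rmult_le_compat_r; [apply Cmod_ge_0|]. apply Rle_pow; [lra|lia]. }
    specialize (HK v). nra.
Qed.

(** At a lattice point [twos] makes the polynomial see the index shifted by l0, and the exponential
    completes [gw] to [gw] at the shifted index. Over each residue class modulo n the coefficient is
    then constant up to sign, so the sum vanishes by [exists_p]. At 0 the same sum vanishes as well,
    but only to an order that the division by v^(N - d) uses up. *)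
Lemma exists_G : exists G, PAG n kap0 G /\ G (RtoC 0) = RtoC 1 /\
  forall m l : Z, (m <> 0 \/ l <> 0)%Z -> G (RtoC (IZR m) + RtoC (IZR l) * tau)%C = RtoC 0.
Proof.
  destruct (exists_b n tau Hn HT) as (b & Hb0 & (Bb & Hbb) & Hper & Hmom).
  destruct (exists_order n tau b Bb Hn HT Hbb Hb0 Hmom) as (N & HNn & HMN & HMl).
  destruct (exists_p n tau Hn HT) as (c & Hc & Hsum).
  (* [d] is the degree of the polynomial. *)
  destruct (greatest_below _ n Hc) as (d & Hd & Hcd & Hcl).
  assert (Hcl' : forall k, (d < k < n)%nat -> c k = RtoC 0) by (intros k Hk; apply NNPP; apply Hcl; auto).
  (* For j <= d the series [Th j] has a zero of order at least N - j at 0; [H] is the entire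
     quotient, with the shifted Taylor coefficients. *)
  assert (Hch : forall j, exists H, (j <= d)%nat -> PS (fun k => ci ^ (N - j + k) / RtoC (INR (fact (N - j + k))) * Mom n tau b (N - j + k + j))%C H /\
     forall v, Th n tau b j v = (v ^ (N - j) * H v)%C).
  { intros j. destruct (Compare_dec.le_lt_dec j d) as [Hj|Hj].
    - destruct (PS_shift_iter _ _ (N - j) (Th_PS n tau b Bb Hn HT Hbb j)) as (H & H1 & H2).
      + intros k Hk. rewrite HMl by lia. ring.
      + exists H. auto.
    - exists (fun _ => RtoC 0). intros; lia. }
  destruct (choice _ Hch) as (H & HH).
  set (Q := Qf d H).
  assert (HQ1 : forall k j, (k + j <= d)%nat -> PAG (S k) kap0 (Q k j)).
  { induction k as [|k IH]; intros j Hkj.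
    - apply PAG_gro; auto. destruct (HH j) as (HP & HE); [lia|].
      apply (gro_base b Bb d N j (H j)); auto; try lia. eapply PS_ent; eauto.
    - apply (PAG_plus _ _ (Q k (S j)) (fun v => twos v * Q k j v)%C).
      + apply (PAG_weaken (S k)); [lia|]. apply IH; lia.
      + apply (PAG_ext _ _ (fun v => (- Ci * RtoC (/ Im tau)) * ((v - Cconj v) * Q k j v))%C).
        * intros v. unfold twos. ring.
        * apply PAG_scal, PAG_sub_conj; auto. apply IH; lia. }
  set (bet := fun l => (b l * gw n tau l)%C).
  assert (HQ2 : forall k j v, (k + j <= d)%nat ->
    HS (fun l => Ev n tau v * (bet l * RtoC (mm n l) ^ j * (RtoC (mm n l) + twos v) ^ k * Cexp (ci * RtoC (mm n l) * v)))%C (v ^ (N - d) * Q k j v)%C).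
  { induction k as [|k IH]; intros j v Hkj.
    - destruct (HH j) as (HP & HE); [lia|].
      pose proof (HS_scal _ _ (Ev n tau v) (Th_HS n tau b Bb Hn HT Hbb j v)) as HS1.
      rewrite HE in HS1. replace (N - j)%nat with ((N - d) + (d - j))%nat in HS1 by lia. rewrite Cpow_add_r in HS1.
      unfold Q; simpl.
      replace (v ^ (N - d) * (Ev n tau v * (v ^ (d - j) * H j v)))%C with (Ev n tau v * (v ^ (N - d) * v ^ (d - j) * H j v))%C by ring.
      eapply HS_ext; [|apply HS1]. intros l; simpl. fold ci. unfold bet. ring.
    - replace (v ^ (N - d) * Q (S k) j v)%C with (v ^ (N - d) * Q k (S j) v + twos v * (v ^ (N - d) * Q k j v))%C.
      2:{ unfold Q; simpl. ring. }
      eapply HS_ext; [|apply HS_plus; [apply (IH (S j) v); lia | apply HS_scal, (IH j v); lia]].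
      intros l; simpl. ring. }
  assert (HQ3 : forall k j, Q k j (RtoC 0) = Q O (j + k)%nat (RtoC 0)).
  { induction k as [|k IH]; intros j; [rewrite Nat.add_0_r; auto|].
    assert (E0 : twos (RtoC 0) = RtoC 0). { rewrite twos_im. f_equal. unfold Im; simpl. unfold Rdiv; ring. }
    transitivity (Q k (S j) (RtoC 0) + twos (RtoC 0) * Q k j (RtoC 0))%C; [reflexivity|].
    rewrite E0, IH. replace (S j + k)%nat with (j + S k)%nat by lia. ring. }
  set (G0 := fun v => lsum (seq 0 (S d)) (fun k => c k * Q k O v)%C).
  assert (HG1 : PAG n kap0 G0).
  { apply (PAG_weaken (S d)); [lia|]. unfold G0.
    assert (Hgen : forall L, (forall k, In k L -> (k <= d)%nat) -> PAG (S d) kap0 (fun v => lsum L (fun k => c k * Q k O v)%C)).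
    { induction L as [|k L IH]; intros HL.
      - apply (PAG_weaken 1); [lia|]. simpl. apply PAG_gro; auto. apply gro_zero; auto.
      - simpl. apply PAG_plus; [|apply IH; intros; apply HL; right; auto].
        apply PAG_scal. assert (k <= d)%nat by (apply HL; left; auto).
        apply (PAG_weaken (S k)); [lia|]. apply HQ1. lia. }
    apply Hgen. intros k Hk. apply in_seq in Hk. lia. }
  (* At 0 the factor [twos] vanishes and v^(d - k) kills every k < d; what is left is [c d] times a
     nonzero multiple of [Mom N]. *)
  assert (HG2 : G0 (RtoC 0) <> RtoC 0).
  { unfold G0. rewrite lsum_seq_S, (lsum_ext (seq 0 d) _ (fun _ => RtoC 0)), lsum_zero.
    - rewrite HQ3, Cplus_0_l. unfold Q; simpl. rewrite Nat.sub_diag. simpl.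
      destruct (HH d) as (HP & _); [lia|]. pose proof (PS_at_0 _ _ HP) as E. cbv beta in E.
      rewrite Nat.add_0_r in E. replace (N - d + d)%nat with N in E by lia. rewrite E.
      apply Cmult_neq_0; auto. apply Cmult_neq_0; [unfold Ev; apply Cexp_neq_0|].
      apply Cmult_neq_0; [apply C1_nz|]. apply Cmult_neq_0; auto. unfold Cdiv.
      apply Cmult_neq_0.
      + apply Cpow_nz. unfold ci. apply Cmult_neq_0; [apply Ci_nz|]. apply RtoC_neq0. apply Rgt_not_eq.
        apply Rdiv_lt_0_compat; [apply PI_RGT_0|auto].
      + intros E1. assert (RtoC (INR (fact (N - d))) <> RtoC 0) by (apply RtoC_neq0, INR_fact_neq_0).
        assert (RtoC 1 = RtoC 0); [|apply C1_nz; auto].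
        rewrite <- (Cinv_r (RtoC (INR (fact (N - d))))), E1 by auto. ring.
    - intros k Hk. apply in_seq in Hk. rewrite HQ3. unfold Q; simpl.
      replace (d - k)%nat with (S (d - k - 1))%nat by lia. rewrite Cpow_S. ring. }
  assert (HG3 : forall m l : Z, (m <> 0 \/ l <> 0)%Z -> G0 (RtoC (IZR m) + RtoC (IZR l) * tau)%C = RtoC 0).
  { intros m0 l0 Hml. set (v := (RtoC (IZR m0) + RtoC (IZR l0) * tau)%C).
    assert (Hv : v <> RtoC 0).
    { intros E. assert (E2 := f_equal snd E). unfold v in E2; simpl in E2.
      replace (0 + (IZR l0 * snd tau + 0 * fst tau)) with (IZR l0 * snd tau) in E2 by ring.
      unfold Im in HT. apply Rmult_integral in E2. destruct E2 as [E2|E2]; [|lra].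
      apply eq_IZR in E2. subst l0. destruct Hml as [Hm|Hl]; [|congruence].
      assert (E3 := f_equal fst E). unfold v in E3; simpl in E3.
      replace (IZR m0 + (0 * fst tau - 0 * snd tau)) with (IZR m0) in E3 by ring. apply eq_IZR in E3. auto. }
    assert (Htw : twos v = RtoC (2 * IZR l0)).
    { rewrite twos_im. f_equal. unfold v, Im; simpl. unfold Im in HT. field. lra. }
    set (P := fun X : C => lsum (seq 0 n) (fun k => c k * X ^ k)%C).
    assert (EP : forall X, P X = lsum (seq 0 (S d)) (fun k => c k * X ^ k)%C).
    { intros X. unfold P. assert (En : seq 0 n = seq 0 (S d) ++ seq (S d) (n - S d)).
      { rewrite <- seq_app. f_equal. lia. }
      rewrite En, lsum_app, (lsum_ext (seq (S d) _) _ (fun _ => RtoC 0)), lsum_zero; [ring|].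
      intros k Hk. apply in_seq in Hk. rewrite Hcl' by lia. ring. }
    assert (S1 : HS (fun l => Ev n tau v * (bet l * P (RtoC (mm n l) + twos v) * Cexp (ci * RtoC (mm n l) * v)))%C (v ^ (N - d) * G0 v)%C).
    { unfold G0. rewrite <- lsum_scal.
      apply (HS_ext (fun l => lsum (seq 0 (S d)) (fun k => c k * (Ev n tau v * (bet l * RtoC (mm n l) ^ 0 * (RtoC (mm n l) + twos v) ^ k * Cexp (ci * RtoC (mm n l) * v))))%C)).
      - intros l. rewrite EP.
        transitivity (Ev n tau v * bet l * Cexp (ci * RtoC (mm n l) * v) * lsum (seq 0 (S d)) (fun k => c k * (RtoC (mm n l) + twos v) ^ k))%C; [|ring].
        rewrite <- lsum_scal. apply lsum_ext. intros; simpl; ring.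
      - apply HS_lsum. intros k Hk. apply in_seq in Hk.
        replace (v ^ (N - d) * (c k * Q k O v))%C with (c k * (v ^ (N - d) * Q k O v))%C by ring.
        apply HS_scal. apply HQ2. lia. }
    assert (S2 : HS (fun l => Ev n tau v * (bet l * P (RtoC (mm n l) + twos v) * Cexp (ci * RtoC (mm n l) * v)))%C (RtoC 0)).
    (* [r] collects the coefficients after the shift by l0, including the phase produced by the real
       translation m0; the phase is n-periodic because m0 is an integer. [K] is the factor by which
       the quadratic exponents differ. *)
    { set (ph := fun l : Z => Cexp (ci * RtoC (mm n l * IZR m0))).
      set (r := fun l : Z => (b (l - l0)%Z * ph (l - l0)%Z)%C).
      set (K := (Ev n tau v * Cexp (- (Ci * tau * RtoC (PI * IZR l0 * IZR l0 / INR n))))%C).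
      assert (Hr : forall l j, r (l + Z.of_nat n * j)%Z = (sgnZ (Z.of_nat n * j) * r l)%C).
      { intros l j. unfold r. replace (l + Z.of_nat n * j - l0)%Z with (l - l0 + Z.of_nat n * j)%Z by ring.
        rewrite (per_shift _ b Hper). replace (ph (l - l0 + Z.of_nat n * j)%Z) with (ph (l - l0)%Z); [ring|].
        unfold ph. rewrite mm_shift.
        replace (ci * RtoC ((mm n (l - l0) + 2 * INR n * IZR j) * IZR m0))%C with
          (ci * RtoC (mm n (l - l0) * IZR m0) + RtoC (2 * PI * IZR (j * m0)) * Ci)%C.
        - rewrite Cexp_plus, Cexp_2PI. ring.
        - unfold ci. rewrite mult_IZR. apply injective_projections; simpl; field; lra. }
      assert (Hz : HS (fun l => r l * (P (RtoC (mm n l)) * gw n tau l))%C (RtoC 0)).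
      { apply (residue_sum n); auto. intros rho.
        pose proof (HS_scal _ _ (r rho) (Hsum rho)) as Hs. rewrite Cmult_0_r in Hs.
        eapply HS_ext; [|apply Hs]. intros j; cbv beta. rewrite Hr. unfold P. ring. }
      apply (HS_reindex (fun l => l + l0)%Z (fun l => l - l0)%Z) in Hz; [|intros; ring|intros; ring].
      apply (HS_scal _ _ K) in Hz. rewrite Cmult_0_r in Hz.
      eapply HS_ext; [|apply Hz]. intros l; cbv beta. unfold r.
      replace (l + l0 - l0)%Z with l by ring.
      assert (Em : mm n (l + l0) = mm n l + 2 * IZR l0).
      { unfold mm. rewrite !minus_IZR, !mult_IZR, plus_IZR. ring. }
      rewrite Htw, <- RtoC_plus, <- Em.
      assert (Eg : (Cexp (- (Ci * tau * RtoC (PI * IZR l0 * IZR l0 / INR n))) * ph l * gw n tau (l + l0) = gw n tau l * Cexp (ci * RtoC (mm n l) * v))%C).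
      { unfold ph, gw. rewrite <- !Cexp_plus. f_equal. rewrite Em. unfold ci, v.
        apply injective_projections; simpl; field; lra. }
      unfold K, bet.
      transitivity (Ev n tau v * b l * P (RtoC (mm n (l + l0))) * (Cexp (- (Ci * tau * RtoC (PI * IZR l0 * IZR l0 / INR n))) * ph l * gw n tau (l + l0)))%C; [ring|].
      rewrite Eg. ring. }
    pose proof (HS_unique _ _ _ S1 S2) as E. apply NNPP; intros Hne.
    apply (Cmult_neq_0 (v ^ (N - d)) (G0 v)); auto. apply Cpow_nz; auto. }
  exists (fun v => / G0 (RtoC 0) * G0 v)%C. split; [apply PAG_scal; auto|]. split.
  - field. auto.
  - intros m l Hml. rewrite HG3 by auto. ring.
Qed.
End ExistsG.

(** * Sufficiency *)
Lemma Cnorm2_Cmod z : Cnorm2 z = Cmod z * Cmod z.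
Proof. rewrite Cmod_sqr. reflexivity. Qed.
Lemma Cnorm_Cmod z : Cnorm z = Cmod z.
Proof. unfold Cnorm, Cmod, Cnorm2. f_equal. ring. Qed.
Lemma Cpow_Defs z k : Defs.Cpow z k = (z ^ k)%C.
Proof. induction k as [|k IH]; [reflexivity|]. rewrite Cpow_S, <- IH. reflexivity. Qed.
Lemma csum_lsum N f : csum N f = lsum (seq 0 N) f.
Proof. induction N as [|N IH]; [reflexivity|]. rewrite lsum_seq_S, <- IH. reflexivity. Qed.
Lemma rsum_lsumR N f : rsum N f = lsumR (seq 0 N) f.
Proof. induction N as [|N IH]; [reflexivity|]. rewrite lsumR_seq_S, <- IH. reflexivity. Qed.
Lemma ent_entire f : ent f <-> entire f.
Proof.
  split; intros H z; destruct (H z) as (L & HL); exists L; intros eps He; destruct (HL eps He) as (d & Hd & Hd');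
  exists d; split; auto; intros h Hh.
  - rewrite !Cnorm_Cmod in *. apply Hd'. lra.
  - destruct (Ceq_dec h 0) as [->|Hn].
    + replace (z + 0)%C with z by ring. replace (f z - f z - L * 0)%C with (RtoC 0) by ring. rewrite Cmod_0. lra.
    + specialize (Hd' h). rewrite !Cnorm_Cmod in Hd'. apply Hd'. split; auto. apply Cmod_gt_0; auto.
Qed.

(** A bounded increasing primitive of exp(-|x|): Riemann sums are dominated by its increments and
    telescope. *)
Definition Phi (x : R) : R := if Rle_dec x 0 then exp x else 2 - exp (- x).
Lemma one_minus_exp h : 0 <= h <= 1 -> h / 2 <= 1 - exp (- h).
Proof.
  intros Hh. pose proof (exp_ineq1_le h) as H. pose proof (exp_pos h) as Hp. rewrite exp_Ropp.
  assert (/ exp h <= / (1 + h)) by (apply Rinv_le_contravar; lra).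
  assert (/ (1 + h) <= 1 - h / 2); [|lra].
  apply (Rmult_le_reg_l (1 + h)); [lra|]. rewrite Rinv_r by lra. nra.
Qed.
Lemma Phi_step x h : 0 < h <= 1 -> h * exp (- Rabs x) <= 2 * (Phi (x + h) - Phi x).
Proof.
  intros Hh. unfold Phi. destruct (Rle_dec x 0) as [Hx|Hx]; destruct (Rle_dec (x + h) 0) as [Hy|Hy]; try lra.
  - rewrite Rabs_left1, Ropp_involutive by auto. rewrite exp_plus. pose proof (exp_pos x). pose proof (exp_ineq1_le h). nra.
  - rewrite Rabs_left1, Ropp_involutive by auto.
    pose proof (one_minus_exp (x + h) ltac:(lra)). pose proof (one_minus_exp (- x) ltac:(lra)).
    rewrite Ropp_involutive in H0. assert (exp x <= 1) by (rewrite <- exp_0; apply exp_mono; auto).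
    pose proof (exp_pos x). nra.
  - rewrite Rabs_pos_eq by lra. rewrite Ropp_plus_distr, exp_plus. pose proof (exp_pos (- x)).
    pose proof (one_minus_exp h ltac:(lra)). nra.
Qed.
Lemma Phi_bd x : 0 <= Phi x <= 2.
Proof.
  unfold Phi. destruct (Rle_dec x 0) as [Hx|Hx].
  - pose proof (exp_pos x). assert (exp x <= 1) by (rewrite <- exp_0; apply exp_mono; auto). lra.
  - pose proof (exp_pos (- x)). assert (exp (- x) <= 1) by (rewrite <- exp_0; apply exp_mono; lra). lra.
Qed.
Lemma riemann_exp x0 h N : 0 < h <= 1 -> lsumR (seq 0 N) (fun i => h * exp (- Rabs (x0 + INR i * h))) <= 4.
Proof.
  intros Hh. apply Rle_trans with (2 * (Phi (x0 + INR N * h) - Phi (x0 + 0 * h))).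
  - induction N as [|N IH]; [simpl; lra|]. rewrite lsumR_seq_S, S_INR.
    pose proof (Phi_step (x0 + INR N * h) h Hh) as Hs.
    replace (x0 + INR N * h + h) with (x0 + (INR N + 1) * h) in Hs by ring. lra.
  - pose proof (Phi_bd (x0 + INR N * h)). pose proof (Phi_bd (x0 + 0 * h)). lra.
Qed.

Lemma lsumR_seq_add k r (g : nat -> R) : forall s, lsumR (seq (k + s) r) g = lsumR (seq s r) (fun p => g (k + p)%nat).
Proof.
  induction r as [|r IH]; intros s; [reflexivity|]. simpl. rewrite <- IH, Nat.add_succ_r. reflexivity.
Qed.
Lemma lsumR_seq_prod N r (g : nat -> R) :
  lsumR (seq 0 (N * r)) g = lsumR (seq 0 N) (fun i => lsumR (seq 0 r) (fun p => g (i * r + p)%nat)).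
Proof.
  induction N as [|N IH]; [reflexivity|]. rewrite lsumR_seq_S, <- IH.
  replace (S N * r)%nat with (N * r + r)%nat by lia. rewrite seq_app, lsumR_app. f_equal.
  rewrite <- lsumR_seq_add, Nat.add_0_r. reflexivity.
Qed.

Lemma lsumR_swap {I J} (l : list I) (l' : list J) (f : I -> J -> R) :
  lsumR l (fun i => lsumR l' (f i)) = lsumR l' (fun j => lsumR l (fun i => f i j)).
Proof.
  induction l as [|a l IH]; simpl.
  - induction l' as [|b l' IH']; simpl; [auto | rewrite <- IH'; ring].
  - rewrite IH, <- lsumR_plus. auto.
Qed.

(* A lower Darboux sum does not exceed the Riemann sum of any refinement of its grid. *)
Lemma finite_integral_of_riemann (f : C -> R) M :
  (forall x0 h N, 0 < h <= 1 ->
     lsumR (seq 0 N) (fun i => lsumR (seq 0 N) (fun j => f ((x0 + INR i * h)%R, (x0 + INR j * h)%R) * (h * h))) <= M) ->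
  finite_integral_C f.
Proof.
  intros H. exists M. intros a N c Ha Hc.
  destruct (Nat.eq_dec N 0) as [->|HN].
  { specialize (H 0 1 0%nat ltac:(lra)). simpl in *. auto. }
  assert (HNr : 0 < INR N) by (apply lt_0_INR; lia).
  set (h := 2 * a / INR N). assert (Hh : 0 < h) by (apply Rdiv_lt_0_compat; lra).
  (* Each cell is cut into r by r pieces, which brings the mesh below 1 as the hypothesis
     requires. *)
  destruct (nfloor_ex h) as (r0 & Hr0); [lra|]. set (r := S r0).
  assert (Hr : h < INR r) by (unfold r; rewrite S_INR; lra).
  assert (Hrp : 0 < INR r) by lra.
  set (k := h / INR r). assert (Hk : 0 < k <= 1).
  { unfold k. split; [apply Rdiv_lt_0_compat; lra|]. apply (Rmult_le_reg_r (INR r)); auto.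
    unfold Rdiv. rewrite Rmult_assoc, Rinv_l by lra. lra. }
  assert (Ehk : h = INR r * k) by (unfold k; field; lra).
  eapply Rle_trans; [|apply (H (- a) k (N * r)%nat Hk)].
  rewrite rsum_lsumR, lsumR_seq_prod. apply lsumR_le. intros i Hi. apply in_seq in Hi.
  rewrite rsum_lsumR.
  rewrite (lsumR_ext (seq 0 r) _ (fun p => lsumR (seq 0 N) (fun j => lsumR (seq 0 r) (fun q =>
     f ((- a + INR (i * r + p) * k)%R, (- a + INR (j * r + q) * k)%R) * (k * k))))).
  2:{ intros p _. apply lsumR_seq_prod. }
  rewrite lsumR_swap. apply lsumR_le. intros j Hj. apply in_seq in Hj. fold h.
  replace (c i j * (h * h)) with (lsumR (seq 0 r) (fun _ => lsumR (seq 0 r) (fun _ => c i j * (k * k)))).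
  2:{ rewrite !lsumR_const, length_seq. rewrite Ehk. ring. }
  apply lsumR_le. intros p Hp. apply lsumR_le. intros q Hq. apply in_seq in Hp. apply in_seq in Hq.
  apply Rmult_le_compat_r; [nra|].
  assert (Hsub : forall i p, (p < r)%nat -> - a + INR i * (2 * a / INR N) <= - a + INR (i * r + p) * k <= - a + INR (S i) * (2 * a / INR N)).
  { intros i' p' Hp'. fold h. rewrite Ehk, plus_INR, mult_INR, S_INR.
    pose proof (pos_INR p'). assert (INR p' <= INR r) by (apply le_INR; lia). nra. }
  apply Hc; try lia; apply Hsub; lia.
Qed.

(** The coefficient function is the binomial coefficient of k over i times (-w)^(k - i), zero for i
    > k. It is kept abstract: the expansion over any length n > k, a crude bound and holomorphy in w
    are what the sequel works with. *)
Lemma pow_sub_expand k : exists B : nat -> C -> C, (forall i w, Cmod (B i w) <= (1 + Cmod w) ^ k) /\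
  (forall i, ent (B i)) /\
  forall n z w, (k < n)%nat -> ((z - w) ^ k = lsum (seq 0 n) (fun i => z ^ i * B i w))%C.
Proof.
  induction k as [|k (B & H1 & H2 & H3)].
  - exists (fun i _ => match i with O => RtoC 1 | S _ => RtoC 0 end). split; [|split].
    + intros [|i] w; simpl; rewrite ?Cmod_1, ?Cmod_0; lra.
    + intros [|i]; apply ent_const.
    + intros [|n] z w Hn; [lia|]. rewrite lsum_seq_shift, (lsum_ext _ _ (fun _ => RtoC 0)), lsum_zero; [simpl; ring|].
      intros; ring.
  - exists (fun i w => (match i with O => RtoC 0 | S i' => B i' w end + - w * B i w)%C). split; [|split].
    + intros i w. eapply Rle_trans; [apply Cmod_triangle|]. rewrite Cmod_mult, Cmod_opp. simpl.
      pose proof (Cmod_ge_0 w). specialize (H1 i w) as Hi.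
      assert (Cmod (match i with O => RtoC 0 | S i' => B i' w end) <= (1 + Cmod w) ^ k).
      { destruct i; auto. rewrite Cmod_0. apply pow_le; lra. }
      assert (Cmod w * Cmod (B i w) <= Cmod w * (1 + Cmod w) ^ k) by (apply Rmult_le_compat_l; auto). lra.
    + intros i. apply ent_plus; [destruct i; [apply ent_const|auto]|]. apply ent_mult; [apply ent_opp, ent_id|auto].
    + intros n z w Hn. destruct n as [|n]; [lia|].
      rewrite (lsum_ext _ _ (fun i => z ^ i * match i with O => RtoC 0 | S i' => B i' w end + - w * (z ^ i * B i w))%C) by (intros; ring).
      rewrite lsum_plus, lsum_scal, <- (H3 (S n) z w) by lia. rewrite lsum_seq_shift.
      rewrite (lsum_ext _ (fun i => z ^ S i * B i w)%C (fun i => z * (z ^ i * B i w))%C) by (intros; rewrite Cpow_S; ring).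
      rewrite lsum_scal, <- (H3 n z w) by lia. rewrite Cpow_S. ring.
Qed.

(** * Sums over the lattice *)

Definition latv (tau : C) (x : Z * Z) : C := (RtoC (IZR (fst x)) + RtoC (IZR (snd x)) * tau)%C.

(** Equivalence of norms in the basis 1, tau: the imaginary part controls [d], and then the triangle
    inequality controls [a]. *)
Lemma latv_norm tau : 0 < Im tau -> exists c, 0 < c /\ forall a d : R,
  c * (Rabs a + Rabs d) <= Cmod (RtoC a + RtoC d * tau)%C.
Proof.
  intros HT. set (T := Im tau) in *. set (S := Cmod tau). assert (HS : 0 <= S) by apply Cmod_ge_0.
  exists (T / (T + S + 1)). split; [apply Rdiv_lt_0_compat; lra|]. intros a d.
  set (v := (RtoC a + RtoC d * tau)%C).
  assert (H1 : T * Rabs d <= Cmod v).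
  { eapply Rle_trans; [|apply snd_le_Cmod]. unfold v; simpl.
    replace (0 + (d * snd tau + 0 * fst tau)) with (T * d) by (unfold T, Im; ring).
    rewrite Rabs_mult, (Rabs_pos_eq T) by lra. lra. }
  assert (H2 : Rabs a <= Cmod v + Rabs d * S).
  { rewrite <- (Cmod_R a). replace (RtoC a) with (v + - (RtoC d * tau))%C by (unfold v; ring).
    eapply Rle_trans; [apply Cmod_triangle|]. rewrite Cmod_opp, Cmod_mult, Cmod_R. unfold S; lra. }
  apply (Rmult_le_reg_r (T + S + 1)); [lra|].
  replace (T / (T + S + 1) * (Rabs a + Rabs d) * (T + S + 1)) with (T * (Rabs a + Rabs d)) by (field; lra).
  pose proof (Rabs_pos d). pose proof (Cmod_ge_0 v). nra.
Qed.

Lemma bsum_exp_Z2 c : 0 < c -> exists K, bsum (fun x : Z * Z => exp (- c * (Rabs (IZR (fst x)) + Rabs (IZR (snd x))))) K.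
Proof.
  intros Hc. destruct (bsum_exp_Z c Hc) as (K & HK). exists (K * K).
  apply bsum_le with (fun x : Z * Z => exp (- c * Rabs (IZR (fst x))) * exp (- c * Rabs (IZR (snd x)))).
  - intros x. rewrite <- exp_plus. right. f_equal. ring.
  - apply (bsum_prod (fun l => exp (- c * Rabs (IZR l))) (fun l => exp (- c * Rabs (IZR l)))); auto; intros; left; apply exp_pos.
Qed.

(* Sums over a shifted lattice: z0 = a + d tau with real a, d, and the integer parts of a, d are absorbed by a translation. *)
Lemma bsum_lattice w1 tau s : w1 <> RtoC 0 -> 0 < Im tau -> 0 < s ->
  exists K, forall z, bsum (fun x => exp (- s * Cmod (z - w1 * latv tau x))) K.
Proof.
  intros Hw HT Hs. destruct (latv_norm tau HT) as (c & Hc & Hc').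
  assert (Hw' : 0 < Cmod w1) by (apply Cmod_gt_0; auto).
  set (c1 := s * Cmod w1 * c). assert (Hc1 : 0 < c1) by (unfold c1; repeat apply Rmult_lt_0_compat; auto).
  destruct (bsum_exp_Z2 c1 Hc1) as (K & HK). exists (exp (2 * c1) * K). intros z.
  set (v := (z / w1)%C). set (d := Im v / Im tau). set (a := Re v - d * Re tau).
  assert (Ev : v = (RtoC a + RtoC d * tau)%C).
  { unfold a, d. clearbody v. clear - HT. unfold Im, Re in *. apply injective_projections; simpl; field; lra. }
  destruct (archimed a) as (A1 & A2). destruct (archimed d) as (D1 & D2).
  apply bsum_le with (fun x => exp (2 * c1) * exp (- c1 * (Rabs (IZR (up a - fst x)) + Rabs (IZR (up d - snd x))))).
  - intros x. rewrite <- exp_plus. apply exp_mono.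
    replace (z - w1 * latv tau x)%C with (w1 * (v - latv tau x))%C by (unfold v; field; auto).
    rewrite Cmod_mult.
    replace (v - latv tau x)%C with (RtoC (a - IZR (fst x)) + RtoC (d - IZR (snd x)) * tau)%C.
    2:{ rewrite Ev. unfold latv. rewrite !RtoC_minus. ring. }
    specialize (Hc' (a - IZR (fst x)) (d - IZR (snd x))).
    rewrite !minus_IZR.
    assert (B1 : Rabs (IZR (up a) - IZR (fst x)) <= Rabs (a - IZR (fst x)) + 1).
    { replace (IZR (up a) - IZR (fst x)) with ((a - IZR (fst x)) + (IZR (up a) - a)) by ring.
      eapply Rle_trans; [apply Rabs_triang|]. rewrite (Rabs_pos_eq (IZR (up a) - a)); lra. }
    assert (B2 : Rabs (IZR (up d) - IZR (snd x)) <= Rabs (d - IZR (snd x)) + 1).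
    { replace (IZR (up d) - IZR (snd x)) with ((d - IZR (snd x)) + (IZR (up d) - d)) by ring.
      eapply Rle_trans; [apply Rabs_triang|]. rewrite (Rabs_pos_eq (IZR (up d) - d)); lra. }
    apply (Rmult_le_compat_l (s * Cmod w1)) in Hc'; [|apply Rmult_le_pos; lra].
    unfold c1 in *.
    set (p := Rabs (a - IZR (fst x))) in *. set (q := Rabs (d - IZR (snd x))) in *.
    set (u := s * Cmod w1 * c) in *. replace (s * Cmod w1 * (c * (p + q))) with (u * (p + q)) in Hc' by (unfold u; ring).
    assert (u * (Rabs (IZR (up a) - IZR (fst x)) + Rabs (IZR (up d) - IZR (snd x))) <= u * (p + q + 2)).
    { apply Rmult_le_compat_l; lra. }
    lra.
  - apply bsum_scal; [left; apply exp_pos|].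
    apply (bsum_inj (fun x : Z * Z => ((up a - fst x)%Z, (up d - snd x)%Z)) _ _) in HK; [exact HK|].
    intros [p q] [p' q'] E. simpl in E. injection E as E1 E2. f_equal; lia.
Qed.

(** Weighted Cauchy-Schwarz, from the nonnegativity in t of the sum of k (a - t)^2. *)
Lemma lsumR_cauchy {I} (l : list I) (a k : I -> R) : (forall i, 0 <= k i) ->
  lsumR l (fun i => a i * k i) * lsumR l (fun i => a i * k i) <= lsumR l (fun i => a i * a i * k i) * lsumR l k.
Proof.
  intros Hk. set (X := lsumR l (fun i => a i * a i * k i)). set (Y := lsumR l (fun i => a i * k i)). set (Z := lsumR l k).
  assert (HZ : 0 <= Z) by (apply lsumR_nonneg; auto).
  assert (Hq : forall t, 0 <= X - 2 * t * Y + t * t * Z).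
  { intros t. replace (X - 2 * t * Y + t * t * Z) with (lsumR l (fun i => (a i - t) * (a i - t) * k i)).
    - apply lsumR_nonneg. intros i _. apply Rmult_le_pos; auto. apply Rle_0_sqr.
    - unfold X, Y, Z. rewrite <- !lsumR_scal.
      replace (lsumR l (fun i => a i * a i * k i) - lsumR l (fun i => 2 * t * (a i * k i))) with
        (lsumR l (fun i => a i * a i * k i) + lsumR l (fun i => (-1) * (2 * t * (a i * k i)))).
      + rewrite <- !lsumR_plus. apply lsumR_ext. intros; ring.
      + rewrite lsumR_scal. ring. }
  destruct (Req_dec Z 0) as [HZ0|HZ0].
  - assert (Y = 0) as ->; [|rewrite HZ0; lra].
    (* For total weight 0 the quadratic is affine in t, and this t would give it the value -1. *)
    apply NNPP; intros HY. specialize (Hq ((X + 1) / (2 * Y))). rewrite HZ0 in Hq.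
    replace (X - 2 * ((X + 1) / (2 * Y)) * Y + (X + 1) / (2 * Y) * ((X + 1) / (2 * Y)) * 0) with (-1) in Hq by (field; auto). lra.
  - specialize (Hq (Y / Z)). replace (X - 2 * (Y / Z) * Y + Y / Z * (Y / Z) * Z) with (X - Y * Y / Z) in Hq by (field; auto).
    apply (Rmult_le_compat_r Z) in Hq; [|lra]. rewrite Rmult_0_l in Hq.
    replace ((X - Y * Y / Z) * Z) with (X * Z - Y * Y) in Hq by (field; auto). lra.
Qed.

Lemma gro_uniform kap0 (phi : nat -> C -> C) n : 0 < kap0 -> (forall k, gro kap0 (phi k)) ->
  exists k1 K, 0 <= k1 < kap0 /\ 0 <= K /\ forall k v, (k < n)%nat -> Cmod (phi k v) <= K * exp (k1 * (Cmod v * Cmod v)).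
Proof.
  intros H0 H. induction n as [|n (k1 & K1 & A1 & B1 & D1)].
  - exists 0, 0. split; [lra|]. split; [lra|]. intros; lia.
  - destruct (gro_K _ _ (H n)) as (k2 & K2 & A2 & B2 & D2). exists (Rmax k1 k2), (K1 + K2).
    split. { split; [eapply Rle_trans; [|apply Rmax_l]; lra | apply Rmax_lub_lt; lra]. }
    split; [lra|]. intros k v Hk.
    assert (0 <= Cmod v * Cmod v) by apply Rle_0_sqr.
    assert (E1 : exp (k1 * (Cmod v * Cmod v)) <= exp (Rmax k1 k2 * (Cmod v * Cmod v))).
    { apply exp_mono. apply Rmult_le_compat_r; auto. apply Rmax_l. }
    assert (E2 : exp (k2 * (Cmod v * Cmod v)) <= exp (Rmax k1 k2 * (Cmod v * Cmod v))).
    { apply exp_mono. apply Rmult_le_compat_r; auto. apply Rmax_r. }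
    pose proof (exp_pos (k1 * (Cmod v * Cmod v))). pose proof (exp_pos (k2 * (Cmod v * Cmod v))).
    destruct (Nat.eq_dec k n) as [->|Hne].
    + specialize (D2 v). nra.
    + specialize (D1 k v ltac:(lia)). nra.
Qed.

Lemma one_plus_pow_exp x k n : 0 <= x -> (k <= n)%nat -> (1 + x) ^ k <= exp (INR n * x).
Proof.
  intros Hx Hk. apply Rle_trans with ((1 + x) ^ n); [apply Rle_pow; [lra|auto]|].
  rewrite <- exp_pow. apply pow_incr. pose proof (exp_ineq1_le x). lra.
Qed.

(** [E x z] times [GZ (z - lam x)] is the Fock translate of the function of [exists_G]. Multiplied
    by exp(-pi |z|^2 / 2), its modulus is that of GZ(u) exp(-pi |u|^2 / 2) at u = z - lam x, and
    this decays exponentially because the growth rate [kap] is strictly below pi / 2. Cauchy-Schwarz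
    with the kernel [ker], as in Schur's test, bounds the Fock norm of the superposition by the l^2
    norm of the data. *)
Lemma sufficiency n (w1 tau : C) : (1 <= n)%nat -> w1 <> RtoC 0 -> 0 < Im tau ->
  1 < INR n * (Cmod w1 * Cmod w1) * Im tau ->
  forall alpha : Z * Z -> C, (exists M, bsum (fun x => Cmod (alpha x) * Cmod (alpha x)) M) ->
  exists F, in_polyFock n F /\ forall x, (RtoC (exp (- (PI / 2) * Cnorm2 (w1 * latv tau x)%C)) * F (w1 * latv tau x) = alpha x)%C.
Proof.
  intros Hn Hw HT HD alpha (Ma & HMa).
  set (w0 := Cmod w1) in *. assert (Hw0 : 0 < w0) by (apply Cmod_gt_0; auto).
  set (A := w0 * w0) in *. assert (HA : 0 < A) by (unfold A; nra).
  assert (HN : 0 < INR n) by (apply lt_0_INR; lia). pose proof PI_RGT_0 as HPI.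
  set (kap0 := PI * A / 2). assert (Hk0 : 0 < kap0) by (unfold kap0; nra).
  assert (Hk : PI / (2 * INR n * Im tau) < kap0).
  { unfold kap0. apply (Rmult_lt_reg_r (2 * INR n * Im tau)); [nra|].
    unfold Rdiv at 1. rewrite Rmult_assoc, Rinv_l by nra. nra. }
  destruct (exists_G n tau kap0 Hn HT Hk) as (G & (phi & P1 & P2 & P3) & G0 & GL).
  destruct (gro_uniform kap0 phi n Hk0 P1) as (k1 & K1 & Hk1 & HK1 & Hphi).
  (* The substitution v = z / w1 divides the growth rate by A = |w1|^2. *)
  set (kap := k1 / A). assert (Hkap : 0 <= kap < PI / 2).
  { unfold kap. split; [apply Rdiv_le_0_compat; lra|]. apply (Rmult_lt_reg_r A); auto.
    unfold Rdiv at 1. rewrite Rmult_assoc, Rinv_l by lra. unfold kap0 in Hk1. lra. }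
  set (lam := fun x => (w1 * latv tau x)%C).
  set (GZ := fun z => G (z / w1)%C).
  set (gam := fun k z => ((/ Cconj w1) ^ k * phi k (z / w1))%C).
  set (K2 := exp (INR n * / w0) * K1).
  assert (HK2 : 0 <= K2). { apply Rmult_le_pos; auto. left; apply exp_pos. }
  assert (Hcw : Cconj w1 <> RtoC 0). { apply Cmod_gt_0. rewrite Cmod_conj. auto. }
  assert (Hgam : forall k z, (k < n)%nat -> Cmod (gam k z) <= K2 * exp (kap * (Cmod z * Cmod z))).
  { intros k z Hkn. unfold gam. rewrite Cmod_mult, Cmod_pow, Cmod_inv, Cmod_conj by auto. fold w0.
    specialize (Hphi k (z / w1)%C Hkn). rewrite Cmod_div in Hphi by auto. fold w0 in Hphi.
    replace (k1 * (Cmod z / w0 * (Cmod z / w0))) with (kap * (Cmod z * Cmod z)) in Hphi by (unfold kap, A; field; lra).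
    unfold K2. rewrite Rmult_assoc. apply Rmult_le_compat; auto; [apply pow_le; left; apply Rinv_0_lt_compat; auto | apply Cmod_ge_0|].
    assert (0 < / w0) by (apply Rinv_0_lt_compat; auto).
    apply Rle_trans with ((1 + / w0) ^ k); [apply pow_incr; lra|]. apply one_plus_pow_exp; [lra|lia]. }
  assert (Hgent : forall k, ent (gam k)).
  { intros k. unfold gam. apply ent_mult; [apply ent_const|].
    apply (ent_comp (fun z => z / w1)%C (phi k)); [|apply P1]. apply (ent_mult (fun z => z) (fun _ => / w1)%C); [apply ent_id | apply ent_const]. }
  assert (HGZ : forall z, GZ z = lsum (seq 0 n) (fun k => Cconj z ^ k * gam k z)%C).
  { intros z. unfold GZ. rewrite P3. apply lsum_ext. intros k _. unfold gam.
    rewrite Cdiv_conj by auto. unfold Cdiv. rewrite Cpow_mult_l. ring. }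
  destruct (choice _ pow_sub_expand) as (Bc & HBc).
  set (E := fun x z => Cexp (RtoC PI * z * Cconj (lam x) - RtoC (PI / 2 * (Cmod (lam x) * Cmod (lam x))))%C).
  assert (HE : forall x z, Cmod (E x z) = exp (PI * Re (z * Cconj (lam x))%C - PI / 2 * (Cmod (lam x) * Cmod (lam x)))).
  { intros x z. unfold E. rewrite Cmod_Cexp. f_equal. unfold Re, Cmult, Cminus, Cplus, Copp, RtoC; simpl. ring. }
  assert (Hal : forall x, Cmod (alpha x) <= 1 + Ma).
  { intros x. pose proof (bsum_term _ _ x HMa) as Hx. simpl in Hx. pose proof (Cmod_ge_0 (alpha x)). nra. }
  assert (HMa0 : 0 <= Ma) by (apply (bsum_ge0 _ _ HMa)).
  (* Powers of the conjugate of z - lam x are expanded in powers of the conjugate of z. The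
     coefficient of the i-th power is a sum over the lattice of entire functions, so the
     superposition stays polyanalytic of order n. *)
  set (tm := fun i x z => (alpha x * (E x z * lsum (seq 0 n) (fun k => Bc k i (Cconj (lam x)) * gam k (z - lam x))))%C).
  destruct (bsum_lattice w1 tau 1 Hw HT Rlt_0_1) as (KL & HKL).
  assert (Htm : forall i, ent (fun z => gsum (fun x => tm i x z)) /\ (forall z, HS (fun x => tm i x z) (gsum (fun x => tm i x z)))).
  { intros i. apply (ent_gsum (fun x z => tm i x z)).
    - intros x. unfold tm, E. apply ent_mult; [apply ent_const|]. apply ent_mult.
      + apply ent_exp. apply ent_minus; [|apply ent_const]. apply ent_mult; [apply ent_mult; [apply ent_const|apply ent_id]|apply ent_const].
      + apply ent_lsum. intros k _. apply ent_mult; [apply ent_const|].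
        apply (ent_comp (fun z => z - lam x)%C (gam k)); auto. apply ent_minus; [apply ent_id|apply ent_const].
    - intros r0. set (r := Rmax r0 0). assert (Hr : 0 <= r) by apply Rmax_r.
      destruct (gauss_le_exp (PI / 2 - kap) (PI * r + INR n + 2 * kap * r) ltac:(lra)) as (K3 & HK3 & HK3').
      set (Cst := (1 + Ma) * (INR n * K2 * exp (kap * (r * r))) * K3).
      exists (fun x => Cst * exp (- (1) * Cmod (RtoC 0 - w1 * latv tau x))), (Cst * KL). split.
      + intros x z Hz. assert (Hzr : Cmod z <= r) by (eapply Rle_trans; [apply Hz | apply Rmax_l]).
        replace (RtoC 0 - w1 * latv tau x)%C with (- lam x)%C by (unfold lam; ring). rewrite Cmod_opp.
        set (L := Cmod (lam x)). assert (HL : 0 <= L) by apply Cmod_ge_0.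
        unfold tm. rewrite !Cmod_mult, HE. fold L.
        assert (HRe : Re (z * Cconj (lam x))%C <= r * L).
        { eapply Rle_trans; [apply Re_le_Cmod|]. rewrite Cmod_mult, Cmod_conj. fold L. apply Rmult_le_compat_r; auto. }
        assert (HS1 : Cmod (lsum (seq 0 n) (fun k => Bc k i (Cconj (lam x)) * gam k (z - lam x))%C) <=
           INR n * (exp (INR n * L) * (K2 * exp (kap * ((r + L) * (r + L)))))).
        { eapply Rle_trans; [apply lsum_Cmod|].
          replace (INR n) with (INR (length (seq 0 n))) at 1 by (rewrite length_seq; auto).
          rewrite <- lsumR_const. apply lsumR_le. intros k Hkn. apply in_seq in Hkn.
          rewrite Cmod_mult. apply Rmult_le_compat; try apply Cmod_ge_0.
          - eapply Rle_trans; [apply (HBc k)|]. rewrite Cmod_conj. fold L. apply one_plus_pow_exp; [auto|lia].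
          - eapply Rle_trans; [apply Hgam; lia|]. apply Rmult_le_compat_l; auto. apply exp_mono.
            apply Rmult_le_compat_l; [lra|].
            assert (Cmod (z - lam x) <= r + L).
            { unfold Cminus. eapply Rle_trans; [apply Cmod_triangle|]. rewrite Cmod_opp. fold L. lra. }
            pose proof (Cmod_ge_0 (z - lam x)). nra. }
        apply Rle_trans with ((1 + Ma) * (exp (PI * (r * L) - PI / 2 * (L * L)) * (INR n * (exp (INR n * L) * (K2 * exp (kap * ((r + L) * (r + L)))))))).
        * apply Rmult_le_compat; auto; [apply Cmod_ge_0 | apply Rmult_le_pos; [left; apply exp_pos|apply Cmod_ge_0] |].
          apply Rmult_le_compat; auto; [left; apply exp_pos | apply Cmod_ge_0 |].
          apply exp_mono. nra.
        * specialize (HK3' L). unfold Cst.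
          apply Rle_trans with ((1 + Ma) * (INR n * K2 * exp (kap * (r * r))) * exp (- (PI / 2 - kap) * (L * L) + (PI * r + INR n + 2 * kap * r) * L)).
          -- right.
             transitivity ((1 + Ma) * INR n * K2 * (exp (PI * (r * L) - PI / 2 * (L * L)) * exp (INR n * L) * exp (kap * ((r + L) * (r + L))))); [ring|].
             rewrite <- !exp_plus.
             transitivity ((1 + Ma) * INR n * K2 * (exp (kap * (r * r)) * exp (- (PI / 2 - kap) * (L * L) + (PI * r + INR n + 2 * kap * r) * L))); [|ring].
             rewrite <- exp_plus. f_equal. f_equal. ring.
          -- replace (- (1) * L) with (- L) by ring. rewrite (Rmult_assoc _ K3). apply Rmult_le_compat_l; auto.
             apply Rmult_le_pos; [lra|]. apply Rmult_le_pos; [nra|left; apply exp_pos].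
      + apply bsum_scal; auto. unfold Cst. apply Rmult_le_pos; [|lra]. apply Rmult_le_pos; [lra|].
        apply Rmult_le_pos; [nra|left; apply exp_pos]. }
  set (F := fun z => lsum (seq 0 n) (fun i => Cconj z ^ i * gsum (fun x => tm i x z))%C).
  assert (HF : forall z, HS (fun x => alpha x * (E x z * GZ (z - lam x)))%C (F z)).
  { intros z. apply (HS_ext (fun x => lsum (seq 0 n) (fun i => Cconj z ^ i * tm i x z)%C)).
    - intros x. unfold tm. rewrite HGZ.
      transitivity (alpha x * (E x z * lsum (seq 0 n) (fun i => Cconj z ^ i * lsum (seq 0 n) (fun k => Bc k i (Cconj (lam x)) * gam k (z - lam x)))))%C.
      { rewrite <- lsum_scal, <- lsum_scal. apply lsum_ext. intros; ring. }
      f_equal. f_equal.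
      transitivity (lsum (seq 0 n) (fun k => lsum (seq 0 n) (fun i => Cconj z ^ i * (Bc k i (Cconj (lam x)) * gam k (z - lam x)))))%C.
      + assert (Hswap : forall (l l' : list nat) (f : nat -> nat -> C), lsum l (fun i => lsum l' (f i)) = lsum l' (fun j => lsum l (fun i => f i j))).
        { induction l as [|a l IH]; intros l' f; simpl; [rewrite lsum_zero; auto|]. rewrite IH, <- lsum_plus. auto. }
        rewrite <- Hswap. apply lsum_ext. intros i _. rewrite lsum_scal. auto.
      + apply lsum_ext. intros k Hkn. apply in_seq in Hkn. rewrite Cminus_conj.
        destruct (HBc k) as (_ & _ & H3). rewrite (H3 n) by lia.
        rewrite (Cmult_comm (lsum _ _)), <- lsum_scal. apply lsum_ext. intros; ring.
    - apply HS_lsum. intros i _. apply HS_scal. apply Htm. }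
  exists F. split.
  2:{ intros x0. fold (lam x0). rewrite Cnorm2_Cmod. set (L2 := Cmod (lam x0) * Cmod (lam x0)).
    assert (HF0 : HS (fun x => alpha x * (E x (lam x0) * GZ (lam x0 - lam x)))%C (alpha x0 * E x0 (lam x0))%C).
    { replace (alpha x0 * E x0 (lam x0))%C with (lsum [x0] (fun x => alpha x * (E x (lam x0) * GZ (lam x0 - lam x)))%C).
      - apply HS_finite; [constructor; [simpl; tauto | constructor]|].
        intros x Hx. assert (GZ (lam x0 - lam x)%C = RtoC 0) as ->; [|ring].
        unfold GZ. replace ((lam x0 - lam x) / w1)%C with (RtoC (IZR (fst x0 - fst x)) + RtoC (IZR (snd x0 - snd x)) * tau)%C.
        + apply GL. destruct x0 as [p q], x as [p' q']. simpl in *.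
          destruct (Z.eq_dec p p') as [->|]; [|left; lia]. destruct (Z.eq_dec q q') as [->|]; [|right; lia].
          exfalso; apply Hx; auto.
        + unfold lam, latv. rewrite !minus_IZR, !RtoC_minus. field. auto.
      - simpl. unfold GZ. replace ((lam x0 - lam x0) / w1)%C with (RtoC 0) by (field; auto). rewrite G0. ring. }
    rewrite (HS_unique _ _ _ (HF (lam x0)) HF0).
    assert (EE : (RtoC (exp (- (PI / 2) * L2)) * E x0 (lam x0))%C = RtoC 1).
    { unfold E. fold L2. rewrite <- Cexp_real, <- Cexp_plus, <- Cexp_0. f_equal.
      replace (RtoC PI * lam x0 * Cconj (lam x0))%C with (RtoC (PI * L2)).
      { rewrite <- RtoC_minus, <- RtoC_plus. f_equal. unfold L2. field. }
      rewrite <- Cmult_assoc, <- Cmod2_conj, RtoC_mult. f_equal. unfold L2. f_equal; ring. }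
    transitivity (alpha x0 * (RtoC (exp (- (PI / 2) * L2)) * E x0 (lam x0)))%C; [ring|]. rewrite EE. ring. }
  split.
  { exists (fun i z => gsum (fun x => tm i x z)). split.
    - intros i _. apply ent_entire. apply Htm.
    - intros z. rewrite csum_lsum. unfold F. apply lsum_ext. intros i _. rewrite <- Cpow_Defs. reflexivity. }
  (* The extra 1 in the linear term improves the decay from exp(-|u|) to exp(-2 |u|), which splits
     into one factor exp(-|.|) per coordinate in the Riemann sums. *)
  destruct (gauss_le_exp (PI / 2 - kap) (INR n + 1) ltac:(lra)) as (K3 & HK3 & HK3').
  set (K4 := INR n * K2 * K3). assert (HK4 : 0 <= K4) by (unfold K4; apply Rmult_le_pos; [nra|lra]).
  set (ker := fun z x => K4 * exp (- (2) * Cmod (z - w1 * latv tau x))).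
  assert (Hker0 : forall z x, 0 <= ker z x) by (intros; apply Rmult_le_pos; [auto|left; apply exp_pos]).
  assert (HGk : forall u, Cmod (GZ u) * exp (- (PI / 2) * (Cmod u * Cmod u)) <= K4 * exp (- (2) * Cmod u)).
  { intros u. set (L := Cmod u). assert (HL : 0 <= L) by apply Cmod_ge_0.
    assert (H1 : Cmod (GZ u) <= INR n * (exp (INR n * L) * (K2 * exp (kap * (L * L))))).
    { rewrite HGZ. eapply Rle_trans; [apply lsum_Cmod|].
      replace (INR n) with (INR (length (seq 0 n))) at 1 by (rewrite length_seq; auto).
      rewrite <- lsumR_const. apply lsumR_le. intros k Hkn. apply in_seq in Hkn.
      rewrite Cmod_mult, Cmod_pow, Cmod_conj. fold L. apply Rmult_le_compat; try apply Cmod_ge_0.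
      - apply pow_le; auto.
      - apply Rle_trans with ((1 + L) ^ k); [apply pow_incr; lra|]. apply one_plus_pow_exp; [auto|lia].
      - apply Hgam; lia. }
    specialize (HK3' L).
    apply Rle_trans with (INR n * (exp (INR n * L) * (K2 * exp (kap * (L * L)))) * exp (- (PI / 2) * (L * L))).
    { apply Rmult_le_compat_r; auto. left; apply exp_pos. }
    apply Rle_trans with (INR n * K2 * (exp (- (PI / 2 - kap) * (L * L) + (INR n + 1) * L) * exp (- L))).
    { right. transitivity (INR n * K2 * (exp (INR n * L) * exp (kap * (L * L)) * exp (- (PI / 2) * (L * L)))); [ring|].
      rewrite <- !exp_plus. f_equal. f_equal. ring. }
    unfold K4. rewrite !Rmult_assoc. apply Rmult_le_compat_l; [lra|]. apply Rmult_le_compat_l; auto.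
    replace (K3 * exp (- (2) * L)) with (K3 * exp (- L) * exp (- L)).
    { apply Rmult_le_compat_r; auto. left; apply exp_pos. }
    replace (- (2) * L) with (- L + - L) by ring. rewrite exp_plus. ring. }
  destruct (bsum_lattice w1 tau 2 Hw HT Rlt_0_2) as (K5 & HK5).
  assert (Hker : forall z, bsum (ker z) (K4 * K5)) by (intros z; apply bsum_scal; auto).
  assert (HX : forall z, exists X, HS (fun x => RtoC (Cmod (alpha x) * Cmod (alpha x) * ker z x)) (RtoC X)).
  { intros z. apply (HS_exists_pos _ ((1 + Ma) * (1 + Ma) * (K4 * K5))).
    - intros x. apply Rmult_le_pos; auto. apply Rle_0_sqr.
    - apply bsum_le with (fun x => (1 + Ma) * (1 + Ma) * ker z x).
      + intros x. apply Rmult_le_compat_r; auto. pose proof (Hal x). pose proof (Cmod_ge_0 (alpha x)). nra.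
      + apply bsum_scal; auto. nra. }
  destruct (choice _ HX) as (X & HX').
  assert (HXb : forall z, bsum (fun x => Cmod (alpha x) * Cmod (alpha x) * ker z x) (X z)).
  { intros z. apply HS_pos_bsum; auto. intros x. apply Rmult_le_pos; auto. apply Rle_0_sqr. }
  assert (HFX : forall z, Cnorm2 (F z) * exp (- PI * Cnorm2 z) <= K4 * K5 * X z).
  { intros z. rewrite !Cnorm2_Cmod. set (wz := exp (- (PI / 2) * (Cmod z * Cmod z))).
    assert (Ew : exp (- PI * (Cmod z * Cmod z)) = wz * wz) by (unfold wz; rewrite <- exp_plus; f_equal; field).
    assert (Hwz : 0 < wz) by apply exp_pos.
    assert (HX0 : 0 <= X z) by (apply (bsum_ge0 _ _ (HXb z))).
    assert (HK50 : 0 <= K4 * K5) by (apply (bsum_ge0 _ _ (Hker z))).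
    assert (B : Cmod (RtoC wz * F z) <= sqrt (X z * (K4 * K5))).
    { eapply HS_bound; [apply HS_scal, (HF z)|].
      intros l Hl. apply Rle_trans with (lsumR l (fun x => Cmod (alpha x) * ker z x)).
      - apply lsumR_le. intros x _. rewrite !Cmod_mult, Cmod_R, Rabs_pos_eq, HE by lra.
        specialize (HGk (z - lam x)%C).
        set (g := Cmod (GZ (z - lam x)%C)) in *.
        assert (Ee : wz * exp (PI * Re (z * Cconj (lam x))%C - PI / 2 * (Cmod (lam x) * Cmod (lam x))) = exp (- (PI / 2) * (Cmod (z - lam x)%C * Cmod (z - lam x)%C))).
        { unfold wz. rewrite <- exp_plus. f_equal. rewrite !Cmod_sqr. unfold Re; simpl. field. }
        replace (wz * (Cmod (alpha x) * (exp (PI * Re (z * Cconj (lam x))%C - PI / 2 * (Cmod (lam x) * Cmod (lam x))) * g))) with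
          (Cmod (alpha x) * (g * (wz * exp (PI * Re (z * Cconj (lam x))%C - PI / 2 * (Cmod (lam x) * Cmod (lam x)))))) by ring.
        rewrite Ee. apply Rmult_le_compat_l; [apply Cmod_ge_0|]. apply HGk.
      - apply Rsqr_incr_0_var; [|apply sqrt_pos]. rewrite Rsqr_sqrt by (apply Rmult_le_pos; auto). unfold Rsqr.
        eapply Rle_trans; [apply lsumR_cauchy; auto|].
        apply Rmult_le_compat; [| |apply HXb; auto | apply Hker; auto].
        + apply lsumR_nonneg. intros; apply Rmult_le_pos; auto. apply Rle_0_sqr.
        + apply lsumR_nonneg; auto. }
    rewrite Cmod_mult, Cmod_R, Rabs_pos_eq in B by lra. rewrite Ew.
    replace (Cmod (F z) * Cmod (F z) * (wz * wz)) with ((wz * Cmod (F z)) * (wz * Cmod (F z))) by ring.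
    replace (K4 * K5 * X z) with (sqrt (X z * (K4 * K5)) * sqrt (X z * (K4 * K5))).
    2:{ rewrite sqrt_sqrt; [ring|]. apply Rmult_le_pos; auto. }
    assert (0 <= wz * Cmod (F z)) by (apply Rmult_le_pos; [lra|apply Cmod_ge_0]).
    apply Rmult_le_compat; auto. }
  assert (HK50 : 0 <= K4 * K5) by (apply (bsum_ge0 _ _ (Hker (RtoC 0)))).
  (* The 16 is the product of the bounds 4 of [riemann_exp] in the two coordinates. *)
  apply (finite_integral_of_riemann _ (K4 * K5 * (16 * K4 * Ma))). intros x0 h N Hh.
  set (p := fun i j : nat => ((x0 + INR i * h)%R, (x0 + INR j * h)%R) : C).
  apply Rle_trans with (K4 * K5 * lsumR (seq 0 N) (fun i => lsumR (seq 0 N) (fun j => (h * h) * X (p i j)))).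
  { rewrite <- lsumR_scal. apply lsumR_le. intros i _. rewrite <- lsumR_scal. apply lsumR_le. intros j _.
    fold (p i j). specialize (HFX (p i j)). assert (0 <= h * h) by nra. nra. }
  apply Rmult_le_compat_l; auto.
  assert (HXs : HS (fun x => lsum (seq 0 N) (fun i => lsum (seq 0 N) (fun j => RtoC (h * h) * RtoC (Cmod (alpha x) * Cmod (alpha x) * ker (p i j) x)))%C)
     (lsum (seq 0 N) (fun i => lsum (seq 0 N) (fun j => RtoC (h * h) * RtoC (X (p i j))))%C)).
  { apply HS_lsum. intros i _. apply HS_lsum. intros j _. apply HS_scal. apply HX'. }
  assert (Econv : forall Y : nat -> nat -> R, lsum (seq 0 N) (fun i => lsum (seq 0 N) (fun j => RtoC (h * h) * RtoC (Y i j)))%C =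
     RtoC (lsumR (seq 0 N) (fun i => lsumR (seq 0 N) (fun j => h * h * Y i j)))).
  { intros Y. rewrite <- lsum_RtoC. apply lsum_ext. intros i _. rewrite <- lsum_RtoC. apply lsum_ext. intros j _.
    rewrite <- RtoC_mult. auto. }
  rewrite (Econv (fun i j => X (p i j))) in HXs.
  apply (HS_bound _ _ (16 * K4 * Ma)) in HXs.
  { rewrite Cmod_R in HXs. eapply Rle_trans; [apply Rle_abs | apply HXs]. }
  apply bsum_le with (fun x => 16 * K4 * (Cmod (alpha x) * Cmod (alpha x))); [|apply bsum_scal; auto; lra].
  intros x. rewrite (Econv (fun i j => Cmod (alpha x) * Cmod (alpha x) * ker (p i j) x)), Cmod_R.
  set (a2 := Cmod (alpha x) * Cmod (alpha x)). assert (Ha2 : 0 <= a2) by apply Rle_0_sqr.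
  rewrite Rabs_pos_eq.
  2:{ apply lsumR_nonneg. intros i _. apply lsumR_nonneg. intros j _. apply Rmult_le_pos; [nra|]. apply Rmult_le_pos; auto. }
  apply Rle_trans with (lsumR (seq 0 N) (fun i => (a2 * K4 * (h * exp (- Rabs (x0 - fst (lam x) + INR i * h)))) *
     lsumR (seq 0 N) (fun j => h * exp (- Rabs (x0 - snd (lam x) + INR j * h))))).
  { apply lsumR_le. intros i _. rewrite <- lsumR_scal. apply lsumR_le. intros j _.
    unfold ker. fold (lam x).
    assert (exp (- (2) * Cmod (p i j - lam x)%C) <= exp (- Rabs (x0 - fst (lam x) + INR i * h)) * exp (- Rabs (x0 - snd (lam x) + INR j * h))).
    { rewrite <- exp_plus. apply exp_mono.
      pose proof (fst_le_Cmod (p i j - lam x)%C) as F1. pose proof (snd_le_Cmod (p i j - lam x)%C) as F2.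
      change (fst (p i j - lam x)%C) with (x0 + INR i * h - fst (lam x)) in F1.
      change (snd (p i j - lam x)%C) with (x0 + INR j * h - snd (lam x)) in F2.
      replace (x0 + INR i * h - fst (lam x)) with (x0 - fst (lam x) + INR i * h) in F1 by ring.
      replace (x0 + INR j * h - snd (lam x)) with (x0 - snd (lam x) + INR j * h) in F2 by ring.
      lra. }
    assert (0 <= h * h * (a2 * K4)) by (apply Rmult_le_pos; [nra | apply Rmult_le_pos; auto]).
    apply (Rmult_le_compat_l (h * h * (a2 * K4))) in H; auto. lra. }
  pose proof (riemann_exp (x0 - fst (lam x)) h N Hh) as R1. pose proof (riemann_exp (x0 - snd (lam x)) h N Hh) as R2.
  set (S2 := lsumR (seq 0 N) (fun j => h * exp (- Rabs (x0 - snd (lam x) + INR j * h)))) in *.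
  assert (HS2 : 0 <= S2). { apply lsumR_nonneg. intros j _. apply Rmult_le_pos; [lra|left; apply exp_pos]. }
  rewrite (lsumR_ext _ _ (fun i => (a2 * K4 * S2) * (h * exp (- Rabs (x0 - fst (lam x) + INR i * h))))) by (intros; ring).
  rewrite lsumR_scal.
  set (S1 := lsumR (seq 0 N) (fun i => h * exp (- Rabs (x0 - fst (lam x) + INR i * h)))) in *.
  assert (HS1 : 0 <= S1). { apply lsumR_nonneg. intros j _. apply Rmult_le_pos; [lra|left; apply exp_pos]. }
  assert (S2 * S1 <= 16) by nra. assert (0 <= a2 * K4) by (apply Rmult_le_pos; auto). nra.
Qed.

(** * Local mean-square estimates *)
Lemma lsumR_single {I} (l : list I) (g : I -> R) s0 : NoDup l -> In s0 l ->
  (forall s, In s l -> s <> s0 -> g s = 0) -> lsumR l g = g s0.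
Proof.
  induction l as [|a l IH]; intros ND Hin H; [destruct Hin|].
  inversion ND as [|? ? Ha ND']; subst. simpl. destruct Hin as [->|Hin].
  - rewrite (lsumR_ext l g (fun _ => 0)); [rewrite lsumR_const; ring|].
    intros i Hi. apply H; [right; auto|]. intros ->; auto.
  - rewrite IH; auto; [|intros; apply H; [right|]; auto]. rewrite H; [ring|left; auto|]. intros ->; auto.
Qed.

Lemma nat_cell N : forall t, 0 <= t < INR N -> exists i, (i < N)%nat /\ INR i <= t < INR i + 1.
Proof.
  induction N as [|N IH]; intros t Ht; [simpl in Ht; lra|]. rewrite S_INR in Ht.
  destruct (Rlt_dec t (INR N)) as [H|H].
  - destruct (IH t) as (i & Hi & Hi'); [lra|]. exists i. split; [lia|auto].
  - exists N. split; [lia|lra].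
Qed.

Lemma darboux_points {I} (f : C -> R) M :
  (forall (a : R) (N : nat) (c : nat -> nat -> R), 0 < a ->
    (forall (i j : nat) (x y : R), (i < N)%nat -> (j < N)%nat ->
        -a + INR i * (2 * a / INR N) <= x <= -a + INR (S i) * (2 * a / INR N) ->
        -a + INR j * (2 * a / INR N) <= y <= -a + INR (S j) * (2 * a / INR N) ->
        c i j <= f (x, y)) ->
    rsum N (fun i => rsum N (fun j => c i j * ((2 * a / INR N) * (2 * a / INR N)))) <= M) ->
  (forall z, 0 <= f z) ->
  forall (l : list I) (pt : I -> C) (a : R) (N : nat) (dl : R), 0 < a -> (0 < N)%nat -> NoDup l ->
  (forall i, In i l -> - a <= fst (pt i) < a /\ - a <= snd (pt i) < a) ->
  (forall i j, In i l -> In j l -> Rabs (fst (pt i) - fst (pt j)) < 2 * a / INR N ->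
     Rabs (snd (pt i) - snd (pt j)) < 2 * a / INR N -> i = j) ->
  (forall i (q : C), In i l -> Rabs (fst q - fst (pt i)) <= 2 * a / INR N -> Rabs (snd q - snd (pt i)) <= 2 * a / INR N ->
     f (pt i) - dl <= f q) ->
  lsumR l (fun i => (f (pt i) - dl) * ((2 * a / INR N) * (2 * a / INR N))) <= M.
Proof.
  intros HM Hf l pt a N dl Ha HN ND Hbox Hsep Huc.
  assert (HN' : 0 < INR N) by (apply lt_0_INR; auto).
  set (h := 2 * a / INR N) in *. assert (Hh : 0 < h) by (unfold h; apply Rdiv_lt_0_compat; lra).
  assert (Hcell : forall x, - a <= x < a -> exists i, (i < N)%nat /\ - a + INR i * h <= x < - a + INR i * h + h).
  { intros x Hx. destruct (nat_cell N ((x + a) / h)) as (i & Hi & Hi').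
    - split; [apply Rdiv_le_0_compat; lra|]. apply (Rmult_lt_reg_r h); auto.
      unfold Rdiv. rewrite Rmult_assoc, Rinv_l by lra. unfold h.
      replace (INR N * (2 * a / INR N)) with (2 * a) by (field; lra). lra.
    - exists i. split; auto. assert (E : (x + a) / h * h = x + a) by (field; lra).
      destruct Hi' as [H1 H2]. apply (Rmult_le_compat_r h) in H1; [|lra]. apply (Rmult_lt_compat_r h) in H2; auto. lra. }
  assert (Hch : forall i, exists p : nat * nat, In i l -> (fst p < N)%nat /\ (snd p < N)%nat /\
     - a + INR (fst p) * h <= fst (pt i) < - a + INR (fst p) * h + h /\
     - a + INR (snd p) * h <= snd (pt i) < - a + INR (snd p) * h + h).
  { intros i. destruct (classic (In i l)) as [Hi|Hi]; [|exists (O, O); tauto].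
    destruct (Hbox i Hi) as [H1 H2]. destruct (Hcell _ H1) as (p & Hp1 & Hp2). destruct (Hcell _ H2) as (q & Hq1 & Hq2).
    exists (p, q). intros _. simpl. tauto. }
  destruct (choice _ Hch) as (cl & Hcl).
  set (g := fun i j s => if Nat.eq_dec (fst (cl s)) i then if Nat.eq_dec (snd (cl s)) j then f (pt s) - dl else 0 else 0).
  assert (Hc : forall (i j : nat) (x y : R), (i < N)%nat -> (j < N)%nat ->
        -a + INR i * h <= x <= -a + INR (S i) * h -> -a + INR j * h <= y <= -a + INR (S j) * h ->
        lsumR l (g i j) <= f (x, y)).
  { intros i j x y Hi Hj Hx Hy. rewrite S_INR in Hx, Hy.
    destruct (classic (exists s, In s l /\ fst (cl s) = i /\ snd (cl s) = j)) as [(s & Hs & E1 & E2)|Hno].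
    - rewrite (lsumR_single l (g i j) s); auto.
      + unfold g. rewrite E1, E2. destruct (Nat.eq_dec i i); [|tauto]. destruct (Nat.eq_dec j j); [|tauto].
        destruct (Hcl s Hs) as (_ & _ & B1 & B2). rewrite E1 in B1. rewrite E2 in B2.
        apply Huc; auto; apply Rabs_le; simpl; lra.
      + intros s' Hs' Hne. unfold g. destruct (Nat.eq_dec _ _) as [F1|]; auto. destruct (Nat.eq_dec _ _) as [F2|]; auto.
        exfalso. apply Hne. destruct (Hcl s Hs) as (_ & _ & B1 & B2). destruct (Hcl s' Hs') as (_ & _ & B3 & B4).
        rewrite E1 in B1. rewrite E2 in B2. rewrite F1 in B3. rewrite F2 in B4.
        apply Hsep; auto; apply Rabs_def1; lra.
    - rewrite (lsumR_ext l _ (fun _ => 0)); [rewrite lsumR_const; rewrite Rmult_0_r; auto|].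
      intros s Hs. unfold g. destruct (Nat.eq_dec _ _) as [F1|]; auto. destruct (Nat.eq_dec _ _) as [F2|]; auto.
      exfalso. apply Hno. exists s. auto. }
  specialize (HM a N (fun i j => lsumR l (g i j)) Ha Hc). fold h in HM.
  eapply Rle_trans; [|apply HM]. right. rewrite rsum_lsumR.
  transitivity (lsumR (seq 0 N) (fun i => lsumR l (fun s => lsumR (seq 0 N) (fun j => g i j s * (h * h))))).
  - rewrite <- lsumR_swap. apply lsumR_ext. intros s Hs. destruct (Hcl s Hs) as (B1 & B2 & _).
    rewrite (lsumR_single (seq 0 N) _ (fst (cl s))); [|apply seq_NoDup|apply in_seq; lia|].
    + rewrite (lsumR_single (seq 0 N) _ (snd (cl s))); [|apply seq_NoDup|apply in_seq; lia|].
      * unfold g. destruct (Nat.eq_dec _ _); [|tauto]. destruct (Nat.eq_dec _ _); [|tauto]. auto.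
      * intros j _ Hj. unfold g. destruct (Nat.eq_dec _ _); [|tauto]. destruct (Nat.eq_dec _ _); [congruence|ring].
    + intros i _ Hi. rewrite (lsumR_ext _ _ (fun _ => 0)); [rewrite lsumR_const; ring|]. intros j _.
      unfold g. destruct (Nat.eq_dec _ _); [congruence|ring].
  - apply lsumR_ext. intros i _. rewrite rsum_lsumR. rewrite <- lsumR_swap. apply lsumR_ext. intros j _.
    rewrite (lsumR_ext l _ (fun s => (h * h) * g i j s)) by (intros; ring). rewrite lsumR_scal. ring.
Qed.

(** The powers of this root of unity sum to 0, so some k-th power with k < N has nonpositive real
    part and distance at least 1 from 1. That distance is at most k times the distance of the root
    itself. *)
Lemma wN_sep N d : (0 < N)%nat -> (forall q, d <> (Z.of_nat N * q)%Z) -> / INR N <= Cmod (wN N d - 1).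
Proof.
  intros HN Hd. pose proof (root_sum N d HN Hd) as Hs. assert (HN' : 0 < INR N) by (apply lt_0_INR; auto).
  assert (Hk : exists k, (k < N)%nat /\ Re (wN N (d * Z.of_nat k)) <= 0).
  { apply NNPP. intros Hno.
    assert (Hp : forall k, (k < N)%nat -> 0 < Re (wN N (d * Z.of_nat k))).
    { intros k Hk. apply Rnot_le_lt. intros H. apply Hno. exists k. auto. }
    assert (Hre : forall m, Re (lsum (seq 0 m) (fun k => wN N (d * Z.of_nat k))) = lsumR (seq 0 m) (fun k => Re (wN N (d * Z.of_nat k)))).
    { induction m as [|m IH]; [reflexivity|]. rewrite lsum_seq_S, lsumR_seq_S, <- IH. reflexivity. }
    assert (Hpos : forall m, (m < N)%nat -> 0 < lsumR (seq 0 (S m)) (fun k => Re (wN N (d * Z.of_nat k)))).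
    { induction m as [|m IH]; intros Hm; rewrite lsumR_seq_S; [simpl lsumR at 1; specialize (Hp O Hm); lra|].
      specialize (IH ltac:(lia)). specialize (Hp (S m) Hm). lra. }
    specialize (Hpos (N - 1)%nat ltac:(lia)). replace (S (N - 1)) with N in Hpos by lia.
    rewrite <- Hre, Hs in Hpos. simpl in Hpos. lra. }
  destruct Hk as (k & Hk & Hre).
  assert (H1 : 1 <= Cmod (wN N (d * Z.of_nat k) - 1)).
  { eapply Rle_trans; [|apply fst_le_Cmod]. unfold Re in Hre. simpl. rewrite Rabs_left1; simpl in *; lra. }
  assert (H2 : forall j, Cmod (wN N (d * Z.of_nat j) - 1) <= INR j * Cmod (wN N d - 1)).
  { induction j as [|j IH].
    - rewrite Z.mul_0_r, wN_0. replace (RtoC 1 - 1)%C with (RtoC 0) by ring. rewrite Cmod_0. simpl. lra.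
    - replace (d * Z.of_nat (S j))%Z with (d * Z.of_nat j + d)%Z by lia. rewrite wN_add.
      replace (wN N (d * Z.of_nat j) * wN N d - 1)%C with ((wN N (d * Z.of_nat j) - 1) + wN N (d * Z.of_nat j) * (wN N d - 1))%C by ring.
      eapply Rle_trans; [apply Cmod_triangle|]. rewrite Cmod_mult, wN_Cmod, S_INR. lra. }
  specialize (H2 k). assert (INR k <= INR N) by (apply le_INR; lia).
  pose proof (Cmod_ge_0 (wN N d - 1)).
  apply (Rmult_le_reg_l (INR N)); auto. rewrite Rinv_r by lra. nra.
Qed.

(** Different radii differ by at least r / N; on a common circle [wN_sep] applies, scaled by a
    radius at least r. *)
Lemma polar_sep N r i i' d d' : (0 < N)%nat -> 0 < r -> (i < N)%nat -> (i' < N)%nat -> (d < N)%nat -> (d' < N)%nat ->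
  (i, d) <> (i', d') ->
  r / INR N <= Cmod (RtoC (r + INR i * (r / INR N)) * wN N (Z.of_nat d) - RtoC (r + INR i' * (r / INR N)) * wN N (Z.of_nat d')).
Proof.
  intros HN Hr Hi Hi' Hd Hd' Hne. assert (HN' : 0 < INR N) by (apply lt_0_INR; auto).
  set (e := r / INR N). assert (He : 0 < e) by (apply Rdiv_lt_0_compat; auto).
  pose proof (pos_INR i). pose proof (pos_INR i').
  destruct (Nat.eq_dec i i') as [<-|Hii].
  - assert (Hdd : d <> d') by congruence.
    replace (RtoC (r + INR i * e) * wN N (Z.of_nat d) - RtoC (r + INR i * e) * wN N (Z.of_nat d'))%C with
      (RtoC (r + INR i * e) * (wN N (Z.of_nat d') * (wN N (Z.of_nat d - Z.of_nat d') - 1)))%C.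
    2:{ replace (wN N (Z.of_nat d)) with (wN N (Z.of_nat d') * wN N (Z.of_nat d - Z.of_nat d'))%C; [ring|].
        rewrite <- wN_add. f_equal. lia. }
    rewrite !Cmod_mult, wN_Cmod, Cmod_R, Rabs_pos_eq by nra.
    assert (H1 : / INR N <= Cmod (wN N (Z.of_nat d - Z.of_nat d') - 1)).
    { apply wN_sep; auto. intros q Hq. destruct (Z.eq_dec q 0) as [->|Hq0]; [lia|]. nia. }
    unfold e at 1. unfold Rdiv. assert (0 < / INR N) by (apply Rinv_0_lt_compat; auto).
    assert (0 <= INR i * e) by nra. rewrite Rmult_1_l. apply Rmult_le_compat; lra.
  - assert (Hgap : e <= Rabs ((r + INR i * e) - (r + INR i' * e))).
    { replace ((r + INR i * e) - (r + INR i' * e)) with ((INR i - INR i') * e) by ring.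
      rewrite Rabs_mult, (Rabs_pos_eq e) by lra. assert (1 <= Rabs (INR i - INR i')); [|nra].
      assert (Hlt : (i < i')%nat \/ (i' < i)%nat) by lia. destruct Hlt as [Hlt|Hlt]; apply le_INR in Hlt; rewrite S_INR in Hlt.
      - rewrite Rabs_left1; lra.
      - rewrite Rabs_pos_eq; lra. }
    eapply Rle_trans; [apply Hgap|].
    assert (T : forall a b : C, Rabs (Cmod a - Cmod b) <= Cmod (a - b)).
    { intros a b. apply Rabs_le. pose proof (Cmod_triangle (a - b) b) as H1. pose proof (Cmod_triangle (b - a) a) as H2.
      replace (a - b + b)%C with a in H1 by ring. replace (b - a + a)%C with b in H2 by ring.
      replace (b - a)%C with (- (a - b))%C in H2 by ring. rewrite Cmod_opp in H2. lra. }
    eapply Rle_trans; [|apply T]. rewrite !Cmod_mult, !wN_Cmod, !Cmod_R, (Rabs_pos_eq (r + INR i * e)), (Rabs_pos_eq (r + INR i' * e)) by nra. right. f_equal. ring.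
Qed.

Definition ucont (f : C -> R) : Prop := forall a eps, 0 < eps -> exists eta, 0 < eta /\
  forall p q : C, Rabs (fst p) <= a -> Rabs (snd p) <= a -> Rabs (fst q) <= a -> Rabs (snd q) <= a ->
  Rabs (fst q - fst p) < eta -> Rabs (snd q - snd p) < eta -> Rabs (f q - f p) < eps.

(** The condition inside [finite_integral_C] for a fixed bound. *)
Definition darboux_le (f : C -> R) (M : R) : Prop :=
  forall (a : R) (N : nat) (c : nat -> nat -> R), 0 < a ->
    (forall (i j : nat) (x y : R), (i < N)%nat -> (j < N)%nat ->
        -a + INR i * (2 * a / INR N) <= x <= -a + INR (S i) * (2 * a / INR N) ->
        -a + INR j * (2 * a / INR N) <= y <= -a + INR (S j) * (2 * a / INR N) ->
        c i j <= f (x, y)) ->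
    rsum N (fun i => rsum N (fun j => c i j * ((2 * a / INR N) * (2 * a / INR N)))) <= M.

(** Polar grid of N radii and N angles in the annulus between r and 2 r. *)
Definition polar (r : R) (N : nat) (i d : nat) : C := (RtoC (r + INR i * (r / INR N)) * wN N (Z.of_nat d))%C.

Lemma polar_Cmod r N i d : 0 < r -> (i < N)%nat -> Cmod (polar r N i d) = r + INR i * (r / INR N) /\ r <= Cmod (polar r N i d) <= 2 * r.
Proof.
  intros Hr Hi. assert (HN : 0 < INR N) by (apply lt_0_INR; lia).
  assert (He : 0 < r / INR N) by (apply Rdiv_lt_0_compat; auto). pose proof (pos_INR i).
  assert (HiN : INR i <= INR N) by (apply le_INR; lia).
  assert (E : Cmod (polar r N i d) = r + INR i * (r / INR N)).
  { unfold polar. rewrite Cmod_mult, wN_Cmod, Cmod_R, Rabs_pos_eq by nra. ring. }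
  split; auto. rewrite E. split; [nra|].
  assert (INR i * (r / INR N) <= INR N * (r / INR N)) by (apply Rmult_le_compat_r; lra).
  replace (INR N * (r / INR N)) with r in H0 by (field; lra). lra.
Qed.

Definition avg2 (N : nat) (g : nat -> nat -> R) : R :=
  / (INR N * INR N) * lsumR (seq 0 N) (fun i => lsumR (seq 0 N) (fun d => g i d)).

(** Grid points around one centre are r / N apart by [polar_sep], those around different centres at
    least r, so [darboux_points] applies with cells of side r / (2 N). Each grid point then has
    weight r^2 / (4 N^2), whence the factor 4 / r^2 in front of M for averages over N^2 points. *)
Lemma annulus_sum (f : C -> R) M (lc : list C) r : darboux_le f M -> (forall z, 0 <= f z) -> ucont f ->
  0 < r -> NoDup lc -> (forall p q, In p lc -> In q lc -> p <> q -> 5 * r <= Cmod (p - q)) ->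
  forall dl, 0 < dl -> exists N0, (0 < N0)%nat /\ forall N, (N0 <= N)%nat ->
    lsumR lc (fun c => avg2 N (fun i d => f (c + polar r N i d)%C)) <= 4 * M / (r * r) + INR (length lc) * dl.
Proof.
  intros HM Hf Huc Hr ND Hsep dl Hdl.
  assert (HS : exists Sb : nat, (0 < Sb)%nat /\ forall c, In c lc -> Cmod c + 2 * r < r * INR Sb).
  { assert (HB : forall l : list C, exists B, forall c, In c l -> Cmod c <= B).
    { induction l as [|a l (B & IH)]; [exists 0; intros c []|]. exists (Rmax (Cmod a) B).
      intros c [<-|Hc]; [apply Rmax_l|]. eapply Rle_trans; [apply IH; auto|apply Rmax_r]. }
    destruct (HB lc) as (B & HB'). destruct (nfloor_ex (Rmax ((B + 2 * r) / r) 0)) as (k & Hk); [apply Rmax_r|].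
    exists (S k). split; [lia|]. intros c Hc. specialize (HB' c Hc). rewrite S_INR.
    assert ((B + 2 * r) / r < INR k + 1) by (eapply Rle_lt_trans; [apply Rmax_l | apply Hk]).
    apply (Rmult_lt_compat_l r) in H; auto. replace (r * ((B + 2 * r) / r)) with (B + 2 * r) in H by (field; lra). lra. }
  destruct HS as (Sb & HSb0 & HSb). assert (HSb' : 0 < INR Sb) by (apply lt_0_INR; auto).
  set (a := r * INR Sb). assert (Ha : 0 < a) by (unfold a; nra).
  destruct (Huc (a + r) dl Hdl) as (eta & Heta & Huc').
  destruct (nfloor_ex (r / eta)) as (k & Hk); [apply Rdiv_le_0_compat; lra|].
  exists (S k). split; [lia|]. intros N HN.
  assert (HN' : INR k + 1 <= INR N) by (rewrite <- S_INR; apply le_INR; auto).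
  pose proof (pos_INR k).
  (* Half of the separation r / N, since the two coordinates of a difference are bounded
     separately. *)
  set (h := r / (2 * INR N)).
  assert (Eh : 2 * a / INR (4 * Sb * N) = h).
  { unfold a, h. rewrite !mult_INR. replace (INR 4) with 4 by (simpl; ring). field. lra. }
  assert (Hh : 0 < h) by (apply Rdiv_lt_0_compat; lra).
  assert (Hhe : h < eta).
  { unfold h. apply (Rmult_lt_reg_r (2 * INR N)); [lra|].
    replace (r / (2 * INR N) * (2 * INR N)) with r by (field; lra).
    assert (r / eta < INR N) by lra. apply (Rmult_lt_compat_r eta) in H0; auto.
    replace (r / eta * eta) with r in H0 by (field; lra). nra. }
  assert (Hhr : h <= r). { unfold h. apply (Rmult_le_reg_r (2 * INR N)); [lra|].
    replace (r / (2 * INR N) * (2 * INR N)) with r by (field; lra). nra. }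
  set (idx := flat_map (fun c => map (pair c) (flat_map (fun i => map (pair i) (seq 0 N)) (seq 0 N))) lc).
  assert (NDi : NoDup idx).
  { apply NoDup_pairs; auto. intros c. apply NoDup_pairs; [apply seq_NoDup|intros; apply seq_NoDup]. }
  assert (Hin : forall x, In x idx -> In (fst x) lc /\ (fst (snd x) < N)%nat /\ (snd (snd x) < N)%nat).
  { intros x Hx. unfold idx in Hx. apply in_flat_map in Hx. destruct Hx as (c & Hc & Hx).
    apply in_map_iff in Hx. destruct Hx as (y & <- & Hy). apply in_flat_map in Hy. destruct Hy as (i & Hi & Hy).
    apply in_map_iff in Hy. destruct Hy as (d & <- & Hd). apply in_seq in Hi. apply in_seq in Hd. simpl. split; [auto|lia]. }
  set (pt := fun x : C * (nat * nat) => (fst x + polar r N (fst (snd x)) (snd (snd x)))%C).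
  assert (Hpt : forall x, In x idx -> Rabs (fst (pt x)) < a /\ Rabs (snd (pt x)) < a).
  { intros x Hx. destruct (Hin x Hx) as (H1 & H2 & H3).
    assert (Cmod (pt x) < a).
    { unfold pt. eapply Rle_lt_trans; [apply Cmod_triangle|]. destruct (polar_Cmod r N _ (snd (snd x)) Hr H2) as (_ & H4).
      specialize (HSb _ H1). fold a in HSb. lra. }
    split; [eapply Rle_lt_trans; [apply fst_le_Cmod|auto] | eapply Rle_lt_trans; [apply snd_le_Cmod|auto]]. }
  assert (E : lsumR idx (fun x => (f (pt x) - dl) * (h * h)) <= M).
  { rewrite <- Eh. apply (darboux_points f M HM Hf idx pt a (4 * Sb * N) dl); auto; [nia| | |]; rewrite ?Eh.
    - intros x Hx. destruct (Hpt x Hx) as [H1 H2]. apply Rabs_def2 in H1. apply Rabs_def2 in H2. lra.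
    - intros x y Hx Hy D1 D2. destruct (Hin x Hx) as (A1 & A2 & A3). destruct (Hin y Hy) as (B1 & B2 & B3).
      assert (Dxy : Cmod (pt x - pt y) < r / INR N).
      { eapply Rle_lt_trans; [apply Cmod_le_sum|].
        change (fst (pt x - pt y)%C) with (fst (pt x) - fst (pt y)). change (snd (pt x - pt y)%C) with (snd (pt x) - snd (pt y)).
        replace (r / INR N) with (h + h) by (unfold h; field; lra). lra. }
      destruct x as [c [i d]], y as [c' [i' d']]. simpl in A1, A2, A3, B1, B2, B3. unfold pt in Dxy. simpl in Dxy.
      destruct (polar_Cmod r N i d Hr A2) as (_ & P1). destruct (polar_Cmod r N i' d' Hr B2) as (_ & P2).
      assert (Hcc : c = c').
      { apply NNPP. intros Hne. specialize (Hsep c c' A1 B1 Hne).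
        replace (c - c')%C with ((c + polar r N i d - (c' + polar r N i' d')) + (polar r N i' d' + (- polar r N i d)))%C in Hsep by ring.
        pose proof (Cmod_triangle (c + polar r N i d - (c' + polar r N i' d')) (polar r N i' d' + (- polar r N i d))).
        pose proof (Cmod_triangle (polar r N i' d') (- polar r N i d)). rewrite Cmod_opp in *.
        assert (r / INR N <= r). { apply (Rmult_le_reg_r (INR N)); [lra|]. replace (r / INR N * INR N) with r by (field; lra). nra. }
        lra. }
      subst c'. f_equal. apply NNPP. intros Hne.
      pose proof (polar_sep N r i i' d d' ltac:(lia) Hr A2 B2 A3 B3 Hne) as Hps. fold (polar r N i d) (polar r N i' d') in Hps.
      replace (c + polar r N i d - (c + polar r N i' d'))%C with (polar r N i d - polar r N i' d')%C in Dxy by ring. lra.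
    - intros x q Hx D1 D2. destruct (Hpt x Hx) as [H1 H2].
      assert (Rabs (f q - f (pt x)) < dl).
      { apply Huc'; try lra.
        - replace (fst q) with (fst (pt x) + (fst q - fst (pt x))) by ring. eapply Rle_trans; [apply Rabs_triang|lra].
        - replace (snd q) with (snd (pt x) + (snd q - snd (pt x))) by ring. eapply Rle_trans; [apply Rabs_triang|lra]. }
      apply Rabs_def2 in H0. lra. }
  unfold idx in E. rewrite lsumR_flat_map in E.
  rewrite (lsumR_ext lc _ (fun c => (r * r / 4) * avg2 N (fun i d => f (c + polar r N i d)%C) + - (r * r / 4 * dl))) in E.
  - rewrite lsumR_plus, lsumR_scal, lsumR_const in E.
    set (S := lsumR lc _) in *. apply (Rmult_le_reg_l (r * r / 4)); [nra|].
    replace (r * r / 4 * (4 * M / (r * r) + INR (length lc) * dl)) with (M + INR (length lc) * (r * r / 4 * dl)) by (field; lra). lra.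
  - intros c _. rewrite lsumR_map, lsumR_flat_map. unfold avg2.
    rewrite (lsumR_ext (seq 0 N) _ (fun i => (h * h) * lsumR (seq 0 N) (fun d => f (c + polar r N i d)%C) + - (INR N * (h * h * dl)))).
    + rewrite lsumR_plus, lsumR_scal, lsumR_const, length_seq. unfold h. field. lra.
    + intros i _. rewrite lsumR_map.
      rewrite (lsumR_ext (seq 0 N) _ (fun d => (h * h) * f (c + polar r N i d)%C + - (h * h * dl))).
      * rewrite lsumR_plus, lsumR_scal, lsumR_const, length_seq. ring.
      * intros d _. unfold pt. simpl. ring.
Qed.

(** * Polyanalytic coefficients from values on circles *)

Lemma lsum_single {I} (l : list I) (g : I -> C) s0 : NoDup l -> In s0 l ->
  (forall s, In s l -> s <> s0 -> g s = RtoC 0) -> lsum l g = g s0.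
Proof.
  induction l as [|a l IH]; intros ND Hin H; [destruct Hin|].
  inversion ND as [|? ? Ha ND']; subst. simpl. destruct Hin as [->|Hin].
  - rewrite (lsum_ext l g (fun _ => RtoC 0)); [rewrite lsum_zero; ring|].
    intros i Hi. apply H; [right; auto|]. intros ->; auto.
  - rewrite IH; auto; [|intros; apply H; [right|]; auto]. rewrite H; [ring|left; auto|]. intros ->; auto.
Qed.

Lemma lsum_swap {I J} (l : list I) (l' : list J) (f : I -> J -> C) :
  lsum l (fun i => lsum l' (f i)) = lsum l' (fun j => lsum l (fun i => f i j)).
Proof.
  induction l as [|a l IH]; simpl; [rewrite lsum_zero; auto|]. rewrite IH, <- lsum_plus. auto.
Qed.

Lemma PS_tail a psi B4 K z : PS a psi -> (forall k, Cmod (a k) <= B4) -> Cmod z <= / 2 ->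
  Cmod (psi z - lsum (seq 0 K) (fun k => a k * z ^ k)%C) <= 2 * B4 * (/ 2) ^ K.
Proof.
  intros (_ & HP) Ha Hz. assert (HB : 0 <= B4) by (eapply Rle_trans; [apply Cmod_ge_0|apply (Ha O)]).
  assert (Hm : forall m, Cmod (lsum (seq 0 (K + m)) (fun k => a k * z ^ k)%C - lsum (seq 0 K) (fun k => a k * z ^ k)%C)
     <= 2 * B4 * ((/ 2) ^ K - (/ 2) ^ (K + m))).
  { induction m as [|m IH].
    - rewrite Nat.add_0_r. unfold Cminus. rewrite Cplus_opp_r, Cmod_0. lra.
    - rewrite Nat.add_succ_r, lsum_seq_S.
      match goal with |- Cmod (?x + ?y - ?w) <= _ => replace (x + y - w)%C with ((x - w) + y)%C by ring end.
      eapply Rle_trans; [apply Cmod_triangle|]. rewrite Cmod_mult, Cmod_pow.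
      assert (Cmod z ^ (K + m) <= (/ 2) ^ (K + m)) by (apply pow_incr; split; [apply Cmod_ge_0|auto]).
      specialize (Ha (K + m)%nat). pose proof (Cmod_ge_0 (a (K + m)%nat)).
      assert (0 <= Cmod z ^ (K + m)) by (apply pow_le, Cmod_ge_0).
      assert (Cmod (a (K + m)%nat) * Cmod z ^ (K + m) <= B4 * (/ 2) ^ (K + m)) by (apply Rmult_le_compat; auto).
      simpl. lra. }
  apply le_epsilon. intros eps He. destruct (HS_seq _ _ (HP z) eps He) as (N & HN).
  specialize (HN (K + N)%nat ltac:(lia)). specialize (Hm N).
  set (s1 := lsum (seq 0 (K + N)) _) in *. set (s0 := lsum (seq 0 K) _) in *.
  replace (psi z - s0)%C with (- (s1 - psi z) + (s1 - s0))%C by ring.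
  eapply Rle_trans; [apply Cmod_triangle|]. rewrite Cmod_opp.
  assert (0 <= (/ 2) ^ (K + N)) by (apply pow_le; lra). nra.
Qed.

(** On a circle of radius rho the i-th power of the conjugate times z^k has angular frequency k - i
    and modulus rho^(i + k). The discrete Fourier average with frequency j therefore keeps only k =
    i - j. *)
Lemma root_extract n N i j rho a psi B4 : (i < n)%nat -> (j < n)%nat -> (2 * n < N)%nat -> 0 < rho <= / 2 ->
  PS a psi -> (forall k, Cmod (a k) <= B4) ->
  Cmod (RtoC (/ INR N) * lsum (seq 0 N) (fun d => wN N (Z.of_nat j * Z.of_nat d) *
      (Cconj (RtoC rho * wN N (Z.of_nat d)) ^ i * psi (RtoC rho * wN N (Z.of_nat d))))
    - (if le_dec j i then RtoC (rho ^ (j + 2 * (i - j))) * a (i - j)%nat else RtoC 0))%C <= 2 * B4 * (/ 2) ^ (N - n).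
Proof.
  intros Hi Hj HN Hrho HP Ha. assert (HN' : 0 < INR N) by (apply lt_0_INR; lia).
  assert (HB : 0 <= B4) by (eapply Rle_trans; [apply Cmod_ge_0|apply (Ha O)]).
  (* Degrees below N - n cannot alias with the wanted frequency modulo N; the remaining tail is of
     size 2^(-(N - n)). *)
  set (K := (N - n)%nat). set (ze := fun d => (RtoC rho * wN N (Z.of_nat d))%C).
  set (T := fun z => lsum (seq 0 K) (fun k => a k * z ^ k)%C).
  assert (Hze : forall d, Cmod (ze d) = rho). { intros d. unfold ze. rewrite Cmod_mult, wN_Cmod, Cmod_R, Rabs_pos_eq; lra. }
  assert (Hcj : forall d, Cconj (wN N d) = wN N (- d)).
  { intros d. unfold wN, Cexp, Cconj. simpl. rewrite opp_IZR.
    replace (0 * (2 * PI * - IZR d / INR N) + 1 * 0) with (- (0 * (2 * PI * IZR d / INR N) + 1 * 0)) by (field; lra).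
    replace (0 * 0 + 1 * (2 * PI * - IZR d / INR N)) with (- (0 * 0 + 1 * (2 * PI * IZR d / INR N))) by (field; lra).
    replace (0 * (2 * PI * - IZR d / INR N) - 1 * 0) with (0 * (2 * PI * IZR d / INR N) - 1 * 0) by (field; lra).
    rewrite ?cos_neg, ?sin_neg. f_equal; ring. }
  assert (ET : lsum (seq 0 N) (fun d => wN N (Z.of_nat j * Z.of_nat d) * (Cconj (ze d) ^ i * T (ze d)))%C =
     (RtoC (INR N) * (if le_dec j i then RtoC (rho ^ (j + 2 * (i - j))) * a (i - j)%nat else RtoC 0))%C).
  { transitivity (lsum (seq 0 K) (fun k => (a k * RtoC (rho ^ (i + k))) * lsum (seq 0 N) (fun d => wN N ((Z.of_nat j - Z.of_nat i + Z.of_nat k) * Z.of_nat d)))%C).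
    { transitivity (lsum (seq 0 N) (fun d => lsum (seq 0 K) (fun k => (a k * RtoC (rho ^ (i + k))) * wN N ((Z.of_nat j - Z.of_nat i + Z.of_nat k) * Z.of_nat d))%C)).
      - apply lsum_ext. intros d _. unfold T. rewrite <- !lsum_scal. apply lsum_ext. intros k _.
        unfold ze. rewrite Cmult_conj, Hcj, !Cpow_mult_l, !wN_pow.
        replace (Cconj (RtoC rho)) with (RtoC rho) by (unfold Cconj, RtoC; simpl; f_equal; ring).
        rewrite !RtoC_pow, Cpow_add_r.
        replace ((Z.of_nat j - Z.of_nat i + Z.of_nat k) * Z.of_nat d)%Z with (Z.of_nat j * Z.of_nat d + (- Z.of_nat d * Z.of_nat i + Z.of_nat d * Z.of_nat k))%Z by ring.
        rewrite !wN_add. ring.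
      - rewrite lsum_swap. apply lsum_ext. intros k _. rewrite lsum_scal. auto. }
    assert (Hz : forall k, (k < K)%nat -> (Z.of_nat j - Z.of_nat i + Z.of_nat k <> 0)%Z ->
      lsum (seq 0 N) (fun d => wN N ((Z.of_nat j - Z.of_nat i + Z.of_nat k) * Z.of_nat d)) = RtoC 0).
    { intros k Hk H0. apply root_sum; [lia|]. intros q Hq. unfold K in Hk.
      destruct (Z.eq_dec q 0) as [->|Hq0]; [lia|]. assert (q <= -1 \/ 1 <= q)%Z by lia. nia. }
    destruct (le_dec j i) as [Hji|Hji].
    - rewrite (lsum_single _ _ (i - j)%nat); [|apply seq_NoDup|apply in_seq; unfold K; lia|].
      + rewrite (root_sum_one N _ 0%Z); [|lia|lia]. replace (i + (i - j))%nat with (j + 2 * (i - j))%nat by lia. ring.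
      + intros k Hk Hne. apply in_seq in Hk. rewrite Hz; [ring|lia|lia].
    - rewrite (lsum_ext _ _ (fun _ => RtoC 0)); [rewrite lsum_zero; ring|].
      intros k Hk. apply in_seq in Hk. rewrite Hz; [ring|lia|lia]. }
  set (X := if le_dec j i then _ else _) in *.
  replace (RtoC (/ INR N) * lsum (seq 0 N) (fun d => wN N (Z.of_nat j * Z.of_nat d) *
      (Cconj (RtoC rho * wN N (Z.of_nat d)) ^ i * psi (RtoC rho * wN N (Z.of_nat d)))) - X)%C with
   (RtoC (/ INR N) * lsum (seq 0 N) (fun d => wN N (Z.of_nat j * Z.of_nat d) * (Cconj (ze d) ^ i * (psi (ze d) - T (ze d)))))%C.
  2:{ rewrite (lsum_ext _ _ (fun d => wN N (Z.of_nat j * Z.of_nat d) * (Cconj (ze d) ^ i * psi (ze d)) + (- (1)) *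
        (wN N (Z.of_nat j * Z.of_nat d) * (Cconj (ze d) ^ i * T (ze d))))%C) by (intros; ring).
      rewrite lsum_plus, lsum_scal, ET.
      transitivity (RtoC (/ INR N) * lsum (seq 0 N) (fun d => wN N (Z.of_nat j * Z.of_nat d) * (Cconj (ze d) ^ i * psi (ze d))) - (RtoC (/ INR N) * RtoC (INR N)) * X)%C; [ring|].
      rewrite <- RtoC_mult, Rinv_l by lra. unfold ze. ring. }
  rewrite Cmod_mult, Cmod_R, Rabs_pos_eq by (left; apply Rinv_0_lt_compat; auto).
  apply (Rmult_le_reg_l (INR N)); auto. rewrite <- Rmult_assoc, Rinv_r, Rmult_1_l by lra.
  eapply Rle_trans; [apply lsum_Cmod|].
  replace (INR N) with (INR (length (seq 0 N))) by (rewrite length_seq; auto).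
  rewrite <- lsumR_const. apply lsumR_le. intros d _.
  rewrite !Cmod_mult, wN_Cmod, Cmod_pow, Cmod_conj, Hze, Rmult_1_l.
  pose proof (PS_tail a psi B4 K (ze d) HP Ha ltac:(rewrite Hze; lra)) as Ht. fold (T (ze d)) in Ht.
  assert (0 <= rho ^ i <= 1). { split; [apply pow_le; lra|]. rewrite <- (pow1 i). apply pow_incr. lra. }
  pose proof (Cmod_ge_0 (psi (ze d) - T (ze d))). nra.
Qed.

(* Richardson extrapolation: the values of a polynomial of degree [< n] at [t, 4t, ..., 4^(n-1) t] determine its value at [0]. *)
Lemma extrapolation_weights n : (1 <= n)%nat -> exists W : nat -> R, forall s, (s < n)%nat ->
  lsumR (seq 0 n) (fun k => W k * (4 ^ k) ^ s) = if Nat.eq_dec s 0 then 1 else 0.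
Proof.
  induction n as [|n IH]; [lia|]. intros _. destruct n as [|n].
  - exists (fun _ => 1). intros s Hs. replace s with O by lia. simpl. ring.
  - destruct IH as (W & HW); [lia|]. set (m := S n) in *.
    assert (H4 : 1 < 4 ^ m) by (apply Rlt_pow_R1; [lra|unfold m; lia]).
    set (W0 := fun k => if lt_dec k m then W k else 0).
    (* The old weights are combined with their shift by one scale. This multiplies the s-th sum by
       (4^m - 4^s) / (4^m - 1), which is 0 at s = m and 1 at s = 0. *)
    exists (fun k => (4 ^ m * W0 k - match k with O => 0 | S k' => W0 k' end) / (4 ^ m - 1)).
    intros s Hs. set (Sg := lsumR (seq 0 m) (fun k => W k * (4 ^ k) ^ s)).
    assert (E1 : lsumR (seq 0 (S m)) (fun k => W0 k * (4 ^ k) ^ s) = Sg).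
    { rewrite lsumR_seq_S. unfold W0 at 2. destruct (lt_dec m m); [lia|]. rewrite Rmult_0_l, Rplus_0_r.
      apply lsumR_ext. intros k Hk. apply in_seq in Hk. unfold W0. destruct (lt_dec k m); [auto|lia]. }
    assert (E2 : lsumR (seq 0 (S m)) (fun k => match k with O => 0 | S k' => W0 k' end * (4 ^ k) ^ s) = 4 ^ s * Sg).
    { change (seq 0 (S m)) with (0%nat :: seq (1 + 0) m).
      match goal with |- lsumR (_ :: ?l) ?f = _ => change (f O + lsumR l f = 4 ^ s * Sg) end.
      rewrite lsumR_seq_add. unfold Sg. rewrite <- lsumR_scal. cbv beta iota. rewrite Rmult_0_l, Rplus_0_l. apply lsumR_ext. intros k Hk. apply in_seq in Hk.
      simpl (1 + k)%nat. cbv iota beta. unfold W0. destruct (lt_dec k m); [|lia].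
      change (4 ^ S k) with (4 * 4 ^ k). rewrite Rpow_mult_distr. ring. }
    rewrite (lsumR_ext _ _ (fun k => / (4 ^ m - 1) * (4 ^ m * (W0 k * (4 ^ k) ^ s) + (- (1)) * (match k with O => 0 | S k' => W0 k' end * (4 ^ k) ^ s)))) by (intros; unfold Rdiv; ring).
    rewrite lsumR_scal, lsumR_plus, !lsumR_scal, E1, E2.
    destruct (Nat.eq_dec s m) as [->|Hsm].
    + destruct (Nat.eq_dec m 0); [unfold m in *; lia|]. ring.
    + unfold Sg. rewrite HW by lia. destruct (Nat.eq_dec s 0) as [->|]; [rewrite pow_O; field; lra|ring].
Qed.

Lemma cont0_Cexp u : cont0 u -> cont0 (fun h => Cexp (u h)).
Proof.
  intros H eps He. destruct (cdiff_cont _ _ _ (cdiff_exp (u (RtoC 0))) eps He) as (d & Hd & Hd').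
  destruct (H d Hd) as (d2 & Hd2 & Hd2'). exists d2. split; auto. intros h Hh.
  specialize (Hd' _ (Hd2' h Hh)). replace (u (RtoC 0) + (u h - u (RtoC 0)))%C with (u h) in Hd' by ring. auto.
Qed.

Lemma cont0_conj u : cont0 u -> cont0 (fun h => Cconj (u h)).
Proof.
  intros H eps He. destruct (H eps He) as (d & Hd & Hd'). exists d. split; auto. intros h Hh.
  rewrite <- Cminus_conj, Cmod_conj. auto.
Qed.

Lemma cont0_pow u k : cont0 u -> cont0 (fun h => u h ^ k)%C.
Proof. intros H. induction k as [|k IH]; [apply (cont0_const (RtoC 1))|]. apply (cont0_mult u (fun h => u h ^ k)%C); auto. Qed.

Lemma cont0_lsum {I} (l : list I) (u : I -> C -> C) : (forall i, In i l -> cont0 (u i)) -> cont0 (fun h => lsum l (fun i => u i h)).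
Proof.
  induction l as [|a l IH]; intros H; [apply (cont0_const (RtoC 0))|].
  apply (cont0_plus (u a) (fun h => lsum l (fun i => u i h))); [apply H; left; auto|apply IH; intros; apply H; right; auto].
Qed.

Lemma ucont_of_cont0 (g : C -> C) : (forall z, cont0 (fun h => g (z + h)%C)) -> ucont (fun z => Re (g z)).
Proof.
  intros Hg a eps He.
  assert (H2 : forall x y, - a <= x <= a -> - a <= y <= a -> continuity_2d_pt (fun x y => Re (g (x, y))) x y).
  { intros x y _ _ e. destruct (Hg (x, y) e (cond_pos e)) as (d & Hd & Hd').
    exists (mkposreal (d / 2) ltac:(lra)). intros u v Hu Hv. simpl in Hu, Hv.
    specialize (Hd' (((u, v) : C) - ((x, y) : C))%C).
    assert (Hpq : forall p q : C, (p + (q - p))%C = q) by (intros; ring). rewrite Hpq in Hd'.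
    assert (Hp0 : forall p : C, (p + RtoC 0)%C = p) by (intros; ring). rewrite Hp0 in Hd'.
    eapply Rle_lt_trans; [|apply Hd'].
    - apply (fst_le_Cmod (g (u, v) - g (x, y))%C).
    - eapply Rle_lt_trans; [apply Cmod_le_sum|]. change (fst ((u, v) - (x, y))%C) with (u - x). change (snd ((u, v) - (x, y))%C) with (v - y). lra. }
  destruct (uniform_continuity_2d _ (- a) a (- a) a H2 (mkposreal eps He)) as (d & Hd).
  exists d. split; [apply cond_pos|]. intros [p1 p2] [q1 q2] A1 A2 A3 A4 A5 A6. simpl in *.
  apply Rabs_le_between in A1, A2, A3, A4. apply Hd; auto.
Qed.

(** On the circle of radius 2^k rho, [root_extract] returns psi_j(0) rho^j 2^(k j) plus terms from i
    > j. After division by 2^(k j) these are multiples of (4^k)^(i - j), which the extrapolation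
    weights annihilate. So psi_j(0) is controlled by averages of the whole polyanalytic sum over n
    circles. *)
Lemma center_bound n W j N rho (psi : nat -> C -> C) (a : nat -> nat -> C) B4 : (j < n)%nat -> (2 * n < N)%nat ->
  (forall s, (s < n)%nat -> lsumR (seq 0 n) (fun k => W k * (4 ^ k) ^ s) = if Nat.eq_dec s 0 then 1 else 0) ->
  0 < rho -> 2 ^ n * rho <= / 2 ->
  (forall i, (i < n)%nat -> PS (a i) (psi i)) -> (forall i k, (i < n)%nat -> Cmod (a i k) <= B4) ->
  rho ^ j * Cmod (psi j (RtoC 0)) <= lsumR (seq 0 n) (fun k => Rabs (W k) *
    (/ INR N * lsumR (seq 0 N) (fun d => Cmod (lsum (seq 0 n) (fun i =>
        Cconj (RtoC (2 ^ k * rho) * wN N (Z.of_nat d)) ^ i * psi i (RtoC (2 ^ k * rho) * wN N (Z.of_nat d))))%C)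
     + INR n * (2 * B4 * (/ 2) ^ (N - n)))).
Proof.
  intros Hj HN HW Hr Hr2 HPS Ha. assert (HN' : 0 < INR N) by (apply lt_0_INR; lia).
  set (ze := fun k d => (RtoC (2 ^ k * rho) * wN N (Z.of_nat d))%C).
  set (G := fun z => lsum (seq 0 n) (fun i => Cconj z ^ i * psi i z)%C).
  set (tau := fun k i => if le_dec j i then (RtoC ((2 ^ k * rho) ^ (j + 2 * (i - j))) * a i (i - j)%nat)%C else RtoC 0).
  set (A := fun k => (RtoC (/ INR N) * lsum (seq 0 N) (fun d => wN N (Z.of_nat j * Z.of_nat d) * G (ze k d)))%C).
  assert (HA : forall k, (k < n)%nat -> Cmod (A k - lsum (seq 0 n) (tau k)) <= INR n * (2 * B4 * (/ 2) ^ (N - n))).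
  { intros k Hk.
    assert (Hrk : 0 < 2 ^ k * rho <= / 2).
    { split; [apply Rmult_lt_0_compat; auto; apply pow_lt; lra|]. eapply Rle_trans; [|apply Hr2].
      apply Rmult_le_compat_r; [lra|]. apply Rle_pow; [lra|lia]. }
    replace (A k - lsum (seq 0 n) (tau k))%C with (lsum (seq 0 n) (fun i => RtoC (/ INR N) * lsum (seq 0 N) (fun d =>
      wN N (Z.of_nat j * Z.of_nat d) * (Cconj (ze k d) ^ i * psi i (ze k d))) - tau k i)%C).
    - eapply Rle_trans; [apply lsum_Cmod|].
      replace (INR n) with (INR (length (seq 0 n))) by (rewrite length_seq; auto).
      rewrite <- lsumR_const. apply lsumR_le. intros i Hi. apply in_seq in Hi.
      apply (root_extract n N i j (2 ^ k * rho) (a i) (psi i) B4); auto; [lia|apply HPS; lia|intros; apply Ha; lia].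
    - rewrite (lsum_ext _ _ (fun i => RtoC (/ INR N) * lsum (seq 0 N) (fun d =>
        wN N (Z.of_nat j * Z.of_nat d) * (Cconj (ze k d) ^ i * psi i (ze k d))) + (- (1)) * tau k i)%C) by (intros; ring).
      rewrite lsum_plus, !lsum_scal, lsum_swap. unfold A, G.
      rewrite (lsum_ext (seq 0 N) (fun d => _ * lsum _ _)%C (fun d => lsum (seq 0 n) (fun i => wN N (Z.of_nat j * Z.of_nat d) * (Cconj (ze k d) ^ i * psi i (ze k d)))%C)).
      + ring.
      + intros d _. rewrite lsum_scal. auto. }
  assert (Hps : (RtoC (rho ^ j) * psi j (RtoC 0))%C = lsum (seq 0 n) (fun k => RtoC (W k * (/ 2 ^ k) ^ j) * lsum (seq 0 n) (tau k))%C).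
  { rewrite (PS_at_0 _ _ (HPS j Hj)).
    transitivity (lsum (seq 0 n) (fun i => lsum (seq 0 n) (fun k => RtoC (W k * (/ 2 ^ k) ^ j) * tau k i)%C)).
    - rewrite (lsum_single _ _ j); [|apply seq_NoDup|apply in_seq; lia|].
      + rewrite (lsum_ext _ _ (fun k => RtoC (W k * (4 ^ k) ^ 0) * (RtoC (rho ^ j) * a j O))%C).
        * rewrite (lsum_ext _ _ (fun k => (RtoC (rho ^ j) * a j O) * RtoC (W k * (4 ^ k) ^ 0))%C) by (intros; ring).
          rewrite lsum_scal, lsum_RtoC, HW by lia. simpl. ring.
        * intros k _. unfold tau. destruct (le_dec j j); [|lia]. rewrite Nat.sub_diag, Nat.mul_0_r, Nat.add_0_r.
          rewrite !Cmult_assoc, <- !RtoC_mult. f_equal. f_equal. rewrite Rpow_mult_distr, pow_O.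
          assert (2 ^ k <> 0) by (apply pow_nonzero; lra).
          transitivity (W k * ((/ 2 ^ k) ^ j * (2 ^ k) ^ j) * rho ^ j); [ring|].
          rewrite <- Rpow_mult_distr, Rinv_l, pow1 by auto. ring.
      + intros i Hi Hij. apply in_seq in Hi. unfold tau. destruct (le_dec j i) as [Hji|Hji].
        * rewrite (lsum_ext _ _ (fun k => (RtoC (rho ^ (j + 2 * (i - j))) * a i (i - j)%nat) * RtoC (W k * (4 ^ k) ^ (i - j)))%C).
          -- rewrite lsum_scal, lsum_RtoC, HW by lia. destruct (Nat.eq_dec (i - j) 0); [lia|]. ring.
          -- intros k _. rewrite (Cmult_assoc (RtoC _)), <- RtoC_mult, (Cmult_comm (_ * _) (RtoC (W k * _))), (Cmult_assoc (RtoC (W k * _))), <- RtoC_mult.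
             f_equal. f_equal. rewrite Rpow_mult_distr, pow_add, pow_mult.
             assert (2 ^ k <> 0) by (apply pow_nonzero; lra).
             transitivity (W k * ((/ 2 ^ k) ^ j * (2 ^ k) ^ j) * ((2 ^ k) ^ 2) ^ (i - j) * rho ^ (j + 2 * (i - j))); [ring|].
             rewrite <- Rpow_mult_distr, Rinv_l, pow1 by auto.
             replace (4 ^ k) with ((2 ^ k) ^ 2) by (rewrite <- pow_mult, Nat.mul_comm, pow_mult; f_equal; ring). ring.
        * rewrite (lsum_ext _ _ (fun _ => RtoC 0)); [apply lsum_zero|]. intros; ring.
    - rewrite lsum_swap. apply lsum_ext. intros k _. rewrite lsum_scal. auto. }
  assert (E : rho ^ j * Cmod (psi j (RtoC 0)) = Cmod (RtoC (rho ^ j) * psi j (RtoC 0))).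
  { rewrite Cmod_mult, Cmod_R, Rabs_pos_eq; auto. apply pow_le; lra. }
  rewrite E, Hps. eapply Rle_trans; [apply lsum_Cmod|]. apply lsumR_le. intros k Hk. apply in_seq in Hk.
  rewrite Cmod_mult, Cmod_R, Rabs_mult, Rmult_assoc. apply Rmult_le_compat_l; [apply Rabs_pos|].
  assert (H2 : 1 <= 2 ^ k) by (apply pow_R1_Rle; lra).
  assert (Hq : 0 <= (/ 2 ^ k) ^ j <= 1).
  { assert (0 < / 2 ^ k) by (apply Rinv_0_lt_compat; lra). split; [apply pow_le; lra|].
    rewrite <- (pow1 j). apply pow_incr. split; [lra|]. rewrite <- Rinv_1. apply Rinv_le_contravar; lra. }
  rewrite Rabs_pos_eq by tauto.
  apply Rle_trans with (Cmod (lsum (seq 0 n) (tau k))).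
  { pose proof (Cmod_ge_0 (lsum (seq 0 n) (tau k))). nra. }
  replace (lsum (seq 0 n) (tau k)) with (A k + - (A k - lsum (seq 0 n) (tau k)))%C by ring.
  eapply Rle_trans; [apply Cmod_triangle|]. rewrite Cmod_opp. apply Rplus_le_compat; [|apply HA; lia].
  unfold A. rewrite Cmod_mult, Cmod_R, Rabs_pos_eq by (left; apply Rinv_0_lt_compat; auto).
  apply Rmult_le_compat_l; [left; apply Rinv_0_lt_compat; auto|].
  eapply Rle_trans; [apply lsum_Cmod|]. apply lsumR_le. intros d _. rewrite Cmod_mult, wN_Cmod, Rmult_1_l.
  apply Rle_refl.
Qed.

Lemma lsumR_term {I} (l : list I) (g : I -> R) x : In x l -> (forall y, 0 <= g y) -> g x <= lsumR l g.
Proof.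
  intros Hx Hg. induction l as [|a l IH]; [destruct Hx|]. simpl.
  pose proof (lsumR_nonneg l g ltac:(auto)). destruct Hx as [->|Hx]; [lra|]. specialize (IH Hx). specialize (Hg a). lra.
Qed.

(** When F(c + z) is re-expanded in powers of the conjugate of z, this is the value at z = 0 of the
    coefficient of the j-th power. *)
Definition shifted_coef (n : nat) (Bc : nat -> nat -> C -> C) (phi : nat -> C -> C) (j : nat) (c : C) : C :=
  lsum (seq 0 n) (fun k => Bc k j (- Cconj c) * phi k c)%C.

Section LocalEstimate.
Variables (n : nat) (phi : nat -> C -> C) (F : C -> C) (Bc : nat -> nat -> C -> C).
Hypothesis Hn : (1 <= n)%nat.
Hypothesis Hphi : forall k, (k < n)%nat -> ent (phi k).
Hypothesis HF : forall z, F z = lsum (seq 0 n) (fun k => Cconj z ^ k * phi k z)%C.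
Hypothesis HBc : forall k (z w : C), (k < n)%nat -> ((z - w) ^ k = lsum (seq 0 n) (fun i => z ^ i * Bc k i w))%C.

Let f (z : C) : R := Cnorm2 (F z) * exp (- PI * Cnorm2 z).
(** Coefficients of the Fock translate of F with centre [c]; the exponential is the holomorphic
    factor that replaces the weight at c + z by the weight at z. *)
Let psi (c : C) (j : nat) (z : C) : C :=
  (lsum (seq 0 n) (fun k => Bc k j (- Cconj c) * phi k (c + z)) * Cexp (- RtoC PI * Cconj c * z - RtoC (PI / 2 * (Cmod c * Cmod c))))%C.

Lemma psi_ent c j : ent (psi c j).
Proof.
  unfold psi. apply ent_mult.
  - apply ent_lsum. intros k Hk. apply in_seq in Hk. apply ent_mult; [apply ent_const|].
    apply (ent_comp (fun z => c + z)%C (phi k)); [|apply Hphi; lia]. apply ent_plus; [apply ent_const|apply ent_id].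
  - apply ent_exp. apply ent_minus; [|apply ent_const]. apply ent_mult; [apply ent_const|apply ent_id].
Qed.

Lemma psi_0 c j : Cmod (psi c j (RtoC 0)) = Cmod (shifted_coef n Bc phi j c) * exp (- (PI / 2) * (Cmod c * Cmod c)).
Proof.
  unfold psi. rewrite Cmod_mult, Cmod_Cexp. f_equal.
  - unfold shifted_coef. f_equal. apply lsum_ext. intros k _. replace (c + RtoC 0)%C with c by ring. auto.
  - f_equal. unfold Re, Cminus, Cplus, Copp, Cmult, RtoC; simpl. ring.
Qed.

(** The weights at c + z and at z differ by exp(pi |z|^2), which is at most exp(pi) on the unit
    disc. *)
Lemma psi_sum c z : Cmod z <= 1 ->
  Cmod (lsum (seq 0 n) (fun i => Cconj z ^ i * psi c i z)%C) * Cmod (lsum (seq 0 n) (fun i => Cconj z ^ i * psi c i z)%C) <= exp PI * f (c + z)%C.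
Proof.
  intros Hz.
  assert (E : lsum (seq 0 n) (fun i => Cconj z ^ i * psi c i z)%C = (F (c + z) * Cexp (- RtoC PI * Cconj c * z - RtoC (PI / 2 * (Cmod c * Cmod c))))%C).
  { unfold psi. set (X := Cexp _).
    rewrite (lsum_ext _ _ (fun i => X * lsum (seq 0 n) (fun k => Cconj z ^ i * Bc k i (- Cconj c) * phi k (c + z)))%C).
    2:{ intros i _. rewrite (Cmult_comm (lsum _ _) X).
        rewrite (Cmult_assoc (Cconj z ^ i)), (Cmult_comm (Cconj z ^ i) X), <- Cmult_assoc. f_equal.
        rewrite <- lsum_scal. apply lsum_ext. intros; ring. }
    rewrite lsum_scal, lsum_swap, HF, Cmult_comm. f_equal. apply lsum_ext. intros k Hk. apply in_seq in Hk.
    rewrite Cplus_conj. replace (Cconj c + Cconj z)%C with (Cconj z - - Cconj c)%C by ring.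
    rewrite (HBc k _ _ ltac:(lia)). rewrite (Cmult_comm (lsum _ _)), <- lsum_scal. apply lsum_ext. intros; ring. }
  rewrite E, Cmod_mult, Cmod_Cexp. unfold f. rewrite !Cnorm2_Cmod.
  assert (ER : Re (- RtoC PI * Cconj c * z - RtoC (PI / 2 * (Cmod c * Cmod c))) = - PI * (fst c * fst z + snd c * snd z) - PI / 2 * (Cmod c * Cmod c)).
  { unfold Re, Cminus, Cplus, Copp, Cmult, Cconj, RtoC; simpl. ring. }
  rewrite ER. set (e1 := exp _). set (m := Cmod (F (c + z))).
  replace (m * e1 * (m * e1)) with (m * m * (e1 * e1)) by ring.
  replace (exp PI * (m * m * exp (- PI * (Cmod (c + z) * Cmod (c + z))))) with (m * m * (exp PI * exp (- PI * (Cmod (c + z) * Cmod (c + z))))) by ring.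
  apply Rmult_le_compat_l; [apply Rle_0_sqr|]. unfold e1. rewrite <- !exp_plus. apply exp_mono.
  rewrite !Cmod_sqr. simpl. pose proof (Cmod_sqr z). pose proof (Cmod_ge_0 z). pose proof PI_RGT_0.
  assert (fst z * fst z + snd z * snd z <= 1) by nra. nra.
Qed.

Lemma f_nonneg z : 0 <= f z.
Proof. unfold f. apply Rmult_le_pos; [unfold Cnorm2; nra|left; apply exp_pos]. Qed.

Lemma f_ucont : ucont f.
Proof.
  assert (E : f = fun z => Re (F z * Cconj (F z) * Cexp (- RtoC PI * (z * Cconj z)))%C).
  { apply functional_extensionality. intros z. unfold f.
    rewrite <- !Cmod2_conj, <- RtoC_opp, <- RtoC_mult, Cexp_real, <- RtoC_mult, !Cnorm2_Cmod.
    simpl. rewrite !Rmult_1_r. reflexivity. }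
  rewrite E. apply ucont_of_cont0. intros z.
  assert (HFc : cont0 (fun h => F (z + h)%C)).
  { replace (fun h => F (z + h)%C) with (fun h => lsum (seq 0 n) (fun k => Cconj (z + h) ^ k * phi k (z + h))%C).
    2:{ apply functional_extensionality. intros h. symmetry. apply HF. }
    apply cont0_lsum. intros k Hk. apply in_seq in Hk. destruct (Hphi k ltac:(lia) z) as (L & HL).
      apply cont0_mult; [|apply (cont0_cdiff _ _ _ HL)]. apply (cont0_pow (fun h => Cconj (z + h))). apply cont0_conj.
      apply (cont0_cdiff (fun w => w) _ _ (cdiff_id z)). }
  pose proof (cont0_cdiff (fun w => w) _ _ (cdiff_id z)) as Hid. cbv beta in Hid.
  apply cont0_mult.
  - apply cont0_mult; [auto|]. apply (cont0_conj (fun h => F (z + h)%C)); auto.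
  - apply (cont0_Cexp (fun h => - RtoC PI * ((z + h) * Cconj (z + h)))%C). apply cont0_mult; [apply cont0_const|].
    apply cont0_mult; [auto|]. apply (cont0_conj (fun h => z + h)%C); auto.
Qed.

(** For each radius rho in [r, 2 r], [center_bound] estimates the coefficients at a centre by circle
    averages of the translated function. Averaging over the radii and summing over separated centres
    leads to [annulus_sum]. For a given finite set of centres the discretization errors are removed
    by letting [eta] tend to 0, so the bound does not depend on that set. *)
Lemma local_estimate M d0 : darboux_le f M -> 0 < d0 ->
  exists K, forall j, (j < n)%nat -> forall lc : list C, NoDup lc ->
    (forall p q, In p lc -> In q lc -> p <> q -> d0 <= Cmod (p - q)) ->
    lsumR lc (fun c => Cmod (psi c j (RtoC 0)) * Cmod (psi c j (RtoC 0))) <= K.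
Proof.
  intros HM Hd0.
  assert (HM0 : 0 <= M) by (apply (HM 1 O (fun _ _ => 0)); [lra | intros; lia]).
  destruct (extrapolation_weights n Hn) as (W & HW).
  assert (H2n : 0 < 2 ^ n) by (apply pow_lt; lra).
  assert (H2n1 : 1 <= 2 ^ n) by (apply pow_R1_Rle; lra).
  (* The annuli between 2^k r and 2^(k + 1) r, for k < n, must satisfy the separation condition of
     [annulus_sum] for centres [d0] apart, lie in the unit disc and fulfil the radius condition of
     [center_bound] up to rho = 2 r. *)
  set (r := Rmin (d0 / 5 / 2 ^ n) (/ 4 / 2 ^ n)).
  assert (Hr : 0 < r). { unfold r. apply Rmin_pos; repeat apply Rdiv_lt_0_compat; lra. }
  assert (Hr1 : 5 * (2 ^ n * r) <= d0).
  { assert (r <= d0 / 5 / 2 ^ n) by apply Rmin_l. apply (Rmult_le_compat_l (2 ^ n)) in H; [|lra].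
    replace (2 ^ n * (d0 / 5 / 2 ^ n)) with (d0 / 5) in H by (field; lra). lra. }
  assert (Hr2 : 2 ^ n * r <= / 4).
  { assert (r <= / 4 / 2 ^ n) by apply Rmin_r. apply (Rmult_le_compat_l (2 ^ n)) in H; [|lra].
    replace (2 ^ n * (/ 4 / 2 ^ n)) with (/ 4) in H by (field; lra). lra. }
  assert (Hr3 : r <= 1) by nra.
  set (SW := lsumR (seq 0 n) (fun k => Rabs (W k))).
  assert (HSW : 0 <= SW) by (apply lsumR_nonneg; intros; apply Rabs_pos).
  set (R2 := / (r ^ n * r ^ n)). assert (Hrn : 0 < r ^ n) by (apply pow_lt; auto).
  assert (HR2 : 0 < R2) by (apply Rinv_0_lt_compat; nra).
  pose proof (exp_pos PI) as HeP.
  exists (R2 * (SW * SW * (2 * exp PI * (4 * M / (r * r))))). intros j Hj lc ND Hsep.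
  assert (Hch : forall x : C * nat, exists y : (nat -> C) * R, PS (fst y) (psi (fst x) (snd x)) /\ forall k, Cmod (fst y k) <= snd y).
  { intros [c i]. simpl. destruct (ent_bound _ (psi_ent c i) 2) as (B & HB).
    destruct (ent_PS _ (psi_ent c i)) as (a & Ha1 & Ha2). exists (a, 4 * B). split; auto. intros k. simpl.
    specialize (Ha2 1 B Rlt_0_1 ltac:(intros; apply HB; lra) k). rewrite pow1 in Ha2. lra. }
  destruct (choice _ Hch) as (ab & Hab).
  set (B4 := lsumR lc (fun c => lsumR (seq 0 n) (fun i => Rabs (snd (ab (c, i)))))).
  assert (HB4 : forall c i k, In c lc -> (i < n)%nat -> Cmod (fst (ab (c, i)) k) <= B4).
  { intros c i k Hc Hi. destruct (Hab (c, i)) as (_ & H). eapply Rle_trans; [apply H|]. eapply Rle_trans; [apply Rle_abs|].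
    eapply Rle_trans; [apply (lsumR_term (seq 0 n) (fun i => Rabs (snd (ab (c, i)))))|].
    - apply in_seq; lia.
    - intros; apply Rabs_pos.
    - apply (lsumR_term lc (fun c => lsumR (seq 0 n) (fun i => Rabs (snd (ab (c, i)))))); auto.
      intros; apply lsumR_nonneg; intros; apply Rabs_pos. }
  assert (HB40 : 0 <= B4) by (apply lsumR_nonneg; intros; apply lsumR_nonneg; intros; apply Rabs_pos).
  set (nl := INR (length lc)). assert (Hnl : 0 <= nl) by apply pos_INR.
  (* Coefficient of the error [eta]. It depends on the number of centres, which is harmless because
     [eta] is chosen afterwards. *)
  set (Ce := R2 * (SW * SW * (2 * exp PI * nl + 2 * nl))).
  assert (HCe : 0 <= Ce). { unfold Ce. apply Rmult_le_pos; [lra|]. apply Rmult_le_pos; [nra|]. nra. }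
  set (S0 := lsumR lc _).
  assert (Hmain : forall eta, 0 < eta -> S0 <= R2 * (SW * SW * (2 * exp PI * (4 * M / (r * r)))) + Ce * eta).
  { intros eta Heta.
    assert (HN0 : forall k, exists N0, (k < n)%nat -> (0 < N0)%nat /\ forall N, (N0 <= N)%nat ->
       lsumR lc (fun c => avg2 N (fun i d => f (c + polar (2 ^ k * r) N i d)%C)) <= 4 * M / ((2 ^ k * r) * (2 ^ k * r)) + nl * eta).
    { intros k. destruct (lt_dec k n) as [Hk|Hk]; [|exists O; tauto].
      destruct (annulus_sum f M lc (2 ^ k * r)) with (dl := eta) as (N0 & HN0); auto.
      - apply f_nonneg.
      - apply f_ucont.
      - apply Rmult_lt_0_compat; auto. apply pow_lt; lra.
      - intros p q Hp Hq Hne. eapply Rle_trans; [|apply (Hsep p q Hp Hq Hne)]. eapply Rle_trans; [|apply Hr1].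
        apply Rmult_le_compat_l; [lra|]. apply Rmult_le_compat_r; [lra|]. apply Rle_pow; [lra|lia].
      - exists N0. auto. }
    destruct (choice _ HN0) as (N0 & HN0').
    destruct (pow_half_small (INR n * (2 * B4)) ltac:(apply Rmult_le_pos; [apply pos_INR|lra]) (Rmin 1 eta)) as (m & Hm).
    { apply Rmin_pos; lra. }
    (* Beyond the thresholds of all n annuli, beyond 2 n for [center_bound], and with N - n >= m to
       make the extraction error small. *)
    set (N := (list_max (map N0 (seq 0 n)) + n + m + 2 * n + 1)%nat).
    assert (HNk : forall k, (k < n)%nat -> (N0 k <= N)%nat).
    { intros k Hk. pose proof (proj1 (list_max_le (map N0 (seq 0 n)) (list_max (map N0 (seq 0 n)))) (le_n _)) as Hl.
      rewrite Forall_forall in Hl. specialize (Hl (N0 k)). unfold N.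
      assert (N0 k <= list_max (map N0 (seq 0 n)))%nat; [|lia]. apply Hl. apply in_map. apply in_seq. lia. }
    assert (HN' : 0 < INR N) by (apply lt_0_INR; unfold N; lia).
    set (eN := INR n * (2 * B4 * (/ 2) ^ (N - n))).
    assert (HeN : 0 <= eN <= Rmin 1 eta).
    { split.
      - unfold eN. apply Rmult_le_pos; [apply pos_INR|]. apply Rmult_le_pos; [lra|]. apply pow_le; lra.
      - left. eapply Rle_lt_trans; [|apply Hm]. unfold eN, Rdiv. rewrite <- (Rmult_assoc (INR n)). apply Rmult_le_compat_l.
        + apply Rmult_le_pos; [apply pos_INR|lra].
        + rewrite pow_inv. apply Rinv_le_contravar; [apply pow_lt; lra|]. apply Rle_pow; [lra|unfold N; lia]. }
    assert (HeN2 : eN * eN <= eta). { pose proof (Rmin_l 1 eta). pose proof (Rmin_r 1 eta). nra. }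
    assert (Hc : forall c, In c lc -> Cmod (psi c j (RtoC 0)) * Cmod (psi c j (RtoC 0)) <=
      R2 * (SW * lsumR (seq 0 n) (fun k => Rabs (W k) * (2 * exp PI * avg2 N (fun i d => f (c + polar (2 ^ k * r) N i d)%C) + 2 * eta)))).
    { intros c Hc. set (p := Cmod (psi c j (RtoC 0))). assert (Hp0 : 0 <= p) by apply Cmod_ge_0.
      assert (Hi : forall i, (i < N)%nat -> r ^ n * r ^ n * (p * p) <= SW * lsumR (seq 0 n) (fun k => Rabs (W k) * (2 * exp PI *
          (/ INR N * lsumR (seq 0 N) (fun d => f (c + polar (2 ^ k * r) N i d)%C)) + 2 * eta))).
      { intros i Hi. set (rho := r + INR i * (r / INR N)).
        assert (Hrho : r <= rho <= 2 * r). { destruct (polar_Cmod r N i O Hr Hi) as (E1 & E2). fold rho in E1. rewrite <- E1. auto. }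
        pose proof (center_bound n W j N rho (psi c) (fun i => fst (ab (c, i))) B4 Hj ltac:(unfold N; lia) HW ltac:(lra) ltac:(nra)
           (fun i _ => proj1 (Hab (c, i))) (fun i k Hi => HB4 c i k Hc Hi)) as Hcb.
        fold p in Hcb. fold eN in Hcb.
        set (mk := fun k => / INR N * lsumR (seq 0 N) (fun d => Cmod (lsum (seq 0 n) (fun i0 =>
          Cconj (RtoC (2 ^ k * rho) * wN N (Z.of_nat d)) ^ i0 * psi c i0 (RtoC (2 ^ k * rho) * wN N (Z.of_nat d))))%C)).
        change (rho ^ j * p <= lsumR (seq 0 n) (fun k => Rabs (W k) * (mk k + eN))) in Hcb.
        assert (Hmk0 : forall k, 0 <= mk k).
        { intros k. apply Rmult_le_pos; [left; apply Rinv_0_lt_compat; auto|]. apply lsumR_nonneg. intros; apply Cmod_ge_0. }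
        assert (Hmk : forall k, (k < n)%nat -> mk k * mk k <= exp PI * (/ INR N * lsumR (seq 0 N) (fun d => f (c + polar (2 ^ k * r) N i d)%C))).
        { intros k Hk. set (gd := fun d => Cmod (lsum (seq 0 n) (fun i0 =>
             Cconj (RtoC (2 ^ k * rho) * wN N (Z.of_nat d)) ^ i0 * psi c i0 (RtoC (2 ^ k * rho) * wN N (Z.of_nat d))))%C).
          assert (Emk : mk k = lsumR (seq 0 N) (fun d => gd d * / INR N)).
          { unfold mk. rewrite <- lsumR_scal. apply lsumR_ext. intros d _. unfold gd. ring. }
          rewrite Emk.
          eapply Rle_trans; [apply (lsumR_cauchy (seq 0 N) gd (fun _ => / INR N)); intros; left; apply Rinv_0_lt_compat; auto|].
          rewrite <- (lsumR_scal _ (/ INR N)). unfold gd.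
          rewrite lsumR_const, length_seq, Rinv_r, Rmult_1_r by lra. rewrite <- lsumR_scal. apply lsumR_le. intros d _.
          assert (Hpp : (RtoC (2 ^ k * rho) * wN N (Z.of_nat d))%C = polar (2 ^ k * r) N i d).
          { unfold polar, rho. f_equal. f_equal. field. lra. }
          assert (H2k : 2 ^ k <= 2 ^ n) by (apply Rle_pow; [lra|lia]).
          assert (0 < 2 ^ k) by (apply pow_lt; lra).
          rewrite Hpp. rewrite (Rmult_comm _ (/ INR N)), <- (Rmult_assoc (exp PI)), (Rmult_comm (exp PI)), Rmult_assoc.
          apply Rmult_le_compat_l; [left; apply Rinv_0_lt_compat; auto|]. apply psi_sum.
          destruct (polar_Cmod (2 ^ k * r) N i d ltac:(nra) Hi) as (_ & E2). nra. }
        set (X := lsumR (seq 0 n) (fun k => Rabs (W k) * (mk k + eN))) in *.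
        assert (HX : r ^ n * p <= X).
        { eapply Rle_trans; [|apply Hcb]. apply Rmult_le_compat_r; auto.
          replace n with (j + (n - j))%nat by lia. rewrite pow_add.
          assert (r ^ j <= rho ^ j) by (apply pow_incr; lra). assert (0 < r ^ j) by (apply pow_lt; auto).
          assert (0 <= r ^ (n - j) <= 1). { split; [apply pow_le; lra|]. rewrite <- (pow1 (n - j)). apply pow_incr. lra. }
          nra. }
        assert (0 <= r ^ n * p) by (apply Rmult_le_pos; lra).
        apply Rle_trans with (X * X); [nra|].
        unfold X. rewrite (lsumR_ext _ _ (fun k => (mk k + eN) * Rabs (W k))) by (intros; ring).
        eapply Rle_trans; [apply lsumR_cauchy; intros; apply Rabs_pos|]. fold SW. rewrite Rmult_comm.
        apply Rmult_le_compat_l; auto. apply lsumR_le. intros k Hk. apply in_seq in Hk.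
        rewrite Rmult_comm. apply Rmult_le_compat_l; [apply Rabs_pos|]. specialize (Hmk k ltac:(lia)).
        set (Y := / INR N * _) in *. pose proof (Rle_0_sqr (mk k - eN)). unfold Rsqr in *. lra. }
      apply (Rmult_le_reg_l (r ^ n * r ^ n)); [nra|]. unfold R2.
      match goal with |- _ <= _ * (_ * ?q) => replace (r ^ n * r ^ n * (/ (r ^ n * r ^ n) * q)) with q by (field; lra) end.
      apply (Rmult_le_reg_l (INR N)); auto.
      apply Rle_trans with (lsumR (seq 0 N) (fun i => SW * lsumR (seq 0 n) (fun k => Rabs (W k) * (2 * exp PI *
          (/ INR N * lsumR (seq 0 N) (fun d => f (c + polar (2 ^ k * r) N i d)%C)) + 2 * eta)))).
      - rewrite <- (length_seq N 0) at 1. rewrite <- lsumR_const. apply lsumR_le. intros i Hi'. apply in_seq in Hi'. apply Hi. lia.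
      - rewrite lsumR_scal. right. rewrite lsumR_swap.
        transitivity (SW * (INR N * lsumR (seq 0 n) (fun k => Rabs (W k) * (2 * exp PI * avg2 N (fun i d => f (c + polar (2 ^ k * r) N i d)%C) + 2 * eta)))); [|ring].
        f_equal. rewrite <- lsumR_scal. apply lsumR_ext. intros k _. rewrite lsumR_scal, lsumR_plus, lsumR_const, length_seq, lsumR_scal, lsumR_scal.
        unfold avg2. field. lra. }
    apply Rle_trans with (lsumR lc (fun c => R2 * (SW * lsumR (seq 0 n) (fun k => Rabs (W k) * (2 * exp PI * avg2 N (fun i d => f (c + polar (2 ^ k * r) N i d)%C) + 2 * eta))))).
    { apply lsumR_le. auto. }
    rewrite !lsumR_scal. unfold Ce.
    replace (R2 * (SW * SW * (2 * exp PI * (4 * M / (r * r)))) + R2 * (SW * SW * (2 * exp PI * nl + 2 * nl)) * eta) with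
      (R2 * (SW * (SW * (2 * exp PI * (4 * M / (r * r)) + (2 * exp PI * nl + 2 * nl) * eta)))) by ring.
    apply Rmult_le_compat_l; [lra|].
    apply Rmult_le_compat_l; auto. rewrite lsumR_swap.
    apply Rle_trans with (lsumR (seq 0 n) (fun k => Rabs (W k) * (2 * exp PI * (4 * M / (r * r)) + (2 * exp PI * nl + 2 * nl) * eta))).
    { apply lsumR_le. intros k Hk. apply in_seq in Hk. rewrite lsumR_scal. apply Rmult_le_compat_l; [apply Rabs_pos|].
      rewrite lsumR_plus, lsumR_scal, lsumR_const. fold nl.
      destruct (HN0' k ltac:(lia)) as (_ & HH). specialize (HH N (HNk k ltac:(lia))).
      assert (H1k : 1 <= 2 ^ k) by (apply pow_R1_Rle; lra).
      assert (4 * M / (2 ^ k * r * (2 ^ k * r)) <= 4 * M / (r * r)).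
      { unfold Rdiv. apply Rmult_le_compat_l; [lra|]. apply Rinv_le_contravar; [nra|].
        assert (r <= 2 ^ k * r) by nra. nra. }
      apply (Rmult_le_compat_l (2 * exp PI)) in HH; [|lra].
      apply (Rmult_le_compat_l (2 * exp PI)) in H; [|lra]. lra. }
    rewrite (lsumR_ext _ _ (fun k => (2 * exp PI * (4 * M / (r * r)) + (2 * exp PI * nl + 2 * nl) * eta) * Rabs (W k))) by (intros; ring).
    rewrite lsumR_scal. fold SW. right. ring. }
  apply le_epsilon. intros eps He. specialize (Hmain (eps / (Ce + 1)) ltac:(apply Rdiv_lt_0_compat; lra)).
  assert (Ce * (eps / (Ce + 1)) <= eps).
  { apply (Rmult_le_reg_r (Ce + 1)); [lra|]. replace (Ce * (eps / (Ce + 1)) * (Ce + 1)) with (Ce * eps) by (field; lra). nra. }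
  lra.
Qed.

End LocalEstimate.

(** * Fourier series of periodic entire functions *)
Lemma CI_shift h a b : a <= b -> ccont_on h (a + 1) (b + 1) -> CI (fun x => h (x + 1)) a b = CI h (a + 1) (b + 1).
Proof.
  intros Hab Hc.
  assert (E : forall f : R -> R, ex_RInt f (a + 1) (b + 1) -> RInt (fun x => f (x + 1)) a b = RInt f (a + 1) (b + 1)).
  { intros f Hf. pose proof (RInt_comp_lin (V := R_CompleteNormedModule) f 1 1 a b) as H. rewrite !Rmult_1_l in H.
    rewrite <- (H Hf). apply RInt_ext. intros x _. rewrite <- (Rmult_1_l x) at 1. symmetry. apply Rmult_1_l. }
  unfold CI. rewrite (E (fun t => fst (h t))), (E (fun t => snd (h t))); auto.
  - apply ccont_ex2; auto; lra.
  - apply ccont_ex1; auto; lra.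
Qed.

Lemma CI_window h s : (forall x, h (x + 1) = h x) -> (forall t, ccont h t) -> 0 <= s <= 1 -> CI h s (s + 1) = CI h 0 1.
Proof.
  intros Hp Hc Hs. rewrite <- (CI_Chasles h s 1 (s + 1)), <- (CI_Chasles h 0 s 1); [|lra|intros t _; auto|lra|intros t _; auto].
  assert (E : CI h 1 (s + 1) = CI h 0 s).
  { pose proof (CI_shift h 0 s ltac:(lra) (fun t _ => Hc t)) as H. rewrite Rplus_0_l in H. rewrite <- H.
    apply CI_ext; [lra|]. intros; auto. }
  rewrite E. ring.
Qed.

Lemma ent_ccont F y x : ent F -> ccont (fun x => F ((x, y) : C)) x.
Proof. intros H. destruct (H (x, y)) as (L & HL). apply contC_h. apply (cdiff_contC _ _ _ HL). Qed.

Lemma CI_ent_lsum {I} (l : list I) (F : I -> C -> C) y a b : a <= b -> (forall i, In i l -> ent (F i)) ->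
  CI (fun x => lsum l (fun i => F i ((x, y) : C))) a b = lsum l (fun i => CI (fun x => F i ((x, y) : C)) a b).
Proof.
  intros Hab. induction l as [|i l IH]; intros H.
  - simpl. pose proof (CI_lin (RtoC 0) (RtoC 0) a b) as E.
    rewrite <- (CI_ext (fun _ => RtoC 0)) in E; [|auto|intros; ring]. rewrite E. ring.
  - simpl. rewrite <- IH by (intros; apply H; right; auto). apply CI_plus; auto.
    + intros t _. apply ent_ccont. apply H. left; auto.
    + intros t _. apply (ent_ccont (fun v => lsum l (fun i => F i v))). apply ent_lsum. intros; apply H; right; auto.
Qed.

Definition ek (q : Z) (v : C) : C := Cexp (RtoC (2 * PI * IZR q) * Ci * v)%C.
Lemma ek_add p q v : ek (p + q) v = (ek p v * ek q v)%C.
Proof. unfold ek. rewrite <- Cexp_plus. f_equal. rewrite plus_IZR, !RtoC_mult, RtoC_plus. ring. Qed.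
Lemma ek_0 v : ek 0 v = RtoC 1.
Proof. unfold ek. rewrite <- Cexp_0. f_equal. rewrite Rmult_0_r. ring. Qed.
Lemma ek_plus q v w : ek q (v + w) = (ek q v * ek q w)%C.
Proof. unfold ek. rewrite <- Cexp_plus. f_equal. ring. Qed.
Lemma ek_per q v : ek q (v + 1) = ek q v.
Proof. rewrite ek_plus. unfold ek at 2. rewrite Cmult_1_r, Cexp_2PI. ring. Qed.
Lemma ek_ent q : ent (ek q).
Proof. apply ent_exp. apply ent_mult; [apply ent_const|apply ent_id]. Qed.
Lemma ek_Cmod q v : Cmod (ek q v) = exp (- (2 * PI * IZR q * snd v)).
Proof. unfold ek. rewrite Cmod_Cexp. f_equal. unfold Re, Cmult, RtoC; simpl. ring. Qed.

(** Fourier coefficient along the line Im v = y, with the complex exponential taken at x + i y, so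
    that for a periodic entire function it does not depend on y. *)
Definition fc (g : C -> C) (y : R) (q : Z) : C := CI (fun x => g ((x, y) : C) * ek (- q) ((x, y) : C))%C 0 1.

Lemma pair_plus_1 x y : ((x + 1, y) : C) = (((x, y) : C) + 1)%C.
Proof. unfold Cplus; simpl. f_equal; ring. Qed.

Lemma RI_periodic f x y1 y2 : (forall v, f (v + 1)%C = f v) ->
  RI f x (x + 1) y1 y2 = (CI (fun t => f ((t, y1) : C)) x (x + 1) - CI (fun t => f ((t, y2) : C)) x (x + 1))%C.
Proof.
  intros H. unfold RI. replace (fun y => f (x + 1, y)) with (fun y => f (x, y)); [ring|].
  apply functional_extensionality. intros y. rewrite pair_plus_1, H. auto.
Qed.

(** The vertical sides of a period rectangle cancel, so [goursat] equates the two horizontal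
    integrals. *)
Lemma CI_line_indep f y1 y2 : ent f -> (forall v, f (v + 1)%C = f v) ->
  CI (fun x => f ((x, y1) : C)) 0 1 = CI (fun x => f ((x, y2) : C)) 0 1.
Proof.
  intros Hf Hp.
  assert (L : forall a b, a <= b -> CI (fun x => f ((x, a) : C)) 0 1 = CI (fun x => f ((x, b) : C)) 0 1).
  { intros a b Hab. pose proof (goursat f 0 (0 + 1) a b ltac:(lra) Hab (fun z _ => Hf z)) as G.
    rewrite (RI_periodic f 0 a b Hp) in G. rewrite Rplus_0_l in G.
    rewrite <- (Cplus_0_r (CI (fun x => f ((x, b) : C)) 0 1)), <- G. ring. }
  destruct (Rle_dec y1 y2); [apply L; auto|symmetry; apply L; lra].
Qed.

Lemma fc_indep g y1 y2 q : ent g -> (forall v, g (v + 1)%C = g v) -> fc g y1 q = fc g y2 q.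
Proof.
  intros Hg Hp. apply (CI_line_indep (fun v => g v * ek (- q) v)%C).
  - apply ent_mult; [auto|apply ek_ent].
  - intros v. rewrite Hp, ek_per. auto.
Qed.

(** Moving the line from height 0 to height 1 multiplies the integral by a factor of modulus exp(2
    pi q), different from 1 for q <> 0, while [fc_indep] leaves it unchanged; hence it is 0. *)
Lemma fc_const c y q : fc (fun _ => c) y q = if Z.eq_dec q 0 then c else RtoC 0.
Proof.
  destruct (Z.eq_dec q 0) as [->|Hq].
  - unfold fc. rewrite (CI_ext _ (fun t => c + 0 * RtoC t)%C); [|lra|].
    + rewrite CI_lin. replace (1 - 0) with 1 by ring. ring.
    + intros t _. simpl Z.opp. rewrite ek_0. ring.
  - assert (E : fc (fun _ => c) 1 q = (ek (- q) (0, 1) * fc (fun _ => c) 0 q)%C).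
    { unfold fc. rewrite <- CI_scal; [|lra|].
      - apply CI_ext; [lra|]. intros t _. replace ((t, 1) : C) with (((0, 1) : C) + ((t, 0) : C))%C.
        + rewrite ek_plus. ring.
        + unfold Cplus; simpl. f_equal; ring.
      - intros t _. apply (ent_ccont (fun v => c * ek (- q) v)%C). apply ent_mult; [apply ent_const|apply ek_ent]. }
    rewrite (fc_indep (fun _ => c) 1 0 q (ent_const c) (fun v => eq_refl)) in E.
    assert (N : (ek (- q) (0, 1)%R - 1)%C <> RtoC 0).
    { intros N. assert (E1 : Cmod (ek (- q) (0, 1)%R) = 1).
      { replace (ek (- q) (0, 1)%R) with ((ek (- q) (0, 1)%R - 1) + 1)%C by ring. rewrite N, Cplus_0_l. apply Cmod_1. }
      rewrite ek_Cmod in E1. assert (E0 : - (2 * PI * IZR (- q) * snd (0, 1)) = 0) by (apply exp_inv; rewrite exp_0; auto).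
      simpl snd in E0. rewrite opp_IZR in E0.
      pose proof PI_RGT_0. apply Hq. apply eq_IZR. assert (E2 : (2 * PI) * IZR q = 0) by lra. destruct (Rmult_integral _ _ E2); lra. }
    rewrite (fc_indep (fun _ => c) y 0 q (ent_const c) (fun v => eq_refl)).
    set (X := fc _ 0 q) in *.
    replace X with ((ek (- q) (0, 1)%R * X - X) / (ek (- q) (0, 1)%R - 1))%C by (field; auto). rewrite <- E. field. auto.
Qed.

Lemma dirichlet_telescope (Q : Z) (u : C) : forall M : nat,
  ((1 - ek 1 u) * lsum (seq 0 M) (fun k => ek (Q - Z.of_nat k - 1) u) = ek (Q - Z.of_nat M) u - ek Q u)%C.
Proof.
  induction M as [|M IH].
  - replace (Q - Z.of_nat 0)%Z with Q by lia. simpl. ring.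
  - rewrite lsum_seq_S, Cmult_plus_distr_l, IH.
    replace (Q - Z.of_nat M)%Z with (1 + (Q - Z.of_nat M - 1))%Z at 1 by lia.
    replace (Q - Z.of_nat (S M))%Z with (Q - Z.of_nat M - 1)%Z by lia. rewrite ek_add. ring.
Qed.

Lemma ek1_eq u : ek 1 u = RtoC 1 -> exists k, u = RtoC (IZR k).
Proof.
  intros H. pose proof PI_RGT_0.
  assert (E1 : Cmod (ek 1 u) = 1) by (rewrite H; apply Cmod_1). rewrite ek_Cmod in E1.
  assert (E0 : - (2 * PI * 1 * snd u) = 0) by (apply exp_inv; rewrite exp_0; auto).
  assert (Hs : snd u = 0). { assert (E2 : (2 * PI) * snd u = 0) by lra. destruct (Rmult_integral _ _ E2); lra. }
  destruct (Cexp_eq_1 (2 * PI * fst u)) as (k & Hk).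
  - rewrite <- H. unfold ek. f_equal. destruct u as [a b]. simpl in Hs. subst b. unfold Cmult, RtoC, Ci; simpl. f_equal; ring.
  - exists k. destruct u as [a b]. simpl in *. subst b. unfold RtoC. f_equal.
    apply (Rmult_eq_reg_l (2 * PI)); lra.
Qed.

(** The error of the partial sum is an integral of g(v0) - g(v) against a Dirichlet kernel along Im
    v = y0 - 1. The kernel is a difference of ek(-Q) and ek(Q) over 1 - ek(1). The first part is
    small on that line; the second is moved across the removable singularity to Im v = y0 + 1, where
    it is small too. *)
Lemma fourier_window g (v0 : C) : ent g -> (forall v, g (v + 1)%C = g v) -> 1 / 2 <= fst v0 <= 3 / 2 ->
  exists M, forall Q : nat, (1 <= Q)%nat ->
    Cmod (g v0 - lsum (seq 0 (2 * Q)) (fun k => fc g 0 (1 + Z.of_nat k - Z.of_nat Q) * ek (1 + Z.of_nat k - Z.of_nat Q) v0))%C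
      <= M * exp (- (2 * PI * INR Q)).
Proof.
  intros Hg Hp Hx. set (x0 := fst v0) in *. set (y0 := snd v0). set (s := x0 - 1 / 2).
  pose proof PI_RGT_0 as HPI.
  (* The numerator vanishes at v0, the only zero of the denominator in the rectangle, so [h] is
     bounded near v0. *)
  set (h := fun v => ((g v0 - g v) * / (1 - ek 1 (v - v0)))%C).
  assert (Hne : forall z : C, inrect s (s + 1) (y0 - 1) (y0 + 1) z -> z <> v0 -> (1 - ek 1 (z - v0))%C <> RtoC 0).
  { intros z [Hz1 Hz2] Hz E. destruct (ek1_eq (z - v0)) as (k & Hk).
    - replace (ek 1 (z - v0)) with (1 - (1 - ek 1 (z - v0)))%C by ring. rewrite E. ring.
    - assert (Hk1 : fst z - x0 = IZR k) by (apply (f_equal fst) in Hk; simpl in Hk; unfold x0; lra).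
      assert (k = 0)%Z. { unfold s in Hz1. assert (-1 < IZR k < 1) by lra. assert (-1 < k)%Z by (apply lt_IZR; lra). assert (k < 1)%Z by (apply lt_IZR; lra). lia. }
      subst k. apply Hz. replace z with (v0 + (z - v0))%C by ring. rewrite Hk. ring. }
  assert (Hh : forall z : C, inrect s (s + 1) (y0 - 1) (y0 + 1) z -> z <> v0 -> exists L, cdiff h z L).
  { intros z Hz Hzn. specialize (Hne z Hz Hzn).
    assert (H1 : ent (fun v => g v0 - g v)%C) by (apply ent_minus; [apply ent_const|auto]).
    assert (H2 : ent (fun v => 1 - ek 1 (v - v0))%C).
    { apply ent_minus; [apply ent_const|]. apply (ent_comp (fun v => v - v0)%C (ek 1)); [apply ent_minus; [apply ent_id|apply ent_const]|apply ek_ent]. }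
    destruct (H1 z) as (L1 & HL1). destruct (H2 z) as (L2 & HL2).
    eexists. unfold h. apply cdiff_mult; [apply HL1|]. apply (cdiff_comp (fun v => 1 - ek 1 (v - v0))%C (fun w => / w)%C z L2 (- / ((1 - ek 1 (z - v0)) * (1 - ek 1 (z - v0))))%C HL2). apply cdiff_inv. auto. }
  assert (Hlines : forall y, y = y0 - 1 \/ y = y0 + 1 -> forall x, s <= x <= s + 1 ->
     inrect s (s + 1) (y0 - 1) (y0 + 1) ((x, y) : C) /\ ((x, y) : C) <> v0).
  { intros y Hy x Hxx. split.
    - split; simpl; lra.
    - intros E. assert (y = y0) by (unfold y0; rewrite <- E; auto). lra. }
  assert (Hhc : forall y, y = y0 - 1 \/ y = y0 + 1 -> ccont_on (fun x => h ((x, y) : C)) s (s + 1)).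
  { intros y Hy x Hxx. destruct (Hlines y Hy x Hxx) as [A B]. destruct (Hh _ A B) as (L & HL). apply contC_h. apply (cdiff_contC _ _ _ HL). }
  destruct (ccont_bounded _ s (s + 1) ltac:(lra) (Hhc (y0 - 1) (or_introl eq_refl))) as (M1 & HM1).
  destruct (ccont_bounded _ s (s + 1) ltac:(lra) (Hhc (y0 + 1) (or_intror eq_refl))) as (M2 & HM2).
  assert (Hhb : exists B d, 0 < d /\ forall z, z <> v0 -> Cmod (z - v0) < d -> Cmod (h z) <= B).
  { destruct (Hg v0) as (L & HL). destruct (cdiff_bound _ _ _ HL) as (d1 & Hd1 & Hb1).
    assert (Hde : cdiff (ek 1) (RtoC 0) (ek 1 (RtoC 0) * (RtoC (2 * PI * 1) * Ci))%C).
    { assert (Hlin : cdiff (fun w => RtoC (2 * PI * 1) * Ci * w)%C (RtoC 0) (RtoC (2 * PI * 1) * Ci)%C).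
      { pose proof (cdiff_mult (fun _ => RtoC (2 * PI * 1) * Ci)%C (fun w => w) (RtoC 0) _ _ (cdiff_const _ _) (cdiff_id _)) as Hm. cbv beta in Hm.
        replace (RtoC 0 * RtoC 0 + RtoC (2 * PI * 1) * Ci * 1)%C with (RtoC (2 * PI * 1) * Ci)%C in Hm by ring. auto. }
      apply (cdiff_comp _ Cexp (RtoC 0) _ _ Hlin). apply cdiff_exp. }
    destruct (Hde 1 Rlt_0_1) as (d2 & Hd2 & Hb2).
    exists (Cmod L + 1), (Rmin d1 d2). split; [apply Rmin_pos; auto|]. intros z Hz Hd.
    assert (Hz1 : Cmod (z - v0) < d1) by (eapply Rlt_le_trans; [apply Hd|apply Rmin_l]).
    assert (Hz2 : Cmod (z - v0) < d2) by (eapply Rlt_le_trans; [apply Hd|apply Rmin_r]).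
    specialize (Hb1 _ Hz1). specialize (Hb2 _ Hz2). set (u := (z - v0)%C) in *.
    assert (Hu : 0 < Cmod u). { apply Cmod_gt_0. intros E. apply Hz. replace z with (v0 + u)%C by (unfold u; ring). rewrite E. ring. }
    replace (v0 + u)%C with z in Hb1 by (unfold u; ring).
    rewrite Cplus_0_l in Hb2. replace (ek 1 (RtoC 0)) with (RtoC 1) in Hb2.
    2:{ unfold ek. rewrite <- Cexp_0. f_equal. ring. }
    assert (Hlow : Cmod u <= Cmod (1 - ek 1 u)).
    { assert (H2 : Cmod (RtoC 1 * (RtoC (2 * PI * 1) * Ci) * u) = 2 * PI * Cmod u).
      { rewrite !Cmod_mult, Cmod_1, Cmod_R, Rabs_pos_eq by lra. replace (Cmod Ci) with 1; [ring|].
        unfold Cmod, Ci; simpl. replace (0 * (0 * 1) + 1 * (1 * 1)) with 1 by ring. rewrite sqrt_1. auto. }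
      pose proof (Cmod_triangle (1 - ek 1 u) (ek 1 u - 1 - RtoC 1 * (RtoC (2 * PI * 1) * Ci) * u)) as H3.
      replace (1 - ek 1 u + (ek 1 u - 1 - RtoC 1 * (RtoC (2 * PI * 1) * Ci) * u))%C with (- (RtoC 1 * (RtoC (2 * PI * 1) * Ci) * u))%C in H3 by ring.
      rewrite Cmod_opp, H2 in H3. pose proof PI2_3_2. nra. }
    unfold h. fold u. assert (Hn0 : (1 - ek 1 u)%C <> RtoC 0) by (apply Cmod_gt_0; lra).
    rewrite Cmod_mult, Cmod_inv by auto. replace (g v0 - g z)%C with (- (g z - g v0))%C by ring. rewrite Cmod_opp.
    apply (Rmult_le_reg_r (Cmod (1 - ek 1 u))); [lra|]. rewrite Rmult_assoc, Rinv_l by lra.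
    pose proof (Cmod_ge_0 L). nra. }
  destruct Hhb as (B & d & Hd & HB).
  exists (2 * M1 + 2 * M2). intros Q HQ. set (Qz := Z.of_nat Q).
  set (D := lsum (seq 0 (2 * Q)) _).
  set (S := fun v => lsum (seq 0 (2 * Q)) (fun k => (g v0 - g v) * ek (Qz - Z.of_nat k - 1) (v - v0))%C).
  assert (HSent : forall k q, ent (fun v => k * ek q (v - v0))%C).
  { intros k q. apply ent_mult; [apply ent_const|]. apply (ent_comp (fun v => v - v0)%C (ek q)); [apply ent_minus; [apply ent_id|apply ent_const]|apply ek_ent]. }
  assert (A : CI (fun x => S ((x, (y0 - 1)%R) : C)) s (s + 1) = (g v0 - D)%C).
  { unfold S. rewrite (CI_ent_lsum _ (fun k v => (g v0 - g v) * ek (Qz - Z.of_nat k - 1) (v - v0))%C); [|lra|].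
    2:{ intros k _. apply ent_mult; [apply ent_minus; [apply ent_const|auto]|].
        apply (ent_comp (fun v => v - v0)%C (ek _)); [apply ent_minus; [apply ent_id|apply ent_const]|apply ek_ent]. }
    transitivity (lsum (seq 0 (2 * Q)) (fun k => (fc (fun _ => g v0) 0 (1 + Z.of_nat k - Qz) * ek (1 + Z.of_nat k - Qz) v0) +
       (- (1)) * (fc g 0 (1 + Z.of_nat k - Qz) * ek (1 + Z.of_nat k - Qz) v0))%C).
    - apply lsum_ext. intros k _. set (q := (1 + Z.of_nat k - Qz)%Z). replace (Qz - Z.of_nat k - 1)%Z with (- q)%Z by (unfold q; lia).
      rewrite (fc_indep _ 0 (y0 - 1) q (ent_const (g v0)) (fun v => eq_refl)), (fc_indep g 0 (y0 - 1) q Hg Hp).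
      transitivity (ek q v0 * CI (fun x => (g v0 * ek (- q) ((x, (y0 - 1)%R) : C) + (- (1)) * (g ((x, (y0 - 1)%R) : C) * ek (- q) ((x, (y0 - 1)%R) : C)))) s (s + 1))%C.
      + rewrite <- CI_scal; [|lra|].
        * apply CI_ext; [lra|]. intros t _. unfold Cminus at 2. rewrite ek_plus.
          replace (ek (- q) (- v0)) with (ek q v0); [ring|]. unfold ek. f_equal. rewrite opp_IZR, !RtoC_mult, RtoC_opp. ring.
        * intros t _. apply (ent_ccont (fun v => g v0 * ek (- q) v + (- (1)) * (g v * ek (- q) v))%C).
          apply ent_plus; [apply ent_mult; [apply ent_const|apply ek_ent]|]. apply ent_mult; [apply ent_const|]. apply ent_mult; [auto|apply ek_ent].
      + rewrite (CI_window (fun x => (g v0 * ek (- q) ((x, (y0 - 1)%R) : C) + (- (1)) * (g ((x, (y0 - 1)%R) : C) * ek (- q) ((x, (y0 - 1)%R) : C)))%C)).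
        * unfold fc. cbv beta. rewrite CI_plus, (CI_scal (- (1))%C); [ring|lra| |lra| |].
          -- intros t _. apply (ent_ccont (fun v => (g v * ek (- q) v))%C). apply ent_mult; [auto|apply ek_ent].
          -- intros t _. apply (ent_ccont (fun v => g v0 * ek (- q) v)%C). apply ent_mult; [apply ent_const|apply ek_ent].
          -- intros t _. apply (ent_ccont (fun v => (- (1)) * (g v * ek (- q) v))%C). apply ent_mult; [apply ent_const|]. apply ent_mult; [auto|apply ek_ent].
        * intros x. rewrite pair_plus_1, ek_per, Hp. auto.
        * intros t. apply (ent_ccont (fun v => g v0 * ek (- q) v + (- (1)) * (g v * ek (- q) v))%C).
          apply ent_plus; [apply ent_mult; [apply ent_const|apply ek_ent]|]. apply ent_mult; [apply ent_const|]. apply ent_mult; [auto|apply ek_ent].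
        * unfold s. lra.
    (* The frequency 1 + k - Q is 0 exactly at k = Q - 1; only there does the constant g(v0) have a
       nonzero coefficient. *)
    - rewrite lsum_plus, lsum_scal. fold D. rewrite (lsum_single _ _ (Q - 1)%nat); [|apply seq_NoDup|apply in_seq; lia|].
      + replace (1 + Z.of_nat (Q - 1) - Qz)%Z with 0%Z by (unfold Qz; lia). rewrite fc_const, ek_0. simpl. ring.
      + intros k _ Hk. rewrite fc_const. destruct (Z.eq_dec _ _) as [E|E]; [exfalso; unfold Qz in E; lia|ring]. }
  set (hq := fun q v => (h v * ek q (v - v0))%C).
  assert (Hhq : forall q, forall z : C, inrect s (s + 1) (y0 - 1) (y0 + 1) z -> z <> v0 -> exists L, cdiff (hq q) z L).
  { intros q z Hz Hzn. destruct (Hh z Hz Hzn) as (L & HL). destruct (HSent (RtoC 1) q z) as (L' & HL').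
    eexists. unfold hq. apply (cdiff_mult h (fun v => ek q (v - v0)) z L L'); auto.
    eapply cdiff_ext; [|apply HL']. intros w. cbv beta. ring. }
  assert (Hhqc : forall q y, y = y0 - 1 \/ y = y0 + 1 -> ccont_on (fun x => hq q ((x, y) : C)) s (s + 1)).
  { intros q y Hy x Hxx. destruct (Hlines y Hy x Hxx) as [A1 B1]. destruct (Hhq q _ A1 B1) as (L & HL). apply contC_h. apply (cdiff_contC _ _ _ HL). }
  assert (Bt : CI (fun x => S ((x, (y0 - 1)%R) : C)) s (s + 1) =
    (CI (fun x => hq (- Qz)%Z ((x, (y0 - 1)%R) : C)) s (s + 1) - CI (fun x => hq Qz ((x, (y0 - 1)%R) : C)) s (s + 1))%C).
  { transitivity (CI (fun x => hq (- Qz)%Z ((x, (y0 - 1)%R) : C) + (- (1)) * hq Qz ((x, (y0 - 1)%R) : C))%C s (s + 1)).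
    - apply CI_ext; [lra|]. intros t Ht. destruct (Hlines (y0 - 1) (or_introl eq_refl) t ltac:(lra)) as [A1 B1].
      specialize (Hne _ A1 B1). unfold S, hq, h. rewrite lsum_scal. set (u := (_ - v0)%C) in *.
      pose proof (dirichlet_telescope Qz u (2 * Q)) as T. replace (Qz - Z.of_nat (2 * Q))%Z with (- Qz)%Z in T by (unfold Qz; lia).
      match type of T with (_ * ?Y)%C = _ => set (X := Y) in * end. replace X with ((1 - ek 1 u) * X * / (1 - ek 1 u))%C by (field; auto). rewrite T. ring.
    - rewrite CI_plus, CI_scal; [ring|lra|apply Hhqc; auto|lra|apply Hhqc; auto|].
      intros t Ht eps He. destruct (Hhqc Qz (y0 - 1) (or_introl eq_refl) t Ht eps He) as (dd & Hdd & Hdd').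
      exists dd. split; auto. intros s' Hs'. specialize (Hdd' s' Hs').
      match goal with |- Cmod (?a * ?x - ?a * ?y) < _ => replace (a * x - a * y)%C with (- (x - y))%C by ring end.
      rewrite Cmod_opp. auto. }
  assert (G : CI (fun x => hq Qz ((x, (y0 - 1)%R) : C)) s (s + 1) = CI (fun x => hq Qz ((x, (y0 + 1)%R) : C)) s (s + 1)).
  { assert (R0 : RI (hq Qz) s (s + 1) (y0 - 1) (y0 + 1) = RtoC 0).
    { apply (goursat_removable (hq Qz) s (s + 1) (y0 - 1) (y0 + 1) v0 (B * exp (2 * PI * INR Q * d)) d).
      - fold x0. unfold s. lra.
      - fold y0. lra.
      - apply Hhq.
      - auto.
      - intros z Hz Hzd. unfold hq. rewrite Cmod_mult, ek_Cmod. apply Rmult_le_compat; [apply Cmod_ge_0|left; apply exp_pos|apply HB; auto|].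
        apply exp_mono. unfold Qz. rewrite <- INR_IZR_INZ. pose proof (snd_le_Cmod (z - v0)%C) as H1.
        assert (- snd (z - v0)%C <= d). { pose proof (Rabs_maj2 (snd (z - v0)%C)). lra. }
        assert (0 <= 2 * PI * INR Q) by (pose proof (pos_INR Q); nra). nra. }
    rewrite RI_periodic in R0.
    - match type of R0 with (?x - ?y)%C = _ => set (a := x) in *; set (b := y) in * end.
      transitivity ((a - b) + b)%C; [ring|]. rewrite R0. ring.
    - intros v. unfold hq, h. rewrite Hp. replace (v + 1 - v0)%C with (v - v0 + 1)%C by ring. rewrite !ek_per. auto. }
  rewrite <- A, Bt, G. unfold Cminus. eapply Rle_trans; [apply Cmod_triangle|]. rewrite Cmod_opp, Rmult_plus_distr_r.
  assert (Hcb : forall y q M, y = y0 - 1 \/ y = y0 + 1 -> (forall t, s <= t <= s + 1 -> Cmod (h ((t, y) : C)) <= M) ->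
     2 * PI * IZR q * (y - y0) = 2 * PI * INR Q -> Cmod (CI (fun x => hq q ((x, y) : C)) s (s + 1)) <= 2 * M * exp (- (2 * PI * INR Q))).
  { intros y q M Hy HM Hq.
    replace (2 * M * exp (- (2 * PI * INR Q))) with (2 * (M * exp (- (2 * PI * INR Q))) * (s + 1 - s)) by ring.
    apply CI_bound; [lra|apply Hhqc; auto|]. intros t Ht. unfold hq. rewrite Cmod_mult, ek_Cmod.
    apply Rmult_le_compat; [apply Cmod_ge_0|left; apply exp_pos|apply HM; auto|]. right. f_equal.
    change (snd (((t, y) : C) - v0)%C) with (y - y0). lra. }
  apply Rplus_le_compat.
  - apply Hcb; auto. unfold Qz. rewrite opp_IZR, <- INR_IZR_INZ. ring.
  - apply Hcb; auto. unfold Qz. rewrite <- INR_IZR_INZ. ring.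
Qed.

(** Every coefficient may be computed on a line of its own, a freedom exploited by [yq]. Absolute
    convergence comes from taking the line one unit below the point for q >= 0 and one unit above it
    for q < 0. *)
Lemma fourier_series g (v0 : C) (ys : Z -> R) : ent g -> (forall v, g (v + 1)%C = g v) ->
  HS (fun q => fc g (ys q) q * ek q v0)%C (g v0).
Proof.
  intros Hg Hp. pose proof PI_RGT_0 as HPI.
  apply (HS_ext (fun q => fc g 0 q * ek q v0)%C).
  { intros q. rewrite (fc_indep g (ys q) 0 q); auto. }
  assert (HpZ : forall k v, g (v + RtoC (IZR k))%C = g v).
  { assert (HpN : forall k v, g (v + RtoC (INR k))%C = g v).
    { induction k as [|k IH]; intros v; [simpl; f_equal; ring|]. rewrite S_INR, RtoC_plus, Cplus_assoc, Hp. apply IH. }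
    intros k v. destruct (Z.le_gt_cases 0 k) as [Hk|Hk].
    - rewrite <- (Z2Nat.id k) by auto. rewrite <- INR_IZR_INZ. apply HpN.
    - rewrite <- (HpN (Z.to_nat (- k)) (v + RtoC (IZR k))%C). f_equal. rewrite INR_IZR_INZ, Z2Nat.id, opp_IZR, RtoC_opp by lia. ring. }
  assert (HekZ : forall q k v, ek q (v + RtoC (IZR k))%C = ek q v).
  { intros q k v. rewrite ek_plus. replace (ek q (RtoC (IZR k))) with (RtoC 1); [ring|]. symmetry. unfold ek.
    rewrite <- (Cexp_2PI (q * k)). f_equal. rewrite mult_IZR, !RtoC_mult. ring. }
  (* An integer translation brings the abscissa into [1/2, 3/2], as [fourier_window] requires. *)
  set (k0 := (up (fst v0 - 3 / 2))%Z). destruct (archimed (fst v0 - 3 / 2)) as [H1 H2]. fold k0 in H1, H2.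
  set (v1 := (v0 - RtoC (IZR k0))%C).
  assert (Ev : v0 = (v1 + RtoC (IZR k0))%C) by (unfold v1; ring).
  assert (E0 : g v0 = g v1) by (rewrite Ev; apply HpZ).
  rewrite E0. apply (HS_ext (fun q => fc g 0 q * ek q v1)%C).
  { intros q. rewrite Ev, HekZ. auto. }
  assert (Hv1 : 1 / 2 <= fst v1 <= 3 / 2). { unfold v1. simpl. lra. }
  destruct (fourier_window g v1 Hg Hp Hv1) as (M & HM).
  assert (Hbs : exists K, bsum (fun q => Cmod (fc g 0 q * ek q v1)%C) K).
  { set (yb := snd v1 - 1). set (yt := snd v1 + 1).
    destruct (ccont_bounded (fun x => g ((x, yb) : C)) 0 1 Rle_0_1 (fun t _ => ent_ccont g yb t Hg)) as (B1 & HB1).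
    destruct (ccont_bounded (fun x => g ((x, yt) : C)) 0 1 Rle_0_1 (fun t _ => ent_ccont g yt t Hg)) as (B2 & HB2).
    assert (HB10 : 0 <= B1) by (eapply Rle_trans; [apply Cmod_ge_0|apply (HB1 0); lra]).
    assert (HB20 : 0 <= B2) by (eapply Rle_trans; [apply Cmod_ge_0|apply (HB2 0); lra]).
    destruct (bsum_exp_Z (2 * PI) ltac:(lra)) as (K & HK).
    exists (2 * (B1 + B2) * K). eapply bsum_le; [|apply bsum_scal; [|apply HK]; lra].
    assert (Hq : forall q y Bq, (forall t, 0 <= t <= 1 -> Cmod (g ((t, y) : C)) <= Bq) -> 2 * PI * IZR q * (y - snd v1) <= - (2 * PI) * Rabs (IZR q) ->
       Cmod (fc g y q * ek q v1)%C <= 2 * Bq * exp (- (2 * PI) * Rabs (IZR q))).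
    { intros q y Bq HBq Hy. assert (0 <= Bq) by (eapply Rle_trans; [apply Cmod_ge_0|apply (HBq 0); lra]).
      rewrite Cmod_mult, ek_Cmod.
      apply Rle_trans with (2 * (Bq * exp (2 * PI * IZR q * y)) * (1 - 0) * exp (- (2 * PI * IZR q * snd v1))).
      - apply Rmult_le_compat_r; [left; apply exp_pos|]. unfold fc. apply CI_bound; [lra| |].
        + intros t _. apply (ent_ccont (fun v => g v * ek (- q) v)%C). apply ent_mult; [auto|apply ek_ent].
        + intros t Ht. rewrite Cmod_mult, ek_Cmod. apply Rmult_le_compat; [apply Cmod_ge_0|left; apply exp_pos|apply HBq; auto|].
          right. f_equal. simpl. rewrite opp_IZR. ring.
      - replace (2 * (Bq * exp (2 * PI * IZR q * y)) * (1 - 0) * exp (- (2 * PI * IZR q * snd v1))) with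
          (2 * Bq * (exp (2 * PI * IZR q * y) * exp (- (2 * PI * IZR q * snd v1)))) by ring.
        rewrite <- exp_plus. apply Rmult_le_compat_l; [lra|]. apply exp_mono. lra. }
    intros q. pose proof (exp_pos (- (2 * PI) * Rabs (IZR q))).
    destruct (Z.le_gt_cases 0 q) as [Hq0|Hq0].
    - rewrite (fc_indep g 0 yb q Hg Hp). eapply Rle_trans; [apply (Hq q yb B1 HB1)|nra].
      apply IZR_le in Hq0. rewrite Rabs_pos_eq by lra. unfold yb. lra.
    - rewrite (fc_indep g 0 yt q Hg Hp). eapply Rle_trans; [apply (Hq q yt B2 HB2)|nra].
      apply IZR_lt in Hq0. rewrite Rabs_left by lra. unfold yt. lra. }
  destruct Hbs as (K & HK). destruct (HS_exists _ _ HK) as (s & Hs).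
  replace (g v1) with s; auto.
  apply NNPP. intros Hne. set (e := Cmod (s - g v1)).
  assert (He : 0 < e). { apply Cmod_gt_0. intros E. apply Hne. replace s with ((s - g v1) + g v1)%C by ring. rewrite E. ring. }
  destruct (Hs (e / 2) ltac:(lra)) as (A & NDA & HA).
  assert (HQ : exists Q0 : nat, forall q, In q A -> (Z.abs_nat q < Q0)%nat).
  { clear. induction A as [|a A (Q0 & IH)]; [exists O; intros q []|]. exists (S (Nat.max (Z.abs_nat a) Q0)).
    intros q [<-|Hq]; [lia|]. specialize (IH q Hq). lia. }
  destruct HQ as (Q0 & HQ0).
  assert (HM0 : 0 <= M). { pose proof (HM 1%nat (le_n _)) as H. pose proof (exp_pos (- (2 * PI * INR 1))). pose proof (Cmod_ge_0 (g v1 - lsum (seq 0 (2 * 1)) (fun k => fc g 0 (1 + Z.of_nat k - Z.of_nat 1) * ek (1 + Z.of_nat k - Z.of_nat 1) v1))%C).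
    apply Rnot_lt_le. intros Hneg. nra. }
  destruct (nfloor_ex (2 * M / e)) as (k & Hk). { apply Rdiv_le_0_compat; lra. }
  set (Q := (Q0 + k + 2)%nat). specialize (HM Q ltac:(unfold Q; lia)).
  set (lst := map (fun k => (1 + Z.of_nat k - Z.of_nat Q)%Z) (seq 0 (2 * Q))).
  specialize (HA lst).
  assert (HA' : Cmod (lsum lst (fun q => fc g 0 q * ek q v1)%C - s) < e / 2).
  { apply HA.
    - unfold lst. apply Injective_map_NoDup; [|apply seq_NoDup]. intros a b. lia.
    - intros q Hq. specialize (HQ0 q Hq). unfold lst. apply in_map_iff. exists (Z.to_nat (q + Z.of_nat Q - 1)). split; [unfold Q; lia|].
      apply in_seq. unfold Q. lia. }
  unfold lst in HA'. rewrite lsum_map in HA'. set (X := lsum (seq 0 (2 * Q)) _) in *.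
  assert (Hex : M * exp (- (2 * PI * INR Q)) < e / 2).
  { rewrite exp_Ropp. assert (INR Q < exp (2 * PI * INR Q)).
    { pose proof (exp_ineq1_le (2 * PI * INR Q)). pose proof PI2_3_2. pose proof (pos_INR Q). nra. }
    assert (2 * M / e < INR Q). { unfold Q. rewrite !plus_INR. pose proof (pos_INR Q0). simpl (INR 2). lra. }
    assert (HQp : 0 < INR Q) by (apply lt_0_INR; unfold Q; lia).
    apply (Rmult_lt_reg_r (exp (2 * PI * INR Q))); [apply exp_pos|]. rewrite Rmult_assoc, Rinv_l, Rmult_1_r by (apply Rgt_not_eq, exp_pos).
    apply Rlt_trans with (e / 2 * INR Q); [|apply Rmult_lt_compat_l; lra].
    apply (Rmult_lt_compat_r (e / 2)) in H0; [|lra]. replace (2 * M / e * (e / 2)) with M in H0 by (field; lra). lra. }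
  assert (e < e); [|lra]. unfold e at 1. replace (s - g v1)%C with (- (X - s) + - (g v1 - X))%C by ring.
  eapply Rle_lt_trans; [apply Cmod_triangle|]. rewrite !Cmod_opp. lra.
Qed.

(** * Necessity *)
(* The shift l -> l + n q turns the factor exp (2 pi i q l tau) into a shift of the moments of [b] and [gw]. *)
Lemma annihilation n tau (b : Z -> C) : (1 <= n)%nat ->
  (forall l, b (l + Z.of_nat n)%Z = (sgnZ (Z.of_nat n) * b l)%C) -> moment_vanish n tau b ->
  forall p q, (p < n)%nat ->
  HS (fun l => b l * gw n tau l * ek q (RtoC (IZR l) * tau) * RtoC (IZR l) ^ p)%C (RtoC 0).
Proof.
  intros Hn Hper Hmom p q Hp. set (Nz := Z.of_nat n) in *.
  assert (HN : 0 < INR n) by (apply lt_0_INR; lia).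
  set (cst := Cexp (Ci * tau * RtoC (PI * INR n * (IZR q * IZR q - IZR q)))%C).
  assert (Hgw : forall l, gw n tau (l + Nz * q) = (gw n tau l * ek q (RtoC (IZR l) * tau) * cst)%C).
  { intros l. unfold gw, ek, cst. rewrite <- !Cexp_plus. f_equal.
    replace (mm n (l + Nz * q)) with (mm n l + 2 * INR n * IZR q) by (symmetry; apply mm_shift).
    assert (El : IZR l = (mm n l + INR n) / 2). { unfold mm. rewrite minus_IZR, mult_IZR, <- INR_IZR_INZ. field. }
    rewrite El.
    replace (RtoC (2 * PI * IZR q) * Ci * (RtoC ((mm n l + INR n) / 2) * tau))%C with (Ci * tau * RtoC (PI * IZR q * (mm n l + INR n)))%C.
    2:{ replace (PI * IZR q * (mm n l + INR n)) with (2 * PI * IZR q * ((mm n l + INR n) / 2)) by field. rewrite RtoC_mult. ring. }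
    rewrite <- !Cmult_plus_distr_l, <- !RtoC_plus. f_equal. f_equal. field. lra. }
  (* 2 l = mm n (l + n q) - th, so powers of l are combinations of powers of the shifted [mm] of no
     larger degree. *)
  set (th := 2 * INR n * IZR q - INR n).
  assert (Hk : forall k, (k < n)%nat -> HS (fun l => b l * gw n tau l * ek q (RtoC (IZR l) * tau) * RtoC (mm n (l + Nz * q)) ^ k)%C (RtoC 0)).
  { intros k Hk. pose proof (Hmom k Hk) as H.
    apply (HS_reindex (fun l => (l + Nz * q)%Z) (fun l => (l - Nz * q)%Z)) in H; [|intros; lia|intros; lia].
    apply (HS_scal _ _ (sgnZ (Nz * q) * / cst)%C) in H. rewrite Cmult_0_r in H.
    eapply HS_ext; [|apply H]. intros l. cbv beta. rewrite (per_shift Nz b Hper q l), Hgw.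
    assert (Hc : cst <> RtoC 0) by apply Cexp_neq_0.
    transitivity ((sgnZ (Nz * q) * sgnZ (Nz * q)) * (b l * gw n tau l * ek q (RtoC (IZR l) * tau) * RtoC (mm n (l + Nz * q)) ^ k))%C.
    - field. auto.
    - rewrite sgnZ_sq. ring. }
  destruct (pow_sub_expand p) as (B & _ & _ & HB).
  apply (HS_ext (fun l => lsum (seq 0 n) (fun i => (RtoC (/ 2) ^ p * B i (RtoC th)) * (b l * gw n tau l * ek q (RtoC (IZR l) * tau) * RtoC (mm n (l + Nz * q)) ^ i)))%C).
  - intros l.
    assert (El : RtoC (IZR l) = (RtoC (/ 2) * (RtoC (mm n (l + Nz * q)) - RtoC th))%C).
    { rewrite <- RtoC_minus, <- RtoC_mult. f_equal. unfold th, Nz. rewrite mm_shift. unfold mm. rewrite minus_IZR, mult_IZR, <- INR_IZR_INZ. field. }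
    rewrite El at 2. rewrite Cpow_mult_l, (HB n) by auto. rewrite <- !lsum_scal. apply lsum_ext. intros; ring.
  - replace (RtoC 0) with (lsum (seq 0 n) (fun i => (RtoC (/ 2) ^ p * B i (RtoC th)) * RtoC 0)%C).
    + apply HS_lsum. intros i Hi. apply in_seq in Hi. apply HS_scal. apply Hk. lia.
    + rewrite (lsum_ext _ _ (fun _ => RtoC 0)); [apply lsum_zero|]. intros; ring.
Qed.

(** The polynomial in X with coefficients phi_k(c) equals the one in X minus the conjugate of c with
    the shifted coefficients. Averages over n-th roots of unity X recover phi_k(c), and there the
    new variable is at most 1 + |c| in modulus. *)
Lemma coef_from_shifted n (Bc : nat -> nat -> C -> C) (phi : nat -> C -> C) (c : C) k :
  (forall k (z w : C), (k < n)%nat -> ((z - w) ^ k = lsum (seq 0 n) (fun i => z ^ i * Bc k i w))%C) -> (k < n)%nat ->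
  Cmod (phi k c) <= lsumR (seq 0 n) (fun i => (1 + Cmod c) ^ i * Cmod (shifted_coef n Bc phi i c)).
Proof.
  intros HBc Hk. assert (HN : 0 < INR n) by (apply lt_0_INR; lia).
  set (Rd := fun d => lsum (seq 0 n) (fun k' => wN n (Z.of_nat d) ^ k' * phi k' c)%C).
  assert (E : phi k c = (RtoC (/ INR n) * lsum (seq 0 n) (fun d => wN n (- Z.of_nat k * Z.of_nat d) * Rd d))%C).
  { transitivity (RtoC (/ INR n) * lsum (seq 0 n) (fun k' => phi k' c * lsum (seq 0 n) (fun d => wN n ((Z.of_nat k' - Z.of_nat k) * Z.of_nat d))))%C.
    - rewrite (lsum_single (seq 0 n) (fun k' => _) k); [|apply seq_NoDup|apply in_seq; lia|].
      + rewrite (root_sum_one n _ 0%Z); [|lia|lia].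
        transitivity ((RtoC (/ INR n) * RtoC (INR n)) * phi k c)%C; [|ring]. rewrite <- RtoC_mult, Rinv_l by lra. ring.
      + intros k' Hk' Hne. apply in_seq in Hk'. rewrite root_sum; [ring|lia|]. intros q Hq.
        destruct (Z.eq_dec q 0) as [->|Hq0]; [lia|]. assert (q <= -1 \/ 1 <= q)%Z by lia. nia.
    - f_equal.
      rewrite (lsum_ext _ _ (fun k' => lsum (seq 0 n) (fun d => phi k' c * wN n ((Z.of_nat k' - Z.of_nat k) * Z.of_nat d))%C)).
      + rewrite lsum_swap. apply lsum_ext. intros d _. unfold Rd. rewrite <- lsum_scal. apply lsum_ext. intros k' _.
        rewrite wN_pow. replace ((Z.of_nat k' - Z.of_nat k) * Z.of_nat d)%Z with (- Z.of_nat k * Z.of_nat d + Z.of_nat d * Z.of_nat k')%Z by ring.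
        rewrite wN_add. ring.
      + intros; rewrite lsum_scal; auto. }
  rewrite E, Cmod_mult, Cmod_R, Rabs_pos_eq by (left; apply Rinv_0_lt_compat; auto).
  apply (Rmult_le_reg_l (INR n)); auto. rewrite <- Rmult_assoc, Rinv_r, Rmult_1_l by lra.
  eapply Rle_trans; [apply lsum_Cmod|]. rewrite <- (length_seq n 0) at 2. rewrite <- lsumR_const. apply lsumR_le. intros d _.
  rewrite Cmod_mult, wN_Cmod, Rmult_1_l.
  assert (ER : Rd d = lsum (seq 0 n) (fun i => (wN n (Z.of_nat d) - Cconj c) ^ i * shifted_coef n Bc phi i c)%C).
  { unfold Rd, shifted_coef.
    rewrite (lsum_ext (seq 0 n) (fun i => _ ^ i * lsum _ _)%C (fun i => lsum (seq 0 n) (fun k0 => (wN n (Z.of_nat d) - Cconj c) ^ i * (Bc k0 i (- Cconj c) * phi k0 c))%C)).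
    - rewrite lsum_swap. apply lsum_ext. intros k0 Hk0. apply in_seq in Hk0.
      replace (wN n (Z.of_nat d)) with ((wN n (Z.of_nat d) - Cconj c) - (- Cconj c))%C at 1 by ring.
      rewrite (HBc k0) by lia. rewrite (Cmult_comm (lsum _ _)), <- lsum_scal. apply lsum_ext. intros; ring.
    - intros; rewrite lsum_scal; auto. }
  rewrite ER. eapply Rle_trans; [apply lsum_Cmod|]. apply lsumR_le. intros i _. rewrite Cmod_mult, Cmod_pow.
  apply Rmult_le_compat_r; [apply Cmod_ge_0|]. apply pow_incr. split; [apply Cmod_ge_0|].
  unfold Cminus. eapply Rle_trans; [apply Cmod_triangle|]. rewrite Cmod_opp, Cmod_conj, wN_Cmod. lra.
Qed.

Lemma bsum_exp_shift s : 0 < s -> exists K, forall th, bsum (fun l : Z => exp (- s * Rabs (IZR l + th))) K.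
Proof.
  intros Hs. destruct (bsum_exp_Z s Hs) as (K & HK). exists (exp s * K). intros th.
  set (k := up th). destruct (archimed th) as [H1 H2]. fold k in H1, H2.
  apply (bsum_le _ (fun l => exp s * exp (- s * Rabs (IZR (l + k))))).
  - intros l. rewrite <- exp_plus. apply exp_mono. rewrite plus_IZR.
    assert (Rabs (IZR l + IZR k) <= Rabs (IZR l + th) + 1); [|nra].
    replace (IZR l + IZR k) with ((IZR l + th) + (IZR k - th)) by ring. eapply Rle_trans; [apply Rabs_triang|].
    rewrite (Rabs_pos_eq (IZR k - th)) by lra. lra.
  - apply bsum_scal; [left; apply exp_pos|]. apply (bsum_inj (fun l => (l + k)%Z) (fun l => exp (- s * Rabs (IZR l)))); auto. intros; lia.
Qed.

Section Necessity.
Variables (n : nat) (w1 tau : C) (phi : nat -> C -> C) (F : C -> C) (Bc : nat -> nat -> C -> C) (b : Z -> C) (Bb K kap : R).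
Hypothesis Hn : (1 <= n)%nat.
Hypothesis HT : 0 < Im tau.
Hypothesis Hphi : forall k, (k < n)%nat -> ent (phi k).
Hypothesis HF : forall z, F z = lsum (seq 0 n) (fun k => Cconj z ^ k * phi k z)%C.
Hypothesis HBc : forall k (z w : C), (k < n)%nat -> ((z - w) ^ k = lsum (seq 0 n) (fun i => z ^ i * Bc k i w))%C.
Hypothesis HBb : forall k i w, Cmod (Bc k i w) <= (1 + Cmod w) ^ k.
Hypothesis HBe : forall k i, ent (Bc k i).
Hypothesis Hbb : forall l, Cmod (b l) <= Bb.
Hypothesis Hper : forall l, b (l + Z.of_nat n)%Z = (sgnZ (Z.of_nat n) * b l)%C.
Hypothesis Hmom : moment_vanish n tau b.
Hypothesis HK : forall i c, (i < n)%nat -> Cmod (shifted_coef n Bc phi i c) * exp (- (PI / 2) * (Cmod c * Cmod c)) <= K.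
Hypothesis Hkap : PI / 2 * (Cmod w1 * Cmod w1) < kap.

Let T := Im tau.
Let A := Cmod w1 * Cmod w1.
(** On the row Im v = l T the conjugate of v is v - 2 i l T, that is, v + l [tt]. *)
Let tt : C := (Ci * RtoC (- (2) * T))%C.

(** The Gaussian makes the periodization converge. On the row Im v = l T the factor exp(i pi v) has
    modulus exp(-pi l T), which cancels the linear part of the exponent of [gw]. *)
Definition Egauss (v : C) : C := Cexp (- RtoC kap * (v * v) + Ci * RtoC PI * v)%C.
(* [ff l] agrees with [F (w1 v)] times a Gaussian on the row Im v = l Im tau, and is holomorphic and polynomial in [l]. *)
Definition ff (l : Z) (v : C) : C :=
  (lsum (seq 0 n) (fun k => (Cconj w1 * (v + RtoC (IZR l) * tt)) ^ k * phi k (w1 * v)) * Egauss v)%C.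
(** The coefficient of l^p in [ff l]; it is the same for all rows, so n periodizations serve every
    l. *)
Definition hp (p : nat) (v : C) : C :=
  (lsum (seq 0 n) (fun k => Cconj w1 ^ k * (tt ^ p * Bc k p (- v)) * phi k (w1 * v)) * Egauss v)%C.

Lemma ff_hp l v : ff l v = lsum (seq 0 n) (fun p => RtoC (IZR l) ^ p * hp p v)%C.
Proof.
  unfold ff, hp.
  rewrite (lsum_ext (seq 0 n) (fun p => _ ^ p * (_ * _))%C (fun p => Egauss v * lsum (seq 0 n) (fun k => RtoC (IZR l) ^ p * (Cconj w1 ^ k * (tt ^ p * Bc k p (- v)) * phi k (w1 * v))))%C).
  - rewrite lsum_scal, Cmult_comm. f_equal. rewrite lsum_swap. apply lsum_ext. intros k Hk. apply in_seq in Hk.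
    replace (v + RtoC (IZR l) * tt)%C with (RtoC (IZR l) * tt - (- v))%C by ring.
    rewrite Cpow_mult_l, (HBc k) by lia.
    transitivity ((Cconj w1 ^ k * phi k (w1 * v)) * lsum (seq 0 n) (fun i => (RtoC (IZR l) * tt) ^ i * Bc k i (- v)))%C; [ring|].
    rewrite <- lsum_scal. apply lsum_ext. intros i _. rewrite Cpow_mult_l. ring.
  - intros p _. rewrite lsum_scal. ring.
Qed.

Lemma conj_shift (v : C) l : (v + RtoC (IZR l) * tt)%C = (Cconj v + Ci * RtoC (2 * (snd v - IZR l * T)))%C.
Proof. unfold tt. destruct v as [x y]. unfold Cconj, Ci, RtoC, Cmult, Cplus; simpl. f_equal; ring. Qed.

Lemma ff_row l (v : C) : snd v = IZR l * T -> ff l v = (F (w1 * v) * Egauss v)%C.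
Proof.
  intros Hv. unfold ff. f_equal. rewrite HF. apply lsum_ext. intros k _. f_equal. f_equal.
  rewrite conj_shift, Hv, Cmult_conj. replace (2 * (IZR l * T - IZR l * T)) with 0 by ring. ring.
Qed.

(** Weighted modulus of the shifted coefficient at w1 v, the quantity that [local_estimate] bounds
    in mean square. *)
Definition Nn (i : nat) (v : C) : R := Cmod (shifted_coef n Bc phi i (w1 * v)) * exp (- (PI / 2 * A) * (Cmod v * Cmod v)).

Lemma Nn_bound i v : (i < n)%nat -> 0 <= Nn i v <= K.
Proof.
  intros Hi. split; [apply Rmult_le_pos; [apply Cmod_ge_0|left; apply exp_pos]|].
  eapply Rle_trans; [|apply (HK i (w1 * v)%C Hi)]. right. unfold Nn. f_equal. f_equal. rewrite Cmod_mult. unfold A. ring.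
Qed.

Lemma shifted_Nn i v : Cmod (shifted_coef n Bc phi i (w1 * v)) = Nn i v * exp (PI / 2 * A * (Cmod v * Cmod v)).
Proof.
  unfold Nn. rewrite Rmult_assoc, <- exp_plus.
  replace (- (PI / 2 * A) * (Cmod v * Cmod v) + PI / 2 * A * (Cmod v * Cmod v)) with 0 by ring. rewrite exp_0. ring.
Qed.

Lemma Egauss_Cmod (v : C) : Cmod (Egauss v) = exp (- kap * (fst v * fst v - snd v * snd v) - PI * snd v).
Proof. unfold Egauss. rewrite Cmod_Cexp. f_equal. unfold Re, Cplus, Copp, Cmult, RtoC, Ci; simpl. ring. Qed.

(** The variable substituted for the conjugate of w1 v in [ff l] differs from it by 2 i (Im v - l T)
    times the conjugate of w1. Re-expansion around the true conjugate shows that leaving the row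
    costs only a polynomial in the distance, with the shifted coefficients as coefficients. *)
Lemma ff_bound l (v : C) : Cmod (ff l v) <= exp (PI / 2 * A * (Cmod v * Cmod v) - kap * (fst v * fst v - snd v * snd v) - PI * snd v) *
  lsumR (seq 0 n) (fun i => (2 * Cmod w1 * Rabs (snd v - IZR l * T)) ^ i * Nn i v).
Proof.
  assert (E : ff l v = (Egauss v * lsum (seq 0 n) (fun i => (Cconj w1 * Ci * RtoC (2 * (snd v - IZR l * T))) ^ i * shifted_coef n Bc phi i (w1 * v)))%C).
  { unfold ff, shifted_coef. rewrite Cmult_comm. f_equal.
    set (s := (Cconj w1 * Ci * RtoC (2 * (snd v - IZR l * T)))%C).
    rewrite (lsum_ext (seq 0 n) (fun i => s ^ i * lsum _ _)%C (fun i => lsum (seq 0 n) (fun k0 => s ^ i * (Bc k0 i (- Cconj (w1 * v)) * phi k0 (w1 * v)))%C)).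
    - rewrite lsum_swap. apply lsum_ext. intros k Hk. apply in_seq in Hk.
      replace (Cconj w1 * (v + RtoC (IZR l) * tt))%C with (s - (- Cconj (w1 * v)))%C.
      + rewrite (HBc k) by lia. rewrite (Cmult_comm (lsum _ _)), <- lsum_scal. apply lsum_ext. intros; ring.
      + rewrite conj_shift, Cmult_conj. unfold s. ring.
    - intros; rewrite lsum_scal; auto. }
  rewrite E, Cmod_mult, Egauss_Cmod.
  apply Rle_trans with (exp (- kap * (fst v * fst v - snd v * snd v) - PI * snd v) *
     lsumR (seq 0 n) (fun i => exp (PI / 2 * A * (Cmod v * Cmod v)) * ((2 * Cmod w1 * Rabs (snd v - IZR l * T)) ^ i * Nn i v))).
  - apply Rmult_le_compat_l; [left; apply exp_pos|]. eapply Rle_trans; [apply lsum_Cmod|]. apply lsumR_le. intros i _.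
    rewrite Cmod_mult, Cmod_pow, !Cmod_mult, Cmod_conj, Cmod_R, shifted_Nn, Rabs_mult, (Rabs_pos_eq 2) by lra.
    replace (Cmod Ci) with 1; [right; rewrite Rmult_1_r; replace (Cmod w1 * (2 * Rabs (snd v - IZR l * T))) with (2 * Cmod w1 * Rabs (snd v - IZR l * T)) by ring; ring|].
    unfold Cmod, Ci; simpl. replace (0 * (0 * 1) + 1 * (1 * 1)) with 1 by ring. rewrite sqrt_1. auto.
  - rewrite lsumR_scal, <- Rmult_assoc, <- exp_plus. right. f_equal. f_equal. ring.
Qed.

Lemma hp_ent p : ent (hp p).
Proof.
  unfold hp. apply ent_mult.
  - apply ent_lsum. intros k Hk. apply in_seq in Hk. apply ent_mult.
    + apply ent_mult; [apply ent_const|]. apply ent_mult; [apply ent_const|].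
      apply (ent_comp (fun v => - v)%C (Bc k p)); [apply ent_opp, ent_id|auto].
    + apply (ent_comp (fun v => w1 * v)%C (phi k)); [apply ent_mult; [apply ent_const|apply ent_id]|apply Hphi; lia].
  - unfold Egauss. apply ent_exp. apply ent_plus; [apply ent_mult; [apply ent_const|apply ent_mult; apply ent_id]|].
    apply ent_mult; [apply ent_const|apply ent_id].
Qed.

(** A rough bound, made for the convergence of the periodization: [kap] above pi A / 2 leaves
    Gaussian decay along horizontal lines. *)
Lemma hp_growth p : exists C0, 0 <= C0 /\ forall v : C, Cmod (hp p v) <=
  C0 * exp (- (kap - PI / 2 * A) * (Cmod v * Cmod v) + (INR n + INR n * Cmod w1) * Cmod v) * exp (2 * kap * (snd v * snd v) - PI * snd v).
Proof.
  assert (HK0 : 0 <= K). { destruct (Nn_bound 0 (RtoC 0)); [lia|lra]. }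
  pose proof (Cmod_ge_0 w1) as Hw. pose proof (pos_INR n) as HN.
  exists (lsumR (seq 0 n) (fun k => Cmod w1 ^ k) * Cmod tt ^ p * (INR n * K)). split.
  - apply Rmult_le_pos; [|apply Rmult_le_pos; auto]. apply Rmult_le_pos; [|apply pow_le, Cmod_ge_0].
    apply lsumR_nonneg. intros; apply pow_le; auto.
  - intros v. set (L := Cmod v). assert (HL : 0 <= L) by apply Cmod_ge_0.
    assert (Hph : forall k, (k < n)%nat -> Cmod (phi k (w1 * v)%C) <= INR n * K * exp (INR n * (Cmod w1 * L)) * exp (PI / 2 * A * (L * L))).
    { intros k Hk. eapply Rle_trans; [apply (coef_from_shifted n Bc phi (w1 * v) k HBc Hk)|].
      replace (INR n * K * exp (INR n * (Cmod w1 * L)) * exp (PI / 2 * A * (L * L))) with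
        (INR (length (seq 0 n)) * (K * exp (INR n * (Cmod w1 * L)) * exp (PI / 2 * A * (L * L)))) by (rewrite length_seq; ring).
      rewrite <- lsumR_const. apply lsumR_le. intros i Hi. apply in_seq in Hi. rewrite shifted_Nn. fold L.
      destruct (Nn_bound i v ltac:(lia)) as [N1 N2]. rewrite <- Rmult_assoc. apply Rmult_le_compat_r; [left; apply exp_pos|].
      rewrite (Rmult_comm K). apply Rmult_le_compat; auto; [apply pow_le; pose proof (Cmod_ge_0 (w1 * v)); lra|].
      rewrite Cmod_mult. fold L. apply one_plus_pow_exp; [nra|lia]. }
    unfold hp. rewrite Cmod_mult, Egauss_Cmod.
    apply Rle_trans with (lsumR (seq 0 n) (fun k => (Cmod tt ^ p * exp (INR n * L) * (INR n * K * exp (INR n * (Cmod w1 * L)) * exp (PI / 2 * A * (L * L)))) * Cmod w1 ^ k) *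
       exp (- kap * (fst v * fst v - snd v * snd v) - PI * snd v)).
    + apply Rmult_le_compat_r; [left; apply exp_pos|]. eapply Rle_trans; [apply lsum_Cmod|]. apply lsumR_le. intros k Hk. apply in_seq in Hk.
      rewrite !Cmod_mult, !Cmod_pow, Cmod_conj. specialize (Hph k ltac:(lia)).
      assert (HB1 : Cmod (Bc k p (- v)) <= exp (INR n * L)).
      { eapply Rle_trans; [apply HBb|]. rewrite Cmod_opp. fold L. apply one_plus_pow_exp; [auto|lia]. }
      assert (0 <= Cmod w1 ^ k) by (apply pow_le; auto). assert (0 <= Cmod tt ^ p) by (apply pow_le, Cmod_ge_0).
      pose proof (Cmod_ge_0 (Bc k p (- v))). pose proof (Cmod_ge_0 (phi k (w1 * v)%C)).
      apply Rle_trans with (Cmod w1 ^ k * (Cmod tt ^ p * exp (INR n * L)) * (INR n * K * exp (INR n * (Cmod w1 * L)) * exp (PI / 2 * A * (L * L)))).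
      * apply Rmult_le_compat; auto.
        -- apply Rmult_le_pos; auto. apply Rmult_le_pos; auto.
        -- apply Rmult_le_compat_l; auto. apply Rmult_le_compat_l; auto.
      * right. ring.
    + rewrite lsumR_scal. right. set (Sw := lsumR _ _).
      assert (EL : fst v * fst v - snd v * snd v = L * L - 2 * (snd v * snd v)) by (unfold L; rewrite Cmod_sqr; ring).
      rewrite EL.
      transitivity (Sw * Cmod tt ^ p * (INR n * K) * (exp (INR n * L) * exp (INR n * (Cmod w1 * L)) * exp (PI / 2 * A * (L * L)) * exp (- kap * (L * L - 2 * (snd v * snd v)) - PI * snd v))); [ring|].
      transitivity (Sw * Cmod tt ^ p * (INR n * K) * (exp (- (kap - PI / 2 * A) * (L * L) + (INR n + INR n * Cmod w1) * L) * exp (2 * kap * (snd v * snd v) - PI * snd v))); [|ring].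
      f_equal. rewrite <- !exp_plus. f_equal. ring.
Qed.

Definition gp (p : nat) (v : C) : C := gsum (fun j : Z => hp p (v + RtoC (IZR j))%C).

Lemma gp_props p : ent (gp p) /\ forall v, HS (fun j : Z => hp p (v + RtoC (IZR j))%C) (gp p v).
Proof.
  apply (ent_gsum (fun (j : Z) v => hp p (v + RtoC (IZR j))%C)).
  - intros j. apply (ent_comp (fun v => v + RtoC (IZR j))%C (hp p)); [apply ent_plus; [apply ent_id|apply ent_const]|apply hp_ent].
  - intros r0. set (r := Rmax r0 0). assert (Hr : 0 <= r) by apply Rmax_r. pose proof PI_RGT_0 as HPI.
    assert (Hkp : 0 < kap). { fold A in Hkap. assert (0 <= A) by apply Rle_0_sqr. nra. }
    destruct (hp_growth p) as (C0 & HC0 & Hg).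
    destruct (gauss_le_exp (kap - PI / 2 * A) (INR n + INR n * Cmod w1)) as (K3 & HK3 & HK3'); [fold A in Hkap; lra|].
    destruct (bsum_exp_Z 1 Rlt_0_1) as (K4 & HK4).
    set (Cst := C0 * K3 * exp r * exp (2 * kap * (r * r) + PI * r)).
    assert (HCst : 0 <= Cst). { unfold Cst. repeat apply Rmult_le_pos; try lra; left; apply exp_pos. }
    exists (fun j => Cst * exp (- (1) * Rabs (IZR j))), (Cst * K4). split; [|apply bsum_scal; auto].
    intros j v Hv. assert (Hvr : Cmod v <= r) by (eapply Rle_trans; [apply Hv|apply Rmax_l]).
    set (u := (v + RtoC (IZR j))%C). eapply Rle_trans; [apply Hg|].
    assert (Hu : Rabs (IZR j) - r <= Cmod u).
    { replace (Rabs (IZR j)) with (Cmod (RtoC (IZR j))) by apply Cmod_R.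
      replace (RtoC (IZR j)) with (u + - v)%C by (unfold u; ring). pose proof (Cmod_triangle u (- v)). rewrite Cmod_opp in H. lra. }
    assert (Hy : Rabs (snd u) <= r).
    { replace (snd u) with (snd v) by (unfold u; simpl; ring). eapply Rle_trans; [apply snd_le_Cmod|auto]. }
    apply Rle_trans with (C0 * (K3 * exp (- Cmod u)) * exp (2 * kap * (r * r) + PI * r)).
    + apply Rmult_le_compat; [apply Rmult_le_pos; [auto|left; apply exp_pos]|left; apply exp_pos| |].
      * apply Rmult_le_compat_l; auto.
      * apply exp_mono. apply Rabs_le_between in Hy. assert (snd u * snd u <= r * r) by nra. nra.
    + unfold Cst. replace (- (1) * Rabs (IZR j)) with (- Rabs (IZR j)) by ring.
      replace (C0 * K3 * exp r * exp (2 * kap * (r * r) + PI * r) * exp (- Rabs (IZR j))) with (C0 * (K3 * (exp r * exp (- Rabs (IZR j)))) * exp (2 * kap * (r * r) + PI * r)) by ring.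
      apply Rmult_le_compat_r; [left; apply exp_pos|]. apply Rmult_le_compat_l; auto. apply Rmult_le_compat_l; [lra|].
      rewrite <- exp_plus. apply exp_mono. lra.
Qed.

Lemma gp_per p v : gp p (v + 1)%C = gp p v.
Proof.
  destruct (gp_props p) as (_ & H). apply (HS_unique (fun j : Z => hp p (v + 1 + RtoC (IZR j))%C)); [apply H|].
  apply (HS_ext (fun j => (fun j => hp p (v + RtoC (IZR j))%C) (j + 1)%Z)).
  - intros j. cbv beta. f_equal. rewrite plus_IZR, RtoC_plus. ring.
  - apply (HS_reindex (fun j => (j + 1)%Z) (fun j => (j - 1)%Z) (fun j => hp p (v + RtoC (IZR j))%C) (gp p v)); [intros; lia|intros; lia|apply H].
Qed.

Definition GG (l : Z) (v : C) : C := lsum (seq 0 n) (fun p => RtoC (IZR l) ^ p * gp p v)%C.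

Lemma GG_ent l : ent (GG l).
Proof. apply ent_lsum. intros p _. apply ent_mult; [apply ent_const|apply gp_props]. Qed.

Lemma GG_per l v : GG l (v + 1)%C = GG l v.
Proof. apply lsum_ext. intros p _. rewrite gp_per. auto. Qed.

Lemma GG_HS l v : HS (fun j : Z => ff l (v + RtoC (IZR j))%C) (GG l v).
Proof.
  eapply HS_ext; [intros j; symmetry; apply ff_hp|]. apply HS_lsum. intros p _. apply HS_scal. apply gp_props.
Qed.

Lemma GG_fc l y q : fc (GG l) y q = lsum (seq 0 n) (fun p => RtoC (IZR l) ^ p * fc (gp p) y q)%C.
Proof.
  unfold fc. transitivity (CI (fun x => lsum (seq 0 n) (fun p => (fun p v => RtoC (IZR l) ^ p * (gp p v * ek (- q) v))%C p ((x, y) : C))) 0 1).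
  - apply CI_ext; [lra|]. intros t _. unfold GG. rewrite Cmult_comm, <- lsum_scal. apply lsum_ext. intros; ring.
  - rewrite (CI_ent_lsum _ (fun p v => RtoC (IZR l) ^ p * (gp p v * ek (- q) v))%C); [|lra|].
    + apply lsum_ext. intros p _. apply CI_scal; [lra|]. intros t _. apply (ent_ccont (fun v => gp p v * ek (- q) v)%C).
      apply ent_mult; [apply gp_props|apply ek_ent].
    + intros p _. apply ent_mult; [apply ent_const|]. apply ent_mult; [apply gp_props|apply ek_ent].
Qed.

(** The double array behind the trace relation: row l sums over q to the weighted lattice values on
    row l by [term_row], column q sums over l to 0 by [term_col]. The relation results from
    exchanging the two summations, exactly or approximately. *)
Definition term (ys : Z -> R) (l q : Z) : C := (b l * gw n tau l * (fc (GG l) (ys q) q * ek q (RtoC (IZR l) * tau)))%C.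

Lemma term_row ys l : HS (term ys l) (b l * gw n tau l * GG l (RtoC (IZR l) * tau))%C.
Proof. apply HS_scal. apply fourier_series; [apply GG_ent|apply GG_per]. Qed.

(** The q-th Fourier coefficient of [GG l] is a polynomial in l of degree below n, so [annihilation]
    applies to each of its powers. *)
Lemma term_col ys q : HS (fun l => term ys l q) (RtoC 0).
Proof.
  apply (HS_ext (fun l => lsum (seq 0 n) (fun p => fc (gp p) (ys q) q * (b l * gw n tau l * ek q (RtoC (IZR l) * tau) * RtoC (IZR l) ^ p))%C)).
  - intros l. unfold term. rewrite GG_fc.
    transitivity ((b l * gw n tau l * ek q (RtoC (IZR l) * tau)) * lsum (seq 0 n) (fun p => RtoC (IZR l) ^ p * fc (gp p) (ys q) q))%C; [|ring].
    rewrite <- lsum_scal. apply lsum_ext. intros; ring.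
  - replace (RtoC 0) with (lsum (seq 0 n) (fun p => fc (gp p) (ys q) q * RtoC 0)%C).
    + apply HS_lsum. intros p Hp. apply in_seq in Hp. apply HS_scal. apply (annihilation n tau b); auto. lia.
    + rewrite (lsum_ext _ _ (fun _ => RtoC 0)); [apply lsum_zero|]. intros; ring.
Qed.

(** What remains of the Gaussian in [ff_bound] once exp(pi y^2 / (n T) - pi y), the part used to
    complete the square in [term_bound], is split off. *)
Definition weight (v : C) : R :=
  exp (PI / 2 * A * (Cmod v * Cmod v) - kap * (fst v * fst v - snd v * snd v) - PI / (INR n * T) * (snd v * snd v)).

(* The q-th Fourier coefficient is estimated on the line Im v = [yq q], which completes the square in [term_bound]. *)
Definition yq (q : Z) : R := - (INR n * T * (IZR q - 1 / 2)).

(** On the line chosen for q the exponents of [gw], of the split-off factor and of the two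
    exponentials add up to -(pi T / n) t^2 with t = l + n (q - 1/2). The column q is thus
    concentrated on rows near -n (q - 1/2). *)
Lemma term_bound l q U :
  (forall x i, 0 <= x <= 1 -> (i < n)%nat -> bsum (fun j : Z => Nn i (((x, yq q) : C) + RtoC (IZR j))%C * weight (((x, yq q) : C) + RtoC (IZR j))%C) U) ->
  Cmod (term yq l q) <= 2 * Bb * U * (exp (- (PI * T / INR n) * ((IZR l + INR n * (IZR q - 1 / 2)) * (IZR l + INR n * (IZR q - 1 / 2)))) *
     lsumR (seq 0 n) (fun i => (2 * Cmod w1 * (T * Rabs (IZR l + INR n * (IZR q - 1 / 2)))) ^ i)).
Proof.
  intros HU. set (t := IZR l + INR n * (IZR q - 1 / 2)). set (y := yq q).
  assert (HN : 0 < INR n) by (apply lt_0_INR; lia).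
  assert (HBb0 : 0 <= Bb) by (eapply Rle_trans; [apply Cmod_ge_0|apply (Hbb 0%Z)]).
  set (SP := lsumR (seq 0 n) (fun i => (2 * Cmod w1 * (T * Rabs t)) ^ i)).
  set (X := exp (PI / (INR n * T) * (y * y) - PI * y)).
  pose proof (Cmod_ge_0 w1) as Hw.
  assert (HT' : 0 < T) by exact HT.
  assert (HP0 : forall i, 0 <= (2 * Cmod w1 * (T * Rabs t)) ^ i).
  { intros i. apply pow_le. apply Rmult_le_pos; [lra|]. apply Rmult_le_pos; [lra|apply Rabs_pos]. }
  assert (HSP : 0 <= SP) by (apply lsumR_nonneg; auto).
  assert (Hyl : Rabs (y - IZR l * T) = T * Rabs t).
  { unfold y, yq, t. replace (- (INR n * T * (IZR q - 1 / 2)) - IZR l * T) with (- (T * (IZR l + INR n * (IZR q - 1 / 2)))) by ring.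
    rewrite Rabs_Ropp, Rabs_mult, (Rabs_pos_eq T); lra. }
  assert (HG : forall x, 0 <= x <= 1 -> Cmod (GG l ((x, y) : C)) <= X * (U * SP)).
  { intros x Hx. apply (HS_bound _ _ _ (GG_HS l ((x, y) : C))).
    apply (bsum_le _ (fun j : Z => X * lsumR (seq 0 n) (fun i => (2 * Cmod w1 * (T * Rabs t)) ^ i * (Nn i (((x, y) : C) + RtoC (IZR j))%C * weight (((x, y) : C) + RtoC (IZR j))%C)))).
    - intros j. set (v := (((x, y) : C) + RtoC (IZR j))%C). eapply Rle_trans; [apply ff_bound|].
      assert (Ev : snd v = y) by (unfold v; simpl; ring). rewrite Ev, Hyl.
      rewrite (lsumR_ext _ (fun i => _ * (Nn i v * weight v)) (fun i => weight v * ((2 * Cmod w1 * (T * Rabs t)) ^ i * Nn i v))) by (intros; ring).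
      rewrite lsumR_scal, <- (Rmult_assoc X). right. f_equal. unfold X, weight. rewrite <- exp_plus. f_equal. rewrite Ev. ring.
    - intros L NL. rewrite lsumR_scal. apply Rmult_le_compat_l; [left; apply exp_pos|]. rewrite lsumR_swap.
      unfold SP. rewrite <- lsumR_scal. apply lsumR_le. intros i Hi. apply in_seq in Hi. rewrite lsumR_scal, Rmult_comm.
      apply Rmult_le_compat_r; auto. apply HU; auto. lia. }
  assert (HU0 : 0 <= U). { apply (bsum_ge0 _ _ (HU 0 0%nat ltac:(lra) ltac:(lia))). }
  assert (Hfc : Cmod (fc (GG l) y q) <= 2 * (X * (U * SP) * exp (2 * PI * IZR q * y))).
  { replace (2 * (X * (U * SP) * exp (2 * PI * IZR q * y))) with (2 * (X * (U * SP) * exp (2 * PI * IZR q * y)) * (1 - 0)) by ring.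
    apply CI_bound; [lra| |].
    - intros s _. apply (ent_ccont (fun v => GG l v * ek (- q) v)%C). apply ent_mult; [apply GG_ent|apply ek_ent].
    - intros s Hs. rewrite Cmod_mult, ek_Cmod. apply Rmult_le_compat; [apply Cmod_ge_0|left; apply exp_pos|apply HG; auto|].
      right. f_equal. simpl. rewrite opp_IZR. ring. }
  unfold term. rewrite !Cmod_mult, gw_Cmod, ek_Cmod. fold T y.
  apply Rle_trans with (Bb * exp (- (PI * T / (4 * INR n)) * (mm n l * mm n l - INR n * INR n)) *
    (2 * (X * (U * SP) * exp (2 * PI * IZR q * y)) * exp (- (2 * PI * IZR q * snd (RtoC (IZR l) * tau)%C)))).
  - apply Rmult_le_compat.
    + apply Rmult_le_pos; [apply Cmod_ge_0|left; apply exp_pos].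
    + apply Rmult_le_pos; [apply Cmod_ge_0|left; apply exp_pos].
    + apply Rmult_le_compat_r; [left; apply exp_pos|auto].
    + apply Rmult_le_compat_r; [left; apply exp_pos|auto].
  - replace (snd (RtoC (IZR l) * tau)%C) with (IZR l * T) by (unfold T, Im; simpl; ring).
    right. transitivity (2 * Bb * U * SP * (exp (- (PI * T / (4 * INR n)) * (mm n l * mm n l - INR n * INR n)) * X * exp (2 * PI * IZR q * y) * exp (- (2 * PI * IZR q * (IZR l * T))))); [ring|].
    transitivity (2 * Bb * U * SP * exp (- (PI * T / INR n) * (t * t))); [|ring].
    f_equal. unfold X. rewrite <- !exp_plus. f_equal.
    unfold y, yq, t, mm. rewrite minus_IZR, mult_IZR, <- INR_IZR_INZ. field. lra.
Qed.

End Necessity.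

(** [local_estimate] gives the uniform bound when applied to a single centre, and the mean-square
    bound along rows when applied to the points w1 (v + j), which are |w1| apart. The 1 added to [K]
    turns a bound on a square into one on the number itself. *)
Lemma fock_data n w1 F : (1 <= n)%nat -> w1 <> RtoC 0 -> in_polyFock n F ->
  exists (phi : nat -> C -> C) (Bc : nat -> nat -> C -> C) (K : R),
    (forall k, (k < n)%nat -> ent (phi k)) /\
    (forall z, F z = lsum (seq 0 n) (fun k => Cconj z ^ k * phi k z)%C) /\
    (forall k (z w : C), (k < n)%nat -> ((z - w) ^ k = lsum (seq 0 n) (fun i => z ^ i * Bc k i w))%C) /\
    (forall k i w, Cmod (Bc k i w) <= (1 + Cmod w) ^ k) /\
    (forall k i, ent (Bc k i)) /\
    (forall i c, (i < n)%nat -> Cmod (shifted_coef n Bc phi i c) * exp (- (PI / 2) * (Cmod c * Cmod c)) <= K) /\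
    (forall i v, (i < n)%nat -> bsum (fun j : Z => Nn n w1 phi Bc i (v + RtoC (IZR j))%C * Nn n w1 phi Bc i (v + RtoC (IZR j))%C) K).
Proof.
  intros Hn Hw ((phi & Hp & HFp) & (M & HM)).
  destruct (choice _ pow_sub_expand) as (Bc & HBc).
  assert (Hphi : forall k, (k < n)%nat -> ent (phi k)) by (intros; apply ent_entire; auto).
  assert (HF : forall z, F z = lsum (seq 0 n) (fun k => Cconj z ^ k * phi k z)%C).
  { intros z. rewrite HFp, csum_lsum. apply lsum_ext. intros k _. reflexivity. }
  assert (HB3 : forall k (z w : C), (k < n)%nat -> ((z - w) ^ k = lsum (seq 0 n) (fun i => z ^ i * Bc k i w))%C).
  { intros k z w Hk. apply (HBc k); auto. }
  assert (Hw0 : 0 < Cmod w1) by (apply Cmod_gt_0; auto).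
  destruct (local_estimate n phi F Bc Hn Hphi HF HB3 M (Cmod w1) HM Hw0) as (K & HK).
  assert (HK0 : 0 <= K). { apply (HK O ltac:(lia) []); [constructor|intros p q []]. }
  assert (Hle : forall x, x * x <= K -> x <= K + 1) by (intros; nra).
  exists phi, Bc, (K + 1). repeat split; auto.
  - intros k i w. apply (HBc k).
  - intros k i. apply (HBc k).
  - intros i c Hi. rewrite <- psi_0. apply Hle.
    specialize (HK i Hi [c]). simpl in HK.
    apply Rle_trans with (Cmod (lsum (seq 0 n) (fun k => Bc k i (- Cconj c) * phi k (c + RtoC 0))%C * Cexp (- RtoC PI * Cconj c * RtoC 0 - RtoC (PI / 2 * (Cmod c * Cmod c)))) *
       Cmod (lsum (seq 0 n) (fun k => Bc k i (- Cconj c) * phi k (c + RtoC 0))%C * Cexp (- RtoC PI * Cconj c * RtoC 0 - RtoC (PI / 2 * (Cmod c * Cmod c)))) + 0); [lra|].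
    apply HK; [constructor; [simpl; tauto|constructor]|]. intros p q [<-|[]] [<-|[]]. tauto.
  - intros i v Hi L NL. apply Rle_trans with K; [|lra].
    specialize (HK i Hi (map (fun j : Z => (w1 * (v + RtoC (IZR j)))%C) L)).
    rewrite lsumR_map in HK.
    eapply Rle_trans; [|apply HK].
    + apply lsumR_le. intros j _. rewrite psi_0. right. unfold Nn. rewrite Cmod_mult.
      replace (- (PI / 2) * (Cmod w1 * Cmod (v + RtoC (IZR j)) * (Cmod w1 * Cmod (v + RtoC (IZR j))))) with
        (- (PI / 2 * (Cmod w1 * Cmod w1)) * (Cmod (v + RtoC (IZR j)) * Cmod (v + RtoC (IZR j)))) by ring. auto.
    + apply Injective_map_NoDup; auto. intros j j' Hj. apply (f_equal (fun z => z / w1 - v)%C) in Hj.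
      replace (w1 * (v + RtoC (IZR j)) / w1 - v)%C with (RtoC (IZR j)) in Hj by (field; auto).
      replace (w1 * (v + RtoC (IZR j')) / w1 - v)%C with (RtoC (IZR j')) in Hj by (field; auto).
      apply RtoC_inj in Hj. apply eq_IZR in Hj. auto.
    + intros p q Hp1 Hq Hne. apply in_map_iff in Hp1. apply in_map_iff in Hq. destruct Hp1 as (j & <- & _). destruct Hq as (j' & <- & _).
      replace (w1 * (v + RtoC (IZR j)) - w1 * (v + RtoC (IZR j')))%C with (w1 * (RtoC (IZR (j - j'))))%C by (rewrite minus_IZR, RtoC_minus; ring).
      rewrite Cmod_mult, Cmod_R. assert (j <> j') by (intros ->; auto).
      assert (1 <= Rabs (IZR (j - j'))); [|nra].
      rewrite <- abs_IZR. apply IZR_le. lia.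
Qed.

(** The order of quantifiers matters: [K] and [N] are fixed before [kap], which the critical case
    lets depend on L. *)
Lemma trace_identities n w1 tau (b : Z -> C) Bb F : (1 <= n)%nat -> w1 <> RtoC 0 -> 0 < Im tau ->
  (forall l, Cmod (b l) <= Bb) -> (forall l, b (l + Z.of_nat n)%Z = (sgnZ (Z.of_nat n) * b l)%C) -> moment_vanish n tau b ->
  in_polyFock n F ->
  exists (K : R) (N : nat -> C -> R), (forall i v, (i < n)%nat -> 0 <= N i v <= K) /\
    (forall i v, (i < n)%nat -> bsum (fun j : Z => N i (v + RtoC (IZR j))%C * N i (v + RtoC (IZR j))%C) K) /\
    forall kap, PI / 2 * (Cmod w1 * Cmod w1) < kap -> exists (trm : Z -> Z -> C) (Gv : Z -> C),
      (forall l, HS (fun j : Z => F (w1 * latv tau (j, l)) * Egauss kap (latv tau (j, l)))%C (Gv l)) /\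
      (forall l, HS (trm l) (b l * gw n tau l * Gv l)%C) /\
      (forall q, HS (fun l => trm l q) (RtoC 0)) /\
      forall l q U, (forall x i, 0 <= x <= 1 -> (i < n)%nat ->
          bsum (fun j : Z => N i (((x, yq n tau q) : C) + RtoC (IZR j))%C * weight n w1 tau kap (((x, yq n tau q) : C) + RtoC (IZR j))%C) U) ->
        Cmod (trm l q) <= 2 * Bb * U * (exp (- (PI * Im tau / INR n) * ((IZR l + INR n * (IZR q - 1 / 2)) * (IZR l + INR n * (IZR q - 1 / 2)))) *
          lsumR (seq 0 n) (fun i => (2 * Cmod w1 * (Im tau * Rabs (IZR l + INR n * (IZR q - 1 / 2)))) ^ i)).
Proof.
  intros Hn Hw HT Hbb Hper Hmom HFock.
  destruct (fock_data n w1 F Hn Hw HFock) as (phi & Bc & K & Hphi & HF & HBc & HBb & HBe & HK & HK2).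
  exists K, (Nn n w1 phi Bc). split; [intros i v Hi; apply (Nn_bound n w1 phi Bc K HK); auto|]. split; [auto|].
  intros kap Hkap. exists (term n w1 tau phi Bc b kap (yq n tau)), (fun l => GG n w1 tau phi Bc kap l (RtoC (IZR l) * tau)%C).
  split; [|split; [|split]].
  - intros l. eapply HS_ext; [|apply (GG_HS n w1 tau phi Bc K kap Hn Hphi HBc HBb HBe HK Hkap)].
    intros j. cbv beta. replace (latv tau (j, l)) with (RtoC (IZR l) * tau + RtoC (IZR j))%C by (unfold latv; simpl; ring).
    apply ff_row; auto. unfold Im; simpl. ring.
  - intros l. apply (term_row n w1 tau phi Bc b K kap Hn Hphi HBc HBb HBe HK Hkap).
  - intros q. apply (term_col n w1 tau phi Bc b K kap Hn Hphi HBc HBb HBe Hper Hmom HK Hkap).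
  - intros l q U HU. apply (term_bound n w1 tau phi Bc b Bb K kap Hn HT Hphi HBc HBb HBe Hbb HK Hkap l q U HU).
Qed.

Lemma gauss_poly_le c B n : 0 < c -> 0 <= B -> exists K, 0 < K /\ forall t,
  exp (- c * (t * t)) * lsumR (seq 0 n) (fun i => (B * Rabs t) ^ i) <= K * exp (- Rabs t).
Proof.
  intros Hc HB. destruct (gauss_le_exp c (INR n * B) Hc) as (K & HK & HK').
  exists (INR n * K + 1). pose proof (pos_INR n). split; [nra|]. intros t. set (u := Rabs t). assert (Hu : 0 <= u) by apply Rabs_pos.
  replace (t * t) with (u * u) by (unfold u; rewrite <- Rabs_mult; apply Rabs_pos_eq, Rle_0_sqr).
  apply Rle_trans with (exp (- c * (u * u)) * (INR n * exp (INR n * B * u))).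
  - apply Rmult_le_compat_l; [left; apply exp_pos|]. rewrite <- (length_seq n 0) at 2. rewrite <- lsumR_const.
    apply lsumR_le. intros i Hi. apply in_seq in Hi. assert (0 <= B * u) by (apply Rmult_le_pos; auto).
    eapply Rle_trans; [apply pow_le_exp; auto|]. apply exp_mono.
    assert (INR i <= INR n) by (apply le_INR; lia). rewrite Rmult_assoc. apply Rmult_le_compat_r; auto.
  - replace (exp (- c * (u * u)) * (INR n * exp (INR n * B * u))) with (INR n * (exp (- c * (u * u)) * exp (INR n * B * u))) by ring.
    rewrite <- exp_plus. specialize (HK' u). pose proof (exp_pos (- u)). nra.
Qed.

(** * Density strictly above n *)

Definition interpolates (n : nat) (w1 tau : C) : Prop :=
  forall alpha : Z * Z -> C, (exists M, bsum (fun x => Cmod (alpha x) * Cmod (alpha x)) M) ->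
    exists F, in_polyFock n F /\ forall x, (RtoC (exp (- (PI / 2) * Cnorm2 (w1 * latv tau x)%C)) * F (w1 * latv tau x) = alpha x)%C.

Lemma interp_value (F : C -> C) (z a : C) : (RtoC (exp (- (PI / 2) * Cnorm2 z)) * F z = a)%C ->
  F z = (a * RtoC (exp (PI / 2 * (Cmod z * Cmod z))))%C.
Proof.
  intros H. rewrite <- H, Cnorm2_Cmod. rewrite (Cmult_comm _ (F z)), <- Cmult_assoc, <- RtoC_mult, <- exp_plus.
  replace (- (PI / 2) * (Cmod z * Cmod z) + PI / 2 * (Cmod z * Cmod z)) with 0 by ring. rewrite exp_0. ring.
Qed.

(** With kap = pi / (2 n T) the weight is a Gaussian decaying at the same positive rate [dl] in both
    coordinates. The double array is then absolutely summable, and exchanging the sums gives an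
    exact trace relation. Data supported at one point of a row where b is nonzero reduce it to a
    single nonzero term. *)
Lemma necessity_strict n (w1 tau : C) : (1 <= n)%nat -> w1 <> RtoC 0 -> 0 < Im tau ->
  INR n * (Cmod w1 * Cmod w1) * Im tau < 1 -> ~ interpolates n w1 tau.
Proof.
  intros Hn Hw HT HD Hint.
  destruct (exists_b n tau Hn HT) as (b & (l0 & Hl0) & (Bb & HBb) & Hper & Hmom).
  set (x0 := (0%Z, l0)). set (alpha := fun x : Z * Z => if eq_dec_classic x x0 then RtoC 1 else RtoC 0).
  destruct (Hint alpha) as (F & HFock & HFi).
  { exists 1. intros L NL. destruct (classic (In x0 L)) as [Hin|Hin].
    - rewrite (lsumR_single L _ x0); auto.
      + unfold alpha. destruct (eq_dec_classic x0 x0); [|tauto]. rewrite Cmod_1. lra.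
      + intros s _ Hs. unfold alpha. destruct (eq_dec_classic s x0); [tauto|]. rewrite Cmod_0. ring.
    - rewrite (lsumR_ext _ _ (fun _ => 0)); [rewrite lsumR_const; lra|]. intros s Hs. unfold alpha.
      destruct (eq_dec_classic s x0); [congruence|]. rewrite Cmod_0. ring. }
  destruct (trace_identities n w1 tau b Bb F Hn Hw HT HBb Hper Hmom HFock) as (K & N & HN1 & _ & Htr).
  set (A := Cmod w1 * Cmod w1) in *. set (T := Im tau) in *. pose proof PI_RGT_0 as HPI.
  assert (HnR : 0 < INR n) by (apply lt_0_INR; lia).
  assert (HA' : A < / (INR n * T)).
  { apply (Rmult_lt_reg_l (INR n * T)); [nra|]. rewrite Rinv_r by nra. lra. }
  set (dl := PI / 2 * (/ (INR n * T) - A)). assert (Hdl : 0 < dl) by (unfold dl; apply Rmult_lt_0_compat; lra).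
  destruct (Htr (PI / 2 * / (INR n * T))) as (trm & Gv & HG & Hrow & Hcol & Hbd); [nra|].
  destruct (gauss_le_exp dl 0 Hdl) as (K3 & HK3 & HK3').
  destruct (bsum_exp_shift 1 Rlt_0_1) as (Ks & HKs).
  assert (HK0 : 0 <= K) by (destruct (HN1 O (RtoC 0)); [lia|lra]).
  assert (HKs0 : 0 <= Ks) by apply (bsum_ge0 _ _ (HKs 0)).
  assert (HBb0 : 0 <= Bb) by (eapply Rle_trans; [apply Cmod_ge_0|apply (HBb 0%Z)]).
  (* One factor K3 exp(-|.|) for each coordinate of the Gaussian weight; [Ks] sums the horizontal
     one along the row. *)
  set (U := fun q => K * K3 * Ks * (K3 * exp (- Rabs (yq n tau q)))).
  assert (HU : forall q x i, 0 <= x <= 1 -> (i < n)%nat ->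
     bsum (fun j : Z => N i (((x, yq n tau q) : C) + RtoC (IZR j))%C * weight n w1 tau (PI / 2 * / (INR n * T)) (((x, yq n tau q) : C) + RtoC (IZR j))%C) (U q)).
  { intros q x i Hx Hi. set (y := yq n tau q). unfold U. fold y.
    replace (K * K3 * Ks * (K3 * exp (- Rabs y))) with ((K * K3 * (K3 * exp (- Rabs y))) * Ks) by ring.
    apply (bsum_le _ (fun j : Z => (K * K3 * (K3 * exp (- Rabs y))) * exp (- (1) * Rabs (IZR j + x)))).
    - intros j. set (v := (((x, y) : C) + RtoC (IZR j))%C).
      assert (Ew : weight n w1 tau (PI / 2 * / (INR n * T)) v = exp (- dl * (Rabs (IZR j + x) * Rabs (IZR j + x)) + 0 * Rabs (IZR j + x)) * exp (- dl * (Rabs y * Rabs y) + 0 * Rabs y)).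
      { unfold weight. rewrite <- exp_plus. f_equal. rewrite (Cmod_sqr v). fold A T.
        assert (Esq : forall u, Rabs u * Rabs u = u * u) by (intros u; rewrite <- Rabs_mult; apply Rabs_pos_eq, Rle_0_sqr).
        rewrite !Esq. unfold v; simpl. unfold dl. field. lra. }
      rewrite Ew. destruct (HN1 i v Hi) as [N1 N2]. pose proof (HK3' (Rabs (IZR j + x))) as G1. pose proof (HK3' (Rabs y)) as G2.
      replace (- (1) * Rabs (IZR j + x)) with (- Rabs (IZR j + x)) by ring.
      apply Rle_trans with (K * ((K3 * exp (- Rabs (IZR j + x))) * (K3 * exp (- Rabs y)))); [|right; ring].
      apply Rmult_le_compat; auto; [apply Rmult_le_pos; left; apply exp_pos|].
      apply Rmult_le_compat; auto; left; apply exp_pos.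
    - apply bsum_scal; auto. repeat apply Rmult_le_pos; try lra. left; apply exp_pos. }
  destruct (gauss_poly_le (PI * T / INR n) (2 * Cmod w1 * T) n) as (K5 & HK5 & HK5').
  { apply Rdiv_lt_0_compat; [nra|auto]. }
  { pose proof (Cmod_ge_0 w1). apply Rmult_le_pos; [lra|lra]. }
  assert (HU0 : forall q, 0 <= U q). { intros q. unfold U. repeat apply Rmult_le_pos; try lra. left; apply exp_pos. }
  assert (Hb2 : forall l q, Cmod (trm l q) <= 2 * Bb * U q * (K5 * exp (- (1) * Rabs (IZR l + INR n * (IZR q - 1 / 2))))).
  { intros l q. eapply Rle_trans; [apply (Hbd l q (U q) (HU q))|]. apply Rmult_le_compat_l.
    - apply Rmult_le_pos; [lra|auto].
    - replace (- (1) * Rabs (IZR l + INR n * (IZR q - 1 / 2))) with (- Rabs (IZR l + INR n * (IZR q - 1 / 2))) by ring.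
      eapply Rle_trans; [|apply HK5']. right. f_equal. apply lsumR_ext. intros i _. f_equal. fold T. ring. }
  assert (Hnt : 0 < INR n * T) by (apply Rmult_lt_0_compat; auto).
  destruct (bsum_exp_shift (INR n * T) Hnt) as (Ky & HKy).
  assert (Hbs : exists Kt, bsum (fun x : Z * Z => Cmod (trm (snd x) (fst x))) Kt).
  { exists ((2 * Bb * (K * K3 * Ks * K3) * (K5 * Ks)) * Ky).
    apply (bsum_Fubini _ (fun q => 2 * Bb * U q * (K5 * Ks))).
    - intros; apply Cmod_ge_0.
    - intros q. simpl. eapply bsum_le; [intros l; apply Hb2|]. apply bsum_scal; [apply Rmult_le_pos; [lra|auto]|]. apply bsum_scal; [lra|]. apply HKs.
    - apply (bsum_le _ (fun q => (2 * Bb * (K * K3 * Ks * K3) * (K5 * Ks)) * exp (- (INR n * T) * Rabs (IZR q + - (1 / 2))))).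
      + intros q. unfold U, yq. fold T. rewrite Rabs_Ropp, Rabs_mult, (Rabs_pos_eq (INR n * T)) by lra.
        right. replace (- (INR n * T * Rabs (IZR q - 1 / 2))) with (- (INR n * T) * Rabs (IZR q + - (1 / 2))) by (unfold Rminus; ring). ring.
      + apply bsum_scal; [repeat apply Rmult_le_pos; lra|apply HKy]. }
  destruct Hbs as (Kt & HKt). destruct (HS_exists _ _ HKt) as (s & Hs).
  assert (Hs0 : s = RtoC 0).
  { pose proof (HS_Fubini _ (fun _ : Z => RtoC 0) s Hs (fun q => Hcol q)) as H0. apply (HS_unique _ _ _ H0 HS_zero). }
  subst s. apply HS_swap in Hs. simpl in Hs.
  pose proof (HS_Fubini _ (fun l => (b l * gw n tau l * Gv l)%C) (RtoC 0) Hs (fun l => Hrow l)) as Htot.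
  assert (HGv : forall l, l <> l0 -> Gv l = RtoC 0).
  { intros l Hl. apply (HS_unique _ _ _ (HG l)). apply (HS_ext (fun _ => RtoC 0)); [|apply HS_zero].
    intros j. rewrite (interp_value _ _ _ (HFi (j, l))). unfold alpha. destruct (eq_dec_classic (j, l) x0) as [E|E]; [unfold x0 in E; congruence|]. ring. }
  assert (HGv0 : Gv l0 <> RtoC 0).
  { set (gfun := fun j : Z => (F (w1 * latv tau (j, l0)) * Egauss (PI / 2 * / (INR n * T)) (latv tau (j, l0)))%C).
    assert (E : Gv l0 = lsum [0%Z] gfun).
    { apply (HS_unique gfun); [apply HG|]. apply HS_finite; [constructor; [simpl; tauto|constructor]|].
      intros j Hj. unfold gfun. rewrite (interp_value _ _ _ (HFi (j, l0))). unfold alpha. destruct (eq_dec_classic (j, l0) x0) as [E|E]; [|ring].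
      exfalso. apply Hj. unfold x0 in E. injection E. intros ->. simpl; auto. }
    rewrite E. simpl. unfold gfun. rewrite (interp_value _ _ _ (HFi (0%Z, l0))). unfold alpha. destruct (eq_dec_classic (0%Z, l0) x0) as [E1|E1]; [|unfold x0 in E1; tauto].
    rewrite Cplus_0_r, Cmult_1_l. apply Cmult_neq_0; [|apply Cexp_neq_0]. apply RtoC_neq0. apply Rgt_not_eq, exp_pos. }
  assert (E : RtoC 0 = lsum [l0] (fun l => (b l * gw n tau l * Gv l)%C)).
  { apply (HS_unique _ _ _ Htot). apply HS_finite; [constructor; [simpl; tauto|constructor]|].
    intros l Hl. rewrite HGv; [ring|]. intros ->. apply Hl. simpl; auto. }
  simpl in E. rewrite Cplus_0_r in E. symmetry in E. revert E. apply Cmult_neq_0; auto. apply Cmult_neq_0; auto. apply Cexp_neq_0.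
Qed.

(** * The critical density *)
(** A Gaussian of width L sampled at unit steps sums to O(L), uniformly in the offset: exp(-u^2) is
    dominated by a multiple of exp(-u), which leaves two geometric series of ratio exp(-1/L). *)
Lemma bsum_gauss_scale : exists K6, 0 < K6 /\ forall (L : nat) x, (1 <= L)%nat -> 0 <= x <= 1 ->
  bsum (fun j : Z => exp (- / (INR L * INR L) * ((x + IZR j) * (x + IZR j)))) (K6 * INR L).
Proof.
  exists (4 * (exp 1 * exp 1)). pose proof (exp_pos 1) as He. split; [nra|]. intros L x HL Hx.
  assert (HLR : 1 <= INR L) by (apply (le_INR 1); auto).
  set (q := exp (- / INR L)).
  assert (HiL : 0 < / INR L <= 1). { split; [apply Rinv_0_lt_compat; lra|]. rewrite <- Rinv_1. apply Rinv_le_contravar; lra. }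
  pose proof (one_minus_exp (/ INR L) ltac:(lra)) as Hq. fold q in Hq.
  assert (Hq0 : 0 <= q < 1) by (split; [left; apply exp_pos|lra]).
  assert (Hinv : / (1 - q) <= 2 * INR L).
  { replace (2 * INR L) with (/ (/ INR L / 2)) by (field; lra). apply Rinv_le_contravar; lra. }
  replace (4 * (exp 1 * exp 1) * INR L) with (exp 1 * exp 1 * (2 * INR L + 2 * INR L)) by ring.
  apply (bsum_le _ (fun j : Z => exp 1 * exp 1 * exp (- / INR L * Rabs (IZR j)))).
  - intros j. rewrite <- !exp_plus. apply exp_mono. set (u := Rabs (x + IZR j) * / INR L).
    replace (- / (INR L * INR L) * ((x + IZR j) * (x + IZR j))) with (- (u * u)).
    2:{ unfold u. replace (Rabs (x + IZR j) * / INR L * (Rabs (x + IZR j) * / INR L)) with ((Rabs (x + IZR j) * Rabs (x + IZR j)) * / (INR L * INR L)) by (field; lra).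
        rewrite <- Rabs_mult, (Rabs_pos_eq (_ * _)) by apply Rle_0_sqr. ring. }
    assert (Hj : Rabs (IZR j) <= Rabs (x + IZR j) + 1).
    { replace (IZR j) with ((x + IZR j) + - x) at 1 by ring. eapply Rle_trans; [apply Rabs_triang|]. rewrite Rabs_Ropp, (Rabs_pos_eq x); lra. }
    assert (/ INR L * Rabs (IZR j) <= u + 1). { unfold u. nra. }
    pose proof (Rle_0_sqr (u - 1)) as Hu. unfold Rsqr in Hu. pose proof (Rle_0_sqr u) as Hu2. unfold Rsqr in Hu2. nra.
  - apply bsum_scal; [nra|]. apply bsum_Z.
    + apply (bsum_le _ (fun k => q ^ k)); [|eapply bsum_weaken; [apply Hinv|apply bsum_geom; auto]].
      intros k. unfold q. rewrite exp_pow, <- INR_IZR_INZ, Rabs_pos_eq by apply pos_INR. right. f_equal. ring.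
    + apply (bsum_le _ (fun k => q ^ k)); [|eapply bsum_weaken; [apply Hinv|apply bsum_geom; auto]].
      intros k. unfold q. rewrite exp_pow, opp_IZR, Rabs_Ropp, <- INR_IZR_INZ, Rabs_pos_eq by apply pos_INR. right. f_equal. ring.
Qed.

(* Points on opposite sides of [0, L] are at distance at least the sum of their distances to one of its ends. *)
Lemma opposite_sides (L l a : R) : 0 <= L -> (0 <= l <= L /\ ~ (0 <= a <= L) \/ ~ (0 <= l < L) /\ 0 <= a <= L) ->
  exp (- Rabs (l - a)) <= exp (- Rabs (a - L)) * exp (- Rabs (l - L)) + exp (- Rabs a) * exp (- Rabs l).
Proof.
  intros HL H. rewrite <- !exp_plus.
  pose proof (exp_pos (- Rabs (a - L) + - Rabs (l - L))) as P1. pose proof (exp_pos (- Rabs a + - Rabs l)) as P2.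
  assert (H' : Rabs (l - a) >= Rabs (a - L) + Rabs (l - L) \/ Rabs (l - a) >= Rabs a + Rabs l).
  { assert (Hc : (l <= L <= a \/ a <= L <= l) \/ (l <= 0 <= a \/ a <= 0 <= l)).
    { destruct (Rlt_dec a 0), (Rlt_dec L a), (Rlt_dec l 0), (Rle_dec L l); destruct H as [[H1 H2]|[H1 H2]];
      first [lra | left; lra | right; lra | exfalso; apply H2; lra | exfalso; apply H1; lra]. }
    destruct Hc as [Hc|Hc]; [left|right]; unfold Rabs; repeat destruct Rcase_abs; lra. }
  destruct H' as [H'|H'].
  - assert (exp (- Rabs (l - a)) <= exp (- Rabs (a - L) + - Rabs (l - L))) by (apply exp_mono; lra). lra.
  - assert (exp (- Rabs (l - a)) <= exp (- Rabs a + - Rabs l)) by (apply exp_mono; lra). lra.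
Qed.

(** With kap = pi A / 2 + eps the weight is exp(eps y^2 - eps x^2). Cauchy-Schwarz along a row gives
    the factor sqrt L, and the growth in y is absorbed near the first L rows. A column centred in
    [0, L] is replaced by minus its part outside the truncation, since columns sum to 0. Hence every
    column contributes only terms across 0 or L from its centre, and these are summable over q with
    a bound independent of L. *)
Lemma critical_upper n w1 tau (b : Z -> C) Bb F : (1 <= n)%nat -> w1 <> RtoC 0 -> 0 < Im tau ->
  (forall l, Cmod (b l) <= Bb) -> (forall l, b (l + Z.of_nat n)%Z = (sgnZ (Z.of_nat n) * b l)%C) -> moment_vanish n tau b ->
  in_polyFock n F -> INR n * (Cmod w1 * Cmod w1) * Im tau = 1 ->
  exists (Cu : R) (L0 : nat), 0 <= Cu /\ forall L : nat, (L0 <= L)%nat -> (1 <= L)%nat -> exists Gv : Z -> C,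
    (forall l, HS (fun j : Z => F (w1 * latv tau (j, l)) * Egauss (PI / 2 * (Cmod w1 * Cmod w1) + / (INR L * INR L)) (latv tau (j, l)))%C (Gv l)) /\
    Cmod (lsum (seq 0 L) (fun m => b (Z.of_nat m) * gw n tau (Z.of_nat m) * Gv (Z.of_nat m))%C) <= Cu * sqrt (INR L).
Proof.
  intros Hn Hw HT HBb Hper Hmom HFock Hcrit.
  destruct (trace_identities n w1 tau b Bb F Hn Hw HT HBb Hper Hmom HFock) as (K & N & HN1 & HN2 & Htr).
  set (A := Cmod w1 * Cmod w1) in *. set (T := Im tau) in *. pose proof PI_RGT_0 as HPI.
  assert (HnR : 1 <= INR n) by (apply (le_INR 1); auto).
  assert (HA' : A = / (INR n * T)). { apply (Rmult_eq_reg_l (INR n * T)); [|nra]. rewrite Rinv_r by nra. lra. }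
  destruct bsum_gauss_scale as (K6 & HK6 & HK6').
  set (c := PI * T / INR n). assert (Hc : 0 < c) by (apply Rdiv_lt_0_compat; nra).
  destruct (gauss_poly_le (c / 2) (2 * Cmod w1 * T) n) as (K5 & HK5 & HK5').
  { lra. } { pose proof (Cmod_ge_0 w1). apply Rmult_le_pos; lra. }
  destruct (bsum_exp_shift 1 Rlt_0_1) as (Ks & HKs).
  assert (HK0 : 0 <= K) by (destruct (HN1 O (RtoC 0)); [lia|lra]).
  assert (HKs0 : 0 <= Ks) by apply (bsum_ge0 _ _ (HKs 0)).
  assert (HBb0 : 0 <= Bb) by (eapply Rle_trans; [apply Cmod_ge_0|apply (HBb 0%Z)]).
  (* This threshold gives 2 T^2 eps <= c / 2, so that half of the Gaussian in t absorbs the growth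
     exp(eps y^2). *)
  destruct (nfloor_ex (4 * (T * T) / c)) as (L0 & HL0). { apply Rdiv_le_0_compat; nra. }
  set (C1 := 2 * Bb * exp (2 * (T * T)) * K5).
  assert (HC1 : 0 <= C1). { unfold C1. repeat apply Rmult_le_pos; try lra. left; apply exp_pos. }
  exists (C1 * sqrt (K * K6) * Ks * (Ks + Ks)), (S L0). split.
  { repeat apply Rmult_le_pos; try lra; first [apply sqrt_pos | left; apply exp_pos]. }
  intros L HL HL1.
  assert (HLR : INR L0 + 1 <= INR L) by (rewrite <- S_INR; apply le_INR; auto).
  assert (HLR1 : 1 <= INR L) by (apply (le_INR 1); auto).
  set (eps := / (INR L * INR L)) in *. assert (Heps : 0 < eps) by (apply Rinv_0_lt_compat; nra).
  assert (HepsL : eps * (INR L * INR L) = 1) by (unfold eps; apply Rinv_l; nra).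
  assert (HepsT : 2 * (T * T) * eps <= c / 2).
  { assert (H4 : 4 * (T * T) < c * INR L).
    { assert (4 * (T * T) / c < INR L) by lra. apply (Rmult_lt_compat_r c) in H; auto.
      replace (4 * (T * T) / c * c) with (4 * (T * T)) in H by (field; lra). lra. }
    assert (4 * (T * T) <= c * (INR L * INR L)) by nra.
    apply (Rmult_le_compat_r eps) in H; [|lra]. replace (c * (INR L * INR L) * eps) with (c * (eps * (INR L * INR L))) in H by ring. rewrite HepsL in H. lra. }
  destruct (Htr (PI / 2 * A + eps)) as (trm & Gv & HG & Hrow & Hcol & Hbd); [lra|].
  exists Gv. split; [auto|].
  set (SL := sqrt (K * (K6 * INR L))).
  assert (HSL : 0 <= SL) by apply sqrt_pos.
  assert (HU : forall q x i, 0 <= x <= 1 -> (i < n)%nat ->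
     bsum (fun j : Z => N i (((x, yq n tau q) : C) + RtoC (IZR j))%C * weight n w1 tau (PI / 2 * A + eps) (((x, yq n tau q) : C) + RtoC (IZR j))%C)
       (exp (eps * (yq n tau q * yq n tau q)) * SL)).
  { intros q x i Hx Hi. set (y := yq n tau q).
    apply (bsum_le _ (fun j : Z => exp (eps * (y * y)) * (N i (((x, y) : C) + RtoC (IZR j))%C * exp (- eps * ((x + IZR j) * (x + IZR j)))))).
    - intros j. set (v := (((x, y) : C) + RtoC (IZR j))%C). right.
      assert (Ew : weight n w1 tau (PI / 2 * A + eps) v = exp (eps * (y * y)) * exp (- eps * ((x + IZR j) * (x + IZR j)))).
      { unfold weight. rewrite <- exp_plus. f_equal. rewrite (Cmod_sqr v). fold A T.
        assert (Ex : fst v = x + IZR j) by reflexivity. assert (Ey : snd v = y) by (unfold v; simpl; ring).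
        rewrite Ex, Ey. replace (PI / (INR n * T)) with (PI * A) by (unfold Rdiv; f_equal; exact HA'). field. }
      rewrite Ew. ring.
    - apply bsum_scal; [left; apply exp_pos|]. intros Q NQ.
      apply Rsqr_incr_0_var; [|auto]. unfold SL. rewrite Rsqr_sqrt by (apply Rmult_le_pos; [auto|nra]). unfold Rsqr.
      eapply Rle_trans; [apply lsumR_cauchy; intros; left; apply exp_pos|].
      apply Rmult_le_compat.
      + apply lsumR_nonneg. intros j _. apply Rmult_le_pos; [apply Rle_0_sqr|left; apply exp_pos].
      + apply lsumR_nonneg. intros; left; apply exp_pos.
      + eapply Rle_trans; [|apply (HN2 i ((x, y) : C) Hi Q NQ)]. apply lsumR_le. intros j _.
        rewrite <- (Rmult_1_r (N i (((x, y) : C) + RtoC (IZR j))%C * _)) at 2. apply Rmult_le_compat_l; [apply Rle_0_sqr|].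
        rewrite <- exp_0. apply exp_mono. pose proof (Rle_0_sqr (x + IZR j)) as Hs. unfold Rsqr in Hs. nra.
      + apply HK6'; auto. }
  (* The position among the rows around which column q is concentrated. *)
  set (aq := fun q => - (INR n * (IZR q - 1 / 2))).
  (* Either alternative gives aq^2 <= 2 L^2 + 2 t^2, hence eps y^2 <= 2 T^2 + (c / 2) t^2. *)
  assert (Hb2 : forall l q, 0 <= IZR l <= INR L \/ 0 <= aq q <= INR L -> Cmod (trm l q) <= C1 * SL * exp (- Rabs (IZR l - aq q))).
  { intros l q Hlq. eapply Rle_trans; [apply (Hbd l q _ (HU q))|]. set (t := IZR l + INR n * (IZR q - 1 / 2)).
    assert (Ht : t = IZR l - aq q) by (unfold t, aq; ring).
    assert (Hy : eps * (yq n tau q * yq n tau q) <= 2 * (T * T) + c / 2 * (t * t)).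
    { replace (yq n tau q) with (T * aq q) by (unfold yq, aq; fold T; ring).
      assert (Ha : aq q * aq q <= 2 * (INR L * INR L) + 2 * (t * t)).
      { destruct Hlq as [Hlq|Hlq].
        - replace (aq q) with (IZR l - t) by lra. pose proof (Rle_0_sqr (IZR l + t)) as Hs. unfold Rsqr in Hs. nra.
        - pose proof (Rle_0_sqr t) as Hs. unfold Rsqr in Hs. nra. }
      apply Rle_trans with (eps * (T * T) * (2 * (INR L * INR L) + 2 * (t * t))).
      - replace (eps * (T * aq q * (T * aq q))) with (eps * (T * T) * (aq q * aq q)) by ring. apply Rmult_le_compat_l; [|auto]. apply Rmult_le_pos; [lra|apply Rle_0_sqr].
      - replace (eps * (T * T) * (2 * (INR L * INR L) + 2 * (t * t))) with (2 * (T * T) * (eps * (INR L * INR L)) + 2 * (T * T) * eps * (t * t)) by ring.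
        rewrite HepsL, Rmult_1_r. apply Rplus_le_compat_l. apply Rmult_le_compat_r; [apply Rle_0_sqr|auto]. }
    rewrite <- Ht. set (SP := lsumR _ _).
    assert (HSP : SP = lsumR (seq 0 n) (fun i => (2 * Cmod w1 * T * Rabs t) ^ i)).
    { unfold SP. apply lsumR_ext. intros i _. f_equal. fold T. ring. }
    specialize (HK5' t). rewrite <- HSP in HK5'.
    assert (HSP0 : 0 <= SP). { rewrite HSP. apply lsumR_nonneg. intros i _. apply pow_le. pose proof (Rabs_pos t). pose proof (Cmod_ge_0 w1). repeat apply Rmult_le_pos; lra. }
    assert (He2 : exp (eps * (yq n tau q * yq n tau q)) * exp (- c * (t * t)) <= exp (2 * (T * T)) * exp (- (c / 2) * (t * t))).
    { rewrite <- !exp_plus. apply exp_mono. lra. }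
    fold T. fold c.
    replace (2 * Bb * (exp (eps * (yq n tau q * yq n tau q)) * SL) * (exp (- c * (t * t)) * SP)) with
      (2 * Bb * SL * ((exp (eps * (yq n tau q * yq n tau q)) * exp (- c * (t * t))) * SP)) by ring.
    unfold C1. replace (2 * Bb * exp (2 * (T * T)) * K5 * SL * exp (- Rabs t)) with (2 * Bb * SL * (exp (2 * (T * T)) * (K5 * exp (- Rabs t)))) by ring.
    apply Rmult_le_compat_l; [apply Rmult_le_pos; lra|].
    apply Rle_trans with (exp (2 * (T * T)) * exp (- (c / 2) * (t * t)) * SP); [apply Rmult_le_compat_r; auto|].
    rewrite Rmult_assoc. apply Rmult_le_compat_l; [left; apply exp_pos|auto]. }
  set (ev := fun q l => exp (- Rabs (aq q - INR L)) * exp (- Rabs (IZR l - INR L)) + exp (- Rabs (aq q)) * exp (- Rabs (IZR l))).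
  assert (Hev : forall q, bsum (ev q) ((exp (- Rabs (aq q - INR L)) + exp (- Rabs (aq q))) * Ks)).
  { intros q. rewrite Rmult_plus_distr_r. apply bsum_plus; apply bsum_scal; try (left; apply exp_pos).
    - eapply bsum_le; [|apply (HKs (- INR L))]. intros l. right. simpl. f_equal. unfold Rminus. ring.
    - eapply bsum_le; [|apply (HKs 0)]. intros l. right. simpl. f_equal. rewrite Rplus_0_r. ring. }
  assert (HS1 : forall q, Cmod (lsum (seq 0 L) (fun m => trm (Z.of_nat m) q)) <= C1 * SL * ((exp (- Rabs (aq q - INR L)) + exp (- Rabs (aq q))) * Ks)).
  { intros q. assert (HC1S : 0 <= C1 * SL) by (apply Rmult_le_pos; auto).
    set (Rl := map Z.of_nat (seq 0 L)). assert (NDR : NoDup Rl) by (apply Injective_map_NoDup; [intros x y; lia|apply seq_NoDup]).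
    assert (HRl : forall l, In l Rl <-> (0 <= l < Z.of_nat L)%Z).
    { intros l. unfold Rl. rewrite in_map_iff. split.
      - intros (m & <- & Hm). apply in_seq in Hm. lia.
      - intros Hl. exists (Z.to_nat l). split; [lia|]. apply in_seq. lia. }
    assert (EL : IZR (Z.of_nat L) = INR L) by (symmetry; apply INR_IZR_INZ).
    rewrite <- (lsum_map Z.of_nat (seq 0 L) (fun l => trm l q)). fold Rl.
    (* For a centre inside [0, L] the sum over the first L rows equals minus the sum over all other
       rows; for a centre outside it is estimated directly. *)
    destruct (classic (0 <= aq q <= INR L)) as [Ha|Ha].
    - set (ind := fun l => if in_dec Z.eq_dec l Rl then trm l q else RtoC 0).
      assert (Hind : HS ind (lsum Rl ind)).
      { apply HS_finite; auto. intros l Hl. unfold ind. destruct (in_dec _ _ _); [tauto|auto]. }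
      assert (Eind : lsum Rl ind = lsum Rl (fun l => trm l q)).
      { apply lsum_ext. intros l Hl. unfold ind. destruct (in_dec _ _ _); [auto|tauto]. }
      rewrite Eind in Hind.
      pose proof (HS_plus _ _ _ _ (Hcol q) (HS_scal _ _ (- (1))%C Hind)) as Hout.
      apply HS_bound with (M := C1 * SL * ((exp (- Rabs (aq q - INR L)) + exp (- Rabs (aq q))) * Ks)) in Hout.
      + rewrite Cplus_0_l, Cmod_mult, Cmod_opp, Cmod_1, Rmult_1_l in Hout. auto.
      + eapply bsum_le; [|apply bsum_scal; [apply HC1S|apply (Hev q)]]. intros l. cbv beta. unfold ind.
        destruct (in_dec Z.eq_dec l Rl) as [Hl|Hl].
        * replace (trm l q + - (1) * trm l q)%C with (RtoC 0) by ring. rewrite Cmod_0. apply Rmult_le_pos; auto. unfold ev.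
          pose proof (exp_pos (- Rabs (aq q - INR L))). pose proof (exp_pos (- Rabs (IZR l - INR L))). pose proof (exp_pos (- Rabs (aq q))). pose proof (exp_pos (- Rabs (IZR l))). nra.
        * replace (trm l q + - (1) * RtoC 0)%C with (trm l q) by ring. eapply Rle_trans; [apply Hb2; auto|].
          apply Rmult_le_compat_l; auto. apply opposite_sides; [lra|]. right. split; auto.
          intros [H1 H2]. apply Hl. apply HRl. split; [apply le_IZR; auto|apply lt_IZR; lra].
    - eapply Rle_trans; [apply lsum_Cmod|].
      apply Rle_trans with (lsumR Rl (fun l => C1 * SL * ev q l)).
      + apply lsumR_le. intros l Hl. apply HRl in Hl. destruct Hl as [H1 H2]. apply IZR_le in H1. apply IZR_lt in H2.
        eapply Rle_trans; [apply Hb2; left; lra|]. apply Rmult_le_compat_l; auto. apply opposite_sides; [lra|]. left. split; [lra|auto].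
      + rewrite lsumR_scal. apply Rmult_le_compat_l; auto. apply Hev; auto. }
  assert (HE : HS (fun q => lsum (seq 0 L) (fun m => trm (Z.of_nat m) q)) (lsum (seq 0 L) (fun m => b (Z.of_nat m) * gw n tau (Z.of_nat m) * Gv (Z.of_nat m))%C)).
  { apply HS_lsum. intros m _. apply Hrow. }
  assert (ESL : SL = sqrt (K * K6) * sqrt (INR L)).
  { unfold SL. rewrite <- Rmult_assoc. apply sqrt_mult; [nra|lra]. }
  replace (C1 * sqrt (K * K6) * Ks * (Ks + Ks) * sqrt (INR L)) with (C1 * SL * Ks * (Ks + Ks)) by (rewrite ESL; ring).
  apply (HS_bound _ _ _ HE).
  apply (bsum_le _ (fun q => C1 * SL * Ks * (exp (- (1) * Rabs (IZR q + (INR L / INR n - 1 / 2))) + exp (- (1) * Rabs (IZR q + - (1 / 2)))))).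
  - intros q. eapply Rle_trans; [apply HS1|].
    replace (C1 * SL * ((exp (- Rabs (aq q - INR L)) + exp (- Rabs (aq q))) * Ks)) with (C1 * SL * Ks * (exp (- Rabs (aq q - INR L)) + exp (- Rabs (aq q)))) by ring.
    apply Rmult_le_compat_l; [repeat apply Rmult_le_pos; auto; first [lra | left; apply exp_pos]|]. apply Rplus_le_compat; apply exp_mono.
    + replace (aq q - INR L) with (- (INR n * (IZR q + (INR L / INR n - 1 / 2)))) by (unfold aq; field; lra).
      rewrite Rabs_Ropp, Rabs_mult, (Rabs_pos_eq (INR n)) by lra. pose proof (Rabs_pos (IZR q + (INR L / INR n - 1 / 2))). nra.
    + replace (aq q) with (- (INR n * (IZR q + - (1 / 2)))) by (unfold aq; field).
      rewrite Rabs_Ropp, Rabs_mult, (Rabs_pos_eq (INR n)) by lra. pose proof (Rabs_pos (IZR q + - (1 / 2))). nra.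
  - apply bsum_scal; [repeat apply Rmult_le_pos; auto; first [lra | left; apply exp_pos]|]. apply bsum_plus; apply HKs.
Qed.

Lemma Re_lsum {I} (l : list I) f : Re (lsum l f) = lsumR l (fun i => Re (f i)).
Proof. induction l as [|a l IH]; [reflexivity|]. simpl. rewrite <- IH. reflexivity. Qed.

Lemma cos_ge_half u : Rabs u <= 1 -> 1 / 2 <= cos u.
Proof.
  intros Hu. pose proof PI2_3_2.
  assert (E : cos u = cos (Rabs u)). { unfold Rabs. destruct (Rcase_abs u); auto. rewrite cos_neg. auto. }
  rewrite E, <- cos_PI3. pose proof (Rabs_pos u). apply cos_decr_1; lra.
Qed.

(** Telescoping against 2 / sqrt m from m = 1 on; the term at m = 0 is an inverse of 0, which is 0
    here. *)
Lemma bsum_three_halves : bsum (fun m : nat => / (INR m * sqrt (INR m))) 3.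
Proof.
  assert (H0 : / (INR 0 * sqrt (INR 0)) = 0). { simpl. rewrite Rmult_0_l. apply Rinv_0. }
  apply bsum_nat.
  - intros [|k]; [rewrite H0; lra|]. left. apply Rinv_0_lt_compat.
    assert (0 < INR (S k)) by (apply lt_0_INR; lia). apply Rmult_lt_0_compat; auto. apply sqrt_lt_R0; auto.
  - assert (H : forall M, lsumR (seq 0 (S (S M))) (fun m : nat => / (INR m * sqrt (INR m))) <= 3 - 2 / sqrt (INR (S M))).
    { induction M as [|M IH].
      - rewrite !lsumR_seq_S. rewrite H0. simpl. rewrite sqrt_1. lra.
      - rewrite lsumR_seq_S. eapply Rle_trans; [apply Rplus_le_compat_r, IH|].
        set (a := sqrt (INR (S M))). set (s := sqrt (INR (S (S M)))).
        assert (HM : 0 < INR (S M)) by (apply lt_0_INR; lia).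
        assert (Ha : 0 < a) by (apply sqrt_lt_R0; auto).
        assert (Hs2 : s * s = INR (S (S M))) by (apply sqrt_sqrt, pos_INR).
        assert (Ha2 : a * a = INR (S M)) by (apply sqrt_sqrt, pos_INR).
        rewrite (S_INR (S M)) in Hs2.
        assert (Hs0 : 0 <= s) by apply sqrt_pos. assert (Has : a < s) by nra.
        replace (INR (S (S M))) with (s * s) by (rewrite (S_INR (S M)); auto).
        assert (E : 2 / a - 2 / s = 2 / (a * s * (s + a))).
        { replace 2 with (2 * (s * s - a * a)) at 3 by (rewrite Hs2, Ha2; ring). field. repeat split; lra. }
        assert (/ (s * s * s) <= 2 / (a * s * (s + a))).
        { replace (/ (s * s * s)) with (2 / (s * s * (s + s))) by (field; lra). unfold Rdiv. apply Rmult_le_compat_l; [lra|].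
          apply Rinv_le_contravar; [repeat apply Rmult_lt_0_compat; lra|].
          assert (a * s <= s * s) by nra. apply Rmult_le_compat; nra. }
        lra. }
    intros [|[|M]]; [simpl; lra|rewrite lsumR_seq_S, H0; simpl; lra|]. eapply Rle_trans; [apply H|].
    assert (0 < / sqrt (INR (S M))). { apply Rinv_0_lt_compat, sqrt_lt_R0, lt_0_INR. lia. } unfold Rdiv. lra.
Qed.

(** * Data violating the critical bound *)

Section Critical.
Variables (n : nat) (w1 tau : C) (b : Z -> C) (Bb : R) (S0 : nat).
Hypothesis Hn : (1 <= n)%nat.
Hypothesis HT : 0 < Im tau.
Hypothesis HBb : forall l, Cmod (b l) <= Bb.
Hypothesis Hcrit : INR n * (Cmod w1 * Cmod w1) * Im tau = 1.
Hypothesis HS0 : (1 <= S0)%nat.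
Hypothesis HS0T : 2 * Im tau <= INR S0.

Let T := Im tau.
Let A := Cmod w1 * Cmod w1.

(** The factor with which the datum at (j, l) enters the trace relation when kap = pi A / 2. *)
Definition row_coef (j l : Z) : C :=
  (b l * gw n tau l * RtoC (exp (PI / 2 * A * (Cmod (latv tau (j, l)) * Cmod (latv tau (j, l))))) * Egauss (PI / 2 * A) (latv tau (j, l)))%C.

(** The relation n A T = 1 is exactly what makes all Gaussian factors cancel. *)
Lemma row_coef_Cmod j l : Cmod (row_coef j l) = Cmod (b l).
Proof.
  unfold row_coef. assert (HN : 0 < INR n) by (apply lt_0_INR; lia).
  rewrite !Cmod_mult, gw_Cmod, Cmod_R, Rabs_pos_eq, Egauss_Cmod by (left; apply exp_pos).
  rewrite !Rmult_assoc, <- !exp_plus. rewrite <- (Rmult_1_r (Cmod (b l))) at 2. f_equal. rewrite <- exp_0. f_equal.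
  rewrite Cmod_sqr. set (x := fst _). replace (snd (latv tau (j, l))) with (IZR l * T) by (unfold latv, T, Im; simpl; ring).
  unfold mm. rewrite minus_IZR, mult_IZR, <- INR_IZR_INZ. fold T.
  assert (E : PI * T * (T * A * INR n) = PI * T). { replace (T * A * INR n) with (INR n * A * T) by ring. unfold A, T. rewrite Hcrit. ring. }
  apply (Rmult_eq_reg_r (INR n)); [|lra].
  transitivity (PI * (IZR l * IZR l) * T * (T * A * INR n) - PI * T * (IZR l * IZR l)); [field; lra|].
  replace (PI * (IZR l * IZR l) * T * (T * A * INR n)) with ((IZR l * IZR l) * (PI * T * (T * A * INR n))) by ring. rewrite E. ring.
Qed.

(** The offset that places the first zone point of row l at an abscissa in [0, 1). *)
Definition ofs (l : Z) : Z := (up (IZR l * Re tau) - 1)%Z.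
(** Consecutive points of row l, in number l / S0 rounded down, with abscissas between 0 and l /
    S0. *)
Definition zone (l : Z) : list Z := if Z_lt_dec 0 l then map (fun i => (Z.of_nat i - ofs l)%Z) (seq 0 (Z.to_nat l / S0)) else [].
(** This is l^(-5/4). The exponent lies strictly between 1, needed for square summability of the
    data, and 3/2, needed for the row sums to exceed sqrt L. *)
Definition rho (l : Z) : R := / (IZR l * sqrt (sqrt (IZR l))).
(* Supported in a cone where Re exp (- v^2 / L^2) stays bounded below on the first [L] rows, so that no cancellation occurs. *)
Definition alpha_c (x : Z * Z) : C :=
  if in_dec Z.eq_dec (fst x) (zone (snd x)) then (Cconj (row_coef (fst x) (snd x)) * RtoC (rho (snd x)))%C else RtoC 0.

Lemma zone_NoDup l : NoDup (zone l).
Proof.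
  unfold zone. destruct (Z_lt_dec 0 l); [|constructor]. apply Injective_map_NoDup; [|apply seq_NoDup]. intros x y; lia.
Qed.

Lemma zone_pos j l : In j (zone l) -> (0 < l)%Z /\ 0 <= fst (latv tau (j, l)) <= IZR l / INR S0.
Proof.
  unfold zone. destruct (Z_lt_dec 0 l) as [Hl|Hl]; [|intros []]. intros Hj. split; auto.
  apply in_map_iff in Hj. destruct Hj as (i & <- & Hi). apply in_seq in Hi.
  destruct (archimed (IZR l * Re tau)) as [H1 H2].
  assert (E : fst (latv tau ((Z.of_nat i - ofs l)%Z, l)) = INR i + (IZR l * Re tau - IZR (up (IZR l * Re tau)) + 1)).
  { unfold latv, ofs, Re. simpl. rewrite !minus_IZR, <- INR_IZR_INZ. unfold Re. ring. }
  rewrite E. pose proof (pos_INR i). split; [lra|].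
  assert (Hi1 : INR i + 1 <= INR (Z.to_nat l / S0)) by (rewrite <- S_INR; apply le_INR; lia).
  assert (HSp : 0 < INR S0) by (apply lt_0_INR; lia).
  assert (Hd : INR (Z.to_nat l / S0) * INR S0 <= IZR l).
  { rewrite <- mult_INR. replace (IZR l) with (INR (Z.to_nat l)) by (rewrite INR_IZR_INZ, Z2Nat.id; auto; lia).
    apply le_INR. rewrite Nat.mul_comm. apply Nat.Div0.mul_div_le. }
  apply Rle_trans with (INR (Z.to_nat l / S0)); [lra|].
  apply (Rmult_le_reg_r (INR S0)); auto. replace (IZR l / INR S0 * INR S0) with (IZR l) by (field; lra). auto.
Qed.

Lemma sqrt4 x : 0 < x -> 0 < sqrt (sqrt x) /\ sqrt (sqrt x) * sqrt (sqrt x) = sqrt x.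
Proof. intros Hx. assert (0 < sqrt x) by (apply sqrt_lt_R0; auto). split; [apply sqrt_lt_R0; auto|apply sqrt_sqrt; lra]. Qed.

Lemma alpha_c_l2 : exists M, bsum (fun x => Cmod (alpha_c x) * Cmod (alpha_c x)) M.
Proof.
  assert (HBb0 : 0 <= Bb) by (eapply Rle_trans; [apply Cmod_ge_0|apply (HBb 0%Z)]).
  set (f := fun x : Z * Z => Cmod (alpha_c (snd x, fst x)) * Cmod (alpha_c (snd x, fst x))).
  set (m := fun l => if Z_lt_dec 0 l then Bb * Bb * / (IZR l * sqrt (IZR l)) else 0).
  exists (Bb * Bb * 3 + 0).
  apply (bsum_inj (fun x : Z * Z => (snd x, fst x)) f); [intros [a c] [a' c']; simpl; congruence|].
  apply (bsum_Fubini f m).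
  - intros x. apply Rle_0_sqr.
  - intros l. assert (Hfin : bsum (fun j => f (l, j)) (lsumR (zone l) (fun j => f (l, j)))).
    { apply HS_pos_bsum; [intros; apply Rle_0_sqr|]. rewrite <- lsum_RtoC. apply HS_finite; [apply zone_NoDup|].
      intros j Hj. unfold f, alpha_c. simpl. destruct (in_dec Z.eq_dec j (zone l)); [tauto|]. rewrite Cmod_0. f_equal. ring. }
    eapply bsum_weaken; [|apply Hfin]. unfold m, zone.
    destruct (Z_lt_dec 0 l) as [Hl|Hl]; [|simpl; lra].
    assert (HlR : 0 < IZR l) by (apply IZR_lt; auto).
    assert (HSp : 1 <= INR S0) by (apply (le_INR 1); auto).
    destruct (sqrt4 (IZR l) HlR) as [Hs1 Hs2]. assert (Hsq : 0 < sqrt (IZR l)) by (apply sqrt_lt_R0; auto).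
    assert (Hrho : 0 < rho l). { apply Rinv_0_lt_compat. nra. }
    apply Rle_trans with (lsumR (map (fun i : nat => (Z.of_nat i - ofs l)%Z) (seq 0 (Z.to_nat l / S0))) (fun _ => Bb * Bb * (rho l * rho l))).
    + apply lsumR_le. intros j _. unfold f, alpha_c. simpl. destruct (in_dec _ _ _).
      * rewrite Cmod_mult, Cmod_conj, row_coef_Cmod, Cmod_R, Rabs_pos_eq by lra. pose proof (HBb l). pose proof (Cmod_ge_0 (b l)).
        replace (Cmod (b l) * rho l * (Cmod (b l) * rho l)) with (Cmod (b l) * Cmod (b l) * (rho l * rho l)) by ring.
        apply Rmult_le_compat_r; nra.
      * rewrite Cmod_0. replace (0 * 0) with 0 by ring. repeat apply Rmult_le_pos; lra.
    + rewrite lsumR_const, length_map, length_seq.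
      assert (Hd : INR (Z.to_nat l / S0) <= IZR l).
      { replace (IZR l) with (INR (Z.to_nat l)) by (rewrite INR_IZR_INZ, Z2Nat.id; auto; lia). apply le_INR.
        apply Nat.Div0.div_le_upper_bound. nia. }
      apply Rle_trans with (IZR l * (Bb * Bb * (rho l * rho l))).
      * apply Rmult_le_compat_r; auto. repeat apply Rmult_le_pos; lra.
      * right. unfold rho. rewrite <- Rinv_mult.
        replace (IZR l * sqrt (sqrt (IZR l)) * (IZR l * sqrt (sqrt (IZR l)))) with (IZR l * IZR l * (sqrt (sqrt (IZR l)) * sqrt (sqrt (IZR l)))) by ring.
        rewrite Hs2. field. split; lra.
  - apply (bsum_Z m).
    + apply (bsum_le _ (fun k : nat => Bb * Bb * / (INR k * sqrt (INR k)))); [|apply bsum_scal; [nra|apply bsum_three_halves]].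
      intros k. unfold m. destruct (Z_lt_dec 0 (Z.of_nat k)) as [Hk|Hk].
      * rewrite <- INR_IZR_INZ. lra.
      * replace k with O by lia. simpl. rewrite Rmult_0_l, Rinv_0. lra.
    + intros L _. rewrite (lsumR_ext L _ (fun _ => 0)); [rewrite lsumR_const; lra|]. intros k _. unfold m.
      destruct (Z_lt_dec 0 (- Z.of_nat k)); [lia|auto].
Qed.

(** The conjugate in [alpha_c] turns each term of the row into rho |b|^2 Re exp(-eps v^2). In the
    zone eps x^2 <= 1, so the modulus is at least exp(-1); and x <= l / S0 with S0 >= 2 T gives 2
    eps x y <= 1, so the cosine is at least 1/2. *)
Lemma row_lower F (L m : nat) (G : C) :
  (forall x, (RtoC (exp (- (PI / 2) * Cnorm2 (w1 * latv tau x)%C)) * F (w1 * latv tau x) = alpha_c x)%C) ->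
  (m < L)%nat ->
  HS (fun j : Z => F (w1 * latv tau (j, Z.of_nat m)) * Egauss (PI / 2 * A + / (INR L * INR L)) (latv tau (j, Z.of_nat m)))%C G ->
  0 <= Re (b (Z.of_nat m) * gw n tau (Z.of_nat m) * G)%C /\
  ((S0 <= m)%nat -> Cmod (b (Z.of_nat m)) * Cmod (b (Z.of_nat m)) * exp (- (1)) / (4 * INR S0 * sqrt (sqrt (INR L))) <= Re (b (Z.of_nat m) * gw n tau (Z.of_nat m) * G)%C).
Proof.
  intros HF HmL HG. set (l := Z.of_nat m) in *. set (eps := / (INR L * INR L)) in *.
  assert (HLp : 0 < INR L) by (apply lt_0_INR; lia).
  assert (Heps : 0 < eps) by (apply Rinv_0_lt_compat; nra).
  assert (HSp : 1 <= INR S0) by (apply (le_INR 1); auto).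
  set (B2 := Cmod (b l) * Cmod (b l)). assert (HB2 : 0 <= B2) by apply Rle_0_sqr.
  set (gfun := fun j : Z => (F (w1 * latv tau (j, l)) * Egauss (PI / 2 * A + eps) (latv tau (j, l)))%C) in *.
  assert (EG : G = lsum (zone l) gfun).
  { apply (HS_unique gfun); [exact HG|]. apply HS_finite; [apply zone_NoDup|]. intros j Hj. unfold gfun.
    rewrite (interp_value _ _ _ (HF (j, l))). unfold alpha_c. simpl. destruct (in_dec Z.eq_dec j (zone l)); [tauto|]. ring. }
  assert (ER : Re (b l * gw n tau l * G)%C = lsumR (zone l) (fun j => rho l * B2 * Re (Cexp (- RtoC eps * (latv tau (j, l) * latv tau (j, l)))%C))).
  { rewrite EG, <- lsum_scal, Re_lsum. apply lsumR_ext. intros j Hj. unfold gfun.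
    rewrite (interp_value _ _ _ (HF (j, l))). unfold alpha_c. cbn [fst snd]. destruct (in_dec Z.eq_dec j (zone l)); [|tauto].
    set (v := latv tau (j, l)).
    assert (EE : Egauss (PI / 2 * A + eps) v = (Egauss (PI / 2 * A) v * Cexp (- RtoC eps * (v * v)))%C).
    { unfold Egauss. rewrite <- Cexp_plus. f_equal. rewrite RtoC_plus. ring. }
    rewrite EE, Cmod_mult.
    replace (PI / 2 * (Cmod w1 * Cmod v * (Cmod w1 * Cmod v))) with (PI / 2 * A * (Cmod v * Cmod v)) by (unfold A; ring).
    transitivity (Re (RtoC (rho l * B2) * Cexp (- RtoC eps * (v * v)))%C); [|unfold Re, Cmult, RtoC; simpl; ring].
    f_equal.
    transitivity (row_coef j l * Cconj (row_coef j l) * RtoC (rho l) * Cexp (- RtoC eps * (v * v)))%C.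
    - unfold row_coef at 2. fold v. ring.
    - rewrite <- Cmod2_conj, row_coef_Cmod. unfold B2. rewrite (Rmult_comm (rho l)), RtoC_mult. f_equal. f_equal. f_equal. simpl. ring. }
  assert (HRe : forall j, In j (zone l) -> exp (- (1)) / 2 <= Re (Cexp (- RtoC eps * (latv tau (j, l) * latv tau (j, l)))%C)).
  { intros j Hj. destruct (zone_pos j l Hj) as (Hl & Hx). set (x := fst (latv tau (j, l))) in *.
    assert (Ey : snd (latv tau (j, l)) = IZR l * T) by (unfold latv, T, Im; simpl; ring).
    set (y := IZR l * T) in *.
    assert (HlR : 0 < IZR l) by (apply IZR_lt; auto).
    assert (HlL : IZR l <= INR L) by (unfold l; rewrite <- INR_IZR_INZ; apply le_INR; lia).
    assert (EC : Re (Cexp (- RtoC eps * (latv tau (j, l) * latv tau (j, l)))%C) = exp (- eps * (x * x - y * y)) * cos (- (2 * eps * (x * y)))).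
    { destruct (latv tau (j, l)) as [x' y'] eqn:Ev. simpl in Ey. subst y'. unfold x. unfold Cexp, Re; simpl. f_equal; f_equal; ring. }
    rewrite EC. assert (HxS : x * INR S0 <= IZR l).
    { destruct Hx as [Hx0 Hx1]. apply (Rmult_le_compat_r (INR S0)) in Hx1; [|lra].
      replace (IZR l / INR S0 * INR S0) with (IZR l) in Hx1 by (field; lra). auto. }
    assert (HxL : x <= INR L) by nra.
    assert (HepsL : eps * (INR L * INR L) = 1) by (unfold eps; apply Rinv_l; nra).
    assert (H1 : exp (- (1)) <= exp (- eps * (x * x - y * y))).
    { apply exp_mono. assert (eps * (x * x) <= eps * (INR L * INR L)) by (apply Rmult_le_compat_l; nra).
      assert (0 <= eps * (y * y)) by (apply Rmult_le_pos; [lra|apply Rle_0_sqr]). lra. }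
    assert (HTp : 0 < T) by exact HT.
    assert (H2 : 1 / 2 <= cos (- (2 * eps * (x * y)))).
    { apply cos_ge_half. rewrite Rabs_Ropp, Rabs_pos_eq.
      - rewrite <- HepsL. replace (2 * eps * (x * y)) with (eps * (2 * (x * y))) by ring. apply Rmult_le_compat_l; [lra|].
        unfold y. apply Rle_trans with (IZR l * IZR l); [|nra].
        replace (2 * (x * (IZR l * T))) with (IZR l * (x * (2 * T))) by ring. apply Rmult_le_compat_l; [lra|].
        apply Rle_trans with (x * INR S0); [|auto]. apply Rmult_le_compat_l; [lra|exact HS0T].
      - repeat apply Rmult_le_pos; try lra. }
    pose proof (exp_pos (- (1))). nra. }
  rewrite ER. pose proof (exp_pos (- (1))) as He.
  assert (Hlow : INR (length (zone l)) * (rho l * B2 * (exp (- (1)) / 2)) <= lsumR (zone l) (fun j => rho l * B2 * Re (Cexp (- RtoC eps * (latv tau (j, l) * latv tau (j, l)))%C))).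
  { rewrite <- lsumR_const. apply lsumR_le. intros j Hj. apply Rmult_le_compat_l; [|apply HRe; auto].
    destruct (zone_pos j l Hj) as (Hl & _). apply IZR_lt in Hl. destruct (sqrt4 _ Hl) as [Hs _].
    apply Rmult_le_pos; auto. left. apply Rinv_0_lt_compat. nra. }
  split.
  - destruct (Z_lt_dec 0 l) as [Hl|Hl].
    + eapply Rle_trans; [|apply Hlow]. apply IZR_lt in Hl. destruct (sqrt4 _ Hl) as [Hs _].
      apply Rmult_le_pos; [apply pos_INR|]. apply Rmult_le_pos; [|lra]. apply Rmult_le_pos; auto. left. apply Rinv_0_lt_compat. nra.
    + unfold zone. destruct (Z_lt_dec 0 l); [tauto|]. simpl. lra.
  - intros HmS. eapply Rle_trans; [|apply Hlow].
    unfold zone. destruct (Z_lt_dec 0 l) as [Hl|Hl]; [|unfold l in Hl; lia]. rewrite length_map, length_seq.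
    unfold l. rewrite Nat2Z.id. fold l.
    assert (HmR : 0 < INR m) by (apply lt_0_INR; lia).
    assert (Elm : IZR l = INR m) by (unfold l; symmetry; apply INR_IZR_INZ).
    (* For m >= S0 rounding the quotient m / S0 down loses at most half of it. *)
    assert (Hcnt : INR m <= 2 * INR S0 * INR (m / S0)).
    { replace 2 with (INR 2) by (simpl; ring). rewrite <- !mult_INR. apply le_INR.
      pose proof (Nat.div_mod_eq m S0) as E. pose proof (Nat.mod_upper_bound m S0 ltac:(lia)) as E2.
      assert (1 <= m / S0)%nat by (apply Nat.div_le_lower_bound; lia). nia. }
    destruct (sqrt4 (INR m) HmR) as [Hs1 _].
    destruct (sqrt4 (INR L) HLp) as [Hs2 _].
    assert (Hss : sqrt (sqrt (INR m)) <= sqrt (sqrt (INR L))).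
    { apply sqrt_le_1_alt, sqrt_le_1_alt, le_INR. lia. }
    unfold rho. rewrite Elm. set (sm := sqrt (sqrt (INR m))) in *. set (sL := sqrt (sqrt (INR L))) in *.
    apply Rle_trans with (B2 * exp (- (1)) / (4 * INR S0 * sm)).
    + unfold Rdiv. apply Rmult_le_compat_l; [apply Rmult_le_pos; lra|]. apply Rinv_le_contravar; [|apply Rmult_le_compat_l; lra].
      apply Rmult_lt_0_compat; lra.
    + apply (Rmult_le_reg_r (4 * INR S0 * sm * INR m)); [repeat apply Rmult_lt_0_compat; lra|].
      replace (B2 * exp (- (1)) / (4 * INR S0 * sm) * (4 * INR S0 * sm * INR m)) with (B2 * exp (- (1)) * INR m) by (field; split; lra).
      replace (INR (m / S0) * (/ (INR m * sm) * B2 * (exp (- (1)) / 2)) * (4 * INR S0 * sm * INR m)) with (B2 * exp (- (1)) * (2 * INR S0 * INR (m / S0))) by (field; split; lra).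
      apply Rmult_le_compat_l; [apply Rmult_le_pos; lra|auto].
Qed.
End Critical.

(** All rows contribute a nonnegative real part, so the truncated sum is bounded below by the rows
    of one residue class modulo n, on which |b| is a fixed positive number. This grows like L^(3/4),
    against the bound [Cu * sqrt (INR L)]. *)
Lemma necessity_critical n (w1 tau : C) : (1 <= n)%nat -> w1 <> RtoC 0 -> 0 < Im tau ->
  INR n * (Cmod w1 * Cmod w1) * Im tau = 1 -> ~ interpolates n w1 tau.
Proof.
  intros Hn Hw HT Hcrit Hint.
  destruct (exists_b n tau Hn HT) as (b & (l0 & Hl0) & (Bb & HBb) & Hper & Hmom).
  destruct (nfloor_ex (2 * Im tau)) as (s & Hs); [lra|]. set (S0 := S s).
  assert (HS0 : (1 <= S0)%nat) by (unfold S0; lia).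
  assert (HS0T : 2 * Im tau <= INR S0) by (unfold S0; rewrite S_INR; lra).
  destruct (Hint (alpha_c n w1 tau b S0) (alpha_c_l2 n w1 tau b Bb S0 Hn HBb Hcrit HS0)) as (F & HFock & HFi).
  destruct (critical_upper n w1 tau b Bb F Hn Hw HT HBb Hper Hmom HFock Hcrit) as (Cu & L0 & HCu & Hup).
  assert (HnR : 1 <= INR n) by (apply (le_INR 1); auto).
  set (r0 := (l0 mod Z.of_nat n)%Z). assert (Hr0 : (0 <= r0 < Z.of_nat n)%Z) by (apply Z.mod_pos_bound; lia).
  set (B0 := Cmod (b l0)). assert (HB0 : 0 < B0) by (apply Cmod_gt_0; auto).
  assert (HbC : forall i : nat, Cmod (b (Z.of_nat (i * n + Z.to_nat r0))) = B0).
  { intros i. replace (Z.of_nat (i * n + Z.to_nat r0)) with (l0 + Z.of_nat n * (Z.of_nat i - l0 / Z.of_nat n))%Z.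
    - rewrite (per_shift _ b Hper), Cmod_mult, sgnZ_Cmod. unfold B0. ring.
    - rewrite Nat2Z.inj_add, Nat2Z.inj_mul, Z2Nat.id by lia. unfold r0. pose proof (Z.div_mod l0 (Z.of_nat n) ltac:(lia)). lia. }
  assert (HSp : 1 <= INR S0) by (apply (le_INR 1); auto). pose proof (exp_pos (- (1))) as He.
  set (D := B0 * B0 * exp (- (1)) / (4 * INR S0)).
  assert (HD : 0 < D). { unfold D. apply Rdiv_lt_0_compat; [|lra]. apply Rmult_lt_0_compat; [nra|auto]. }
  destruct (nfloor_ex (2 * (Cu * (INR n * INR n * INR n)) / D)) as (k0 & Hk0).
  { apply Rdiv_le_0_compat; auto. apply Rmult_le_pos; [lra|]. apply Rmult_le_pos; auto. nra. }
  (* L is n times a fourth power, so that its fourth root is at most n k and the comparison becomes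
     one of k^4 with k^3. The summand k0 decides it, L0 meets the threshold, and 2 S0 makes the rows
     below S0 negligible. *)
  set (k := (k0 + L0 + 2 * S0 + 1)%nat). set (I := (k * k * (k * k))%nat). set (L := (I * n)%nat).
  assert (Hk1 : (1 <= k)%nat) by (unfold k; lia).
  assert (HkI : (k <= I)%nat). { unfold I. clearbody k. assert (k <= k * k)%nat by nia. assert (1 <= k * k)%nat by nia. generalize dependent (k * k)%nat. intros; nia. }
  assert (HL0 : (L0 <= L)%nat). { assert (L0 <= k)%nat by (unfold k; lia). unfold L. clearbody I k. nia. }
  assert (HL1 : (1 <= L)%nat) by (unfold L; clearbody I k; nia).
  destruct (Hup L HL0 HL1) as (Gv & HG & HE).
  assert (HkR : 1 <= INR k) by (apply (le_INR 1); auto).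
  assert (EI : INR I = INR k * INR k * (INR k * INR k)) by (unfold I; rewrite !mult_INR; ring).
  assert (EL : INR L = INR I * INR n) by (unfold L; apply mult_INR).
  assert (Hsq1 : sqrt (INR L) <= INR n * INR n * (INR k * INR k)).
  { rewrite <- (sqrt_square (INR n * INR n * (INR k * INR k))) by (repeat apply Rmult_le_pos; lra). apply sqrt_le_1_alt.
    rewrite EL, EI. replace (INR n * INR n * (INR k * INR k) * (INR n * INR n * (INR k * INR k))) with (INR k * INR k * (INR k * INR k) * (INR n * INR n * (INR n * INR n))) by ring.
    apply Rmult_le_compat_l; [repeat apply Rmult_le_pos; lra|]. assert (1 <= INR n * INR n) by nra. nra. }
  assert (Hsq2 : sqrt (sqrt (INR L)) <= INR n * INR k).
  { rewrite <- (sqrt_square (INR n * INR k)) by (apply Rmult_le_pos; lra). apply sqrt_le_1_alt. eapply Rle_trans; [apply Hsq1|]. right; ring. }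
  assert (HLR : 0 < INR L) by (apply lt_0_INR; lia). destruct (sqrt4 _ HLR) as [Hs2 _].
  set (sL := sqrt (sqrt (INR L))) in *.
  set (g := fun m : nat => Re (b (Z.of_nat m) * gw n tau (Z.of_nat m) * Gv (Z.of_nat m))%C).
  assert (Hrow : forall m, (m < L)%nat -> 0 <= g m /\ ((S0 <= m)%nat ->
     Cmod (b (Z.of_nat m)) * Cmod (b (Z.of_nat m)) * exp (- (1)) / (4 * INR S0 * sL) <= g m)).
  { intros m Hm. apply (row_lower n w1 tau b S0 Hn HT Hcrit HS0 HS0T F L m (Gv (Z.of_nat m)) HFi Hm). apply HG. }
  assert (Hlow : (INR I - INR S0) * (D / sL) <= lsumR (seq 0 L) g).
  { unfold L. rewrite lsumR_seq_prod.
    assert (HI : (S0 <= I)%nat). { assert (S0 <= k)%nat by (unfold k; lia). lia. }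
    apply Rle_trans with (lsumR (seq 0 I) (fun i => if le_dec S0 i then D / sL else 0)).
    - assert (Hc : forall J, (S0 <= J)%nat -> (INR J - INR S0) * (D / sL) <= lsumR (seq 0 J) (fun i => if le_dec S0 i then D / sL else 0)).
      { assert (HDs : 0 < D / sL) by (apply Rdiv_lt_0_compat; auto).
        induction J as [|J IH]; intros HJ; [unfold S0 in HJ; lia|]. rewrite lsumR_seq_S, S_INR.
        destruct (le_dec S0 J) as [HSJ|HSJ].
        - specialize (IH HSJ). lra.
        - replace S0 with (S J) by lia. rewrite S_INR. replace (INR J + 1 - (INR J + 1)) with 0 by ring. rewrite Rmult_0_l.
          apply Rplus_le_le_0_compat; [|lra]. apply lsumR_nonneg. intros i _. destruct (le_dec _ i); lra. }
      apply Hc; auto.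
    - apply lsumR_le. intros i Hi. apply in_seq in Hi.
      assert (Hpn : forall p, (p < n)%nat -> (i * n + p < L)%nat) by (intros p Hp; unfold L; nia).
      destruct (le_dec S0 i) as [HSi|HSi].
      (* Clamping at 0 leaves the terms in range unchanged and makes the function nonnegative
         everywhere, as [lsumR_incl] requires. *)
      + rewrite (lsumR_ext (seq 0 n) _ (fun p => Rmax 0 (g (i * n + p)%nat))).
        2:{ intros p Hp. apply in_seq in Hp. symmetry. apply Rmax_right. apply Hrow. apply Hpn. lia. }
        eapply Rle_trans; [|apply (lsumR_incl [Z.to_nat r0] (seq 0 n) (fun p => Rmax 0 (g (i * n + p)%nat)))].
        * simpl. rewrite Rplus_0_r. eapply Rle_trans; [|apply Rmax_r].
          destruct (Hrow (i * n + Z.to_nat r0)%nat) as (_ & Hr); [apply Hpn; lia|]. rewrite HbC in Hr.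
          eapply Rle_trans; [|apply Hr; nia]. right. unfold D. field. split; lra.
        * constructor; [simpl; tauto|constructor].
        * apply seq_NoDup.
        * intros p [<-|[]]. apply in_seq. lia.
        * intros p. apply Rmax_l.
      + apply lsumR_nonneg. intros p Hp. apply in_seq in Hp. apply Hrow. apply Hpn. lia. }
  assert (HRe : lsumR (seq 0 L) g <= Cu * sqrt (INR L)).
  { unfold g. rewrite <- Re_lsum. eapply Rle_trans; [apply Re_le_Cmod|apply HE]. }
  set (kr := INR k) in *. set (N3 := INR n * INR n * INR n).
  assert (HS2 : INR S0 <= INR I / 2).
  { assert (INR S0 * 2 <= kr).
    { unfold kr. replace 2 with (INR 2) by (simpl; ring). rewrite <- mult_INR. apply le_INR. unfold k. lia. }
    rewrite EI. assert (1 <= kr * kr) by nra. assert (kr * 1 <= kr * kr * (kr * kr)) by (apply Rmult_le_compat; nra). lra. }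
  assert (H1 : INR I / 2 * D <= Cu * N3 * (kr * kr * kr)).
  { apply Rle_trans with ((INR I - INR S0) * D); [apply Rmult_le_compat_r; lra|].
    apply Rle_trans with (Cu * (INR n * INR n * (kr * kr)) * (INR n * kr)); [|right; unfold N3; ring].
    apply Rle_trans with (Cu * (INR n * INR n * (kr * kr)) * sL).
    - apply (Rmult_le_reg_r (/ sL)); [apply Rinv_0_lt_compat; auto|].
      replace (Cu * (INR n * INR n * (kr * kr)) * sL * / sL) with (Cu * (INR n * INR n * (kr * kr))) by (field; lra).
      apply Rle_trans with (Cu * sqrt (INR L)); [|apply Rmult_le_compat_l; auto].
      eapply Rle_trans; [|apply HRe]. eapply Rle_trans; [|apply Hlow]. right. unfold Rdiv. ring.
    - apply Rmult_le_compat_l; [|auto]. repeat apply Rmult_le_pos; lra. }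
  assert (H2 : kr * D <= 2 * (Cu * N3)).
  { rewrite EI in H1. assert (0 < kr * kr * kr) by (repeat apply Rmult_lt_0_compat; lra).
    apply (Rmult_le_reg_r (kr * kr * kr)); auto.
    replace (kr * D * (kr * kr * kr)) with (2 * (kr * kr * (kr * kr) / 2 * D)) by field.
    replace (2 * (Cu * N3) * (kr * kr * kr)) with (2 * (Cu * N3 * (kr * kr * kr))) by ring. lra. }
  assert (H3 : INR k0 + 1 <= kr). { unfold kr. rewrite <- S_INR. apply le_INR. unfold k. lia. }
  destruct Hk0 as [_ Hk0]. fold N3 in Hk0. apply (Rmult_lt_compat_r D) in Hk0; auto.
  replace (2 * (Cu * N3) / D * D) with (2 * (Cu * N3)) in Hk0 by (field; lra). nra.
Qed.

(** * From an arbitrary lattice matrix to the normalized basis *)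

Lemma Cscale_RtoC r z : Cscale r z = (RtoC r * z)%C.
Proof. unfold Cscale, Cmult, RtoC. simpl. f_equal; ring. Qed.

(** The index squares exhaust Z^2, so for nonnegative terms bounding the sums over them bounds all
    finite sums. *)
Lemma l2_bsum (alpha : Z -> Z -> C) :
  l2_Z2 alpha <-> exists M, bsum (fun x : Z * Z => Cmod (alpha (fst x) (snd x)) * Cmod (alpha (fst x) (snd x))) M.
Proof.
  set (g := fun x : Z * Z => Cmod (alpha (fst x) (snd x)) * Cmod (alpha (fst x) (snd x))).
  set (zs := fun N : nat => map (fun i => (Z.of_nat i - Z.of_nat N)%Z) (seq 0 (2 * N + 1))).
  set (box := fun N => flat_map (fun i => map (pair i) (zs N)) (zs N)).
  assert (Hzs : forall N, NoDup (zs N)).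
  { intros N. apply Injective_map_NoDup; [intros x y; lia|apply seq_NoDup]. }
  assert (Hbox : forall N, NoDup (box N)) by (intros N; apply NoDup_pairs; auto).
  assert (E : forall N, rsum (2 * N + 1) (fun i => rsum (2 * N + 1) (fun j =>
      Cnorm2 (alpha (Z.of_nat i - Z.of_nat N)%Z (Z.of_nat j - Z.of_nat N)%Z))) = lsumR (box N) g).
  { intros N. assert (Ez : forall h : Z -> R, lsumR (zs N) h = rsum (2 * N + 1) (fun i => h (Z.of_nat i - Z.of_nat N)%Z)).
    { intros h. unfold zs. rewrite lsumR_map, rsum_lsumR. auto. }
    unfold box. rewrite lsumR_flat_map, Ez, !rsum_lsumR. apply lsumR_ext. intros i _.
    rewrite lsumR_map, Ez, !rsum_lsumR. apply lsumR_ext. intros j _. apply Cnorm2_Cmod. }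
  split; intros (M & HM); exists M.
  - intros L NL.
    assert (HN : exists N : nat, forall x, In x L -> (Z.abs (fst x) <= Z.of_nat N /\ Z.abs (snd x) <= Z.of_nat N)%Z).
    { clear NL. induction L as [|a L (N & IH)]; [exists O; intros x []|].
      exists (N + Z.abs_nat (fst a) + Z.abs_nat (snd a))%nat. intros x [<-|Hx]; [lia|]. specialize (IH x Hx). lia. }
    destruct HN as (N & HN). specialize (HM N). rewrite E in HM. eapply Rle_trans; [|apply HM].
    apply lsumR_incl; auto; [|intros; apply Rle_0_sqr].
    assert (Hz : forall z, (Z.abs z <= Z.of_nat N)%Z -> In z (zs N)).
    { intros z Hz. apply in_map_iff. exists (Z.to_nat (z + Z.of_nat N)). split; [lia|]. apply in_seq. lia. }
    intros [p q] Hx. specialize (HN _ Hx). simpl in HN. apply in_flat_map. exists p. split; [apply Hz; lia|]. apply in_map. apply Hz; lia.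
  - intros N. rewrite E. apply HM; auto.
Qed.

(** The sign [s] orients the basis. Since s^2 = 1, the relabelling k -> s k is an involution and
    carries square summable data to square summable data in both directions. *)
Lemma lattice_interpolates n (a11 a12 a21 a22 : R) (s : Z) (tau : C) : (s = 1 \/ s = -1)%Z ->
  (forall m k, lattice_pt a11 a12 a21 a22 m k = ((a11, a21) * latv tau (m, (s * k)%Z))%C) ->
  (interpolating_lattice n a11 a12 a21 a22 <-> interpolates n (a11, a21) tau).
Proof.
  intros Hs Hpt.
  assert (Hss : forall k, (s * (s * k) = k)%Z) by (intros k; destruct Hs as [-> | ->]; lia).
  assert (Hinj : forall x y : Z * Z, (fst x, (s * snd x)%Z) = (fst y, (s * snd y)%Z) -> x = y).
  { intros [p q] [p' q'] H. simpl in H. injection H as -> H. f_equal. rewrite <- (Hss q), <- (Hss q'). congruence. }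
  split.
  - intros H alpha (M & HM). destruct (H (fun m k => alpha (m, (s * k)%Z))) as (F & HF & HFi).
    + apply l2_bsum. exists M. apply (bsum_inj (fun x : Z * Z => (fst x, (s * snd x)%Z)) (fun x => Cmod (alpha x) * Cmod (alpha x))); auto.
    + exists F. split; auto. intros [m k]. specialize (HFi m (s * k)%Z). cbv beta in HFi. rewrite Cscale_RtoC, Hpt, !Hss in HFi. apply HFi.
  - intros H alpha Hal. apply l2_bsum in Hal. destruct Hal as (M & HM).
    destruct (H (fun x => alpha (fst x) (s * snd x)%Z)) as (F & HF & HFi).
    + exists M. apply (bsum_inj (fun x : Z * Z => (fst x, (s * snd x)%Z)) (fun x => Cmod (alpha (fst x) (snd x)) * Cmod (alpha (fst x) (snd x)))); auto.
    + exists F. split; auto. intros m k. specialize (HFi (m, (s * k)%Z)). cbn [fst snd] in HFi. rewrite Hss in HFi. rewrite Cscale_RtoC, Hpt. apply HFi.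
Qed.

(** With w1, w2 the columns of the matrix, tau = s w2 / w1, where the sign of the determinant makes
    Im tau positive; then |w1|^2 Im tau is the covolume. *)
Lemma oriented_basis (a11 a12 a21 a22 : R) (s : Z) : (s = 1 \/ s = -1)%Z -> 0 < IZR s * (a11 * a22 - a12 * a21) ->
  exists tau : C, 0 < Im tau /\ ((a11, a21) : C) <> RtoC 0 /\
    Cmod (a11, a21) * Cmod (a11, a21) * Im tau = Rabs (a11 * a22 - a12 * a21) /\
    forall m k, lattice_pt a11 a12 a21 a22 m k = ((a11, a21) * latv tau (m, (s * k)%Z))%C.
Proof.
  intros Hs Hd. set (w1 := ((a11, a21) : C)). set (w2 := ((a12, a22) : C)).
  assert (Hw : w1 <> RtoC 0). { intros E. injection E as -> ->. lra. }
  assert (HA : 0 < a11 * a11 + a21 * a21).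
  { destruct (Req_dec a11 0) as [->|]; [|nra]. destruct (Req_dec a21 0) as [->|]; [|nra]. lra. }
  exists (RtoC (IZR s) * w2 / w1)%C.
  assert (EI : Im (RtoC (IZR s) * w2 / w1)%C = IZR s * (a11 * a22 - a12 * a21) / (a11 * a11 + a21 * a21)).
  { unfold w1, w2, Cdiv, Cinv, Cmult, RtoC, Im; simpl. field; repeat split; nra. }
  rewrite EI. split; [apply Rdiv_lt_0_compat; auto|]. split; [auto|]. split.
  - unfold w1. rewrite Cmod_sqr. simpl.
    replace ((a11 * a11 + a21 * a21) * (IZR s * (a11 * a22 - a12 * a21) / (a11 * a11 + a21 * a21))) with (IZR s * (a11 * a22 - a12 * a21)) by (field; lra).
    destruct Hs as [-> | ->]; [rewrite Rabs_pos_eq; lra|rewrite Rabs_left; lra].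
  - intros m k. match goal with |- ?p = ?q => change (@eq C p q) end.
    transitivity (RtoC (IZR m) * w1 + RtoC (IZR k) * w2)%C.
    + unfold lattice_pt, w1, w2, Cmult, Cplus, RtoC; simpl. f_equal; ring.
    + unfold latv. simpl fst. simpl snd. rewrite mult_IZR, RtoC_mult.
      transitivity (RtoC (IZR m) * w1 + (RtoC (IZR s) * RtoC (IZR s)) * RtoC (IZR k) * w2)%C.
      * replace (RtoC (IZR s) * RtoC (IZR s))%C with (RtoC 1); [ring|]. rewrite <- RtoC_mult. f_equal. destruct Hs as [-> | ->]; ring.
      * field. auto.
Qed.

Theorem theorem6 (n : nat) (a11 a12 a21 a22 : R) :
  (1 <= n)%nat ->
  a11 * a22 - a12 * a21 <> 0 ->
  (interpolating_lattice n a11 a12 a21 a22 <-> lattice_density a11 a12 a21 a22 < INR n).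
Proof.
  intros Hn Hdet.
  assert (Hs : exists s : Z, (s = 1 \/ s = -1)%Z /\ 0 < IZR s * (a11 * a22 - a12 * a21)).
  { destruct (Rlt_dec 0 (a11 * a22 - a12 * a21)); [exists 1%Z|exists (-1)%Z]; split; auto; lra. }
  destruct Hs as (s & Hs & Hd).
  destruct (oriented_basis a11 a12 a21 a22 s Hs Hd) as (tau & HT & Hw & HA & Hpt).
  rewrite (lattice_interpolates n a11 a12 a21 a22 s tau Hs Hpt). unfold lattice_density.
  set (w1 := ((a11, a21) : C)) in *. set (D := Rabs (a11 * a22 - a12 * a21)) in *.
  assert (HD : 0 < D) by (apply Rabs_pos_lt; auto).
  assert (HnD : INR n * (Cmod w1 * Cmod w1) * Im tau = INR n * D) by (rewrite <- HA; ring).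
  split.
  - intros H. apply Rnot_le_lt. intros Hle.
    assert (Hle1 : INR n * D <= 1).
    { apply (Rmult_le_compat_r D) in Hle; [|lra]. rewrite Rinv_l in Hle; lra. }
    (* Density at least n means n |det| <= 1; equality is the critical case and has its own
       argument. *)
    destruct (Rle_lt_or_eq_dec _ _ Hle1) as [Hlt|Heq].
    + apply (necessity_strict n w1 tau Hn Hw HT); [lra|auto].
    + apply (necessity_critical n w1 tau Hn Hw HT); [lra|auto].
  - intros H alpha Hal. apply (sufficiency n w1 tau Hn Hw HT); [|auto].
    rewrite HnD. apply (Rmult_lt_compat_r D) in H; auto. rewrite Rinv_l in H; lra.
Qed.
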